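(* Consider the real planar system with real coefficients $a_{ij},b_{ij}$ and real parameter $\varepsilon$ $$\begin{cases}\dot x=y+\varepsilon(a_{20}x^2+a_{11}xy+a_{02}y^2+a_{30}x^3+a_{21}x^2y+a_{12}xy^2+a_{03}y^3),\\ \dot y=-x^3+\varepsilon(b_{11}xy+b_{02}y^2+b_{21}x^2y+b_{12}xy^2+b_{03}y^3).\end{cases}$$ The origin is a weakly persistent center if and only if one of the following conditions holds: (C1) $b_{02}=b_{11}-3a_{20}=b_{21}+3a_{30}=a_{02}=a_{12}=a_{21}=b_{03}=b_{12}=a_{11}=a_{03}=0$; (C2) $a_{20}=a_{30}=b_{02}-2a_{11}=b_{21}=a_{02}=b_{03}=b_{12}-2a_{21}=a_{12}=a_{03}=0$; (C3) $a_{11}=a_{30}=b_{02}=b_{21}=a_{12}=b_{03}=0$; (C4) $b_{11}=a_{20}=b_{21}=a_{02}=a_{30}=b_{03}=a_{12}=0$; (C5) $b_{11}+2a_{20}=b_{02}+\frac{a_{11}}{2}=b_{21}+3a_{30}=b_{03}+\frac{a_{12}}{3}=b_{12}+a_{21}=0$.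
   Context: The linear part at the origin is nilpotent. For fixed coefficients, the origin is called a weakly persistent center if, for every real value of the perturbation parameter $\varepsilon$ for which the origin is a monodromic singular point, the origin is a center. Monodromic means that the orbits near the origin turn around it, i.e. a first return map is well defined on a small transversal half-arc with endpoint at the origin (equivalently, no orbit tends to the origin in forward or backward time with a definite tangent direction); center means that all orbits in a punctured neighborhood of the origin are closed orbits surrounding it. A chain of expressions ''$=\dots=0$'' means that every expression in the chain vanishes. *)

(* Defs.v *)
From Stdlib Require Import Reals.
From Coquelicot Require Import Coquelicot.
Local Open Scope R_scope.

Definition origin : R * R := (0, 0).

Definition enorm (p : R * R) : R := sqrt (fst p ^ 2 + snd p ^ 2).

Definition det2 (u v : R * R) : R := fst u * snd v - snd u * fst v.

Definition has_velocity (c : R -> R * R) (t : R) (v : R * R) : Prop :=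
  is_derive (fun u => fst (c u)) t (fst v) /\
  is_derive (fun u => snd (c u)) t (snd v).

(* The derivatives are two-sided also when [I] is a closed interval; this is no
   restriction, since a solution on a closed interval extends differentiably
   beyond its endpoints.  The same remark applies to [angle_along]. *)
Definition solution_on (X : R * R -> R * R) (I : R -> Prop) (c : R -> R * R) : Prop :=
  forall t, I t -> has_velocity c t (X (c t)).

Definition angle_along (I : R -> Prop) (c : R -> R * R) (theta : R -> R) : Prop :=
  forall t, I t ->
    c t <> origin /\
    continuous theta t /\
    c t = (enorm (c t) * cos (theta t), enorm (c t) * sin (theta t)).

(* The half-arc is the part [0 <= s < r] of the C^1 curve [g].  Defining [g] also
   for [- r < s < 0] only serves to express that the half-arc is C^1 and has a
   nonzero tangent vector up to its endpoint (in particular it does not spiral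
   around the origin). *)
Definition transversal_half_arc (X : R * R -> R * R) (g : R -> R * R) (r : R) : Prop :=
  0 < r /\
  g 0 = origin /\
  (forall s1 s2, 0 <= s1 < r -> 0 <= s2 < r -> g s1 = g s2 -> s1 = s2) /\
  exists dg : R -> R * R,
    (forall s, - r < s < r ->
       has_velocity g s (dg s) /\
       continuous (fun u => fst (dg u)) s /\
       continuous (fun u => snd (dg u)) s /\
       dg s <> origin) /\
    (forall s, 0 < s < r -> det2 (dg s) (X (g s)) <> 0).

(* [c] starts at [g s] and first meets the half-arc again at time [T], in
   [g s']; the closed curve made of this orbit segment and of the piece of the
   half-arc from [g s'] back to [g s] has winding number 1 or -1 around the
   origin.  [phi] is a polar angle along the half-arc. *)
Definition first_return (X : R * R -> R * R) (g : R -> R * R) (r : R) (phi : R -> R)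
    (s s' T : R) (c : R -> R * R) : Prop :=
  0 < T /\
  solution_on X (fun t => 0 <= t <= T) c /\
  c 0 = g s /\
  0 < s' < r /\ c T = g s' /\
  (forall t u, 0 < t < T -> 0 < u < r -> c t <> g u) /\
  exists theta : R -> R,
    angle_along (fun t => 0 <= t <= T) c theta /\
    theta 0 = phi s /\
    Rabs (theta T - phi s') = 2 * PI.

(* The orbit segments up to the first return are required to shrink to the
   origin: otherwise a saddle with a figure-eight homoclinic loop, for which
   orbits far away also return to a half-arc, would count as monodromic. *)
Definition monodromic (X : R * R -> R * R) : Prop :=
  X origin = origin /\
  exists (g : R -> R * R) (r : R) (phi : R -> R),
    transversal_half_arc X g r /\
    angle_along (fun s => 0 < s < r) g phi /\
    forall delta, 0 < delta ->
      exists rho, 0 < rho <= r /\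
        forall s, 0 < s < rho ->
          exists (s' T : R) (c : R -> R * R),
            first_return X g r phi s s' T c /\
            forall t, 0 <= t <= T -> enorm (c t) < delta.

(* A closed orbit is a Jordan curve, hence surrounds the origin exactly when its
   winding number over the least period is 1 or -1. *)
Definition closed_orbit_around_origin (X : R * R -> R * R) (p : R * R) : Prop :=
  exists (c : R -> R * R) (T : R),
    0 < T /\
    solution_on X (fun _ => True) c /\
    c 0 = p /\
    (forall t, c (t + T) = c t) /\
    exists theta : R -> R,
      angle_along (fun t => 0 <= t <= T) c theta /\
      Rabs (theta T - theta 0) = 2 * PI.

Definition is_center (X : R * R -> R * R) : Prop :=
  X origin = origin /\
  exists delta, 0 < delta /\
    forall p, 0 < enorm p < delta -> closed_orbit_around_origin X p.

Definition weakly_persistent_center (X : R -> R * R -> R * R) : Prop :=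
  forall eps : R, monodromic (X eps) -> is_center (X eps).

Definition cubic_system
    (a20 a11 a02 a30 a21 a12 a03 b11 b02 b21 b12 b03 : R)
    (eps : R) (p : R * R) : R * R :=
  let (x, y) := p in
  (y + eps * (a20 * x ^ 2 + a11 * x * y + a02 * y ^ 2
              + a30 * x ^ 3 + a21 * x ^ 2 * y + a12 * x * y ^ 2 + a03 * y ^ 3),
   - x ^ 3 + eps * (b11 * x * y + b02 * y ^ 2
              + b21 * x ^ 2 * y + b12 * x * y ^ 2 + b03 * y ^ 3)).

(* Main.v *)
(**
Sufficiency.  Under (C5) the system is Hamiltonian.  Under (C1)-(C4) it is reversible: a reflection (for (C1) sheared,
for (C2) only implicitly defined) fixes a line through the origin pointwise and, up to a positive time change, reverses the flow.
Monodromy makes orbits near the origin turn by more than three half turns, so that they cross that line twice, and reflecting the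
arc in between closes the orbit.  Winding numbers show that the arc of the definition of monodromy cannot come back to the origin
while orbits return to it, and the closed orbits through the arc are open and closed in a punctured disc.

Necessity.  The system with parameter [e] is the system with [eps = 1] and coefficients multiplied by [e]; for small [e]
it is monodromic, since with weights 1 of x and 2 of y it is close to [x' = y + e a20 x^2, y' = - x^3 + e b11 x y] and orbits turn.
So the origin is a center and there is no strict Lyapunov function.  With [Q] the quartic inverse integrating factor of that leading
part, one solves order by order for [w_m] in a formal first integral [ln Q - tau sigma + w_1 + w_2 + ...], where [sigma]
is an angle and [tau = e (2 a20 + b11)]; each [w_m] is a combination of 1 and [sigma] with polynomial coefficients over a power of [Q].
An obstruction is a number multiplying a definite form, so it must vanish.  Once the free coefficients of the [w_m] are eliminated,
obstructions are polynomials in [e] and in the coefficients, all of whose components in [e] vanish; the identities up to the seventh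
order in the subfamilies that occur leave exactly (C1)-(C5).
*)
Require Import Defs.
From Stdlib Require Import Reals Lra Lia Psatz ZArith QArith Qreals List Bool.
From Stdlib Require Import ClassicalEpsilon FunctionalExtensionality.
From Coquelicot Require Import Coquelicot.
Import ListNotations.
Local Open Scope R_scope.

(** Let [X_1] be the part of weight 1 of the field. Then [X_1 Q = tau x Q], where [tau x] is the
    divergence of [X_1], and [X_1 sigma = x]; so [ln Q - tau sigma] is a first integral of [X_1].
    Solving for [w_m] leaves one residual [r x^(5m+1) / Q^m]. For odd [m] the power of [x] is even
    and the residual is a true obstruction; for even [m] the coefficient of [y^(5m/2)] in [w_m] is
    free and serves to cancel it. These free coefficients depend on the parameter of the system, so
    they must be eliminated before obstructions are expanded in it. As [x^(5m+1)] vanishes on a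
    line, a correction built from [x y] makes the derivative definite.

    The solver that finds the [w_m] is not proved correct: its output is a certificate, whose
    identities are checked by computation and then interpreted over the reals.

    Monodromy only supplies a [C^1] arc and first returns to unknown places of it; locating these
    returns near the origin is what the winding numbers are for. Flows are built for truncated
    fields, so that orbits exist for all times. *)

Local Notation "p .1" := (fst p) (at level 1, left associativity, format "p .1").
Local Notation "p .2" := (snd p) (at level 1, left associativity, format "p .2").
Local Notation "!!" := ltac:(lra) (only parsing).

Ltac cancel H := apply Rmult_integral in H; destruct H as [H|H]; try contradiction.
Tactic Notation "absp" constr(x) := pose proof (Rabs_pos x).
Ltac absle H := apply Rabs_le_between in H.
Ltac mins e := lazymatch e with
  | Rmin ?a ?b => pose proof (Rmin_l a b); pose proof (Rmin_r a b); mins a; mins b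
  | _ => idtac end.

(** Equations left by the derivative lemmas may live over the carrier of a normed module; restated
    over [R] they are accessible to [ring] and [field]. *)
Ltac eqR := match goal with |- @eq _ ?a ?b => change (@eq R a b) end.

(** * Elementary calculus on the line *)

Lemma is_derive_constR (c x : R) : is_derive (fun _ : R => c) x 0.
Proof. auto_derive; auto. Qed.

Lemma is_derive_idR (x : R) : is_derive (fun u : R => u) x 1.
Proof. auto_derive; auto. Qed.

Lemma nonneg_derive_le (f df : R -> R) (a b : R) :
  a <= b -> (forall t, a <= t <= b -> is_derive f t (df t)) ->
  (forall t, a <= t <= b -> 0 <= df t) -> f a <= f b.
Proof.
  intros Hab Hd Hp. destruct (MVT_gen f a b df) as [c [Hc He]].
  - intros x Hx. apply Hd. rewrite Rmin_left, Rmax_right in Hx; lra.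
  - intros x Hx. rewrite Rmin_left, Rmax_right in Hx by lra.
    apply continuity_pt_filterlim. apply (ex_derive_continuous f). exists (df x). apply Hd; lra.
  - rewrite Rmin_left, Rmax_right in Hc by lra. specialize (Hp c Hc). nra.
Qed.

Lemma pos_derive_lt (f df : R -> R) (a b : R) :
  a < b -> (forall t, a <= t <= b -> is_derive f t (df t)) ->
  (forall t, a <= t <= b -> 0 < df t) -> f a < f b.
Proof.
  intros Hab Hd Hp. destruct (MVT_gen f a b df) as [c [Hc He]].
  - intros x Hx. apply Hd. rewrite Rmin_left, Rmax_right in Hx; lra.
  - intros x Hx. rewrite Rmin_left, Rmax_right in Hx by lra.
    apply continuity_pt_filterlim. apply (ex_derive_continuous f). exists (df x). apply Hd; lra.
  - rewrite Rmin_left, Rmax_right in Hc by lra. specialize (Hp c Hc). nra.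
Qed.

Lemma is_derive_const_eq (f : R -> R) (a b : R) :
  a <= b -> (forall t, a <= t <= b -> is_derive f t 0) -> f a = f b.
Proof.
  intros Hab Hd. apply Rle_antisym.
  - apply (nonneg_derive_le f (fun _ => 0)); auto. intros; lra.
  - assert (- f a <= - f b); [|lra]. apply (nonneg_derive_le (fun t => - f t) (fun _ => 0)); auto; [|intros; lra].
    intros t Ht. evar_last. apply (is_derive_opp f). apply Hd; auto. unfold opp; simpl; lra.
Qed.

Lemma is_derive_comp_opp (f : R -> R) (t l : R) :
  is_derive f (- t) l -> is_derive (fun u => f (- u)) t (- l).
Proof.
  intros H. replace (- l) with (scal (-1) l) by (unfold scal; simpl; unfold mult; simpl; ring).
  apply (is_derive_comp f (fun u => - u)). exact H. auto_derive; auto; ring.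
Qed.

Lemma is_derive_cont (f : R -> R) (t l : R) : is_derive f t l -> continuous f t.
Proof. intros H. apply (ex_derive_continuous f). exists l; exact H. Qed.

Lemma continuous_oppR (t : R) : continuous (fun u : R => - u) t.
Proof. apply (ex_derive_continuous (fun u : R => - u)). auto_derive; auto. Qed.

(** * Global flows of bounded Lipschitz planar fields *)

Definition lipschitz2 (L : R) (f : R -> R -> R) : Prop :=
  forall x y x' y', Rabs (f x y - f x' y') <= L * (Rabs (x - x') + Rabs (y - y')).

Lemma lipschitz2_cont (L : R) (f : R -> R -> R) (a b : R -> R) (t : R) :
  lipschitz2 L f -> continuous a t -> continuous b t -> continuous (fun u => f (a u) (b u)) t.
Proof.
  intros Hf Ha Hb. apply filterlim_locally. intros eps. assert (HL : 0 < Rabs L + 1) by (absp (L); lra).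
  assert (He : 0 < eps / (2 * (Rabs L + 1))).
  { apply Rdiv_lt_0_compat. apply eps. lra. }
  pose proof (proj1 (filterlim_locally _ _) Ha (mkposreal _ He)) as A.
  pose proof (proj1 (filterlim_locally _ _) Hb (mkposreal _ He)) as B.
  generalize (filter_and _ _ A B). apply filter_imp. intros u [H1 H2].
  unfold ball in *; simpl in *; unfold AbsRing_ball, abs, minus, plus, opp in *; simpl in *.
  eapply Rle_lt_trans. apply Hf. apply Rle_lt_trans with ((Rabs L + 1) * (Rabs (a u - a t) + Rabs (b u - b t))).
  { apply Rmult_le_compat_r. absp (a u - a t). absp (b u - b t). lra. pose proof (Rle_abs L). lra. }
  unfold Rminus. apply Rlt_le_trans with ((Rabs L + 1) * (eps / (2 * (Rabs L + 1)) + eps / (2 * (Rabs L + 1)))).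
  { apply Rmult_lt_compat_l; lra. }
  right. field. lra.
Qed.

Lemma cont_ex_RInt (f : R -> R) (a b : R) : (forall t, continuous f t) -> ex_RInt f a b.
Proof. intros H. apply (ex_RInt_continuous f). intros; apply H. Qed.

Lemma RInt_minusR (f g : R -> R) (a b : R) : (forall t, continuous f t) -> (forall t, continuous g t) ->
  RInt (fun u => f u - g u) a b = RInt f a b - RInt g a b.
Proof.
  intros Hf Hg. apply (RInt_minus (V:=R_CompleteNormedModule) f g); apply cont_ex_RInt; auto.
Qed.

Lemma continuous_minusR (f g : R -> R) (t : R) : continuous f t -> continuous g t -> continuous (fun u => f u - g u) t.
Proof. intros; apply (continuous_minus (V:=R_NormedModule) f g); auto. Qed.

Lemma RInt_ChaslesR (f : R -> R) (a b c : R) : (forall t, continuous f t) ->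
  RInt f a c - RInt f a b = RInt f b c.
Proof.
  intros Hf. pose proof (RInt_Chasles f a b c (cont_ex_RInt f a b Hf) (cont_ex_RInt f b c Hf)) as H.
  unfold plus in H; simpl in H. apply Rplus_eq_reg_l with (RInt f a b). rewrite H. lra.
Qed.

Lemma Rplus_minus_cancel (a b c : R) : a + b - (a + c) = b - c.
Proof. ring. Qed.

Lemma RInt_deriv (f : R -> R) (a : R) : (forall t, continuous f t) ->
  forall t, is_derive (fun b => RInt f a b) t (f t).
Proof.
  intros H t. apply (is_derive_RInt f (fun b => RInt f a b) a).
  - exists (mkposreal 1 Rlt_0_1). intros b _. apply (RInt_correct f). apply cont_ex_RInt; auto.
  - apply H.
Qed.

Lemma RInt_deriv_const (f : R -> R) (z0 : R) : (forall t, continuous f t) ->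
  forall t, is_derive (fun b => z0 + RInt f 0 b) t (f t).
Proof.
  intros H t. replace (f t) with (0 + f t) by ring.
  apply (is_derive_plus (fun _ => z0) (fun b => RInt f 0 b)). apply is_derive_constR. apply RInt_deriv; auto.
Qed.

(** Integration turns one term of the exponential series into the next one; this is the induction
    step of the Picard estimates. *)
Lemma RInt_pow_bound_pos (f : R -> R) (C : R) (k : nat) (t : R) :
  0 <= t -> (forall u, continuous f u) ->
  (forall u, 0 <= u -> Rabs (f u) <= C * (u ^ k / INR (fact k))) ->
  Rabs (RInt f 0 t) <= C * (t ^ S k / INR (fact (S k))).
Proof.
  intros Ht Hc Hb. assert (HF : INR (fact k) <> 0) by apply INR_fact_neq_0.
  assert (HI : is_RInt (fun u => C * (u ^ k / INR (fact k))) 0 t (C * (t ^ S k / INR (fact (S k))))).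
  { evar_last.
    apply (is_RInt_derive (fun u => C * (u ^ S k / INR (fact (S k)))) (fun u => C * (u ^ k / INR (fact k)))).
    - intros x _. apply is_derive_ext with (fun u => (C / INR (fact (S k))) * u ^ S k).
      { intros u. eqR. field. apply INR_fact_neq_0. }
      evar_last. apply is_derive_scal. apply (is_derive_pow (fun u => u) (S k) x 1). apply is_derive_idR.
      rewrite fact_simpl, mult_INR. cbn [Init.Nat.pred]. eqR. field. split; auto. apply not_0_INR; lia.
    - intros x _. apply (continuous_scal_r C (fun u => u ^ k / INR (fact k))).
      apply (ex_derive_continuous (fun u => u ^ k / INR (fact k))). auto_derive; auto.
    - unfold minus, plus, opp; simpl (0 ^ S k). rewrite Rmult_0_l. simpl. unfold Rdiv. ring. }
  rewrite <- (is_RInt_unique _ _ _ _ HI). apply Rle_trans with (RInt (fun u => Rabs (f u)) 0 t).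
  - apply abs_RInt_le; auto. apply cont_ex_RInt; auto.
  - apply RInt_le; auto.
    + apply cont_ex_RInt. intros u. apply continuous_comp; auto. apply continuous_Rabs.
    + exists (C * (t ^ S k / INR (fact (S k)))); auto.
    + intros x Hx. apply Hb. lra.
Qed.

Lemma RInt_pow_bound (f : R -> R) (C : R) (k : nat) (t : R) :
  (forall u, continuous f u) ->
  (forall u, Rabs (f u) <= C * (Rabs u ^ k / INR (fact k))) ->
  Rabs (RInt f 0 t) <= C * (Rabs t ^ S k / INR (fact (S k))).
Proof.
  intros Hc Hb. destruct (Rle_dec 0 t) as [Ht|Ht].
  - rewrite (Rabs_pos_eq t Ht). apply RInt_pow_bound_pos; auto.
    intros u Hu. rewrite <- (Rabs_pos_eq u Hu) at 2. apply Hb.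
  - rewrite (Rabs_left t) by lra. assert (E : RInt f 0 t = - RInt (fun u => f (- u)) 0 (- t)).
    { symmetry. rewrite <- (Ropp_involutive (RInt f 0 t)). apply f_equal. apply is_RInt_unique.
      apply is_RInt_ext with (fun u => opp (opp (f (- u)))).
      { intros; unfold opp; simpl; ring. }
      apply (is_RInt_opp (fun u => opp (f (- u)))).
      apply (is_RInt_comp_opp (V:=R_NormedModule) f 0 (-t)). rewrite Ropp_0, Ropp_involutive. apply (RInt_correct f). apply cont_ex_RInt; auto. }
    rewrite E, Rabs_Ropp. apply RInt_pow_bound_pos; try lra.
    + intros u. apply (continuous_comp (fun u => -u) f); auto. apply continuous_oppR.
    + intros u Hu. specialize (Hb (- u)). rewrite Rabs_Ropp, (Rabs_pos_eq u Hu) in Hb. auto.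
Qed.

Section Picard.
Variables (P Q : R -> R -> R) (L B : R).
Hypothesis LP : lipschitz2 L P.
Hypothesis LQ : lipschitz2 L Q.
Hypothesis BP : forall x y, Rabs (P x y) <= B.
Hypothesis BQ : forall x y, Rabs (Q x y) <= B.
Variables x0 y0 : R.

Fixpoint pic (n : nat) (t : R) : R * R :=
  match n with
  | O => (x0, y0)
  | S m => (x0 + RInt (fun u => P (pic m u).1 (pic m u).2) 0 t,
            y0 + RInt (fun u => Q (pic m u).1 (pic m u).2) 0 t)
  end.

Lemma pic_cont (n : nat) : forall t, continuous (fun u => (pic n u).1) t /\ continuous (fun u => (pic n u).2) t.
Proof.
  induction n as [|n IH]; intros t; simpl.
  - split; apply continuous_const.
  - split; (eapply is_derive_cont; apply RInt_deriv_const; intros u).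
    + exact (lipschitz2_cont L P _ _ u LP (proj1 (IH u)) (proj2 (IH u))).
    + exact (lipschitz2_cont L Q _ _ u LQ (proj1 (IH u)) (proj2 (IH u))).
Qed.

Lemma pic_B : 0 <= B.
Proof. eapply Rle_trans. apply Rabs_pos. apply (BP 0 0). Qed.
Lemma pic_L : 0 <= L.
Proof.
  specialize (LP 1 0 0 0). absp (P 1 0 - P 0 0). replace (Rabs (1-0)) with 1 in LP by (rewrite Rabs_pos_eq; lra).
  replace (Rabs (0-0)) with 0 in LP by (rewrite Rabs_pos_eq; lra). lra.
Qed.

(** The factor is [2 * L] because the Lipschitz bound is taken in the sum of the two coordinate
    differences, each of which obeys the same estimate. *)
Lemma pic_step (n : nat) (t : R) :
  Rabs ((pic (S n) t).1 - (pic n t).1) <= B * (2 * L) ^ n * (Rabs t ^ S n / INR (fact (S n))) /\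
  Rabs ((pic (S n) t).2 - (pic n t).2) <= B * (2 * L) ^ n * (Rabs t ^ S n / INR (fact (S n))).
Proof.
  revert t. induction n as [|n IH]; intros t.
  - simpl fst; simpl snd. replace (B * (2*L)^0) with B by (simpl; ring). split.
    + rewrite Rplus_minus_l.
      apply RInt_pow_bound. intros; apply continuous_const. intros u. simpl. rewrite Rdiv_1_r, Rmult_1_r. apply BP.
    + rewrite Rplus_minus_l.
      apply RInt_pow_bound. intros; apply continuous_const. intros u. simpl. rewrite Rdiv_1_r, Rmult_1_r. apply BQ.
  - assert (G : forall f, lipschitz2 L f -> forall z0,
      Rabs ((z0 + RInt (fun u => f (pic (S n) u).1 (pic (S n) u).2) 0 t) -
            (z0 + RInt (fun u => f (pic n u).1 (pic n u).2) 0 t)) <=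
       B * (2 * L) ^ S n * (Rabs t ^ S (S n) / INR (fact (S (S n))))).
    { intros f Hf z0. assert (C1 : forall u, continuous (fun u => f (pic (S n) u).1 (pic (S n) u).2) u).
      { intros u. exact (lipschitz2_cont L f _ _ u Hf (proj1 (pic_cont (S n) u)) (proj2 (pic_cont (S n) u))). }
      assert (C2 : forall u, continuous (fun u => f (pic n u).1 (pic n u).2) u).
      { intros u. exact (lipschitz2_cont L f _ _ u Hf (proj1 (pic_cont n u)) (proj2 (pic_cont n u))). }
      replace ((z0 + RInt (fun u => f (pic (S n) u).1 (pic (S n) u).2) 0 t) -
            (z0 + RInt (fun u => f (pic n u).1 (pic n u).2) 0 t)) with
        (RInt (fun u => (f (pic (S n) u).1 (pic (S n) u).2) - (f (pic n u).1 (pic n u).2)) 0 t)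
        by (rewrite RInt_minusR by auto; eqR; ring).
      apply RInt_pow_bound.
      { intros u. apply continuous_minusR; auto. }
      intros u. eapply Rle_trans. apply Hf. destruct (IH u) as [I1 I2].
      replace (B * (2 * L) ^ S n * (Rabs u ^ S n / INR (fact (S n)))) with
        (L * (B * (2 * L) ^ n * (Rabs u ^ S n / INR (fact (S n))) + B * (2 * L) ^ n * (Rabs u ^ S n / INR (fact (S n))))).
      2:{ replace ((2*L)^S n) with (2*L*(2*L)^n) by reflexivity. ring. }
      apply Rmult_le_compat_l. apply pic_L. lra. }
    split; apply G; auto.
Qed.

Definition pica (t : R) (n : nat) : R := B * (2 * L) ^ n * (Rabs t ^ S n / INR (fact (S n))).

Lemma pica_pos t n : 0 <= pica t n.
Proof.
  unfold pica. pose proof pic_B. pose proof pic_L. apply Rmult_le_pos. apply Rmult_le_pos; auto. apply pow_le; lra.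
  apply Rmult_le_pos. apply pow_le, Rabs_pos. left; apply Rinv_0_lt_compat, INR_fact_lt_0.
Qed.

Lemma pica_mono t t' n : Rabs t <= Rabs t' -> pica t n <= pica t' n.
Proof.
  intros H. unfold pica. pose proof pic_B. pose proof pic_L. apply Rmult_le_compat_l.
  apply Rmult_le_pos; auto. apply pow_le; lra. apply Rmult_le_compat_r. left; apply Rinv_0_lt_compat, INR_fact_lt_0.
  apply pow_incr. split; auto. apply Rabs_pos.
Qed.

Lemma pica_sum t : ex_series (pica t).
Proof.
  apply (ex_series_le (V:=R_CompleteNormedModule)) with (fun n => (B * Rabs t) * ((2 * L * Rabs t) ^ n / INR (fact n))).
  - intros n. unfold norm; simpl. unfold abs; simpl. rewrite Rabs_pos_eq by apply pica_pos.
    unfold pica. rewrite (Rpow_mult_distr (2 * L) (Rabs t) n). simpl (Rabs t ^ S n).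
    replace (B * (2 * L) ^ n * (Rabs t * Rabs t ^ n / INR (fact (S n)))) with
      ((B * Rabs t * ((2 * L) ^ n * Rabs t ^ n)) * / INR (fact (S n))) by (unfold Rdiv; ring).
    replace (B * Rabs t * ((2 * L) ^ n * Rabs t ^ n / INR (fact n))) with
      ((B * Rabs t * ((2 * L) ^ n * Rabs t ^ n)) * / INR (fact n)) by (unfold Rdiv; ring).
    pose proof pic_B. pose proof pic_L. absp t. apply Rmult_le_compat_l.
    + apply Rmult_le_pos; [apply Rmult_le_pos; auto | apply Rmult_le_pos; apply pow_le; lra].
    + apply Rinv_le_contravar. apply INR_fact_lt_0. apply le_INR. rewrite fact_simpl. nia.
  - apply (ex_series_scal_l (V:=R_NormedModule) (B * Rabs t) (fun n => (2 * L * Rabs t) ^ n / INR (fact n))).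
    exists (exp (2 * L * Rabs t)). apply is_series_ext with (fun n => / INR (fact n) * (2 * L * Rabs t) ^ n).
    intros n. eqR. unfold Rdiv. ring. pose proof (is_exp_Reals (2 * L * Rabs t)) as H. unfold is_pseries in H.
    eapply is_series_ext; [|exact H]. intros n. simpl. unfold scal; simpl. unfold mult; simpl. rewrite pow_n_pow. eqR. ring.
Qed.

(** The limit of the iterates is written as a telescoping series, so that its convergence is a
    comparison with the exponential series [pica]. *)
Definition picx (t : R) : R := x0 + Series (fun n => (pic (S n) t).1 - (pic n t).1).
Definition picy (t : R) : R := y0 + Series (fun n => (pic (S n) t).2 - (pic n t).2).

Lemma series_tail_bound (u : nat -> R) (a : nat -> R) (s0 : R) (v : nat -> R) :
  (forall n, Rabs (v (S n) - v n) <= a n) -> v O = s0 -> ex_series a ->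
  forall n, Rabs (s0 + Series (fun n => v (S n) - v n) - v n) <= Series (fun k => a (n + k)%nat).
Proof.
  intros Hb H0 Ha n. assert (EX : ex_series (fun n => Rabs (v (S n) - v n))).
  { apply (ex_series_le (V:=R_CompleteNormedModule)) with a; auto. intros k. unfold norm; simpl; unfold abs; simpl. rewrite Rabs_Rabsolu. auto. }
  assert (EX1 : ex_series (fun n => v (S n) - v n)) by (apply ex_series_Rabs; auto).
  assert (SUM : forall m, sum_n (fun n => v (S n) - v n) m = v (S m) - s0).
  { induction m. rewrite sum_O, H0; auto. rewrite sum_Sn, IHm. unfold plus; simpl. ring. }
  assert (E : s0 + Series (fun n => v (S n) - v n) - v n = Series (fun k => v (S (n + k)) - v (n + k)%nat)).
  { destruct n as [|n].
    - simpl. rewrite H0. ring_simplify. apply Series_ext; auto.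
    - rewrite (Series_incr_n _ (S n)); auto; [|lia]. simpl pred. rewrite <- sum_n_Reals, SUM. ring_simplify. apply Series_ext. auto. }
  rewrite E. eapply Rle_trans. apply Series_Rabs. apply (ex_series_incr_n (fun n => Rabs (v (S n) - v n)) n). auto.
  apply Series_le. intros k. split. apply Rabs_pos. apply Hb. apply (ex_series_incr_n a n). auto.
Qed.

Lemma pic_tail_lim (t : R) : is_lim_seq (fun n => Series (fun k => pica t (n + k))) 0.
Proof.
  pose proof (pica_sum t) as H.
  assert (E : forall n, (0 < n)%nat -> Series (fun k => pica t (n + k)) = Series (pica t) - sum_n (pica t) (pred n)).
  { intros n Hn. rewrite (Series_incr_n (pica t) n); auto. rewrite sum_n_Reals. ring. }
  apply is_lim_seq_incr_1. apply is_lim_seq_ext with (fun n => Series (pica t) - sum_n (pica t) n).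
  { intros n. rewrite E by lia. reflexivity. }
  replace (Finite 0) with (Finite (Series (pica t) - Series (pica t))) by (f_equal; ring).
  apply is_lim_seq_minus'. apply is_lim_seq_const. apply (Series_correct (pica t) H).
Qed.

Lemma pic_conv (t s : R) (n : nat) : Rabs s <= Rabs t ->
  Rabs (picx s - (pic n s).1) <= Series (fun k => pica t (n + k)) /\
  Rabs (picy s - (pic n s).2) <= Series (fun k => pica t (n + k)).
Proof.
  intros Hs. unfold picx, picy. split.
  - apply (series_tail_bound (fun _ => 0) (pica t) x0 (fun n => (pic n s).1)).
    + intros m. eapply Rle_trans. apply pic_step. apply pica_mono; auto.
    + reflexivity.
    + apply pica_sum.
  - apply (series_tail_bound (fun _ => 0) (pica t) y0 (fun n => (pic n s).2)).
    + intros m. eapply Rle_trans. apply pic_step. apply pica_mono; auto.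
    + reflexivity.
    + apply pica_sum.
Qed.

Lemma RInt_bounded (f : R -> R) (C a b : R) : (forall u, continuous f u) ->
  (forall u, Rmin a b <= u <= Rmax a b -> Rabs (f u) <= C) -> Rabs (RInt f a b) <= C * Rabs (b - a).
Proof.
  intros Hc Hb. destruct (Rle_dec a b) as [H|H].
  - rewrite Rmin_left, Rmax_right in Hb by lra.
    rewrite (Rabs_pos_eq (b - a)) by lra. rewrite Rmult_comm. apply abs_RInt_le_const; auto. apply cont_ex_RInt; auto.
  - rewrite Rmin_right, Rmax_left in Hb by lra.
    rewrite <- (opp_RInt_swap (V:=R_CompleteNormedModule)) by (apply cont_ex_RInt; auto).
    unfold opp; simpl. rewrite Rabs_Ropp, (Rabs_left (b - a)) by lra. rewrite Rmult_comm.
    replace (- (b - a)) with (a - b) by ring. apply abs_RInt_le_const; auto. lra. apply cont_ex_RInt; auto.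
Qed.

Lemma le_of_lim0 (x : R) (u : nat -> R) : (forall n, x <= u n) -> is_lim_seq u 0 -> x <= 0.
Proof.
  intros H1 H2. assert (Rbar_le x 0); auto. apply is_lim_seq_le with (fun _ => x) u; auto. apply is_lim_seq_const.
Qed.

Lemma pic_lip_time (n : nat) (s t : R) :
  Rabs ((pic n s).1 - (pic n t).1) <= B * Rabs (s - t) /\
  Rabs ((pic n s).2 - (pic n t).2) <= B * Rabs (s - t).
Proof.
  destruct n as [|n].
  - simpl. rewrite !Rminus_diag, Rabs_R0. pose proof pic_B. absp (s - t). split; nra.
  - simpl. assert (G : forall f z0, lipschitz2 L f -> (forall x y, Rabs (f x y) <= B) ->
      Rabs (z0 + RInt (fun u => f (pic n u).1 (pic n u).2) 0 s -
       (z0 + RInt (fun u => f (pic n u).1 (pic n u).2) 0 t)) <= B * Rabs (s - t)).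
    { intros f z0 Hf Hb. assert (C2 : forall u, continuous (fun u => f (pic n u).1 (pic n u).2) u).
      { intros u. exact (lipschitz2_cont L f _ _ u Hf (proj1 (pic_cont n u)) (proj2 (pic_cont n u))). }
      rewrite Rplus_minus_cancel, RInt_ChaslesR by auto. apply RInt_bounded; auto. }
    split; apply G; auto.
Qed.

(** Every iterate is [B]-Lipschitz in time because the field is bounded by [B]. The bound passes to
    pointwise limits and yields the continuity of the limit at once. *)
Lemma pic_lim_lip (s t : R) :
  Rabs (picx s - picx t) <= B * Rabs (s - t) /\ Rabs (picy s - picy t) <= B * Rabs (s - t).
Proof.
  set (m := Rmax (Rabs s) (Rabs t)).
  assert (Hm : Rabs m = m). { apply Rabs_pos_eq. unfold m. eapply Rle_trans. apply Rabs_pos. apply Rmax_l. }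
  assert (Hs : Rabs s <= Rabs m) by (rewrite Hm; apply Rmax_l).
  assert (Ht : Rabs t <= Rabs m) by (rewrite Hm; apply Rmax_r).
  assert (LIM : is_lim_seq (fun n => 2 * Series (fun k => pica m (n + k))) 0).
  { replace (Finite 0) with (Rbar_mult 2 0) by (simpl; f_equal; ring). apply is_lim_seq_scal_l. apply pic_tail_lim. }
  split.
  - apply Rminus_le. apply le_of_lim0 with (2 := LIM). intros n.
    pose proof (proj1 (pic_conv m s n Hs)). pose proof (proj1 (pic_conv m t n Ht)).
    pose proof (proj1 (pic_lip_time n s t)).
    replace (picx s - picx t) with ((picx s - (pic n s).1) + ((pic n s).1 - (pic n t).1) + - (picx t - (pic n t).1)) by ring.
    eapply Rle_trans. apply Rplus_le_compat_r. eapply Rle_trans. apply Rabs_triang.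
    apply Rplus_le_compat. apply Rabs_triang. rewrite Rabs_Ropp. apply Rle_refl. lra.
  - apply Rminus_le. apply le_of_lim0 with (2 := LIM). intros n.
    pose proof (proj2 (pic_conv m s n Hs)). pose proof (proj2 (pic_conv m t n Ht)).
    pose proof (proj2 (pic_lip_time n s t)).
    replace (picy s - picy t) with ((picy s - (pic n s).2) + ((pic n s).2 - (pic n t).2) + - (picy t - (pic n t).2)) by ring.
    eapply Rle_trans. apply Rplus_le_compat_r. eapply Rle_trans. apply Rabs_triang.
    apply Rplus_le_compat. apply Rabs_triang. rewrite Rabs_Ropp. apply Rle_refl. lra.
Qed.

Lemma lip_cont (f : R -> R) (C : R) : 0 <= C -> (forall s t, Rabs (f s - f t) <= C * Rabs (s - t)) -> forall t, continuous f t.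
Proof.
  intros HC H t. apply filterlim_locally. intros eps.
  assert (He : 0 < eps / (C + 1)) by (apply Rdiv_lt_0_compat; [apply eps|lra]). exists (mkposreal _ He). intros s Hs.
  unfold ball in *; simpl in *; unfold AbsRing_ball, abs, minus, plus, opp in *; simpl in *.
  eapply Rle_lt_trans. apply H. apply Rle_lt_trans with ((C + 1) * Rabs (s - t)).
  { apply Rmult_le_compat_r; [apply Rabs_pos|lra]. }
  unfold Rminus. apply Rlt_le_trans with ((C+1) * (eps / (C+1))). apply Rmult_lt_compat_l; lra. right; field; lra.
Qed.

(** On the interval between 0 and [t] all iterates are within the same tail [tl n] of the limit; the
    defect of the integral equation is at most [tl (S n) + 2 L |t| tl n], which tends to 0. *)
Lemma pic_integral (t : R) :
  picx t = x0 + RInt (fun u => P (picx u) (picy u)) 0 t /\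
  picy t = y0 + RInt (fun u => Q (picx u) (picy u)) 0 t.
Proof.
  assert (CX : forall u, continuous picx u) by (apply lip_cont with B; [apply pic_B|intros; apply pic_lim_lip]).
  assert (CY : forall u, continuous picy u) by (apply lip_cont with B; [apply pic_B|intros; apply pic_lim_lip]).
  set (tl := fun n => Series (fun k => pica t (n + k))).
  assert (LIM : is_lim_seq (fun n => tl (S n) + (2 * L * Rabs t) * tl n) 0).
  { replace (Finite 0) with (Finite (0 + (2 * L * Rabs t) * 0)) by (f_equal; ring).
    apply is_lim_seq_plus'. apply -> (is_lim_seq_incr_1 tl). apply pic_tail_lim.
    apply (is_lim_seq_scal_l tl (2 * L * Rabs t) 0). apply pic_tail_lim. }
  assert (G : forall (f : R -> R -> R) (z0 z : R) (v : nat -> R),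
     lipschitz2 L f -> (forall n, v (S n) = z0 + RInt (fun u => f (pic n u).1 (pic n u).2) 0 t) ->
     (forall n, Rabs (z - v n) <= tl n) -> z = z0 + RInt (fun u => f (picx u) (picy u)) 0 t).
  { intros f z0 z v Hf Hv Hz. assert (HH : Rabs (z - (z0 + RInt (fun u => f (picx u) (picy u)) 0 t)) <= 0).
    { apply le_of_lim0 with (2 := LIM). intros n. replace (z - (z0 + RInt (fun u => f (picx u) (picy u)) 0 t)) with
        ((z - v (S n)) + - (RInt (fun u => f (picx u) (picy u)) 0 t - RInt (fun u => f (pic n u).1 (pic n u).2) 0 t))
        by (rewrite Hv; ring).
      eapply Rle_trans. apply Rabs_triang. rewrite Rabs_Ropp. apply Rplus_le_compat. apply Hz.
      assert (C1 : forall u, continuous (fun u => f (picx u) (picy u)) u).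
      { intros u. apply (lipschitz2_cont L f _ _ u Hf); auto. }
      assert (C2 : forall u, continuous (fun u => f (pic n u).1 (pic n u).2) u).
      { intros u. exact (lipschitz2_cont L f _ _ u Hf (proj1 (pic_cont n u)) (proj2 (pic_cont n u))). }
      rewrite <- RInt_minusR by auto.
      replace (2 * L * Rabs t * tl n) with ((2 * L * tl n) * Rabs (t - 0)) by (rewrite Rminus_0_r; ring).
      apply RInt_bounded.
      { intros u. apply continuous_minusR; auto. }
      intros u Hu. eapply Rle_trans. apply Hf. assert (Hu' : Rabs u <= Rabs t).
      { revert Hu. unfold Rmin, Rmax. destruct (Rle_dec 0 t); intros; unfold Rabs; repeat destruct Rcase_abs; lra. }
      destruct (pic_conv t u n Hu'). fold (tl n) in *. pose proof pic_L. nra. }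
    absp ((z - (z0 + RInt (fun u => f (picx u) (picy u)) 0 t))).
    assert (Rabs (z - (z0 + RInt (fun u => f (picx u) (picy u)) 0 t)) = 0) by lra. apply Rabs_eq_0 in H0. lra. }
  split.
  - apply (G P x0 _ (fun n => (pic n t).1)); auto. intros n. apply pic_conv. lra.
  - apply (G Q y0 _ (fun n => (pic n t).2)); auto. intros n. apply pic_conv. lra.
Qed.

Lemma pic_solution :
  picx 0 = x0 /\ picy 0 = y0 /\
  (forall t, is_derive picx t (P (picx t) (picy t))) /\
  (forall t, is_derive picy t (Q (picx t) (picy t))).
Proof.
  assert (CX : forall u, continuous picx u) by (apply lip_cont with B; [apply pic_B|intros; apply pic_lim_lip]).
  assert (CY : forall u, continuous picy u) by (apply lip_cont with B; [apply pic_B|intros; apply pic_lim_lip]).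
  split; [|split; [|split]].
  - rewrite (proj1 (pic_integral 0)), RInt_point. unfold zero; simpl; ring.
  - rewrite (proj2 (pic_integral 0)), RInt_point. unfold zero; simpl; ring.
  - intros t. apply is_derive_ext with (fun t => x0 + RInt (fun u => P (picx u) (picy u)) 0 t).
    intros; symmetry; apply pic_integral.
    apply (RInt_deriv_const (fun u => P (picx u) (picy u))). intros u. eapply lipschitz2_cont; eauto.
  - intros t. apply is_derive_ext with (fun t => y0 + RInt (fun u => Q (picx u) (picy u)) 0 t).
    intros; symmetry; apply pic_integral.
    apply (RInt_deriv_const (fun u => Q (picx u) (picy u))). intros u. eapply lipschitz2_cont; eauto.
Qed.
End Picard.

Definition d1 (p q : R * R) : R := Rabs (p.1 - q.1) + Rabs (p.2 - q.2).

Lemma d1_pos p q : 0 <= d1 p q.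
Proof. unfold d1. absp (p.1 - q.1). absp (p.2 - q.2). lra. Qed.
Lemma d1_sym p q : d1 p q = d1 q p.
Proof. unfold d1. rewrite (Rabs_minus_sym p.1), (Rabs_minus_sym p.2). auto. Qed.
Lemma d1_tri p q r : d1 p r <= d1 p q + d1 q r.
Proof.
  unfold d1. pose proof (Rabs_triang (p.1 - q.1) (q.1 - r.1)). pose proof (Rabs_triang (p.2 - q.2) (q.2 - r.2)).
  replace (p.1 - q.1 + (q.1 - r.1)) with (p.1 - r.1) in H by ring.
  replace (p.2 - q.2 + (q.2 - r.2)) with (p.2 - r.2) in H0 by ring. lra.
Qed.
Lemma d1_refl p : d1 p p = 0.
Proof. unfold d1. rewrite !Rminus_diag, Rabs_R0. ring. Qed.
Lemma d1_0 p q : d1 p q <= 0 -> p = q.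
Proof.
  unfold d1. intros H. absp (p.1 - q.1). absp (p.2 - q.2).
  assert (A : Rabs (p.1 - q.1) = 0) by lra. assert (A' : Rabs (p.2 - q.2) = 0) by lra.
  apply Rabs_eq_0 in A. apply Rabs_eq_0 in A'. destruct p, q; simpl in *. f_equal; lra.
Qed.

Definition glip (L B : R) (X : R * R -> R * R) : Prop :=
  (forall p q, Rabs ((X p).1 - (X q).1) <= L * d1 p q /\ Rabs ((X p).2 - (X q).2) <= L * d1 p q) /\
  (forall p, Rabs (X p).1 <= B /\ Rabs (X p).2 <= B).

Lemma glip_L L B X : glip L B X -> 0 <= L.
Proof.
  intros [H _]. destruct (H (1, 0) (0, 0)) as [H1 _]. absp (((X (1,0)).1 - (X (0,0)).1)).
  unfold d1 in H1; simpl in H1. rewrite !Rminus_0_r, Rabs_R0, Rabs_R1 in H1. lra.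
Qed.
Lemma glip_B L B X : glip L B X -> 0 <= B.
Proof. intros [_ H]. destruct (H (0,0)) as [H1 _]. absp ((X (0,0)).1). lra. Qed.

Definition field_opp (X : R * R -> R * R) (p : R * R) : R * R := (- (X p).1, - (X p).2).

Lemma glip_opp L B X : glip L B X -> glip L B (field_opp X).
Proof.
  intros [H1 H2]. split.
  - intros p q. destruct (H1 p q). unfold field_opp; simpl.
    replace (- (X p).1 - - (X q).1) with (- ((X p).1 - (X q).1)) by ring.
    replace (- (X p).2 - - (X q).2) with (- ((X p).2 - (X q).2)) by ring. rewrite !Rabs_Ropp. auto.
  - intros p. unfold field_opp; simpl. rewrite !Rabs_Ropp. auto.
Qed.

Definition flow (X : R * R -> R * R) (t : R) (p : R * R) : R * R :=
  (picx (fun x y => (X (x, y)).1) (fun x y => (X (x, y)).2) p.1 p.2 t,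
   picy (fun x y => (X (x, y)).1) (fun x y => (X (x, y)).2) p.1 p.2 t).

Lemma flow_spec L B X p : glip L B X ->
  flow X 0 p = p /\ solution_on X (fun _ => True) (fun t => flow X t p).
Proof.
  intros [H1 H2].
  destruct (pic_solution (fun x y => (X (x, y)).1) (fun x y => (X (x, y)).2) L B) with (x0 := p.1) (y0 := p.2)
    as [A [A' [D D']]].
  - intros x y x' y'. apply (H1 (x, y) (x', y')).
  - intros x y x' y'. apply (H1 (x, y) (x', y')).
  - intros; apply H2.
  - intros; apply H2.
  - split.
    + unfold flow. rewrite A, A'. destruct p; auto.
    + intros t _. split; simpl; unfold flow; simpl; auto.
Qed.

Lemma flow_0 L B X p : glip L B X -> flow X 0 p = p.
Proof. intros HX. apply (proj1 (flow_spec L B X p HX)). Qed.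
Lemma flow_sol L B X p t : glip L B X -> has_velocity (fun t => flow X t p) t (X (flow X t p)).
Proof. intros HX. apply (proj2 (flow_spec L B X p HX) t I). Qed.

(** The squared Euclidean distance is differentiable along solutions and so fits Gronwall's
    inequality, while [d1] fits the coordinatewise Lipschitz bounds; both are needed. *)
Definition Ed (p q : R * R) : R := (p.1 - q.1) ^ 2 + (p.2 - q.2) ^ 2.
Lemma Ed_d1 p q : Ed p q <= d1 p q ^ 2 /\ d1 p q ^ 2 <= 2 * Ed p q.
Proof.
  unfold Ed, d1. rewrite <- (pow2_abs (p.1 - q.1)), <- (pow2_abs (p.2 - q.2)).
  generalize (Rabs_pos (p.1 - q.1)) (Rabs_pos (p.2 - q.2)).
  generalize (Rabs (p.1 - q.1)) (Rabs (p.2 - q.2)). intros a b Ha Hb. pose proof (pow2_ge_0 (a - b)). split; nra.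
Qed.

Lemma gronwall (f df : R -> R) (C a b : R) :
  a <= b -> (forall t, a <= t <= b -> is_derive f t (df t)) ->
  (forall t, a <= t <= b -> df t <= C * f t) -> f b <= f a * exp (C * (b - a)).
Proof.
  intros Hab Hd Hb. assert (H : - (f a * exp (- C * a)) <= - (f b * exp (- C * b))).
  { apply (nonneg_derive_le (fun t => - (f t * exp (- C * t)))
      (fun t => - (df t * exp (- C * t) + f t * (- C * exp (- C * t))))); auto.
    - intros t Ht. specialize (Hd t Ht). auto_derive. exists (df t); auto.
      replace (Derive (fun x => f x) t) with (df t) by (symmetry; apply is_derive_unique; exact Hd). ring.
    - intros t Ht. specialize (Hb t Ht). pose proof (exp_pos (- C * t)). nra. }
  replace (f b) with ((f b * exp (- C * b)) * exp (C * b)).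
  2:{ rewrite Rmult_assoc, <- exp_plus. replace (- C * b + C * b) with 0 by ring. rewrite exp_0. ring. }
  replace (f a * exp (C * (b - a))) with ((f a * exp (- C * a)) * exp (C * b)).
  2:{ rewrite Rmult_assoc, <- exp_plus. f_equal. f_equal. ring. }
  apply Rmult_le_compat_r. left; apply exp_pos. lra.
Qed.

Lemma is_derive_sqdiff (f g : R -> R) (t a b : R) : is_derive f t a -> is_derive g t b ->
  is_derive (fun u => (f u - g u) ^ 2) t (2 * (f t - g t) * (a - b)).
Proof.
  intros Hf Hg. replace (2 * (f t - g t) * (a - b)) with (INR 2 * (a - b) * (f t - g t) ^ pred 2) by (simpl; ring).
  apply (is_derive_pow (fun u => f u - g u) 2). apply (is_derive_minus f g); auto.
Qed.

(* A nonautonomous factor [k] is allowed so that time changes are covered. *)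
Lemma solutions_Ed L B X (k : R -> R) (M : R) (c d : R -> R * R) (a b : R) :
  glip L B X -> 0 <= M -> a <= b ->
  (forall t, a <= t <= b -> Rabs (k t) <= M) ->
  (forall t, a <= t <= b -> has_velocity c t (k t * (X (c t)).1, k t * (X (c t)).2)) ->
  (forall t, a <= t <= b -> has_velocity d t (k t * (X (d t)).1, k t * (X (d t)).2)) ->
  Ed (c b) (d b) <= Ed (c a) (d a) * exp (4 * L * M * (b - a)).
Proof.
  intros HX HM Hab Hk Hc Hd. pose proof (glip_L _ _ _ HX) as HL. apply (gronwall (fun t => Ed (c t) (d t))
    (fun t => 2 * ((c t).1 - (d t).1) * (k t * ((X (c t)).1 - (X (d t)).1)) +
              2 * ((c t).2 - (d t).2) * (k t * ((X (c t)).2 - (X (d t)).2)))); auto.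
  - intros t Ht. destruct (Hc t Ht) as [A1 A2]. destruct (Hd t Ht) as [B1 B2]. simpl in *. unfold Ed.
    replace (2 * ((c t).1 - (d t).1) * (k t * ((X (c t)).1 - (X (d t)).1))) with
      (2 * ((c t).1 - (d t).1) * (k t * (X (c t)).1 - k t * (X (d t)).1)) by ring.
    replace (2 * ((c t).2 - (d t).2) * (k t * ((X (c t)).2 - (X (d t)).2))) with
      (2 * ((c t).2 - (d t).2) * (k t * (X (c t)).2 - k t * (X (d t)).2)) by ring.
    apply (is_derive_plus (fun t => ((c t).1 - (d t).1) ^ 2) (fun t => ((c t).2 - (d t).2) ^ 2)).
    + apply (is_derive_sqdiff (fun t => (c t).1) (fun t => (d t).1)); auto.
    + apply (is_derive_sqdiff (fun t => (c t).2) (fun t => (d t).2)); auto.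
  - intros t Ht. destruct HX as [HX _]. destruct (HX (c t) (d t)) as [H1 H2]. specialize (Hk t Ht).
    destruct (Ed_d1 (c t) (d t)) as [_ E]. set (a1 := (c t).1 - (d t).1) in *. set (a2 := (c t).2 - (d t).2) in *.
    set (e1 := (X (c t)).1 - (X (d t)).1) in *. set (e2 := (X (c t)).2 - (X (d t)).2) in *.
    assert (G : forall u v w, Rabs v <= M -> Rabs w <= L * d1 (c t) (d t) -> 2 * u * (v * w) <= 2 * Rabs u * (M * (L * d1 (c t) (d t)))).
    { intros u v w Hv Hw. pose proof (Rle_abs (2 * u * (v * w))) as Q. rewrite !Rabs_mult in Q.
      rewrite (Rabs_pos_eq 2) in Q by lra. eapply Rle_trans. exact Q. apply Rmult_le_compat_l. absp u. lra.
      apply Rmult_le_compat; auto; apply Rabs_pos. }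
    eapply Rle_trans. apply Rplus_le_compat; apply G; eauto.
    replace (2 * Rabs a1 * (M * (L * d1 (c t) (d t))) + 2 * Rabs a2 * (M * (L * d1 (c t) (d t)))) with
      (2 * M * L * (d1 (c t) (d t)) ^ 2) by (unfold d1; fold a1 a2; ring).
    replace (4 * L * M * Ed (c t) (d t)) with (2 * M * L * (2 * Ed (c t) (d t))) by ring.
    apply Rmult_le_compat_l; auto. apply Rmult_le_pos; lra.
Qed.

Lemma has_velocity_ext c t v w : v = w -> has_velocity c t v -> has_velocity c t w.
Proof. intros; subst; auto. Qed.

Lemma has_velocity_opp c t v : has_velocity c (- t) v -> has_velocity (fun u => c (- u)) t (- v.1, - v.2).
Proof.
  intros [H1 H2]. split; simpl.
  - apply (is_derive_comp_opp (fun u => (c u).1)); auto.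
  - apply (is_derive_comp_opp (fun u => (c u).2)); auto.
Qed.

Lemma is_derive_shift (f : R -> R) (a t l : R) : is_derive f (t + a) l -> is_derive (fun u => f (u + a)) t l.
Proof.
  intros H. replace l with (scal 1 l) by (unfold scal; simpl; unfold mult; simpl; ring).
  apply (is_derive_comp f (fun u => u + a)). exact H. auto_derive; auto; ring.
Qed.

Lemma has_velocity_shift c a t v : has_velocity c (t + a) v -> has_velocity (fun u => c (u + a)) t v.
Proof.
  intros [H1 H2]. split; simpl.
  - apply (is_derive_shift (fun u => (c u).1)); auto.
  - apply (is_derive_shift (fun u => (c u).2)); auto.
Qed.

Lemma Ed_le_0 p q : Ed p q <= 0 -> p = q.
Proof.
  intros H. apply d1_0. destruct (Ed_d1 p q). pose proof (d1_pos p q). nra.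
Qed.
Lemma Ed_refl p : Ed p p = 0.
Proof. unfold Ed. ring. Qed.

Lemma solutions_unique_fwd L B X (c d : R -> R * R) (a b : R) :
  glip L B X -> solution_on X (fun t => a <= t <= b) c -> solution_on X (fun t => a <= t <= b) d ->
  c a = d a -> forall t, a <= t <= b -> c t = d t.
Proof.
  intros HX Hc Hd E t Ht. apply Ed_le_0.
  replace 0 with (Ed (c a) (d a) * exp (4 * L * 1 * (t - a))) by (rewrite E, Ed_refl; ring).
  apply (solutions_Ed L B X (fun _ => 1)); auto; try lra.
  - intros; rewrite Rabs_R1; lra.
  - intros s Hs. eapply has_velocity_ext; [|apply Hc; lra]. destruct (X (c s)); simpl; f_equal; ring.
  - intros s Hs. eapply has_velocity_ext; [|apply Hd; lra]. destruct (X (d s)); simpl; f_equal; ring.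
Qed.

Lemma solution_opp X (I : R -> Prop) c :
  solution_on X I c -> solution_on (field_opp X) (fun t => I (- t)) (fun t => c (- t)).
Proof. intros H t Ht. apply has_velocity_opp. apply H; auto. Qed.

Lemma solutions_unique_bwd L B X (c d : R -> R * R) (a b : R) :
  glip L B X -> solution_on X (fun t => a <= t <= b) c -> solution_on X (fun t => a <= t <= b) d ->
  c b = d b -> forall t, a <= t <= b -> c t = d t.
Proof.
  intros HX Hc Hd E t Ht. replace t with (- - t) by ring.
  apply (solutions_unique_fwd L B (field_opp X) (fun t => c (- t)) (fun t => d (- t)) (- b) (- a)).
  - apply glip_opp; auto.
  - intros s Hs. apply (solution_opp X (fun t => a <= t <= b) c); auto. lra.
  - intros s Hs. apply (solution_opp X (fun t => a <= t <= b) d); auto. lra.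
  - rewrite Ropp_involutive; auto.
  - lra.
Qed.

Lemma solutions_unique L B X (c d : R -> R * R) (a b t0 : R) :
  glip L B X -> solution_on X (fun t => a <= t <= b) c -> solution_on X (fun t => a <= t <= b) d ->
  a <= t0 <= b -> c t0 = d t0 -> forall t, a <= t <= b -> c t = d t.
Proof.
  intros HX Hc Hd H0 E t Ht. destruct (Rle_dec t0 t).
  - apply (solutions_unique_fwd L B X c d t0 b); auto; try lra.
    + intros s Hs; apply Hc; lra.
    + intros s Hs; apply Hd; lra.
  - apply (solutions_unique_bwd L B X c d a t0); auto; try lra.
    + intros s Hs; apply Hc; lra.
    + intros s Hs; apply Hd; lra.
Qed.

Section Flow.
Variables (L B : R) (X : R * R -> R * R).
Hypothesis HX : glip L B X.
Notation Phi := (flow X).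

Lemma flow_unique c a b t0 : solution_on X (fun t => a <= t <= b) c -> a <= t0 <= b ->
  forall t, a <= t <= b -> c t = Phi (t - t0) (c t0).
Proof.
  intros Hc H0 t Ht. apply (solutions_unique L B X c (fun t => Phi (t - t0) (c t0)) a b t0); auto.
  - intros s Hs. apply (has_velocity_shift (fun t => Phi t (c t0)) (- t0)). apply (flow_sol L B); auto.
  - rewrite Rminus_diag, (flow_0 L B); auto.
Qed.

Lemma flow_plus s t p : Phi (s + t) p = Phi s (Phi t p).
Proof.
  rewrite (flow_unique (fun u => Phi u p) (Rmin t (s + t)) (Rmax t (s + t)) t).
  - f_equal. ring.
  - intros u _. apply (flow_sol L B); auto.
  - split; [apply Rmin_l|apply Rmax_l].
  - split; [apply Rmin_r|apply Rmax_r].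
Qed.

Lemma flow_inv t p : Phi (- t) (Phi t p) = p.
Proof. rewrite <- flow_plus. rewrite Rplus_opp_l. apply (flow_0 L B); auto. Qed.

Lemma flow_inv' t p : Phi t (Phi (- t) p) = p.
Proof. rewrite <- flow_plus. rewrite Rplus_opp_r. apply (flow_0 L B); auto. Qed.

Lemma flow_inj t p q : Phi t p = Phi t q -> p = q.
Proof. intros H. rewrite <- (flow_inv t p), H. apply flow_inv. Qed.

Lemma flow_Ed t p q : 0 <= t -> Ed (Phi t p) (Phi t q) <= Ed p q * exp (4 * L * t).
Proof.
  intros Ht. replace (Ed p q) with (Ed (Phi 0 p) (Phi 0 q)) by (rewrite !(flow_0 L B); auto).
  replace (4 * L * t) with (4 * L * 1 * (t - 0)) by ring.
  apply (solutions_Ed L B X (fun _ => 1) 1 (fun u => Phi u p) (fun u => Phi u q)); auto; try lra.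
  - intros; rewrite Rabs_R1; lra.
  - intros s _. eapply has_velocity_ext; [|apply (flow_sol L B); auto]. destruct (X (Phi s p)); simpl; f_equal; ring.
  - intros s _. eapply has_velocity_ext; [|apply (flow_sol L B); auto]. destruct (X (Phi s q)); simpl; f_equal; ring.
Qed.
End Flow.

Lemma flow_opp L B X t p : glip L B X -> flow (field_opp X) t p = flow X (- t) p.
Proof.
  intros HX.
  pose proof (flow_unique L B (field_opp X) (glip_opp _ _ _ HX) (fun u => flow X (- u) p) (Rmin 0 t) (Rmax 0 t) 0) as H.
  rewrite H.
  - rewrite Ropp_0, (flow_0 L B), Rminus_0_r; auto.
  - intros s _. apply (solution_opp X (fun _ => True) (fun t => flow X t p)); auto. intros u _. apply (flow_sol L B); auto.
  - split; [apply Rmin_l|apply Rmax_l].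
  - split; [apply Rmin_r|apply Rmax_r].
Qed.

Section Flow2.
Variables (L B : R) (X : R * R -> R * R).
Hypothesis HX : glip L B X.
Notation Phi := (flow X).

Lemma flow_Ed_abs t p q : Ed (Phi t p) (Phi t q) <= Ed p q * exp (4 * L * Rabs t).
Proof.
  destruct (Rle_dec 0 t).
  - rewrite Rabs_pos_eq by auto. apply (flow_Ed L B); auto.
  - rewrite Rabs_left by lra. pose proof (flow_Ed L B (field_opp X) (glip_opp _ _ _ HX) (- t) p q !!) as H.
    rewrite !(flow_opp L B), Ropp_involutive in H; auto.
Qed.

Lemma flow_d1 t p q : d1 (Phi t p) (Phi t q) <= 2 * exp (2 * L * Rabs t) * d1 p q.
Proof.
  pose proof (flow_Ed_abs t p q) as H. destruct (Ed_d1 p q) as [A _]. destruct (Ed_d1 (Phi t p) (Phi t q)) as [_ C].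
  pose proof (d1_pos p q). pose proof (d1_pos (Phi t p) (Phi t q)).
  assert (E : exp (4 * L * Rabs t) = exp (2 * L * Rabs t) ^ 2).
  { simpl. rewrite Rmult_1_r, <- exp_plus. f_equal. ring. }
  rewrite E in H. pose proof (exp_pos (2 * L * Rabs t)) as HE. set (e := exp _) in *.
  apply Rsqr_incr_0_var; [|apply Rmult_le_pos; [lra|auto]]. unfold Rsqr. nra.
Qed.

Lemma flow_time t s p : d1 (Phi t p) (Phi s p) <= 2 * B * Rabs (t - s).
Proof.
  assert (G : forall f df : R -> R, (forall u, is_derive f u (df u)) -> (forall u, Rabs (df u) <= B) -> Rabs (f t - f s) <= B * Rabs (t - s)).
  { intros f df Hd Hb. destruct (MVT_gen f s t df) as [c [_ Hc]].
    - intros; auto.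
    - intros x _. apply continuity_pt_filterlim. eapply is_derive_cont. apply Hd.
    - rewrite Hc, Rabs_mult. apply Rmult_le_compat_r. apply Rabs_pos. auto. }
  unfold d1. destruct HX as [_ Hb]. pose proof (G (fun u => (Phi u p).1) (fun u => (X (Phi u p)).1)) as G1.
  pose proof (G (fun u => (Phi u p).2) (fun u => (X (Phi u p)).2)) as G2.
  replace (2 * B * Rabs (t - s)) with (B * Rabs (t - s) + B * Rabs (t - s)) by ring.
  apply Rplus_le_compat; [apply G1|apply G2]; intros u; try apply Hb; apply (flow_sol L B); auto.
Qed.
End Flow2.

(** * Truncation of locally Lipschitz fields *)

Definition clip (K x : R) : R := Rmax (- K) (Rmin K x).

Lemma clip_id K x : Rabs x <= K -> clip K x = x.
Proof. intros H. absle H. unfold clip. rewrite Rmin_right, Rmax_right; lra. Qed.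
Lemma clip_abs K x : 0 <= K -> Rabs (clip K x) <= K.
Proof. intros H. apply Rabs_le. unfold clip, Rmax, Rmin. repeat destruct Rle_dec; lra. Qed.
Lemma clip_lip K x y : 0 <= K -> Rabs (clip K x - clip K y) <= Rabs (x - y).
Proof.
  intros H. unfold clip, Rmax, Rmin. repeat destruct Rle_dec; unfold Rabs; repeat destruct Rcase_abs; lra.
Qed.

(** Composing with the projection onto a square makes the field bounded and globally Lipschitz, so
    that it has a global flow; inside the square nothing changes. *)
Definition clipped (K : R) (X : R * R -> R * R) (p : R * R) : R * R := X (clip K p.1, clip K p.2).

Definition inbox (K : R) (p : R * R) : Prop := Rabs p.1 <= K /\ Rabs p.2 <= K.

Lemma clipped_in K X p : inbox K p -> clipped K X p = X p.
Proof. intros [H1 H2]. unfold clipped. rewrite !clip_id by auto. destruct p; auto. Qed.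

Definition loc_lip (X : R * R -> R * R) : Prop :=
  forall K, 0 <= K -> exists L, forall p q, inbox K p -> inbox K q ->
    Rabs ((X p).1 - (X q).1) <= L * d1 p q /\ Rabs ((X p).2 - (X q).2) <= L * d1 p q.

Lemma clipped_glip K X : 0 <= K -> loc_lip X -> exists L B, glip L B (clipped K X).
Proof.
  intros HK HX. destruct (HX K HK) as [L0 HL]. set (L := Rabs L0). assert (HL' : forall p q, inbox K p -> inbox K q ->
    Rabs ((X p).1 - (X q).1) <= L * d1 p q /\ Rabs ((X p).2 - (X q).2) <= L * d1 p q).
  { intros p q Hp Hq. destruct (HL p q Hp Hq). pose proof (Rle_abs L0). pose proof (d1_pos p q). fold L in H1.
    split; (eapply Rle_trans; [eassumption|apply Rmult_le_compat_r; auto]). }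
  assert (HLp : 0 <= L) by apply Rabs_pos. assert (CB : forall p : R * R, inbox K (clip K p.1, clip K p.2)).
  { intros p. split; simpl; apply clip_abs; auto. }
  exists L, (Rabs (X (0, 0)).1 + Rabs (X (0, 0)).2 + L * (2 * K)). split.
  - intros p q. unfold clipped. destruct (HL' _ _ (CB p) (CB q)) as [A1 A2].
    assert (D : d1 (clip K p.1, clip K p.2) (clip K q.1, clip K q.2) <= d1 p q).
    { unfold d1; simpl. apply Rplus_le_compat; apply clip_lip; auto. }
    split; (eapply Rle_trans; [eassumption|apply Rmult_le_compat_l; auto]).
  - intros p. unfold clipped. assert (I0 : inbox K (0, 0)) by (split; simpl; rewrite Rabs_R0; auto).
    destruct (HL' _ _ (CB p) I0) as [A1 A2]. assert (D : d1 (clip K p.1, clip K p.2) (0, 0) <= 2 * K).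
    { unfold d1; simpl. rewrite !Rminus_0_r. pose proof (clip_abs K p.1 HK). pose proof (clip_abs K p.2 HK). lra. }
    absp ((X (0,0)).1). absp ((X (0,0)).2). set (q := (clip K p.1, clip K p.2)) in *.
    pose proof (Rabs_triang ((X q).1 - (X (0,0)).1) (X (0,0)).1) as T1.
    pose proof (Rabs_triang ((X q).2 - (X (0,0)).2) (X (0,0)).2) as T2.
    replace ((X q).1 - (X (0, 0)).1 + (X (0, 0)).1) with (X q).1 in T1 by ring.
    replace ((X q).2 - (X (0, 0)).2 + (X (0, 0)).2) with (X q).2 in T2 by ring.
    assert (L * d1 q (0,0) <= L * (2 * K)) by (apply Rmult_le_compat_l; auto). split; lra.
Qed.

Definition box_lip (K : R) (f : R * R -> R) : Prop :=
  exists L M, 0 <= L /\ 0 <= M /\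
   (forall p q, inbox K p -> inbox K q -> Rabs (f p - f q) <= L * d1 p q) /\
   (forall p, inbox K p -> Rabs (f p) <= M).

Lemma box_lip_const K c : box_lip K (fun _ => c).
Proof.
  exists 0, (Rabs c). split; [lra|]. split; [apply Rabs_pos|]. split.
  - intros. rewrite Rminus_diag, Rabs_R0. lra.
  - intros; lra.
Qed.
Lemma box_lip_fst K : 0 <= K -> box_lip K fst.
Proof.
  intros HK. exists 1, K. split; [lra|]. split; [auto|]. split.
  - intros p q _ _. unfold d1. absp (p.2 - q.2). lra.
  - intros p [H _]; auto.
Qed.
Lemma box_lip_snd K : 0 <= K -> box_lip K snd.
Proof.
  intros HK. exists 1, K. split; [lra|]. split; [auto|]. split.
  - intros p q _ _. unfold d1. absp (p.1 - q.1). lra.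
  - intros p [_ H]; auto.
Qed.
Lemma box_lip_plus K f g : box_lip K f -> box_lip K g -> box_lip K (fun p => f p + g p).
Proof.
  intros [L [M [H1 [H2 [H3 H4]]]]] [L' [M' [H1' [H2' [H3' H4']]]]]. exists (L + L'), (M + M'). repeat split; try lra.
  - intros p q Hp Hq. specialize (H3 p q Hp Hq). specialize (H3' p q Hp Hq).
    replace (f p + g p - (f q + g q)) with ((f p - f q) + (g p - g q)) by ring.
    eapply Rle_trans. apply Rabs_triang. lra.
  - intros p Hp. specialize (H4 p Hp). specialize (H4' p Hp). eapply Rle_trans. apply Rabs_triang. lra.
Qed.
Lemma box_lip_mult K f g : box_lip K f -> box_lip K g -> box_lip K (fun p => f p * g p).
Proof.
  intros [L [M [H1 [H2 [H3 H4]]]]] [L' [M' [H1' [H2' [H3' H4']]]]]. exists (L * M' + M * L'), (M * M'). repeat split.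
  - apply Rplus_le_le_0_compat; apply Rmult_le_pos; auto.
  - apply Rmult_le_pos; auto.
  - intros p q Hp Hq. pose proof (H3 p q Hp Hq) as A. pose proof (H3' p q Hp Hq) as A'.
    pose proof (H4 q Hq) as C. pose proof (H4' p Hp) as C'.
    replace (f p * g p - f q * g q) with ((f p - f q) * g p + f q * (g p - g q)) by ring.
    eapply Rle_trans. apply Rabs_triang. rewrite !Rabs_mult.
    replace ((L * M' + M * L') * d1 p q) with ((L * d1 p q) * M' + M * (L' * d1 p q)) by ring.
    apply Rplus_le_compat; apply Rmult_le_compat; auto; apply Rabs_pos.
  - intros p Hp. rewrite Rabs_mult. apply Rmult_le_compat; auto; apply Rabs_pos.
Qed.
Lemma box_lip_ext K f g : (forall p, f p = g p) -> box_lip K f -> box_lip K g.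
Proof.
  intros E [L [M [H1 [H2 [H3 H4]]]]]. exists L, M. repeat split; auto.
  - intros. rewrite <- !E; auto.
  - intros. rewrite <- !E; auto.
Qed.
Lemma box_lip_pow K f n : box_lip K f -> box_lip K (fun p => f p ^ n).
Proof. intros H. induction n; simpl. apply box_lip_const. apply box_lip_mult; auto. Qed.

Lemma loc_lip_of_box X : (forall K, 0 <= K -> box_lip K (fun p => (X p).1)) -> (forall K, 0 <= K -> box_lip K (fun p => (X p).2)) -> loc_lip X.
Proof.
  intros H1 H2 K HK. destruct (H1 K HK) as [L [M [A1 [A2 [A3 A4]]]]]. destruct (H2 K HK) as [L' [M' [A1' [A2' [A3' A4']]]]].
  exists (L + L'). intros p q Hp Hq. specialize (A3 p q Hp Hq). specialize (A3' p q Hp Hq). pose proof (d1_pos p q). split; nra.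
Qed.

Lemma loc_lip_opp X : loc_lip X -> loc_lip (field_opp X).
Proof.
  intros H K HK. destruct (H K HK) as [L HL]. exists L. intros p q Hp Hq. destruct (HL p q Hp Hq).
  unfold field_opp; simpl. replace (- (X p).1 - - (X q).1) with (- ((X p).1 - (X q).1)) by ring.
  replace (- (X p).2 - - (X q).2) with (- ((X p).2 - (X q).2)) by ring. rewrite !Rabs_Ropp. auto.
Qed.

(** * Intermediate values and continuous polar angles *)

Lemma cont_pt (f : R -> R) (t : R) : continuous f t -> continuity_pt f t.
Proof. intros H. apply continuity_pt_filterlim. exact H. Qed.

Lemma ivt_incr (f : R -> R) (a b v : R) : a <= b -> (forall t, a <= t <= b -> continuous f t) ->
  f a <= v <= f b -> exists t, a <= t <= b /\ f t = v.
Proof.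
  intros Hab Hc [H1 H2]. destruct (Req_dec (f a) v) as [E|E]; [exists a; split; auto; lra|].
  destruct (Req_dec (f b) v) as [E'|E']; [exists b; split; auto; lra|].
  destruct (Req_dec a b) as [E2|E2]; [subst; lra|].
  destruct (Ranalysis5.IVT_interv (fun t => f t - v) a b) as [t [Ht Hv]]; try lra.
  - intros t Ht. apply cont_pt. apply (continuous_minusR f (fun _ => v)); [apply Hc; auto|apply continuous_const].
  - exists t. split; auto; lra.
Qed.

Lemma ivt_decr (f : R -> R) (a b v : R) : a <= b -> (forall t, a <= t <= b -> continuous f t) ->
  f b <= v <= f a -> exists t, a <= t <= b /\ f t = v.
Proof.
  intros Hab Hc H. destruct (ivt_incr (fun t => - f t) a b (- v)) as [t [Ht E]]; auto; try lra.
  - intros t Ht. apply (continuous_opp (V:=R_NormedModule) f). auto.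
  - exists t. split; auto. lra.
Qed.

Lemma cont_bounded (f : R -> R) (a b : R) : a <= b -> (forall t, a <= t <= b -> continuous f t) ->
  exists M, 0 < M /\ forall t, a <= t <= b -> Rabs (f t) <= M.
Proof.
  intros Hab Hc. destruct (continuity_ab_maj (fun t => Rabs (f t)) a b Hab) as [m [Hm _]].
  - intros c Hcc. apply cont_pt. apply (continuous_comp f Rabs); auto. apply continuous_Rabs.
  - exists (Rabs (f m) + 1). split. absp (f m); lra. intros t Ht. specialize (Hm t Ht). simpl in Hm. lra.
Qed.

Lemma cont_pos_min (f : R -> R) (a b : R) : a <= b -> (forall t, a <= t <= b -> continuous f t) ->
  (forall t, a <= t <= b -> 0 < f t) -> exists m, 0 < m /\ forall t, a <= t <= b -> m <= f t.
Proof.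
  intros Hab Hc Hp. destruct (continuity_ab_min f a b Hab) as [m [Hm Hm']].
  - intros c Hcc. apply cont_pt; auto.
  - exists (f m). split; auto.
Qed.

Lemma cos_1_2kPI (x : R) : cos x = 1 -> exists k : Z, x = 2 * PI * IZR k.
Proof.
  intros H. assert (S : sin (x / 2) = 0).
  { replace x with (2 * (x / 2)) in H by field. rewrite cos_2a_sin in H. nra. }
  destruct (sin_eq_0_0 _ S) as [k Hk]. exists k. lra.
Qed.

Lemma cos_sin_eq_2kPI (a b : R) : cos a = cos b -> sin a = sin b -> exists k : Z, a = b + 2 * PI * IZR k.
Proof.
  intros H1 H2. destruct (cos_1_2kPI (a - b)) as [k Hk].
  - rewrite cos_minus, H1, H2. pose proof (sin2_cos2 b). unfold Rsqr in H. lra.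
  - exists k. lra.
Qed.

(** The difference [D] of two angles of the same vector has cosine 1 everywhere. If its values at
    the ends differed, [D] would pass through [D a + PI] or [D a - PI], where the cosine is -1. *)
Lemma lifts_differ_const (f g : R -> R) (a b : R) : a <= b ->
  (forall t, a <= t <= b -> continuous f t) -> (forall t, a <= t <= b -> continuous g t) ->
  (forall t, a <= t <= b -> cos (f t) = cos (g t) /\ sin (f t) = sin (g t)) ->
  f b - g b = f a - g a.
Proof.
  intros Hab Hf Hg H. set (D := fun t => f t - g t).
  assert (HD : forall t, a <= t <= b -> continuous D t) by (intros; apply continuous_minusR; auto).
  assert (HI : forall t, a <= t <= b -> cos (D t) = 1).
  { intros t Ht. destruct (H t Ht) as [H1 H2]. unfold D. rewrite cos_minus, H1, H2.
    pose proof (sin2_cos2 (g t)) as HH. unfold Rsqr in HH. lra. }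
  change (D b = D a). apply Rminus_diag_uniq. destruct (cos_1_2kPI (D b - D a)) as [k Hk].
  { destruct (cos_1_2kPI (D b)) as [k1 E1]. apply HI; lra. destruct (cos_1_2kPI (D a)) as [k2 E2]. apply HI; lra.
    rewrite E1, E2. rewrite cos_minus.
    assert (C : forall k : Z, cos (2 * PI * IZR k) = 1 /\ sin (2 * PI * IZR k) = 0).
    { intros z. assert (S0 : sin (PI * IZR z) = 0). { rewrite Rmult_comm. apply sin_eq_0_1. exists z; auto. }
      replace (2 * PI * IZR z) with (2 * (PI * IZR z)) by ring. rewrite cos_2a_sin, sin_2a, S0. split; ring. }
    destruct (C k1) as [-> ->]. destruct (C k2) as [-> ->]. ring. }
  pose proof PI_RGT_0. assert (NO : forall t, a <= t <= b -> D t = D a + PI \/ D t = D a - PI -> False).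
  { intros t Ht [E|E]; pose proof (HI t Ht) as Q; rewrite E in Q.
    - rewrite neg_cos, HI in Q; lra.
    - replace (D a - PI) with (- (PI - D a)) in Q by ring. rewrite cos_neg, <- (Ropp_involutive (D a)) in Q.
      replace (PI - - - D a) with (- D a + PI) in Q by ring. rewrite neg_cos, cos_neg, HI in Q; lra. }
  destruct (Z.eq_dec k 0) as [->|Hk0]; [rewrite Hk; ring|exfalso]. destruct (Z_lt_le_dec k 0) as [K|K].
  - assert (IZR k <= -1). { apply IZR_le. lia. }
    destruct (ivt_decr D a b (D a - PI)) as [t [Ht E]]; auto; [nra|]. eapply NO; eauto.
  - assert (1 <= IZR k). { apply IZR_le. lia. }
    destruct (ivt_incr D a b (D a + PI)) as [t [Ht E]]; auto; [nra|]. eapply NO; eauto.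
Qed.

(** The angular velocity of [(x, y)] about the origin. *)
Definition rate (x y dx dy : R -> R) (t : R) : R := (x t * dy t - y t * dx t) / (x t ^ 2 + y t ^ 2).

Lemma sum_sq_pos (x y : R) : (x <> 0 \/ y <> 0) -> 0 < x ^ 2 + y ^ 2.
Proof. intros [H|H]; pose proof (pow2_ge_0 x); pose proof (pow2_ge_0 y); [assert (0 < x ^ 2) by (apply pow2_gt_0; auto)|assert (0 < y ^ 2) by (apply pow2_gt_0; auto)]; lra. Qed.

Lemma continuous_multR (f g : R -> R) (t : R) : continuous f t -> continuous g t -> continuous (fun u => f u * g u) t.
Proof. intros; apply (continuous_mult (K:=R_AbsRing) f g); auto. Qed.
Lemma continuous_plusR (f g : R -> R) (t : R) : continuous f t -> continuous g t -> continuous (fun u => f u + g u) t.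
Proof. intros; apply (continuous_plus (V:=R_NormedModule) f g); auto. Qed.
Lemma continuous_invR (f : R -> R) (t : R) : continuous f t -> f t <> 0 -> continuous (fun u => / f u) t.
Proof. intros. apply (continuous_comp f Rinv); auto. apply continuous_Rinv; auto. Qed.
Lemma continuous_powR (f : R -> R) (n : nat) (t : R) : continuous f t -> continuous (fun u => f u ^ n) t.
Proof. intros H; induction n; simpl. apply continuous_const. apply continuous_multR; auto. Qed.

Lemma rate_cont x y dx dy t : continuous x t -> continuous y t -> continuous dx t -> continuous dy t ->
  (x t <> 0 \/ y t <> 0) -> continuous (rate x y dx dy) t.
Proof.
  intros. unfold rate, Rdiv. apply continuous_multR.
  - apply continuous_minusR; apply continuous_multR; auto.
  - apply continuous_invR. apply continuous_plusR; apply continuous_powR; auto. pose proof (sum_sq_pos _ _ H3). lra.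
Qed.

(* Freezing an integrand outside of a compact interval makes the fundamental theorem available with two-sided derivatives. *)
Definition proj (a b t : R) : R := Rmax a (Rmin b t).
Lemma proj_in a b t : a <= b -> a <= proj a b t <= b.
Proof. intros. unfold proj, Rmax, Rmin. repeat destruct Rle_dec; lra. Qed.
Lemma proj_id a b t : a <= t <= b -> proj a b t = t.
Proof. intros. unfold proj. rewrite Rmin_right, Rmax_right; lra. Qed.
Lemma proj_cont a b t : continuous (proj a b) t.
Proof.
  apply lip_cont with 1. lra. intros. unfold proj, Rmax, Rmin. repeat destruct Rle_dec; unfold Rabs; repeat destruct Rcase_abs; lra.
Qed.

Lemma frozen_cont (f : R -> R) (a b : R) : a <= b -> (forall t, a <= t <= b -> continuous f t) ->
  forall t, continuous (fun u => f (proj a b u)) t.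
Proof. intros Hab H t. apply (continuous_comp (proj a b) f). apply proj_cont. apply H. apply proj_in; auto. Qed.

Section Angle.
Variables (x y dx dy : R -> R) (a b th0 : R).
Hypothesis Hab : a <= b.
Hypothesis Hx : forall t, a <= t <= b -> is_derive x t (dx t).
Hypothesis Hy : forall t, a <= t <= b -> is_derive y t (dy t).
Hypothesis Hdx : forall t, a <= t <= b -> continuous dx t.
Hypothesis Hdy : forall t, a <= t <= b -> continuous dy t.
Hypothesis Hnz : forall t, a <= t <= b -> x t <> 0 \/ y t <> 0.

Definition lift (t : R) : R := th0 + RInt (fun u => rate x y dx dy (proj a b u)) a t.

Lemma rate_cont_in t : a <= t <= b -> continuous (rate x y dx dy) t.
Proof.
  intros Ht. apply rate_cont; auto; eapply is_derive_cont; [apply Hx|apply Hy]; auto.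
Qed.

Lemma lift_deriv t : is_derive lift t (rate x y dx dy (proj a b t)).
Proof.
  unfold lift. rewrite <- (Rplus_0_l (rate x y dx dy (proj a b t))).
  apply (is_derive_plus (fun _ => th0) (fun t => RInt (fun u => rate x y dx dy (proj a b u)) a t)).
  apply is_derive_constR. apply (RInt_deriv (fun u => rate x y dx dy (proj a b u))).
  apply frozen_cont; auto. apply rate_cont_in.
Qed.

Lemma lift_cont t : continuous lift t.
Proof. eapply is_derive_cont. apply lift_deriv. Qed.

Lemma lift_a : lift a = th0.
Proof. unfold lift. rewrite RInt_point. unfold zero; simpl. ring. Qed.

(** In the frame rotated by [lift t] the normalized vector has the coordinates [u] and [w]. Both
    have derivative 0, and they start at 1 and 0. *)
Lemma lift_spec :
  x a = sqrt (x a ^ 2 + y a ^ 2) * cos th0 -> y a = sqrt (x a ^ 2 + y a ^ 2) * sin th0 ->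
  forall t, a <= t <= b ->
    x t = sqrt (x t ^ 2 + y t ^ 2) * cos (lift t) /\ y t = sqrt (x t ^ 2 + y t ^ 2) * sin (lift t).
Proof.
  intros Ha1 Ha2 t Ht. set (N := fun t => x t ^ 2 + y t ^ 2).
  assert (HN : forall s, a <= s <= b -> 0 < N s) by (intros; apply sum_sq_pos; auto).
  set (u := fun t => (x t * cos (lift t) + y t * sin (lift t)) / sqrt (N t)).
  set (w := fun t => (- x t * sin (lift t) + y t * cos (lift t)) / sqrt (N t)).
  assert (Du : forall s, a <= s <= b -> is_derive u s 0 /\ is_derive w s 0).
  { intros s Hs. pose proof (Hx s Hs) as Dx. pose proof (Hy s Hs) as Dy. pose proof (lift_deriv s) as Dl.
    rewrite (proj_id _ _ _ Hs) in Dl. unfold rate in Dl. pose proof (HN s Hs) as P0. set (th' := _ / _) in Dl.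
    assert (SP : 0 < sqrt (N s)) by (apply sqrt_lt_R0; auto).
    assert (SQ : sqrt (N s) * sqrt (N s) = N s) by (apply sqrt_sqrt; lra).
    assert (DN : is_derive N s (2 * x s * dx s + 2 * y s * dy s)).
    { unfold N. replace (2 * x s * dx s + 2 * y s * dy s) with (INR 2 * dx s * x s ^ pred 2 + INR 2 * dy s * y s ^ pred 2) by (simpl; ring).
      apply (is_derive_plus (fun t => x t ^ 2) (fun t => y t ^ 2)); apply is_derive_pow; auto. }
    assert (DS : is_derive (fun t => sqrt (N t)) s ((x s * dx s + y s * dy s) / sqrt (N s))).
    { replace ((x s * dx s + y s * dy s) / sqrt (N s)) with ((2 * x s * dx s + 2 * y s * dy s) / (2 * sqrt (N s))) by (field; lra).
      apply (is_derive_sqrt N); auto. }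
    assert (Dc : is_derive (fun t => cos (lift t)) s (th' * - sin (lift s))).
    { apply (is_derive_comp cos lift). apply is_derive_Reals, derivable_pt_lim_cos. auto. }
    assert (Ds : is_derive (fun t => sin (lift t)) s (th' * cos (lift s))).
    { apply (is_derive_comp sin lift). apply is_derive_Reals, derivable_pt_lim_sin. auto. }
    assert (E : N s = x s ^ 2 + y s ^ 2) by reflexivity.
    assert (T : th' * N s = x s * dy s - y s * dx s) by (unfold th'; rewrite <- E; field; lra). split.
    - evar_last. apply (is_derive_div _ (fun t => sqrt (N t))); [|exact DS|lra].
      apply (is_derive_plus (fun t => x t * cos (lift t)) (fun t => y t * sin (lift t))).
      apply (is_derive_mult x (fun t => cos (lift t))); eauto. intros; apply Rmult_comm.
      apply (is_derive_mult y (fun t => sin (lift t))); eauto. intros; apply Rmult_comm.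
      unfold plus, mult; simpl. set (C := cos (lift s)) in *. set (S := sin (lift s)) in *. clearbody C S.
      field_simplify_eq; [|lra]. replace (sqrt (N s) ^ 2) with (N s) by (simpl; rewrite Rmult_1_r; auto).
      assert (T2 : (th' * N s) * (- x s * S + y s * C) = (x s * dy s - y s * dx s) * (- x s * S + y s * C)) by (rewrite T; auto).
      rewrite E in *. ring_simplify. ring_simplify in T2. lra.
    - evar_last. apply (is_derive_div _ (fun t => sqrt (N t))); [|exact DS|lra].
      apply (is_derive_plus (fun t => - x t * sin (lift t)) (fun t => y t * cos (lift t))).
      apply (is_derive_mult (fun t => - x t) (fun t => sin (lift t))); eauto. apply (is_derive_opp x); eauto. intros; apply Rmult_comm.
      apply (is_derive_mult y (fun t => cos (lift t))); eauto. intros; apply Rmult_comm.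
      unfold plus, mult, opp; simpl. set (C := cos (lift s)) in *. set (S := sin (lift s)) in *. clearbody C S.
      field_simplify_eq; [|lra]. replace (sqrt (N s) ^ 2) with (N s) by (simpl; rewrite Rmult_1_r; auto).
      assert (T2 : (th' * N s) * (x s * C + y s * S) = (x s * dy s - y s * dx s) * (x s * C + y s * S)) by (rewrite T; auto).
      rewrite E in *. ring_simplify. ring_simplify in T2. lra. }
  assert (Eu : u t = u a). { symmetry. apply is_derive_const_eq. lra. intros s Hs. apply Du; lra. }
  assert (Ew : w t = w a). { symmetry. apply is_derive_const_eq. lra. intros s Hs. apply Du; lra. }
  assert (SA : 0 < sqrt (N a)) by (apply sqrt_lt_R0, HN; lra).
  assert (ST : 0 < sqrt (N t)) by (apply sqrt_lt_R0, HN; lra). fold (N a) in Ha1, Ha2. fold (N t).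
  assert (E1 : u a = 1).
  { unfold u. rewrite lift_a, Ha1, Ha2. pose proof (sin2_cos2 th0) as Q. unfold Rsqr in Q.
    field_simplify_eq; [|lra]. fold (N a).
    replace (sqrt (N a) * cos th0 ^ 2 + sqrt (N a) * sin th0 ^ 2) with (sqrt (N a) * (sin th0 * sin th0 + cos th0 * cos th0)) by ring.
    rewrite Q. ring. }
  assert (E2 : w a = 0).
  { unfold w. rewrite lift_a, Ha1, Ha2. field. lra. }
  rewrite E1 in Eu. rewrite E2 in Ew. unfold u in Eu. unfold w in Ew.
  assert (F1 : x t * cos (lift t) + y t * sin (lift t) = sqrt (N t)).
  { replace (sqrt (N t)) with (1 * sqrt (N t)) by ring. rewrite <- Eu. field. lra. }
  assert (F2 : - x t * sin (lift t) + y t * cos (lift t) = 0).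
  { replace 0 with (0 * sqrt (N t)) by ring. rewrite <- Ew. field. lra. }
  pose proof (sin2_cos2 (lift t)) as Q. unfold Rsqr in Q.
  rewrite <- F1. set (C := cos (lift t)) in *. set (S := sin (lift t)) in *. clearbody C S. split.
  - replace (x t) with (x t * (S * S + C * C)) at 1 by (rewrite Q; ring).
    replace ((x t * C + y t * S) * C) with (x t * (S*S + C * C) + S * (- x t * S + y t * C)) by ring. rewrite F2. ring.
  - replace (y t) with (y t * (S * S + C * C)) at 1 by (rewrite Q; ring).
    replace ((x t * C + y t * S) * S) with (y t * (S*S + C * C) - C * (- x t * S + y t * C)) by ring. rewrite F2. ring.
Qed.
End Angle.

(** Compactness of a segment, in the form of an induction: a property of subintervals that is
    additive and holds around every point holds for the whole. The supremum of the good right ends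
    must be [b]. *)
Lemma segment_induction (P : R -> R -> Prop) (a b : R) : a <= b ->
  (forall x y z, a <= x -> x <= y -> y <= z -> z <= b -> P x y -> P y z -> P x z) ->
  (forall x, a <= x <= b -> exists d, 0 < d /\ forall y z, a <= y -> y <= x -> x <= z -> z <= b ->
     x - d < y -> z < x + d -> P y z) ->
  P a b.
Proof.
  intros Hab Hadd Hloc. set (E := fun z => a <= z <= b /\ P a z). assert (Ea : E a).
  { split; [lra|]. destruct (Hloc a !!) as [d [Hd H]]. apply H; lra. }
  destruct (completeness E) as [s [Hs1 Hs2]].
  - exists b. intros z [Hz _]. lra.
  - exists a; auto.
  - assert (Has : a <= s) by (apply Hs1; auto). assert (Hsb : s <= b) by (apply Hs2; intros z [Hz _]; lra).
    destruct (Hloc s !!) as [d [Hd H]]. assert (exists y, E y /\ s - d < y) as [y [Ey Hy]].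
    { apply NNPP. intros N. assert (s <= s - d); [|lra]. apply Hs2. intros z Ez.
      destruct (Rle_dec z (s - d)); auto. exfalso. apply N. exists z. split; auto. lra. }
    assert (Hys : y <= s) by (apply Hs1; auto). destruct Ey as [Hy1 Py]. set (z := Rmin b (s + d / 2)).
    assert (Hz : s <= z) by (unfold z, Rmin; destruct Rle_dec; lra). assert (Hz2 : z <= b) by apply Rmin_l.
    assert (Hz3 : z < s + d) by (unfold z, Rmin; destruct Rle_dec; lra). assert (Pz : P a z).
    { apply (Hadd a y z); auto; try lra. apply H; lra. }
    assert (z <= s) by (apply Hs1; split; auto; lra). assert (z = b). { unfold z, Rmin in *. destruct Rle_dec; lra. }
    subst z. rewrite <- H1. auto.
Qed.

Lemma locally_const (f : R -> R) (a b : R) : a <= b ->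
  (forall x, a <= x <= b -> exists d, 0 < d /\ forall y, a <= y <= b -> Rabs (y - x) < d -> f y = f x) ->
  f a = f b.
Proof.
  intros Hab H. apply (segment_induction (fun x y => f x = f y) a b); auto.
  - intros; congruence.
  - intros x Hx. destruct (H x Hx) as [d [Hd Hf]]. exists d. split; auto. intros.
    rewrite (Hf y), (Hf z); auto; try lra; apply Rabs_def1; lra.
Qed.

(** One number [d] serves both as the radius of a neighbourhood and as the admissible value there;
    finitely many such values have a positive minimum. *)
Lemma unif_pos (Q : R -> R -> Prop) (a b : R) : a <= b ->
  (forall v e e', Q v e -> 0 < e' <= e -> Q v e') ->
  (forall x, a <= x <= b -> exists d, 0 < d /\ forall y, a <= y <= b -> Rabs (y - x) < d -> Q y d) ->
  exists e, 0 < e /\ forall v, a <= v <= b -> Q v e.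
Proof.
  intros Hab Hm Hl.
  apply (segment_induction (fun x y => exists e, 0 < e /\ forall v, x <= v <= y -> Q v e) a b); auto.
  - intros x y z _ Hxy Hyz _ [e1 [P1 H1]] [e2 [P2 H2]]. exists (Rmin e1 e2).
    assert (0 < Rmin e1 e2) by (apply Rmin_pos; auto). split; auto. intros v Hv. destruct (Rle_dec v y).
    + apply Hm with e1. apply H1; lra. split; auto. apply Rmin_l.
    + apply Hm with e2. apply H2; lra. split; auto. apply Rmin_r.
  - intros x Hx. destruct (Hl x Hx) as [d [Hd H]]. exists d. split; auto. intros y z H1 H2 H3 H4 H5 H6.
    exists d. split; auto. intros v Hv. apply H. lra. apply Rabs_def1; lra.
Qed.

Lemma polar_exists (x y : R) : x <> 0 \/ y <> 0 ->
  exists th, x = sqrt (x ^ 2 + y ^ 2) * cos th /\ y = sqrt (x ^ 2 + y ^ 2) * sin th.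
Proof.
  intros H. pose proof (sum_sq_pos x y H) as P. set (r := sqrt (x ^ 2 + y ^ 2)).
  assert (Hr : 0 < r) by (apply sqrt_lt_R0; auto). assert (Hr2 : r * r = x ^ 2 + y ^ 2) by (apply sqrt_sqrt; lra).
  assert (B : -1 <= x / r <= 1).
  { split.
    - apply Rmult_le_reg_r with r; auto. replace (x / r * r) with x by (field; lra). nra.
    - apply Rmult_le_reg_r with r; auto. replace (x / r * r) with x by (field; lra). nra. }
  assert (S : sqrt (1 - (x / r)²) = Rabs y / r).
  { replace (1 - (x / r)²) with ((Rabs y / r)²).
    rewrite sqrt_Rsqr; auto. apply Rmult_le_pos; [apply Rabs_pos|left; apply Rinv_0_lt_compat; auto].
    unfold Rsqr. replace (Rabs y / r * (Rabs y / r)) with (Rabs y * Rabs y / (r * r)) by (field; lra).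
    rewrite <- Rabs_mult, Rabs_pos_eq by nra. field_simplify_eq; [|lra]. rewrite <- Rsqr_pow2 in *. unfold Rsqr in *. nra. }
  destruct (Rle_dec 0 y) as [Hy|Hy].
  - exists (acos (x / r)). rewrite cos_acos, sin_acos, S, Rabs_pos_eq by auto. split; field; lra.
  - exists (- acos (x / r)). rewrite cos_neg, sin_neg, cos_acos, sin_acos, S by auto.
    rewrite Rabs_left by lra. split; field; lra.
Qed.

Definition C1on (a b : R) (c v : R -> R * R) : Prop :=
  forall t, a <= t <= b -> has_velocity c t (v t) /\
    continuous (fun u => (v u).1) t /\ continuous (fun u => (v u).2) t.

Definition avoids (a b : R) (c : R -> R * R) (q : R * R) : Prop := forall t, a <= t <= b -> c t <> q.

Definition psub (p q : R * R) : R * R := (p.1 - q.1, p.2 - q.2).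

Lemma psub_nz p q : p <> q -> p.1 - q.1 <> 0 \/ p.2 - q.2 <> 0.
Proof.
  intros H. destruct (Req_dec (p.1 - q.1) 0); auto. destruct (Req_dec (p.2 - q.2) 0); auto.
  exfalso. apply H. destruct p, q; simpl in *. f_equal; lra.
Qed.

(** The angle swept by the curve as seen from [q]. Being an integral whose integrand depends
    explicitly on [q], it can be compared for different points [q]. *)
Definition var (a b : R) (c v : R -> R * R) (q : R * R) : R :=
  RInt (fun u => rate (fun t => (c t).1 - q.1) (fun t => (c t).2 - q.2) (fun t => (v t).1) (fun t => (v t).2) (proj a b u)) a b.

Definition polar (p : R * R) (th : R) : Prop := p = (enorm p * cos th, enorm p * sin th).

Lemma var_lift a b c v q th0 : a <= b -> C1on a b c v -> avoids a b c q -> polar (psub (c a) q) th0 ->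
  exists th, (forall t, continuous th t) /\ th a = th0 /\ th b = th0 + var a b c v q /\
    forall t, a <= t <= b -> polar (psub (c t) q) (th t).
Proof.
  intros Hab HC HA H0. set (x := fun t => (c t).1 - q.1). set (y := fun t => (c t).2 - q.2).
  assert (Dx : forall t, a <= t <= b -> is_derive x t (v t).1).
  { intros t Ht. destruct (HC t Ht) as [[A _] _]. unfold x. replace (v t).1 with ((v t).1 - 0) by ring.
    apply (is_derive_minus (fun t => (c t).1) (fun _ => q.1)); auto. apply is_derive_constR. }
  assert (Dy : forall t, a <= t <= b -> is_derive y t (v t).2).
  { intros t Ht. destruct (HC t Ht) as [[_ A] _]. unfold y. replace (v t).2 with ((v t).2 - 0) by ring.
    apply (is_derive_minus (fun t => (c t).2) (fun _ => q.2)); auto. apply is_derive_constR. }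
  assert (NZ : forall t, a <= t <= b -> x t <> 0 \/ y t <> 0).
  { intros t Ht. apply psub_nz. apply HA; auto. }
  exists (lift x y (fun t => (v t).1) (fun t => (v t).2) a b th0).
  assert (C1 : forall t, a <= t <= b -> continuous (fun t => (v t).1) t) by (intros t Ht; exact (proj1 (proj2 (HC t Ht)))).
  assert (C2 : forall t, a <= t <= b -> continuous (fun t => (v t).2) t) by (intros t Ht; exact (proj2 (proj2 (HC t Ht)))).
  split; [|split; [|split]].
  - intros t. apply lift_cont; auto.
  - apply lift_a.
  - reflexivity.
  - unfold polar, psub, enorm in H0; simpl in H0. injection H0; intros E2 E1.
    intros t Ht. destruct (lift_spec x y (fun t => (v t).1) (fun t => (v t).2) a b th0 Hab Dx Dy C1 C2 NZ E1 E2 t Ht) as [F1 F2].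
    unfold polar, psub, enorm; simpl. f_equal; auto.
Qed.

Lemma enorm_pos p : p <> origin -> 0 < enorm p.
Proof.
  intros H. unfold enorm. apply sqrt_lt_R0. apply sum_sq_pos.
  destruct (Req_dec p.1 0); auto. destruct (Req_dec p.2 0); auto. exfalso. apply H. destruct p; simpl in *; subst; auto.
Qed.

Lemma polar_unique p a b : p <> origin -> polar p a -> polar p b -> cos a = cos b /\ sin a = sin b.
Proof.
  intros Hp Ha Hb. pose proof (enorm_pos p Hp) as E. unfold polar in *.
  destruct p as [x y]. injection Ha; injection Hb; intros.
  split; apply Rmult_eq_reg_l with (enorm (x, y)); try lra; congruence.
Qed.

Lemma polar_exists' p : p <> origin -> exists th, polar p th.
Proof.
  intros H. destruct (polar_exists p.1 p.2) as [th [H1 H2]].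
  - destruct (Req_dec p.1 0); auto. destruct (Req_dec p.2 0); auto. exfalso. apply H. destruct p; simpl in *; subst; auto.
  - exists th. unfold polar, enorm. destruct p; simpl fst in *; simpl snd in *. f_equal; auto.
Qed.

Lemma psub_origin p q : p <> q -> psub p q <> origin.
Proof. intros H E. apply H. unfold psub, origin in E. destruct p, q; simpl in *. injection E; intros. f_equal; lra. Qed.

(** * Variation of the angle about a moving point *)
Lemma d1_cont (c : R -> R * R) q t : continuous (fun u => (c u).1) t -> continuous (fun u => (c u).2) t ->
  continuous (fun u => d1 (c u) q) t.
Proof.
  intros H1 H2. unfold d1. apply continuous_plusR.
  - apply (continuous_comp (fun u => (c u).1 - q.1) Rabs); [|apply continuous_Rabs].
    apply continuous_minusR; auto. apply continuous_const.
  - apply (continuous_comp (fun u => (c u).2 - q.2) Rabs); [|apply continuous_Rabs].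
    apply continuous_minusR; auto. apply continuous_const.
Qed.

Lemma C1on_cont a b c v t : C1on a b c v -> a <= t <= b ->
  continuous (fun u => (c u).1) t /\ continuous (fun u => (c u).2) t.
Proof. intros H Ht. destruct (H t Ht) as [[H1 H2] _]. split; eapply is_derive_cont; eauto. Qed.

Lemma avoids_dist a b c q : a <= b ->
  (forall t, a <= t <= b -> continuous (fun u => (c u).1) t /\ continuous (fun u => (c u).2) t) ->
  avoids a b c q ->
  exists m, 0 < m /\ forall t, a <= t <= b -> m <= d1 (c t) q.
Proof.
  intros Hab HC HA. apply cont_pos_min; auto.
  - intros t Ht. destruct (HC t Ht). apply d1_cont; auto.
  - intros t Ht. destruct (Rle_lt_dec (d1 (c t) q) 0); auto. exfalso. apply (HA t Ht). apply d1_0; auto.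
Qed.

(** The two quotients are the coordinates of the image of a point under inversion in the unit
    circle; away from the origin the inversion is Lipschitz. *)
Lemma inversion_bound (x y x' y' : R) (m : R) : 0 < m -> m <= Rabs x + Rabs y -> m <= Rabs x' + Rabs y' ->
  Rabs (x / (x ^ 2 + y ^ 2) - x' / (x' ^ 2 + y' ^ 2)) <= 4 / m ^ 2 * (Rabs (x - x') + Rabs (y - y')) /\
  Rabs (y / (x ^ 2 + y ^ 2) - y' / (x' ^ 2 + y' ^ 2)) <= 4 / m ^ 2 * (Rabs (x - x') + Rabs (y - y')).
Proof.
  intros Hm H H'. assert (N : forall a b, m <= Rabs a + Rabs b -> m ^ 2 <= 2 * (a ^ 2 + b ^ 2)).
  { intros a b Hab. rewrite <- (pow2_abs a), <- (pow2_abs b). absp a. absp b.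
    generalize dependent (Rabs a); generalize dependent (Rabs b). intros u Hu w Hw Hv. pose proof (pow2_ge_0 (u - w)). nra. }
  pose proof (N _ _ H) as N1. pose proof (N _ _ H') as N2. assert (Hm2 : 0 < m ^ 2) by (apply pow_lt; auto).
  set (n := x ^ 2 + y ^ 2) in *. set (n' := x' ^ 2 + y' ^ 2) in *.
  assert (Pn : 0 < n) by lra. assert (Pn' : 0 < n') by lra. set (h := (x - x') ^ 2 + (y - y') ^ 2).
  set (D := Rabs (x - x') + Rabs (y - y')). assert (HD : 0 <= D) by (unfold D; absp (x - x'); absp (y - y'); lra).
  assert (Hh : h <= D ^ 2).
  { unfold h, D. rewrite <- (pow2_abs (x - x')), <- (pow2_abs (y - y')). absp (x - x'). absp (y - y'). nra. }
  (* Inversion divides the distance of two points by the product of their norms. *)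
  assert (E : (x / n - x' / n') ^ 2 + (y / n - y' / n') ^ 2 = h / (n * n')).
  { unfold h. field_simplify_eq; [|lra]. unfold n, n'. ring. }
  assert (HB : h / (n * n') <= (4 / m ^ 2 * D) ^ 2).
  { apply Rmult_le_reg_r with (n * n'). apply Rmult_lt_0_compat; auto.
    replace (h / (n * n') * (n * n')) with h by (field; lra). assert (m ^ 2 * m ^ 2 <= 4 * (n * n')) by nra.
    replace ((4 / m ^ 2 * D) ^ 2 * (n * n')) with (D ^ 2 * (16 * (n * n') / (m ^ 2 * m ^ 2))) by (field; lra).
    apply Rle_trans with (D ^ 2 * 1); [lra|]. apply Rmult_le_compat_l. apply pow2_ge_0.
    apply Rmult_le_reg_r with (m ^ 2 * m ^ 2). nra.
    replace (16 * (n * n') / (m ^ 2 * m ^ 2) * (m ^ 2 * m ^ 2)) with (16 * (n * n')) by (field; lra). nra. }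
  assert (HP : 0 <= 4 / m ^ 2 * D). { apply Rmult_le_pos; auto. left. apply Rdiv_lt_0_compat; lra. }
  pose proof (pow2_ge_0 (x / n - x' / n')). pose proof (pow2_ge_0 (y / n - y' / n')).
  split; apply Rsqr_incr_0_var; auto; rewrite <- Rsqr_abs, !Rsqr_pow2; lra.
Qed.

(** The angular velocity is the determinant of the inverted position with the velocity, hence
    Lipschitz in the position. *)
Lemma rate_diff_bound (x y dx dy : R -> R) (q q' : R * R) (m V t : R) :
  0 < m -> m <= Rabs (x t - q.1) + Rabs (y t - q.2) -> m <= Rabs (x t - q'.1) + Rabs (y t - q'.2) ->
  Rabs (dx t) <= V -> Rabs (dy t) <= V ->
  Rabs (rate (fun u => x u - q.1) (fun u => y u - q.2) dx dy t - rate (fun u => x u - q'.1) (fun u => y u - q'.2) dx dy t)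
   <= 8 * V / m ^ 2 * d1 q q'.
Proof.
  intros Hm H H' Vx Vy. destruct (inversion_bound _ _ _ _ m Hm H H') as [I1 I2]. unfold rate.
  replace (x t - q.1 - (x t - q'.1)) with (- (q.1 - q'.1)) in * by ring.
  replace (y t - q.2 - (y t - q'.2)) with (- (q.2 - q'.2)) in * by ring. rewrite !Rabs_Ropp in *. fold (d1 q q') in *.
  set (a := x t - q.1) in *. set (b := y t - q.2) in *. set (a' := x t - q'.1) in *. set (b' := y t - q'.2) in *.
  replace ((a * dy t - b * dx t) / (a ^ 2 + b ^ 2) - (a' * dy t - b' * dx t) / (a' ^ 2 + b' ^ 2)) with
    ((a / (a ^ 2 + b ^ 2) - a' / (a' ^ 2 + b' ^ 2)) * dy t - (b / (a ^ 2 + b ^ 2) - b' / (a' ^ 2 + b' ^ 2)) * dx t) by (unfold Rdiv; ring).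
  unfold Rminus at 1. eapply Rle_trans. apply Rabs_triang. rewrite Rabs_Ropp, !Rabs_mult.
  replace (8 * V / m ^ 2 * d1 q q') with (4 / m ^ 2 * d1 q q' * V + 4 / m ^ 2 * d1 q q' * V) by (field; lra).
  apply Rplus_le_compat; apply Rmult_le_compat; auto; apply Rabs_pos.
Qed.

Lemma var_local a b c v q (eta : R) : a <= b -> C1on a b c v -> avoids a b c q -> 0 < eta ->
  exists d, 0 < d /\ forall q', d1 q q' < d -> avoids a b c q' /\ Rabs (var a b c v q' - var a b c v q) <= eta.
Proof.
  intros Hab HC HA He. destruct (avoids_dist a b c q Hab (fun t Ht => C1on_cont a b c v t HC Ht) HA) as [m [Hm Hd]].
  destruct (cont_bounded (fun t => (v t).1) a b Hab (fun t Ht => proj1 (proj2 (HC t Ht)))) as [V1 [PV1 HV1]].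
  destruct (cont_bounded (fun t => (v t).2) a b Hab (fun t Ht => proj2 (proj2 (HC t Ht)))) as [V2 [PV2 HV2]].
  set (V := V1 + V2). set (K := 8 * V / (m / 2) ^ 2 * (b - a)).
  assert (HK : 0 <= K). { unfold K. apply Rmult_le_pos; [|lra]. left. apply Rdiv_lt_0_compat. unfold V; lra. apply pow_lt; lra. }
  exists (Rmin (m / 2) (eta / (K + 1))). split.
  { apply Rmin_pos. lra. apply Rdiv_lt_0_compat; lra. }
  intros q' Hq'. assert (Q1 : d1 q q' < m / 2) by (eapply Rlt_le_trans; [exact Hq'|apply Rmin_l]).
  assert (Q2 : d1 q q' < eta / (K + 1)) by (eapply Rlt_le_trans; [exact Hq'|apply Rmin_r]).
  assert (Hd' : forall t, a <= t <= b -> m / 2 <= d1 (c t) q').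
  { intros t Ht. pose proof (d1_tri (c t) q' q). rewrite (d1_sym q' q) in H. specialize (Hd t Ht). lra. }
  assert (HA' : avoids a b c q').
  { intros t Ht E. specialize (Hd' t Ht). rewrite E, d1_refl in Hd'. lra. }
  split; auto. unfold var.
  set (f := fun z u => rate (fun t => (c t).1 - z.1) (fun t => (c t).2 - z.2) (fun t => (v t).1) (fun t => (v t).2) u).
  assert (CF : forall z, avoids a b c z -> forall t, continuous (fun u => f z (proj a b u)) t).
  { intros z Hz. apply frozen_cont; auto. intros t Ht. unfold f. destruct (C1on_cont a b c v t HC Ht).
    destruct (HC t Ht) as [_ [V1' V2']]. apply rate_cont; auto.
    - apply continuous_minusR; auto. apply continuous_const.
    - apply continuous_minusR; auto. apply continuous_const.
    - apply psub_nz. auto. }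
  change (Rabs (RInt (fun u => f q' (proj a b u)) a b - RInt (fun u => f q (proj a b u)) a b) <= eta).
  rewrite <- RInt_minusR by auto. apply Rle_trans with (8 * V / (m / 2) ^ 2 * d1 q' q * Rabs (b - a)).
  - apply RInt_bounded. intros u. apply continuous_minusR; auto.
    intros u _. pose proof (proj_in a b u Hab) as Hu. unfold f. apply rate_diff_bound.
    + lra.
    + apply (Hd' _ Hu).
    + pose proof (Hd _ Hu). unfold d1 in H. lra.
    + specialize (HV1 _ Hu). unfold V. lra.
    + specialize (HV2 _ Hu). unfold V. lra.
  - rewrite Rabs_pos_eq by lra. rewrite d1_sym.
    replace (8 * V / (m / 2) ^ 2 * d1 q q' * (b - a)) with (K * d1 q q') by (unfold K; ring).
    apply Rle_trans with ((K + 1) * (eta / (K + 1))).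
    + pose proof (d1_pos q q'). apply Rmult_le_compat; lra.
    + right. field. lra.
Qed.

Lemma var_Chasles a m b c v q : a <= m <= b -> C1on a b c v -> avoids a b c q ->
  var a b c v q = var a m c v q + var m b c v q.
Proof.
  intros Hm HC HA.
  set (f := fun u => rate (fun t => (c t).1 - q.1) (fun t => (c t).2 - q.2) (fun t => (v t).1) (fun t => (v t).2) u).
  assert (CF : forall t, a <= t <= b -> continuous f t).
  { intros t Ht. unfold f. destruct (C1on_cont a b c v t HC Ht). destruct (HC t Ht) as [_ [V1' V2']]. apply rate_cont; auto.
    - apply continuous_minusR; auto. apply continuous_const.
    - apply continuous_minusR; auto. apply continuous_const.
    - apply psub_nz. auto. }
  assert (G : forall l r, a <= l -> l <= r -> r <= b -> var l r c v q = RInt f l r).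
  { intros l r H1 H2 H3. unfold var. apply RInt_ext. intros u Hu. rewrite Rmin_left, Rmax_right in Hu by lra.
    rewrite proj_id by lra. reflexivity. }
  rewrite !G by lra. symmetry.
  apply (RInt_Chasles f a m b); apply (ex_RInt_continuous f); intros z Hz; rewrite Rmin_left, Rmax_right in Hz by lra; apply CF; lra.
Qed.

(* [wind] is the winding number of the closed curve made of an orbit segment and the arc between its ends. *)
Section Loop.
Variables (T s s' : R) (c vc g dg : R -> R * R).
Hypothesis HT : 0 <= T.
Hypothesis Hs : s <= s'.
Hypothesis Cc : C1on 0 T c vc.
Hypothesis Cg : C1on s s' g dg.
Hypothesis E0 : c 0 = g s.
Hypothesis ET : c T = g s'.

Definition off (q : R * R) : Prop := avoids 0 T c q /\ avoids s s' g q.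
Definition wind (q : R * R) : R := var 0 T c vc q - var s s' g dg q.

(** Lifts along the orbit and along the arc that start with the same angle end with two angles of
    the same point. *)
Lemma wind_int q : off q -> exists k : Z, wind q = 2 * PI * IZR k.
Proof.
  intros [A1 A2]. assert (N0 : c 0 <> q) by (apply A1; lra). assert (N1 : c T <> q) by (apply A1; lra).
  destruct (polar_exists' _ (psub_origin _ _ N0)) as [th0 H0].
  destruct (var_lift 0 T c vc q th0 HT Cc A1 H0) as [th [_ [B1 [B2 B3]]]]. rewrite E0 in H0.
  destruct (var_lift s s' g dg q th0 Hs Cg A2 H0) as [ph [_ [D1 [D2 D3]]]].
  pose proof (B3 T !!) as P1. pose proof (D3 s' !!) as P2. rewrite <- ET in P2.
  destruct (polar_unique _ _ _ (psub_origin _ _ N1) P1 P2) as [Q1 Q2].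
  destruct (cos_sin_eq_2kPI _ _ Q1 Q2) as [k Hk]. exists k. unfold wind. lra.
Qed.

(** Each of the two variations moves by at most 1 for a small displacement of [q], so [wind] moves
    by at most 2; multiples of [2 * PI] that close are equal. *)
Lemma wind_local q : off q -> exists d, 0 < d /\ forall q', d1 q q' < d -> off q' /\ wind q' = wind q.
Proof.
  intros H. destruct H as [A1 A2]. pose proof PI_RGT_0 as HPI.
  destruct (var_local 0 T c vc q 1 HT Cc A1 !!) as [e1 [P1 H1]].
  destruct (var_local s s' g dg q 1 Hs Cg A2 !!) as [e2 [P2 H2]]. exists (Rmin e1 e2). split. apply Rmin_pos; auto.
  intros q' Hq'. destruct (H1 q') as [A1' V1]. eapply Rlt_le_trans; [exact Hq'|apply Rmin_l].
  destruct (H2 q') as [A2' V2]. eapply Rlt_le_trans; [exact Hq'|apply Rmin_r]. split. split; auto.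
  destruct (wind_int q (conj A1 A2)) as [k Hk]. destruct (wind_int q' (conj A1' A2')) as [k' Hk'].
  assert (AB : Rabs (wind q' - wind q) <= 2).
  { unfold wind. replace (var 0 T c vc q' - var s s' g dg q' - (var 0 T c vc q - var s s' g dg q)) with
     ((var 0 T c vc q' - var 0 T c vc q) + - (var s s' g dg q' - var s s' g dg q)) by ring.
    eapply Rle_trans. apply Rabs_triang. rewrite Rabs_Ropp. lra. }
  assert (k = k'); [|subst; lra]. assert (3 < PI) by (pose proof PI2_3_2; unfold PI2 in *; lra).
  rewrite Hk, Hk' in AB. replace (2 * PI * IZR k' - 2 * PI * IZR k) with (2 * PI * IZR (k' - k)) in AB by (rewrite minus_IZR; ring).
  absle AB. assert (-1 < IZR (k' - k) < 1) by (split; nra).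
  destruct H0 as [L U]. apply lt_IZR in L. apply lt_IZR in U. lia.
Qed.

Lemma wind_path (p : R -> R * R) (a b : R) : a <= b ->
  (forall t, a <= t <= b -> forall e, 0 < e -> exists d, 0 < d /\ forall u, a <= u <= b -> Rabs (u - t) < d -> d1 (p t) (p u) < e) ->
  (forall t, a <= t <= b -> off (p t)) -> wind (p a) = wind (p b).
Proof.
  intros Hab Hc Ho. apply (locally_const (fun t => wind (p t)) a b); auto.
  intros x Hx. destruct (wind_local (p x) (Ho x Hx)) as [d [Hd H]].
  destruct (Hc x Hx d Hd) as [d' [Hd' H']]. exists d'. split; auto. intros y Hy Hyx. apply H. apply H'; auto.
Qed.
End Loop.

(** * Transversal arcs *)

Lemma cont_near (f : R -> R) (t e : R) : continuous f t -> 0 < e ->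
  exists d, 0 < d /\ forall u, Rabs (u - t) < d -> Rabs (f u - f t) < e.
Proof.
  intros H He. pose proof (proj1 (filterlim_locally _ _) H (mkposreal _ He)) as [d Hd].
  exists d. split. apply cond_pos. intros u Hu. apply (Hd u Hu).
Qed.

Lemma mvt_between (f df : R -> R) (z v : R) :
  (forall x, Rmin z v <= x <= Rmax z v -> is_derive f x (df x)) ->
  exists c, Rmin z v <= c <= Rmax z v /\ f v - f z = df c * (v - z).
Proof.
  intros H. destruct (MVT_gen f z v df) as [c [Hc E]].
  - intros x Hx. apply H. lra.
  - intros x Hx. apply cont_pt. eapply is_derive_cont. apply H; auto.
  - exists c; auto.
Qed.

Lemma is_derive_det2 (a : R * R) (g : R -> R * R) t w : has_velocity g t w ->
  is_derive (fun u => det2 a (g u)) t (det2 a w).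
Proof.
  intros [H1 H2]. unfold det2. apply (is_derive_minus (fun u => a.1 * (g u).2) (fun u => a.2 * (g u).1));
  apply is_derive_scal; auto.
Qed.

Lemma det2_diff_bound (a p q : R * R) (e : R) :
  Rabs (p.1 - q.1) <= e -> Rabs (p.2 - q.2) <= e ->
  Rabs (det2 a p - det2 a q) <= (Rabs a.1 + Rabs a.2) * e.
Proof.
  intros H1 H2. unfold det2. replace (a.1 * p.2 - a.2 * p.1 - (a.1 * q.2 - a.2 * q.1)) with
    (a.1 * (p.2 - q.2) + - (a.2 * (p.1 - q.1))) by ring.
  eapply Rle_trans. apply Rabs_triang. rewrite Rabs_Ropp, !Rabs_mult. absp a.1. absp a.2. nra.
Qed.

Lemma arc_d1_near (g : R -> R * R) w t e : has_velocity g t w -> 0 < e ->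
  exists d, 0 < d /\ forall u, Rabs (u - t) < d -> d1 (g u) (g t) < e.
Proof.
  intros [H1 H2] He. destruct (cont_near _ _ (e / 2) (is_derive_cont _ _ _ H1) !!) as [a [Pa Ha]].
  destruct (cont_near _ _ (e / 2) (is_derive_cont _ _ _ H2) !!) as [b [Pb Hb]].
  exists (Rmin a b). split. apply Rmin_pos; auto. intros u Hu. unfold d1.
  mins (Rmin a b). specialize (Ha u !!). specialize (Hb u !!). lra.
Qed.

(* The case [lam = 0] says that an orbit does not meet a transversal arc twice
   in a short time; [lam > 0] is needed for the winding number jump. *)
Lemma flow_box L B X (g dg : R -> R * R) (r0 vs : R) :
  glip L B X -> 0 < r0 -> C1on (vs - r0) (vs + r0) g dg -> det2 (dg vs) (X (g vs)) <> 0 ->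
  exists k, 0 < k /\ k <= r0 /\ forall v z tau lam, Rabs (v - vs) < k -> Rabs (z - vs) < k -> 0 < tau < k -> 0 <= lam ->
    g v <> ((flow X tau (g z)).1 + lam * (X (g vs)).1, (flow X tau (g z)).2 + lam * (X (g vs)).2).
Proof.
  intros HX Hr HC HD. set (a := dg vs) in *. set (e := X (g vs)) in *. set (D := det2 a e) in *.
  pose proof (glip_L _ _ _ HX) as HL. pose proof (glip_B _ _ _ HX) as HB.
  assert (HDp : 0 < Rabs D) by (apply Rabs_pos_lt; auto).
  (* With [mu] a quarter of the determinant, the neighbourhood is chosen so small that pairings with
     [a] and with [e] of the tangents of the arc, and of the field along short orbits, differ by at
     most [mu] from their values at [vs]. *)
  set (mu := Rabs D / 4). assert (Hmu : 0 < mu) by (unfold mu; lra). assert (V0 : vs - r0 <= vs <= vs + r0) by lra.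
  assert (CD : forall w, continuous (fun u => det2 w (dg u)) vs).
  { intros w. unfold det2. destruct (HC vs V0) as [_ [Q1 Q2]]. apply continuous_minusR; apply continuous_multR; try apply continuous_const; assumption. }
  destruct (cont_near _ vs mu (CD a) Hmu) as [k1 [Pk1 K1]]. destruct (cont_near _ vs mu (CD e) Hmu) as [k2 [Pk2 K2]].
  set (W := Rabs a.1 + Rabs a.2 + Rabs e.1 + Rabs e.2 + 1).
  assert (HW : 0 < W). { unfold W. absp a.1. absp a.2. absp e.1. absp e.2. lra. }
  set (nu := mu / (W * (L + 1))). assert (Hnu : 0 < nu). { apply Rdiv_lt_0_compat; auto. apply Rmult_lt_0_compat; lra. }
  destruct (arc_d1_near g (dg vs) vs (nu / 2)) as [k3 [Pk3 K3]]. { apply HC; auto. } lra.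
  set (k4 := nu / (2 * (2 * B + 1))). assert (Pk4 : 0 < k4). { apply Rdiv_lt_0_compat; lra. }
  exists (Rmin (Rmin r0 k1) (Rmin k2 (Rmin k3 k4))).
  assert (M1 := Rmin_l (Rmin r0 k1) (Rmin k2 (Rmin k3 k4))). assert (M2 := Rmin_r (Rmin r0 k1) (Rmin k2 (Rmin k3 k4))).
  assert (M3 := Rmin_l r0 k1). assert (M4 := Rmin_r r0 k1). assert (M5 := Rmin_l k2 (Rmin k3 k4)). assert (M6 := Rmin_r k2 (Rmin k3 k4)).
  assert (M7 := Rmin_l k3 k4). assert (M8 := Rmin_r k3 k4). split. { repeat apply Rmin_pos; auto. }
  set (k := Rmin (Rmin r0 k1) (Rmin k2 (Rmin k3 k4))) in *. split; [lra|]. intros v z tau lam Hv Hz Ht Hl E.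
  assert (Btw : forall c, Rmin z v <= c <= Rmax z v -> Rabs (c - vs) < k).
  { intros c. unfold Rmin, Rmax. apply Rabs_def2 in Hv. apply Rabs_def2 in Hz. destruct Rle_dec; intros; apply Rabs_def1; lra. }
  assert (FX : forall u, 0 <= u <= tau -> forall w, Rabs w.1 + Rabs w.2 <= W -> Rabs (det2 w (X (flow X u (g z))) - det2 w e) <= mu).
  { intros u Hu w Hw. assert (DD : d1 (flow X u (g z)) (g vs) <= nu).
    { eapply Rle_trans. apply (d1_tri _ (g z)).
      pose proof (flow_time L B X HX u 0 (g z)) as F. rewrite (flow_0 L B) in F by auto.
      rewrite Rminus_0_r, Rabs_pos_eq in F by lra. assert (2 * B * u <= nu / 2).
      { apply Rle_trans with ((2 * B + 1) * k4). apply Rmult_le_compat; lra. unfold k4. right. field. lra. }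
      specialize (K3 z !!). lra. }
    destruct HX as [HX1 _]. destruct (HX1 (flow X u (g z)) (g vs)) as [A1 A2]. fold e in A1, A2.
    eapply Rle_trans. apply det2_diff_bound with (e := L * nu).
    - eapply Rle_trans. exact A1. apply Rmult_le_compat_l; auto.
    - eapply Rle_trans. exact A2. apply Rmult_le_compat_l; auto.
    - apply Rle_trans with (W * ((L + 1) * nu)).
      + apply Rmult_le_compat. absp (w.1); absp (w.2); lra.
        apply Rmult_le_pos; lra. auto. apply Rmult_le_compat_r; lra.
      + unfold nu. right. field. split; lra. }
  assert (Wa : Rabs a.1 + Rabs a.2 <= W). { unfold W. absp e.1. absp e.2. lra. }
  assert (We : Rabs e.1 + Rabs e.2 <= W). { unfold W. absp a.1. absp a.2. lra. }
  (* The supposed equality is paired with a constant vector [w] and both increments are expressed by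
     the mean value theorem; it is used for the tangent [a] and for the field direction [e]. *)
  assert (G : forall w, exists c u, Rabs (c - vs) < k /\ 0 <= u <= tau /\
     det2 w (dg c) * (v - z) = det2 w (X (flow X u (g z))) * tau + lam * det2 w e).
  { intros w. destruct (mvt_between (fun u => det2 w (g u)) (fun u => det2 w (dg u)) z v) as [c [Hc Ec]].
    { intros x Hx. apply is_derive_det2. apply HC. specialize (Btw x Hx). apply Rabs_def2 in Btw. lra. }
    destruct (mvt_between (fun u => det2 w (flow X u (g z))) (fun u => det2 w (X (flow X u (g z)))) 0 tau) as [u [Hu Eu]].
    { intros x Hx. apply is_derive_det2. apply (flow_sol L B); auto. }
    rewrite Rmin_left, Rmax_right in Hu by lra. exists c, u. split; auto. split; auto.
    rewrite <- Ec. rewrite Rminus_0_r in Eu. rewrite <- Eu. rewrite (flow_0 L B) by auto.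
    rewrite E. unfold det2; simpl. ring. }
  destruct (G a) as [c1 [u1 [Hc1 [Hu1 E1]]]]. destruct (G e) as [c2 [u2 [Hc2 [Hu2 E2]]]].
  pose proof (K1 c1 !!) as A1. pose proof (K2 c2 !!) as A2.
  pose proof (FX u1 Hu1 a Wa) as B1. pose proof (FX u2 Hu2 e We) as B2.
  assert (Z1 : det2 a (dg vs) = 0) by (unfold a, det2; ring).
  assert (Z2 : det2 e (dg vs) = - D) by (unfold D, a, det2; ring). assert (Z3 : det2 e e = 0) by (unfold det2; ring).
  fold D in B1, E1. cbv beta in A1, A2. rewrite Z1 in A1. rewrite Z2 in A2. rewrite Z3 in B2, E2.
  rewrite Rminus_0_r in A1, B2. rewrite Rmult_0_r, Rplus_0_r in E2.
  set (x1 := det2 a (dg c1)) in *. set (x2 := det2 e (dg c2)) in *.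
  set (y1 := det2 a (X (flow X u1 (g z)))) in *. set (y2 := det2 e (X (flow X u2 (g z)))) in *.
  set (h := v - z) in *. clearbody x1 x2 y1 y2 h. assert (Ab : mu = Rabs D / 4) by reflexivity. clearbody mu D.
  (* Pairing with [e] removes [lam] and forces [|v - z| <= tau / 3]. Pairing with [a] leaves at
     least [3 mu tau] on the side of the flow, where [lam D] has the sign of the main term, but at
     most [mu tau / 3] on the side of the arc. *)
  assert (H1 : Rabs x2 * Rabs h <= mu * tau).
  { rewrite <- Rabs_mult, E2, Rabs_mult, (Rabs_pos_eq tau) by lra. apply Rmult_le_compat_r; lra. }
  assert (H2 : 3 * mu <= Rabs x2).
  { pose proof (Rabs_triang_inv (- D) x2) as Q. rewrite Rabs_Ropp, (Rabs_minus_sym (- D)) in Q. lra. }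
  assert (H3 : Rabs h <= tau / 3). { absp h. nra. }
  assert (H4 : 3 * mu * tau <= Rabs x1 * Rabs h).
  { rewrite <- Rabs_mult, E1. destruct (Rle_dec 0 D).
    - assert (3 * mu <= y1). { absle B1. rewrite (Rabs_pos_eq D) in Ab by auto. lra. }
      eapply Rle_trans; [|apply Rle_abs]. nra.
    - assert (y1 <= - (3 * mu)). { absle B1. rewrite (Rabs_left D) in Ab by lra. lra. }
      rewrite <- Rabs_Ropp. eapply Rle_trans; [|apply Rle_abs]. nra. }
  assert (Rabs x1 * Rabs h <= mu * (tau / 3)) by (apply Rmult_le_compat; try apply Rabs_pos; lra). nra.
Qed.

Lemma cos_sin_2kPI (k : Z) : cos (2 * PI * IZR k) = 1 /\ sin (2 * PI * IZR k) = 0.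
Proof.
  assert (S0 : sin (PI * IZR k) = 0). { rewrite Rmult_comm. apply sin_eq_0_1. exists k; auto. }
  replace (2 * PI * IZR k) with (2 * (PI * IZR k)) by ring. rewrite cos_2a_sin, sin_2a, S0. split; ring.
Qed.

Lemma shift_2kPI (x : R) (k : Z) : cos (x - 2 * PI * IZR k) = cos x /\ sin (x - 2 * PI * IZR k) = sin x.
Proof. rewrite cos_minus, sin_minus. destruct (cos_sin_2kPI k) as [-> ->]. split; ring. Qed.

Lemma floor_2PI (x : R) : exists k : Z, 2 * PI * IZR k <= x < 2 * PI * IZR k + 2 * PI.
Proof.
  pose proof PI_RGT_0. exists (Int_part (x / (2 * PI))). destruct (base_Int_part (x / (2 * PI))) as [A B].
  assert (E : x = 2 * PI * (x / (2 * PI))) by (field; lra). set (y := x / (2 * PI)) in *. set (n := IZR (Int_part y)) in *.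
  split; rewrite E; nra.
Qed.

Definition dot (p q : R * R) : R := p.1 * q.1 + p.2 * q.2.

Lemma polar_pos p th : p <> origin -> polar p th -> exists rho, 0 < rho /\ p = (rho * cos th, rho * sin th).
Proof. intros Hp H. exists (enorm p). split; auto. apply enorm_pos; auto. Qed.

Lemma cos_neg_range x : 0 < x < 2 * PI -> cos x < 0 -> PI / 2 < x < 3 * (PI / 2).
Proof.
  intros Hx Hc. pose proof PI_RGT_0. split.
  - destruct (Rlt_le_dec (PI / 2) x); auto. assert (0 <= cos x) by (apply cos_ge_0; lra). lra.
  - destruct (Rlt_le_dec x (3 * (PI / 2))); auto.
    assert (0 <= cos x); [|lra]. replace x with (2 * PI - (2 * PI - x)) by ring. rewrite cos_minus, cos_2PI, sin_2PI.
    assert (0 <= cos (2 * PI - x)) by (apply cos_ge_0; lra). lra.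
Qed.

(** The plane cut along the ray from [q] in direction [e] carries a single-valued angle in
    [(0, 2 PI)] measured from [e], so the variation is the difference of the end values. Ends on
    different sides of the line through [q], seen under an obtuse angle, confine that difference up
    to sign to [(PI / 2, 3 PI / 2)]. *)
Lemma slit_variation a b c v q (e : R * R) : a <= b -> C1on a b c v -> avoids a b c q -> e <> origin ->
  (forall t lam, a <= t <= b -> 0 <= lam -> c t <> (q.1 + lam * e.1, q.2 + lam * e.2)) ->
  dot (psub (c a) q) (psub (c b) q) < 0 ->
  (0 < det2 e (psub (c a) q) -> det2 e (psub (c b) q) < 0 -> PI / 2 < var a b c v q < 3 * (PI / 2)) /\
  (det2 e (psub (c a) q) < 0 -> 0 < det2 e (psub (c b) q) -> - (3 * (PI / 2)) < var a b c v q < - (PI / 2)).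
Proof.
  intros Hab HC HA He Hr Hdot. pose proof PI_RGT_0 as HPI.
  assert (Na : c a <> q) by (apply HA; lra). assert (Nb : c b <> q) by (apply HA; lra).
  destruct (polar_exists' _ (psub_origin _ _ Na)) as [th0 H0].
  destruct (var_lift a b c v q th0 Hab HC HA H0) as [th [Ct [B1 [B2 B3]]]]. destruct (polar_exists' e He) as [om Hom].
  destruct (polar_pos e om He Hom) as [re [Pre Ee]].
  assert (PP : forall t, a <= t <= b -> exists rho, 0 < rho /\ psub (c t) q = (rho * cos (th t), rho * sin (th t))).
  { intros t Ht. apply polar_pos; auto. apply psub_origin. apply HA; auto. }
  (* The angle is normalized so that the ray corresponds to the multiples of [2 * PI]; [ps] never
     takes such a value and therefore stays between two of them. *)
  destruct (floor_2PI (th a - om)) as [k Hk]. set (ps := fun t => th t - om - 2 * PI * IZR k).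
  assert (Cps : forall t, continuous ps t).
  { intros t. unfold ps. apply continuous_minusR; [|apply continuous_const]. apply continuous_minusR; auto. apply continuous_const. }
  assert (NZ : forall t, a <= t <= b -> forall j : Z, ps t <> 2 * PI * IZR j).
  { intros t Ht j Ej. destruct (PP t Ht) as [rho [Pr Er]].
    apply (Hr t (rho / re) Ht). { apply Rlt_le, Rdiv_lt_0_compat; auto. }
    assert (Et : th t = om + 2 * PI * IZR (k + j)). { rewrite plus_IZR. unfold ps in Ej. lra. }
    assert (C2 : cos (th t) = cos om /\ sin (th t) = sin om).
    { destruct (shift_2kPI (th t) (k + j)) as [S1 S2]. rewrite <- S1, <- S2.
      replace (th t - 2 * PI * IZR (k + j)) with om by lra. auto. }
    destruct C2 as [C2 C3]. rewrite C2, C3 in Er. rewrite Ee; simpl. unfold psub in Er. injection Er; intros.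
    replace (rho / re * (re * cos om)) with (rho * cos om) by (field; lra).
    replace (rho / re * (re * sin om)) with (rho * sin om) by (field; lra).
    destruct (c t); simpl in *. f_equal; lra. }
  assert (Ra : 0 < ps a < 2 * PI).
  { unfold ps. pose proof (NZ a !! 0%Z). unfold ps in H. rewrite Rmult_0_r in H. lra. }
  assert (Rb : 0 < ps b < 2 * PI).
  { split.
    - destruct (Rlt_le_dec 0 (ps b)); auto. exfalso. destruct (ivt_decr ps a b 0 Hab) as [t [Ht Et]]; auto. lra.
      apply (NZ t Ht 0%Z). rewrite Et; ring.
    - destruct (Rlt_le_dec (ps b) (2 * PI)); auto. exfalso. destruct (ivt_incr ps a b (2 * PI) Hab) as [t [Ht Et]]; auto. lra.
      apply (NZ t Ht 1%Z). rewrite Et; ring. }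
  assert (EV : var a b c v q = ps b - ps a). { unfold ps. lra. }
  assert (SG : forall t, a <= t <= b -> exists rho, 0 < rho /\ det2 e (psub (c t) q) = rho * sin (ps t)).
  { intros t Ht. destruct (PP t Ht) as [rho [Pr Er]]. exists (re * rho). split. apply Rmult_lt_0_compat; auto.
    rewrite Er, Ee. unfold det2; simpl. unfold ps. destruct (shift_2kPI (th t - om) k) as [_ ->]. rewrite sin_minus. ring. }
  assert (CV : cos (ps b - ps a) < 0).
  { destruct (PP a !!) as [r1 [P1 E1]]. destruct (PP b !!) as [r2 [P2 E2]].
    rewrite E1, E2 in Hdot. unfold dot in Hdot; simpl in Hdot.
    replace (ps b - ps a) with (th b - th a) by (unfold ps; ring). rewrite cos_minus.
    destruct (Rlt_le_dec (cos (th b) * cos (th a) + sin (th b) * sin (th a)) 0); auto. exfalso.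
    assert (0 <= (r1 * r2) * (cos (th b) * cos (th a) + sin (th b) * sin (th a))). apply Rmult_le_pos; auto. left; apply Rmult_lt_0_compat; auto.
    lra. }
  destruct (SG a !!) as [ra [Pra Ea]]. destruct (SG b !!) as [rb [Prb Eb]]. rewrite Ea, Eb, EV.
  assert (SP : forall rho x, 0 < rho -> 0 < x < 2 * PI -> 0 < rho * sin x -> x < PI).
  { intros rho x Hrho Hx Hp. destruct (Rlt_le_dec x PI); auto. exfalso.
    assert (sin x <= 0) by (apply sin_le_0; lra). nra. }
  assert (SN : forall rho x, 0 < rho -> 0 < x < 2 * PI -> rho * sin x < 0 -> PI < x).
  { intros rho x Hrho Hx Hp. destruct (Rlt_le_dec PI x); auto. exfalso.
    assert (0 <= sin x) by (apply sin_ge_0; lra). nra. }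
  split; intros Q1 Q2.
  - pose proof (SP _ _ Pra Ra Q1). pose proof (SN _ _ Prb Rb Q2). apply cos_neg_range; auto. lra.
  - pose proof (SN _ _ Pra Ra Q1). pose proof (SP _ _ Prb Rb Q2).
    assert (PI / 2 < ps a - ps b < 3 * (PI / 2)); [|lra]. apply cos_neg_range. lra.
    replace (ps a - ps b) with (- (ps b - ps a)) by ring. rewrite cos_neg. auto.
Qed.

Lemma C1on_sub a b a' b' c v : a <= a' -> b' <= b -> C1on a b c v -> C1on a' b' c v.
Proof. intros H1 H2 H t Ht. apply H. lra. Qed.

Lemma avoids_sub a b a' b' c q : a <= a' -> b' <= b -> avoids a b c q -> avoids a' b' c q.
Proof. intros H1 H2 H t Ht. apply H. lra. Qed.

Lemma glip_cont L B X (c : R -> R * R) t : glip L B X -> continuous (fun u => (c u).1) t -> continuous (fun u => (c u).2) t ->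
  continuous (fun u => (X (c u)).1) t /\ continuous (fun u => (X (c u)).2) t.
Proof.
  intros [HX _] H1 H2. split.
  - apply continuous_ext with (fun u => (X ((c u).1, (c u).2)).1). { intros; destruct (c x); auto. }
    apply (lipschitz2_cont L (fun x y => (X (x, y)).1)); auto. intros x y x' y'. apply (HX (x, y) (x', y')).
  - apply continuous_ext with (fun u => (X ((c u).1, (c u).2)).2). { intros; destruct (c x); auto. }
    apply (lipschitz2_cont L (fun x y => (X (x, y)).2)); auto. intros x y x' y'. apply (HX (x, y) (x', y')).
Qed.

Lemma flow_C1on L B X p a b : glip L B X -> C1on a b (fun t => flow X t p) (fun t => X (flow X t p)).
Proof.
  intros HX t _. split. apply (flow_sol L B); auto. destruct (flow_sol L B X p t HX) as [H1 H2].
  apply (glip_cont L B X (fun t => flow X t p)); auto; eapply is_derive_cont; eauto.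
Qed.

Lemma det2_cont_pos (e : R * R) (p : R * R) : 0 < det2 e p -> exists d, 0 < d /\ forall q, d1 q p < d -> 0 < det2 e q.
Proof.
  intros H. set (W := Rabs e.1 + Rabs e.2 + 1). assert (HW : 0 < W). { unfold W. absp e.1. absp e.2. lra. }
  exists (det2 e p / W). split. apply Rdiv_lt_0_compat; auto. intros q Hq.
  assert (Rabs (det2 e q - det2 e p) <= (Rabs e.1 + Rabs e.2) * d1 q p).
  { apply det2_diff_bound; unfold d1. absp (q.2 - p.2); lra. absp (q.1 - p.1); lra. }
  pose proof (d1_pos q p).
  assert (W * d1 q p < det2 e p). { apply Rlt_le_trans with (W * (det2 e p / W)). apply Rmult_lt_compat_l; auto. right; field; lra. }
  absle H0. unfold W in *. nra.
Qed.

Lemma det2_opp e p : det2 (- e.1, - e.2) p = - det2 e p.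
Proof. unfold det2; simpl; ring. Qed.

Lemma dot_cont_neg (p q : R * R) : dot p q < 0 -> exists d, 0 < d /\ forall h, d1 h (0, 0) < d -> dot (psub p h) (psub q h) < 0.
Proof.
  intros H. set (W := Rabs p.1 + Rabs p.2 + Rabs q.1 + Rabs q.2 + 1).
  assert (HW : 1 <= W). { unfold W. absp p.1. absp p.2. absp q.1. absp q.2. lra. }
  exists (Rmin 1 (- dot p q / (2 * W))). split.
  { apply Rmin_pos. lra. apply Rdiv_lt_0_compat; lra. }
  intros h Hh. assert (h1 : d1 h (0,0) < 1) by (eapply Rlt_le_trans; [exact Hh|apply Rmin_l]).
  assert (h2 : d1 h (0,0) < - dot p q / (2 * W)) by (eapply Rlt_le_trans; [exact Hh|apply Rmin_r]).
  unfold d1 in h1, h2; simpl in h1, h2. rewrite !Rminus_0_r in h1, h2. set (x := h.1) in *. set (y := h.2) in *.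
  absp x. absp y.
  assert (E : dot (psub p h) (psub q h) = dot p q - x * (p.1 + q.1) - y * (p.2 + q.2) + (x * x + y * y)).
  { unfold dot, psub; simpl. fold x y. ring. }
  rewrite E. assert (A1 : - (x * (p.1 + q.1)) <= Rabs x * (W - 1)).
  { rewrite <- Rabs_Ropp. eapply Rle_trans. apply Rle_abs. rewrite !Rabs_mult, Rabs_Ropp || rewrite Rabs_Ropp, Rabs_mult.
    rewrite ?Rabs_Ropp. apply Rmult_le_compat_l; auto. pose proof (Rabs_triang p.1 q.1). absp p.2. absp q.2. unfold W. lra. }
  assert (A2 : - (y * (p.2 + q.2)) <= Rabs y * (W - 1)).
  { rewrite <- Rabs_Ropp. eapply Rle_trans. apply Rle_abs. rewrite !Rabs_mult, Rabs_Ropp || rewrite Rabs_Ropp, Rabs_mult.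
    rewrite ?Rabs_Ropp. apply Rmult_le_compat_l; auto. pose proof (Rabs_triang p.2 q.2). absp p.1. absp q.1. unfold W. lra. }
  assert (A3 : x * x <= Rabs x * 1). { rewrite <- (Rabs_pos_eq (x * x)) by nra. rewrite Rabs_mult. apply Rmult_le_compat_l; auto. lra. }
  assert (A4 : y * y <= Rabs y * 1). { rewrite <- (Rabs_pos_eq (y * y)) by nra. rewrite Rabs_mult. apply Rmult_le_compat_l; auto. lra. }
  assert (A5 : (Rabs x + Rabs y) * W <= - dot p q / 2).
  { apply Rle_trans with (- dot p q / (2 * W) * W). apply Rmult_le_compat_r; lra. right. field. lra. }
  nra.
Qed.

Section Tail.
Variables (L B : R) (X : R * R -> R * R) (g dg : R -> R * R) (u3 u2 s s' T : R).
Hypothesis HX : glip L B X.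
Notation Phi := (flow X).
Hypothesis Hg : C1on 0 u3 g dg.
Hypothesis Htr : forall u, 0 < u <= u3 -> det2 (dg u) (X (g u)) <> 0.
Hypothesis Hinj : forall u v, 0 <= u <= u3 -> 0 <= v <= u3 -> g u = g v -> u = v.
Hypothesis Hs : 0 < s /\ s < s' /\ s' < u2 /\ u2 < u3.
Hypothesis HT : 0 < T.
Notation c := (fun t => Phi t (g s)).
Hypothesis HcT : Phi T (g s) = g s'.
Hypothesis Hfirst : forall t u, 0 < t < T -> 0 < u <= u3 -> Phi t (g s) <> g u.
Hypothesis Hc0 : forall t, 0 <= t <= T -> Phi t (g s) <> g 0.

Notation vc := (fun t => X (Phi t (g s))).
Notation W := (wind T s s' c vc g dg).
Notation Off := (off T s s' c g).

Lemma tail_Cc : C1on 0 T c vc.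
Proof. apply (flow_C1on L B); auto. Qed.
Lemma tail_Cg : C1on s s' g dg.
Proof. apply (C1on_sub 0 u3); auto; lra. Qed.
Lemma tail_E0 : Phi 0 (g s) = g s.
Proof. apply (flow_0 L B); auto. Qed.

Lemma tail_off_arc u : 0 <= u <= u3 -> u < s \/ s' < u -> Off (g u).
Proof.
  intros Hu Ho. split.
  - intros t Ht E. destruct (Req_dec u 0) as [->|Hu0]; [eapply Hc0; eauto|]. destruct (Req_dec t 0) as [->|Ht0].
    { rewrite tail_E0 in E. apply Hinj in E; lra. }
    destruct (Req_dec t T) as [->|HtT].
    { rewrite HcT in E. apply Hinj in E; lra. }
    eapply (Hfirst t u); eauto; lra.
  - intros t Ht E. apply Hinj in E; lra.
Qed.

Lemma arc_path_cont (h : R * R -> R * R) a b : 0 <= a -> b <= u3 ->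
  (exists K, 0 < K /\ forall p q, d1 (h p) (h q) <= K * d1 p q) ->
  forall t, a <= t <= b -> forall e, 0 < e -> exists d, 0 < d /\ forall u, a <= u <= b -> Rabs (u - t) < d -> d1 (h (g t)) (h (g u)) < e.
Proof.
  intros Ha Hb [K [PK HK]] t Ht e He.
  destruct (arc_d1_near g (dg t) t (e / K)) as [d [Pd Hd]]. { apply Hg; lra. } apply Rdiv_lt_0_compat; auto.
  exists d. split; auto. intros u Hu Hut. eapply Rle_lt_trans. apply HK. rewrite d1_sym.
  apply Rlt_le_trans with (K * (e / K)). apply Rmult_lt_compat_l; auto. right; field; lra.
Qed.

Lemma flow_const t : exists K, 0 < K /\ forall p q, d1 (Phi t p) (Phi t q) <= K * d1 p q.
Proof.
  exists (2 * exp (2 * L * Rabs t)). split. pose proof (exp_pos (2 * L * Rabs t)). lra. intros. apply (flow_d1 L B); auto.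
Qed.

Lemma near_avoids (k : R -> R * R) (a b vs : R) (sg : R) : Rabs sg = 1 -> 0 < vs < u3 ->
  (a <= b -> (forall t, a <= t <= b -> continuous (fun u => (k u).1) t /\ continuous (fun u => (k u).2) t)) ->
  (forall t, a <= t <= b -> k t <> g vs) ->
  exists d, 0 < d /\ forall v tau, Rabs (v - vs) < d -> 0 < tau < d -> avoids a b k (Phi (sg * tau) (g v)).
Proof.
  intros Hsg Hvs Hk Hav. destruct (Rle_dec a b) as [Hab|Hab].
  2:{ exists 1. split; [lra|]. intros v tau _ _ t Ht. lra. }
  destruct (avoids_dist a b k (g vs) Hab (Hk Hab) Hav) as [m [Pm Hm]].
  destruct (arc_d1_near g (dg vs) vs (m / 2)) as [d [Pd Hd]]. { apply Hg; lra. } lra.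
  pose proof (glip_B _ _ _ HX) as HB.
  exists (Rmin d (m / (2 * (2 * B + 1)))). split. { apply Rmin_pos; auto. apply Rdiv_lt_0_compat; lra. }
  intros v tau Hv Ht t Htt E. mins (Rmin d (m / (2 * (2 * B + 1)))). specialize (Hm t Htt). rewrite E in Hm.
  pose proof (flow_time L B X HX (sg * tau) 0 (g v)) as F. rewrite (flow_0 L B) in F by auto.
  rewrite Rminus_0_r, Rabs_mult, Hsg, Rmult_1_l, (Rabs_pos_eq tau) in F by lra. assert (2 * B * tau <= m / 2).
  { apply Rle_trans with ((2 * B + 1) * (m / (2 * (2 * B + 1)))). apply Rmult_le_compat; lra. right. field. lra. }
  specialize (Hd v !!). pose proof (d1_tri (Phi (sg * tau) (g v)) (g v) (g vs)). lra.
Qed.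

Lemma flow_box' vs : 0 < vs < u3 -> exists k, 0 < k /\ k <= vs /\ k <= u3 - vs /\
  forall v z tau, Rabs (v - vs) < k -> Rabs (z - vs) < k -> 0 < tau < k -> g v <> Phi tau (g z).
Proof.
  intros Hvs. destruct (flow_box L B X g dg (Rmin vs (u3 - vs)) vs HX) as [k [Pk [Hk1 Hk]]].
  - apply Rmin_pos; lra.
  - apply (C1on_sub 0 u3); auto. pose proof (Rmin_l vs (u3 - vs)); lra. pose proof (Rmin_r vs (u3 - vs)); lra.
  - apply Htr. lra.
  - exists k. split; auto. mins (Rmin vs (u3 - vs)). split; [lra|]. split; [lra|].
    intros v z tau Hv Hz Ht E. apply (Hk v z tau 0 Hv Hz Ht !!). rewrite E. destruct (Phi tau (g z)); simpl. f_equal; ring.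
Qed.

(** The part of the arc near [vs] is excluded by the flow box, the two remaining parts by
    [near_avoids]. *)
Lemma arc_avoids (sg vs : R) : sg = 1 \/ sg = -1 -> 0 < vs < u3 ->
  exists d, 0 < d /\ forall v tau, Rabs (v - vs) < d -> 0 < tau < d -> avoids s s' g (Phi (sg * tau) (g v)).
Proof.
  intros Hsg Hvs. destruct (flow_box' vs Hvs) as [k [Pk [Hk1 [Hk2 Hk]]]].
  assert (Asg : Rabs sg = 1) by (destruct Hsg as [->| ->]; [apply Rabs_R1|rewrite Rabs_left; lra]).
  assert (GC : forall t, 0 <= t <= u3 -> continuous (fun u => (g u).1) t /\ continuous (fun u => (g u).2) t).
  { intros t Ht. apply (C1on_cont 0 u3 g dg); auto. }
  destruct (near_avoids g s (Rmin s' (vs - k / 2)) vs sg Asg Hvs) as [d1' [P1 H1]].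
  { intros _ t Ht. apply GC. mins (Rmin s' (vs - k / 2)). lra. }
  { intros t Ht E. mins (Rmin s' (vs - k / 2)). apply Hinj in E; lra. }
  destruct (near_avoids g (Rmax s (vs + k / 2)) s' vs sg Asg Hvs) as [d2 [P2 H2]].
  { intros _ t Ht. apply GC. pose proof (Rmax_l s (vs + k / 2)). lra. }
  { intros t Ht E. pose proof (Rmax_l s (vs + k / 2)). pose proof (Rmax_r s (vs + k / 2)). apply Hinj in E; lra. }
  exists (Rmin k (Rmin d1' d2)). split. { repeat apply Rmin_pos; auto. }
  mins (Rmin k (Rmin d1' d2)). intros v tau Hv Ht z Hz E. destruct (Rle_dec z (vs - k / 2)) as [Q|Q].
  { apply (H1 v tau !! !! z); auto. split; [lra|]. apply Rmin_glb; lra. }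
  destruct (Rle_dec (vs + k / 2) z) as [Q'|Q'].
  { apply (H2 v tau !! !! z); auto. split; [|lra]. apply Rmax_lub; lra. }
  assert (Hzv : Rabs (z - vs) < k) by (apply Rabs_def1; lra). destruct Hsg as [-> | ->].
  - rewrite Rmult_1_l in E. apply (Hk z v tau); auto; lra.
  - apply (Hk v z tau); auto; try lra. rewrite E. replace (-1 * tau) with (- tau) by ring. symmetry. apply (flow_inv' L B); auto.
Qed.

Lemma orbit_cont t : continuous (fun u => (Phi u (g s)).1) t /\ continuous (fun u => (Phi u (g s)).2) t.
Proof. destruct (flow_sol L B X (g s) t HX) as [H1 H2]. split; eapply is_derive_cont; eauto. Qed.

(** Before [g s'] lies the orbit segment itself, hence the restriction to [vs < s']. At [vs = s] a
    coincidence with the beginning of the orbit would carry [g s] to the nearby [g v] in a short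
    positive time, against the flow box. *)
Lemma orbit_avoids_left vs : 0 < vs -> vs < s' ->
  exists d, 0 < d /\ forall v tau, Rabs (v - vs) < d -> 0 < tau < d -> avoids 0 T c (Phi (-1 * tau) (g v)).
Proof.
  intros H0 H1. assert (Hvs : 0 < vs < u3) by lra. assert (A1 : Rabs (-1) = 1) by (rewrite Rabs_left; lra).
  destruct (Req_dec vs s) as [->|Hne].
  - destruct (flow_box' s Hvs) as [k [Pk [Hk1 [Hk2 Hk]]]].
    destruct (near_avoids c (k / 2) T s (-1) A1 Hvs) as [d [Pd Hd]].
    { intros; apply orbit_cont. }
    { intros t Ht E. destruct (Req_dec t T) as [->|HtT]. rewrite HcT in E. apply Hinj in E; lra. apply (Hfirst t s) in E; lra. }
    exists (Rmin (k / 2) d). split. { apply Rmin_pos; lra. }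
    mins (Rmin (k / 2) d). intros v tau Hv Ht t Htt E.
    destruct (Rle_dec (k / 2) t). { apply (Hd v tau !! !! t); auto. lra. }
    apply (Hk v s (tau + t)); try lra. rewrite Rminus_diag, Rabs_R0; lra.
    rewrite (flow_plus L B) by auto. rewrite E. replace (-1 * tau) with (- tau) by ring. symmetry. apply (flow_inv' L B); auto.
  - apply near_avoids; auto.
    + intros; apply orbit_cont.
    + intros t Ht E. destruct (Req_dec t T) as [->|HtT]. { rewrite HcT in E. apply Hinj in E; lra. }
      destruct (Req_dec t 0) as [->|Ht0]. { rewrite tail_E0 in E. apply Hinj in E; lra. } apply (Hfirst t vs) in E; lra.
Qed.

(** The counterpart for forward times: now the points just after [g s] lie on the orbit, and [s'] is
    the parameter that calls for the flow box. *)
Lemma orbit_avoids_right vs : s < vs -> vs < u3 ->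
  exists d, 0 < d /\ forall v tau, Rabs (v - vs) < d -> 0 < tau < d -> avoids 0 T c (Phi (1 * tau) (g v)).
Proof.
  intros H0 H1. assert (Hvs : 0 < vs < u3) by lra. assert (A1 : Rabs 1 = 1) by apply Rabs_R1.
  destruct (Req_dec vs s') as [->|Hne].
  - destruct (flow_box' s' Hvs) as [k [Pk [Hk1 [Hk2 Hk]]]].
    destruct (near_avoids c 0 (T - k / 2) s' 1 A1 Hvs) as [d [Pd Hd]].
    { intros; apply orbit_cont. }
    { intros t Ht E. destruct (Req_dec t 0) as [->|HtT]. rewrite tail_E0 in E. apply Hinj in E; lra. apply (Hfirst t s') in E; lra. }
    exists (Rmin (k / 2) d). split. { apply Rmin_pos; lra. }
    mins (Rmin (k / 2) d). intros v tau Hv Ht t Htt E.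
    destruct (Rle_dec t (T - k / 2)). { apply (Hd v tau !! !! t); auto. lra. }
    apply (Hk s' v (T - t + tau)); try lra. rewrite Rminus_diag, Rabs_R0; lra.
    rewrite (flow_plus L B) by auto. rewrite Rmult_1_l in E. rewrite <- E, <- (flow_plus L B) by auto.
    replace (T - t + t) with T by ring. auto.
  - apply near_avoids; auto.
    + intros; apply orbit_cont.
    + intros t Ht E. destruct (Req_dec t T) as [->|HtT]. { rewrite HcT in E. apply Hinj in E; lra. }
      destruct (Req_dec t 0) as [->|Ht0]. { rewrite tail_E0 in E. apply Hinj in E; lra. } apply (Hfirst t vs) in E; lra.
Qed.

Lemma off_side (sg a b : R) : (sg = -1 /\ 0 < a /\ b < s') \/ (sg = 1 /\ s < a /\ b < u3) -> a <= b ->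
  exists e, 0 < e /\ forall v tau, a <= v <= b -> 0 < tau <= e -> Off (Phi (sg * tau) (g v)).
Proof.
  intros H Hab.
  destruct (unif_pos (fun v e => forall tau, 0 < tau < e -> Off (Phi (sg * tau) (g v))) a b Hab) as [e [Pe He]].
  - intros v e e' Hv He' tau Ht. apply Hv. lra.
  - intros x Hx. destruct (arc_avoids sg x) as [d1' [P1 H1]]. { destruct H as [[-> _]|[-> _]]; auto. } { lra. }
    assert (exists d, 0 < d /\ forall v tau, Rabs (v - x) < d -> 0 < tau < d -> avoids 0 T c (Phi (sg * tau) (g v))) as [d2 [P2 H2]].
    { destruct H as [[-> H]|[-> H]]. apply orbit_avoids_left; lra. apply orbit_avoids_right; lra. }
    exists (Rmin d1' d2). split. { apply Rmin_pos; auto. }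
    mins (Rmin d1' d2). intros y Hy Hyx tau Ht. split; [apply H2|apply H1]; lra.
  - exists (e / 2). split; [lra|]. intros v tau Hv Ht. apply He; auto. lra.
Qed.

(** From [g va], which is off the closed curve, follow the flow for the time [sg * eta] and then the
    arc shifted by this time as far as [g vb]. The whole path avoids the closed curve, so the
    winding number does not change. *)
Lemma wind_side (sg a b va vb : R) : (sg = -1 /\ 0 < a /\ b < s') \/ (sg = 1 /\ s < a /\ b < u3) -> a <= b ->
  a <= va <= b -> (va < s \/ s' < va) -> a <= vb <= b ->
  exists e, 0 < e /\ forall eta, 0 < eta <= e -> Off (Phi (sg * eta) (g vb)) /\ W (Phi (sg * eta) (g vb)) = W (g va).
Proof.
  intros H Hab Hva Hva' Hvb. assert (WP := wind_path T s s' c vc g dg !! !! tail_Cc tail_Cg tail_E0 HcT).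
  destruct (off_side sg a b H Hab) as [e [Pe He]]. exists e. split; auto. intros eta Heta. split. { apply He; auto. }
  transitivity (W (Phi (sg * eta) (g va))).
  - assert (PC : forall t, a <= t <= b -> forall e0, 0 < e0 -> exists d, 0 < d /\ forall u, a <= u <= b -> Rabs (u - t) < d ->
       d1 (Phi (sg * eta) (g t)) (Phi (sg * eta) (g u)) < e0).
    { apply (arc_path_cont (fun p => Phi (sg * eta) p) a b); try lra.
      destruct (flow_const (sg * eta)) as [K [PK HK]]. exists K. split; auto. }
    destruct (Rle_dec va vb).
    + symmetry. apply (WP (fun v => Phi (sg * eta) (g v)) va vb); auto.
      * intros t Ht e0 He0. destruct (PC t !! e0 He0) as [d [Pd Hd]]. exists d. split; auto. intros; apply Hd; auto; lra.
      * intros t Ht. apply He; lra.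
    + apply (WP (fun v => Phi (sg * eta) (g v)) vb va); auto. lra.
      * intros t Ht e0 He0. destruct (PC t !! e0 He0) as [d [Pd Hd]]. exists d. split; auto. intros; apply Hd; auto; lra.
      * intros t Ht. apply He; lra.
  - replace (g va) with (Phi (sg * 0) (g va)) at 2 by (rewrite Rmult_0_r; apply (flow_0 L B); auto).
    symmetry. apply (WP (fun tau => Phi (sg * tau) (g va)) 0 eta). lra.
    + intros t Ht e0 He0. pose proof (glip_B _ _ _ HX) as HB. exists (e0 / (2 * B + 1)). split. { apply Rdiv_lt_0_compat; lra. }
      intros u _ Hu. eapply Rle_lt_trans. apply (flow_time L B); auto.
      replace (sg * t - sg * u) with (sg * (t - u)) by ring. rewrite Rabs_mult.
      replace (Rabs sg) with 1 by (destruct H as [[-> _]|[-> _]]; [rewrite Rabs_left; lra|rewrite Rabs_R1; auto]).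
      rewrite Rmult_1_l, Rabs_minus_sym.
      apply Rle_lt_trans with ((2 * B + 1) * Rabs (u - t)). { apply Rmult_le_compat_r. apply Rabs_pos. lra. }
      apply Rlt_le_trans with ((2 * B + 1) * (e0 / (2 * B + 1))). apply Rmult_lt_compat_l; lra. right; field; lra.
    + intros t Ht. destruct (Req_dec t 0) as [->|Ht0].
      * rewrite Rmult_0_r, (flow_0 L B) by auto. apply tail_off_arc; auto. lra.
      * apply He; lra.
Qed.

(** Seen from the two sides of [g v0], the short piece of the arc around [v0] sweeps angles of
    opposite signs, each larger than [PI / 2], whereas the rest of the closed curve contributes
    almost the same to both. *)
Lemma wind_jump (v0 : R) : s < v0 < s' ->
  exists e, 0 < e /\ forall eta, 0 < eta <= e -> Off (Phi (1 * eta) (g v0)) -> Off (Phi (-1 * eta) (g v0)) ->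
    W (Phi (1 * eta) (g v0)) <> W (Phi (-1 * eta) (g v0)).
Proof.
  intros Hv0. assert (Hv : 0 < v0 < u3) by lra. pose proof PI_RGT_0 as HPI.
  set (e := X (g v0)). set (a := dg v0). set (D := det2 a e). assert (HD : D <> 0) by (apply Htr; lra).
  set (r0 := Rmin (v0 - s) (s' - v0)). assert (Pr0 : 0 < r0) by (apply Rmin_pos; lra).
  assert (R1 : r0 <= v0 - s) by apply Rmin_l. assert (R2 : r0 <= s' - v0) by apply Rmin_r.
  assert (Cr : C1on (v0 - r0) (v0 + r0) g dg) by (apply (C1on_sub 0 u3); auto; lra).
  destruct (flow_box L B X g dg r0 v0 HX Pr0 Cr HD) as [kp [Pkp [Hkp0 Hkp]]].
  assert (HXo : glip L B (field_opp X)) by (apply glip_opp; auto).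
  destruct (flow_box L B (field_opp X) g dg r0 v0 HXo Pr0 Cr) as [km [Pkm [Hkm0 Hkm]]].
  { fold a. replace (det2 a (field_opp X (g v0))) with (- D) by (unfold D, e, det2, field_opp; simpl; ring). lra. }
  assert (He : e <> origin). { intros E. apply HD. unfold D. rewrite E. unfold det2, origin; simpl; ring. }
  assert (Ha : a <> origin). { intros E. apply HD. unfold D. rewrite E. unfold det2, origin; simpl; ring. }
  assert (Pa : 0 < dot a a).
  { unfold dot. replace (a.1 * a.1 + a.2 * a.2) with (a.1 ^ 2 + a.2 ^ 2) by ring. apply sum_sq_pos.
    destruct (Req_dec a.1 0); auto. destruct (Req_dec a.2 0); auto. exfalso; apply Ha. destruct a; simpl in *; subst; auto. }
  (* [nu] bounds the deviation of the tangents from [a]: small enough for the chords from [g v0] to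
     both sides to form an obtuse angle, and for them to lie on different sides of the line along
     [e]. *)
  set (nu := Rmin (dot a a / (4 * (Rabs a.1 + Rabs a.2 + 1))) (Rmin 1 (Rabs D / (2 * (Rabs e.1 + Rabs e.2 + 1))))).
  assert (PA : 0 < Rabs a.1 + Rabs a.2 + 1). { absp a.1. absp a.2. lra. }
  assert (PE : 0 < Rabs e.1 + Rabs e.2 + 1). { absp e.1. absp e.2. lra. }
  assert (PD : 0 < Rabs D) by (apply Rabs_pos_lt; auto).
  assert (Pnu : 0 < nu). { unfold nu. repeat apply Rmin_pos; try lra; apply Rdiv_lt_0_compat; lra. }
  assert (N1 : nu * (4 * (Rabs a.1 + Rabs a.2 + 1)) <= dot a a).
  { apply Rle_trans with (dot a a / (4 * (Rabs a.1 + Rabs a.2 + 1)) * (4 * (Rabs a.1 + Rabs a.2 + 1))).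
    apply Rmult_le_compat_r. lra. apply Rmin_l. right; field; lra. }
  assert (N2 : nu * (2 * (Rabs e.1 + Rabs e.2 + 1)) <= Rabs D).
  { apply Rle_trans with (Rabs D / (2 * (Rabs e.1 + Rabs e.2 + 1)) * (2 * (Rabs e.1 + Rabs e.2 + 1))).
    apply Rmult_le_compat_r. lra. unfold nu. eapply Rle_trans. apply Rmin_r. apply Rmin_r. right; field; lra. }
  assert (N3 : nu <= 1). { unfold nu. eapply Rle_trans. apply Rmin_r. apply Rmin_l. }
  destruct (Hg v0 !!) as [_ [Q1 Q2]].
  destruct (cont_near _ v0 nu Q1 Pnu) as [k1 [Pk1 Hk1]]. destruct (cont_near _ v0 nu Q2 Pnu) as [k2 [Pk2 Hk2]].
  set (ka := Rmin (Rmin kp km) (Rmin k1 k2) / 2).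
  assert (Pka : 0 < ka). { unfold ka. assert (0 < Rmin (Rmin kp km) (Rmin k1 k2)) by (repeat apply Rmin_pos; auto). lra. }
  assert (K1 : ka < kp /\ ka < km /\ ka < k1 /\ ka < k2).
  { unfold ka in *. mins (Rmin (Rmin kp km) (Rmin k1 k2)). repeat split; lra. }
  destruct K1 as [K1 [K2 [K3 K4]]]. set (v1 := v0 - ka). set (v2 := v0 + ka).
  assert (V : s <= v1 /\ v1 < v0 /\ v0 < v2 /\ v2 <= s') by (unfold v1, v2; lra).
  assert (Hnear : forall x, v1 <= x <= v2 -> Rabs (x - v0) < kp /\ Rabs (x - v0) < km /\ Rabs (x - v0) < k1 /\ Rabs (x - v0) < k2).
  { intros x Hx. unfold v1, v2 in Hx. repeat split; apply Rabs_def1; lra. }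
  assert (INC : forall v, v1 <= v <= v2 -> exists x1 x2, Rabs (x1 - a.1) <= nu /\ Rabs (x2 - a.2) <= nu /\ psub (g v) (g v0) = ((v - v0) * x1, (v - v0) * x2)).
  { intros v Hv1. destruct (mvt_between (fun u => (g u).1) (fun u => (dg u).1) v0 v) as [c1 [Hc1 E1]].
    { intros x Hx. apply Hg. unfold Rmin, Rmax in Hx. destruct Rle_dec; unfold v1, v2 in *; lra. }
    destruct (mvt_between (fun u => (g u).2) (fun u => (dg u).2) v0 v) as [c2 [Hc2 E2]].
    { intros x Hx. apply Hg. unfold Rmin, Rmax in Hx. destruct Rle_dec; unfold v1, v2 in *; lra. }
    assert (I1 : v1 <= c1 <= v2) by (unfold Rmin, Rmax in Hc1; destruct Rle_dec; lra).
    assert (I2 : v1 <= c2 <= v2) by (unfold Rmin, Rmax in Hc2; destruct Rle_dec; lra).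
    exists (dg c1).1, (dg c2).2. split; [|split].
    - left. apply Hk1. apply Hnear; auto.
    - left. apply Hk2. apply Hnear; auto.
    - unfold psub. rewrite E1, E2. f_equal; ring. }
  destruct (INC v1 !!) as [x1 [x2 [X1 [X2 EX]]]]. destruct (INC v2 !!) as [y1 [y2 [Y1 [Y2 EY]]]].
  replace (v1 - v0) with (- ka) in EX by (unfold v1; ring). replace (v2 - v0) with ka in EY by (unfold v2; ring).
  assert (DT : dot (psub (g v1) (g v0)) (psub (g v2) (g v0)) < 0).
  { rewrite EX, EY. unfold dot; simpl. assert (0 < x1 * y1 + x2 * y2).
    { assert (G : forall u x y, Rabs (x - u) <= nu -> Rabs (y - u) <= nu -> u * u - nu * (2 * Rabs u) - nu * nu <= x * y).
      { intros u x y Hx Hy. set (hx := x - u) in *. set (hy := y - u) in *.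
        replace (x * y) with (u * u + u * (hx + hy) + hx * hy) by (unfold hx, hy; ring).
        assert (Rabs (u * (hx + hy)) <= Rabs u * (2 * nu)).
        { rewrite Rabs_mult. apply Rmult_le_compat_l. apply Rabs_pos. eapply Rle_trans. apply Rabs_triang. lra. }
        assert (Rabs (hx * hy) <= nu * nu). { rewrite Rabs_mult. apply Rmult_le_compat; auto; apply Rabs_pos. }
        absle H. absle H0. lra. }
      pose proof (G _ _ _ X1 Y1). pose proof (G _ _ _ X2 Y2). unfold dot in N1. absp a.1. absp a.2. nra. }
    replace (- ka * x1 * (ka * y1) + - ka * x2 * (ka * y2)) with (- (ka * ka * (x1 * y1 + x2 * y2))) by ring.
    assert (0 < ka * ka * (x1 * y1 + x2 * y2)); [|lra]. apply Rmult_lt_0_compat; auto. apply Rmult_lt_0_compat; auto. }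
  assert (ED : forall x y, Rabs (x - a.1) <= nu -> Rabs (y - a.2) <= nu -> Rabs (det2 e (x, y) + D) <= Rabs D / 2).
  { intros x y Hx Hy. pose proof (det2_diff_bound e (x, y) a nu Hx Hy) as Q.
    replace (det2 e (x, y) + D) with (det2 e (x, y) - det2 e a) by (unfold D, det2; ring). nra. }
  pose proof (ED _ _ X1 X2) as DX. pose proof (ED _ _ Y1 Y2) as DY.
  assert (S1 : det2 e (psub (g v1) (g v0)) = - ka * det2 e (x1, x2)) by (rewrite EX; unfold det2; simpl; ring).
  assert (S2 : det2 e (psub (g v2) (g v0)) = ka * det2 e (y1, y2)) by (rewrite EY; unfold det2; simpl; ring).
  assert (AV0 : avoids 0 T c (g v0)).
  { intros t Ht E. destruct (Req_dec t 0) as [->|Ht0]. { rewrite tail_E0 in E. apply Hinj in E; lra. }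
    destruct (Req_dec t T) as [->|HtT]. { rewrite HcT in E. apply Hinj in E; lra. } apply (Hfirst t v0) in E; lra. }
  destruct (var_local 0 T c vc (g v0) (1/4) !! tail_Cc AV0 !!) as [w1 [Pw1 Hw1]].
  assert (AV1 : avoids s v1 g (g v0)). { intros t Ht E. apply Hinj in E; lra. }
  destruct (var_local s v1 g dg (g v0) (1/4) !! (C1on_sub 0 u3 s v1 g dg !! !! Hg) AV1 !!) as [w2 [Pw2 Hw2]].
  assert (AV2 : avoids v2 s' g (g v0)). { intros t Ht E. apply Hinj in E; lra. }
  destruct (var_local v2 s' g dg (g v0) (1/4) !! (C1on_sub 0 u3 v2 s' g dg !! !! Hg) AV2 !!) as [w3 [Pw3 Hw3]].
  destruct (dot_cont_neg _ _ DT) as [w4 [Pw4 Hw4]]. assert (exists w5, 0 < w5 /\ forall q, d1 (g v0) q < w5 ->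
     (0 < D -> 0 < det2 e (psub (g v1) q) /\ det2 e (psub (g v2) q) < 0) /\ (D < 0 -> det2 e (psub (g v1) q) < 0 /\ 0 < det2 e (psub (g v2) q))) as [w5 [Pw5 Hw5]].
  { assert (TR : forall p q, d1 (psub p q) (psub p (g v0)) = d1 (g v0) q).
    { intros p q. unfold d1, psub; simpl. replace (p.1 - q.1 - (p.1 - (g v0).1)) with ((g v0).1 - q.1) by ring.
      replace (p.2 - q.2 - (p.2 - (g v0).2)) with ((g v0).2 - q.2) by ring. reflexivity. }
    absle DX. absle DY. set (eD := (D * e.1, D * e.2)). assert (ES : forall p, det2 eD p = D * det2 e p) by (intros; unfold eD, det2; cbn [fst snd]; ring).
    destruct (det2_cont_pos eD (psub (g v1) (g v0))) as [a1 [Pa1 Ha1]].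
    { rewrite ES, S1. assert (D * det2 e (x1, x2) < 0) by (unfold Rabs in DX, PD; destruct (Rcase_abs D); nra). nra. }
    destruct (det2_cont_pos (- eD.1, - eD.2) (psub (g v2) (g v0))) as [a2 [Pa2 Ha2]].
    { rewrite det2_opp, ES, S2. assert (D * det2 e (y1, y2) < 0) by (unfold Rabs in DY, PD; destruct (Rcase_abs D); nra). nra. }
    exists (Rmin a1 a2). split. apply Rmin_pos; auto. intros q Hq. mins (Rmin a1 a2).
    specialize (Ha1 (psub (g v1) q)). specialize (Ha2 (psub (g v2) q)). rewrite TR in Ha1, Ha2.
    rewrite det2_opp in Ha2. rewrite ES in Ha1, Ha2. specialize (Ha1 !!). specialize (Ha2 !!). split; intros; split; nra. }
  pose proof (glip_B _ _ _ HX) as HB. set (w := Rmin (Rmin w1 w2) (Rmin w3 (Rmin w4 w5))).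
  assert (Pw : 0 < w) by (unfold w; repeat apply Rmin_pos; auto).
  assert (Lw : w <= w1 /\ w <= w2 /\ w <= w3 /\ w <= w4 /\ w <= w5).
  { unfold w. mins (Rmin (Rmin w1 w2) (Rmin w3 (Rmin w4 w5))). repeat split; lra. }
  exists (Rmin (w / (2 * (2 * B + 1))) ka). split. { apply Rmin_pos; auto. apply Rdiv_lt_0_compat; lra. }
  intros eta Heta Op Om EW.
  pose proof (Rmin_l (w / (2 * (2 * B + 1))) ka) as ML. pose proof (Rmin_r (w / (2 * (2 * B + 1))) ka) as MR.
  assert (CL : forall sg, Rabs sg = 1 -> d1 (g v0) (Phi (sg * eta) (g v0)) < w).
  { intros sg Hsg. rewrite d1_sym. pose proof (flow_time L B X HX (sg * eta) 0 (g v0)) as F. rewrite (flow_0 L B) in F by auto.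
    rewrite Rminus_0_r, Rabs_mult, Hsg, Rmult_1_l, (Rabs_pos_eq eta) in F by lra. eapply Rle_lt_trans. exact F.
    apply Rle_lt_trans with ((2 * B + 1) * (w / (2 * (2 * B + 1)))). apply Rmult_le_compat; lra.
    replace ((2 * B + 1) * (w / (2 * (2 * B + 1)))) with (w / 2) by (field; lra). lra. }
  assert (A1 : Rabs 1 = 1) by apply Rabs_R1. assert (Am : Rabs (-1) = 1) by (rewrite Rabs_left; lra).
  pose proof (CL 1 A1) as C1. pose proof (CL (-1) Am) as C2.
  (* The three long pieces change by at most 1/4 each when [q] replaces [g v0]. Their total error
     for both sides together is at most 3/2, less than the jump of more than [PI]. *)
  assert (SPL : forall q, Off q -> d1 (g v0) q < w -> exists z, Rabs z <= 3/4 /\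
     W q = var 0 T c vc (g v0) - var s v1 g dg (g v0) - var v2 s' g dg (g v0) + z - var v1 v2 g dg q /\
     dot (psub (g v1) q) (psub (g v2) q) < 0).
  { intros q [Oq1 Oq2] Hq. destruct (Hw1 q !!) as [_ I1]. destruct (Hw2 q !!) as [_ I2]. destruct (Hw3 q !!) as [_ I3].
    exists ((var 0 T c vc q - var 0 T c vc (g v0)) - (var s v1 g dg q - var s v1 g dg (g v0)) - (var v2 s' g dg q - var v2 s' g dg (g v0))).
    split; [|split].
    - absle I1. absle I2. absle I3. apply Rabs_le. lra.
    - unfold wind. rewrite (var_Chasles s v1 s' g dg q) by (auto; try lra; apply tail_Cg).
      rewrite (var_Chasles v1 v2 s' g dg q); [ring|lra|apply (C1on_sub 0 u3); auto; lra|apply (avoids_sub s s'); auto; lra].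
    - assert (TT := Hw4 (psub q (g v0))).
      replace (psub (g v1) q) with (psub (psub (g v1) (g v0)) (psub q (g v0))) by (unfold psub; simpl; f_equal; ring).
      replace (psub (g v2) q) with (psub (psub (g v2) (g v0)) (psub q (g v0))) by (unfold psub; simpl; f_equal; ring).
      apply TT. rewrite d1_sym in Hq. unfold d1 in *. unfold psub; simpl. rewrite !Rminus_0_r. lra. }
  destruct (SPL _ Op C1) as [zp [Zp [Ep Dp]]]. destruct (SPL _ Om C2) as [zm [Zm [Em Dm]]]. rewrite Ep, Em in EW.
  assert (Cv : C1on v1 v2 g dg) by (apply (C1on_sub 0 u3); auto; lra).
  assert (AVp : avoids v1 v2 g (Phi (1 * eta) (g v0))) by (destruct Op; apply (avoids_sub s s'); auto; lra).
  assert (AVm : avoids v1 v2 g (Phi (-1 * eta) (g v0))) by (destruct Om; apply (avoids_sub s s'); auto; lra).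
  assert (Z0 : Rabs (v0 - v0) = 0) by (rewrite Rminus_diag; apply Rabs_R0).
  destruct (slit_variation v1 v2 g dg (Phi (1 * eta) (g v0)) e !! Cv AVp He) as [Ps1 Ps2].
  { intros t lam Ht Hl E. apply (Hkp t v0 eta lam); try lra. apply Hnear; auto. rewrite Rmult_1_l in E. exact E. }
  { exact Dp. }
  assert (He' : field_opp X (g v0) <> origin). { unfold field_opp. fold e. intros E. apply He. unfold origin in *. injection E; intros. destruct e; simpl in *. f_equal; lra. }
  destruct (slit_variation v1 v2 g dg (Phi (-1 * eta) (g v0)) (field_opp X (g v0)) !! Cv AVm He') as [Ms1 Ms2].
  { intros t lam Ht Hl E. apply (Hkm t v0 eta lam); try lra. apply Hnear; auto. rewrite (flow_opp L B) by auto. replace (-1 * eta) with (- eta) in E by ring. exact E. }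
  { exact Dm. }
  unfold field_opp in Ms1, Ms2. fold e in Ms1, Ms2. rewrite !det2_opp in Ms1, Ms2.
  destruct (Hw5 _ ltac:(apply Rlt_le_trans with (1 := C1); apply Lw)) as [Wp1 Wp2].
  destruct (Hw5 _ ltac:(apply Rlt_le_trans with (1 := C2); apply Lw)) as [Wm1 Wm2].
  assert (P3 : 3 < PI) by (pose proof PI2_3_2; unfold PI2 in *; lra). absle Zp. absle Zm.
  destruct (Rlt_le_dec 0 D) as [Dpos|Dneg].
  - destruct (Wp1 Dpos) as [U1 U2]. destruct (Wm1 Dpos) as [U3 U4].
    specialize (Ps1 U1 U2). specialize (Ms2 !! !!). lra.
  - destruct (Wp2 !!) as [U1 U2]. destruct (Wm2 !!) as [U3 U4]. specialize (Ps2 U1 U2). specialize (Ms1 !! !!). lra.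
Qed.

(** Part of Jordan's theorem by hand. The inner end [g 0] is joined to the backward side of the
    middle [g v0] of the enclosed piece of arc, the outer point [g u2] to its forward side; the
    winding number is constant on both paths and jumps between the sides. *)
Lemma wind_tail : W (g 0) <> W (g u2).
Proof.
  assert (WP := wind_path T s s' c vc g dg !! !! tail_Cc tail_Cg tail_E0 HcT).
  set (v0 := (s + s') / 2). assert (Hv0 : s < v0 < s') by (unfold v0; lra).
  destruct (wind_jump v0 Hv0) as [e0 [Pe0 H0]].
  destruct (wind_side (-1) (s / 2) v0 (s / 2) v0) as [e1 [Pe1 H1]]; try lra.
  destruct (wind_side 1 v0 u2 u2 v0) as [e2 [Pe2 H2]]; try lra. set (e := Rmin e0 (Rmin e1 e2)).
  assert (Pe : 0 < e) by (unfold e; repeat apply Rmin_pos; auto). assert (Le : e <= e0 /\ e <= e1 /\ e <= e2).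
  { unfold e. mins (Rmin e0 (Rmin e1 e2)). lra. }
  destruct (H1 e !!) as [O1 E1]. destruct (H2 e !!) as [O2 E2]. intros E. apply (H0 e !! O2 O1). rewrite E1, E2, <- E.
  apply (WP g 0 (s / 2)). lra.
  - apply (arc_path_cont (fun p => p) 0 (s / 2)); try lra. exists 1. split. lra. intros; lra.
  - intros t Ht. apply tail_off_arc; lra.
Qed.
End Tail.

Lemma enorm_d1 p : enorm p <= d1 p origin /\ d1 p origin <= 2 * enorm p.
Proof.
  unfold enorm, d1, origin; simpl fst; simpl snd. rewrite !Rminus_0_r. set (x := p.1). set (y := p.2). absp x. absp y.
  assert (Hs : 0 <= x ^ 2 + y ^ 2) by (pose proof (pow2_ge_0 x); pose proof (pow2_ge_0 y); lra).
  rewrite <- (pow2_abs x), <- (pow2_abs y) in *. set (a := Rabs x) in *. set (b := Rabs y) in *. clearbody a b.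
  pose proof (sqrt_pos (a ^ 2 + b ^ 2)) as P. pose proof (sqrt_sqrt _ Hs) as Q.
  set (n := sqrt (a ^ 2 + b ^ 2)) in *. clearbody n. split.
  - apply Rsqr_incr_0_var; [unfold Rsqr; nra|lra].
  - assert (a <= n) by (apply Rsqr_incr_0_var; [unfold Rsqr; nra|lra]).
    assert (b <= n) by (apply Rsqr_incr_0_var; [unfold Rsqr; nra|lra]). lra.
Qed.

Lemma enorm_origin : enorm origin = 0.
Proof. unfold enorm, origin; cbn [fst snd]. replace (0 ^ 2 + 0 ^ 2) with 0 by ring. apply sqrt_0. Qed.

Lemma inbox_d1 K p : d1 p origin <= K -> inbox K p.
Proof.
  unfold d1, inbox, origin; simpl. rewrite !Rminus_0_r. absp p.1. absp p.2. lra.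
Qed.

Lemma inbox_mono K K' p : K <= K' -> inbox K p -> inbox K' p.
Proof. unfold inbox. lra. Qed.

Lemma curve_inbox (c : R -> R * R) a b : a <= b ->
  (forall t, a <= t <= b -> continuous (fun u => (c u).1) t /\ continuous (fun u => (c u).2) t) ->
  exists K, 0 < K /\ forall t, a <= t <= b -> inbox K (c t).
Proof.
  intros Hab H. destruct (cont_bounded (fun u => (c u).1) a b Hab (fun t Ht => proj1 (H t Ht))) as [K1 [P1 H1]].
  destruct (cont_bounded (fun u => (c u).2) a b Hab (fun t Ht => proj2 (H t Ht))) as [K2 [P2 H2]].
  exists (K1 + K2). split. lra. intros t Ht. specialize (H1 t Ht). specialize (H2 t Ht). split; lra.
Qed.

Lemma solution_clipped K X I c : (forall t, I t -> inbox K (c t)) -> solution_on X I c -> solution_on (clipped K X) I c.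
Proof. intros HK H t Ht. rewrite clipped_in; auto. Qed.

Lemma solution_cont X I c t : solution_on X I c -> I t -> continuous (fun u => (c u).1) t /\ continuous (fun u => (c u).2) t.
Proof. intros H Ht. destruct (H t Ht). split; eapply is_derive_cont; eauto. Qed.

(** On the outer part of the arc the winding number is constant and different from that of the
    origin, near which it is constant as well; so the outer part cannot come close to the origin. *)
Lemma arc_tail_aux X g r s s' T c : loc_lip X -> transversal_half_arc X g r ->
  0 < s -> s < s' -> s' < r -> 0 < T -> solution_on X (fun t => 0 <= t <= T) c ->
  c 0 = g s -> c T = g s' -> (forall t u, 0 < t < T -> 0 < u < r -> c t <> g u) ->
  (forall t, 0 <= t <= T -> c t <> origin) ->
  exists m, 0 < m /\ forall u, s' < u < r -> m <= enorm (g u).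
Proof.
  intros HX [Hr [Hg0 [Hinj [dg [Hdg Htr]]]]] Hs Hss Hs'r HT Hc Hc0 HcT Hfirst Hcne.
  (* The data of the arc are available on closed parameter intervals below [r] only; [u3] bounds
     such an interval and [u2] lies strictly between [s'] and [u3]. *)
  set (u2 := (2 * s' + r) / 3). set (u3 := (s' + 2 * r) / 3).
  assert (U : s' < u2 /\ u2 < u3 /\ u3 < r) by (unfold u2, u3; lra). assert (Cg : C1on 0 u3 g dg).
  { intros t Ht. destruct (Hdg t !!) as [A1 [A2 [A3 A4]]]. auto. }
  destruct (curve_inbox g 0 u3 !! (fun t Ht => C1on_cont 0 u3 g dg t Cg Ht)) as [K1 [PK1 HK1]].
  destruct (curve_inbox c 0 T !! (fun t Ht => solution_cont X _ c t Hc Ht)) as [K2 [PK2 HK2]]. set (K := K1 + K2).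
  destruct (clipped_glip K X ltac:(unfold K; lra) HX) as [L [B HG]].
  assert (Hc' : solution_on (clipped K X) (fun t => 0 <= t <= T) c).
  { apply solution_clipped; auto. intros t Ht. apply inbox_mono with K2; [unfold K; lra|auto]. }
  assert (EF : forall t, 0 <= t <= T -> c t = flow (clipped K X) t (g s)).
  { intros t Ht. rewrite <- Hc0. replace t with (t - 0) at 2 by ring. apply (flow_unique L B (clipped K X) HG c 0 T 0); auto. lra. }
  assert (Htr' : forall u, 0 < u <= u3 -> det2 (dg u) (clipped K X (g u)) <> 0).
  { intros u Hu. rewrite clipped_in. apply Htr; lra. apply inbox_mono with K1; [unfold K; lra|]. apply HK1; lra. }
  assert (Hinj' : forall u v, 0 <= u <= u3 -> 0 <= v <= u3 -> g u = g v -> u = v) by (intros; apply Hinj; auto; lra).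
  assert (EN : forall t, 0 <= t <= T -> flow (clipped K X) t (g s) <> g 0) by (intros t Ht; rewrite <- EF, Hg0; auto).
  assert (HF' : forall t u, 0 < t < T -> 0 < u <= u3 -> flow (clipped K X) t (g s) <> g u) by (intros; rewrite <- EF by lra; apply Hfirst; auto; lra).
  assert (HcT' : flow (clipped K X) T (g s) = g s') by (rewrite <- EF; auto; lra).
  pose proof (wind_tail L B (clipped K X) g dg u3 u2 s s' T HG Cg Htr' Hinj' !! HT HcT' HF' EN) as WT.
  set (cf := fun t => flow (clipped K X) t (g s)) in *. set (vf := fun t => clipped K X (flow (clipped K X) t (g s))) in *.
  assert (Cc : C1on 0 T cf vf) by (apply (flow_C1on L B); auto).
  assert (Cgs : C1on s s' g dg) by (apply (C1on_sub 0 u3); auto; lra).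
  assert (E0 : cf 0 = g s) by (apply (flow_0 L B); auto).
  assert (OFF : forall u, s' < u < r \/ u = 0 -> off T s s' cf g (g u)).
  { intros u Hu. split.
    - intros t Ht E. unfold cf in E. rewrite <- EF in E by auto.
      destruct Hu as [Hu| ->]; [|apply (Hcne t Ht); congruence].
      destruct (Req_dec t 0) as [->|Ht0]. { rewrite Hc0 in E. apply Hinj in E; lra. }
      destruct (Req_dec t T) as [->|HtT]. { rewrite HcT in E. apply Hinj in E; lra. }
      apply (Hfirst t u) in E; lra.
    - intros t Ht E. apply Hinj in E; lra. }
  destruct (wind_local T s s' cf vf g dg !! !! Cc Cgs E0 HcT' (g 0)) as [d [Pd Hd]]. { apply OFF; auto. }
  exists (d / 2). split. lra. intros u Hu. destruct (Rle_lt_dec (d / 2) (enorm (g u))); auto. exfalso. apply WT.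
  destruct (Hd (g u)) as [_ E]. { rewrite Hg0, d1_sym. destruct (enorm_d1 (g u)). lra. }
  rewrite <- E.
  assert (WP : forall a b, s' < a -> a <= b -> b < r -> wind T s s' cf vf g dg (g a) = wind T s s' cf vf g dg (g b)).
  { intros a b Ha Hab Hb. apply (wind_path T s s' cf vf g dg !! !! Cc Cgs E0 HcT' g a b Hab).
    - intros t Ht e He. destruct (Hdg t !!) as [A1 _]. destruct (arc_d1_near g (dg t) t e A1 He) as [d' [Pd' Hd']].
      exists d'. split; auto. intros. rewrite d1_sym. auto.
    - intros t Ht. apply OFF. left; lra. }
  destruct (Rle_dec u u2). apply WP; lra. symmetry. apply WP; lra.
Qed.

Lemma transversal_half_arc_opp X g r : transversal_half_arc X g r -> transversal_half_arc (field_opp X) g r.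
Proof.
  intros [Hr [Hg0 [Hinj [dg [Hdg Htr]]]]]. split; auto. split; auto. split; auto. exists dg. split; auto.
  intros u Hu. replace (det2 (dg u) (field_opp X (g u))) with (- det2 (dg u) (X (g u))) by (unfold det2, field_opp; simpl; ring).
  specialize (Htr u Hu). lra.
Qed.

Lemma solution_reverse X T c : solution_on X (fun t => 0 <= t <= T) c ->
  solution_on (field_opp X) (fun t => 0 <= t <= T) (fun t => c (T - t)).
Proof.
  intros H t Ht.
  replace (field_opp X (c (T - t))) with ((fun u => field_opp X (c (- u))) (t - T)) by (simpl; f_equal; f_equal; ring).
  assert (A : solution_on (field_opp X) (fun u => 0 <= - u <= T) (fun u => c (- u))) by (apply (solution_opp X (fun t => 0 <= t <= T)); auto).
  pose proof (has_velocity_shift (fun u => c (- u)) (- T) t (field_opp X (c (- (t - T))))) as Q.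
  assert (Q' : has_velocity (fun u => c (- (u + - T))) t (field_opp X (c (- (t - T))))).
  { apply Q. apply (A (t + - T)). lra. }
  destruct Q' as [Q1 Q2]. split.
  - eapply is_derive_ext; [|exact Q1]. intros u; simpl. f_equal. f_equal. ring.
  - eapply is_derive_ext; [|exact Q2]. intros u; simpl. f_equal. f_equal. ring.
Qed.

(* Once some orbit returns to a different point of the arc, the Jordan curve
   it makes with the arc keeps the far part of the arc away from the origin. *)
Lemma arc_tail X g r phi s s' T c : loc_lip X -> transversal_half_arc X g r ->
  0 < s < r -> first_return X g r phi s s' T c -> s <> s' ->
  exists m, 0 < m /\ forall u, Rmax s s' < u < r -> m <= enorm (g u).
Proof.
  intros HX HG Hs [HT [Hc [Hc0 [Hs' [HcT [Hf [th [Hth _]]]]]]]] Hne.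
  assert (Hcn : forall t, 0 <= t <= T -> c t <> origin) by (intros t Ht; apply (Hth t Ht)).
  destruct (Rlt_le_dec s s') as [H|H].
  - rewrite Rmax_right by lra. apply (arc_tail_aux X g r s s' T c); auto; lra.
  - rewrite Rmax_left by lra. apply (arc_tail_aux (field_opp X) g r s' s T (fun t => c (T - t))); auto; try lra.
    + apply loc_lip_opp; auto.
    + apply transversal_half_arc_opp; auto.
    + apply solution_reverse; auto.
    + rewrite Rminus_0_r; auto.
    + rewrite Rminus_diag; auto.
    + intros t u Ht Hu. apply Hf; auto. lra.
    + intros t Ht. apply Hcn. lra.
Qed.

Lemma arc_away g X r a b : transversal_half_arc X g r -> 0 < a -> a <= b -> b < r ->
  exists m, 0 < m /\ forall u, a <= u <= b -> m <= enorm (g u).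
Proof.
  intros [Hr [Hg0 [Hinj [dg [Hdg Htr]]]]] Ha Hab Hb. destruct (avoids_dist a b g origin Hab) as [m [Pm Hm]].
  - intros t Ht. destruct (Hdg t !!) as [[A1 A2] _]. split; eapply is_derive_cont; eauto.
  - intros t Ht E. rewrite <- Hg0 in E. apply Hinj in E; lra.
  - exists (m / 2). split. lra. intros u Hu. specialize (Hm u Hu). destruct (enorm_d1 (g u)). lra.
Qed.

Lemma inverse_fun (h dh : R -> R) (a b m : R) : a < b -> 0 < m ->
  (forall v, a <= v <= b -> is_derive h v (dh v)) -> (forall v, a <= v <= b -> m <= dh v) ->
  exists k : R -> R, (forall y, h a <= y <= h b -> a <= k y <= b /\ h (k y) = y) /\
    (forall y y', h a <= y <= h b -> h a <= y' <= h b -> m * Rabs (k y - k y') <= Rabs (y - y')).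
Proof.
  intros Hab Hm Hd Hp. assert (EX : forall y, exists v, h a <= y <= h b -> a <= v <= b /\ h v = y).
  { intros y. destruct (classic (h a <= y <= h b)) as [H|H].
    - destruct (ivt_incr h a b y) as [v [Hv E]]; auto; try lra.
      + intros; eapply is_derive_cont; eauto.
      + exists v; auto.
    - exists a. intros; contradiction. }
  set (k := fun y => proj1_sig (constructive_indefinite_description _ (EX y))).
  assert (Hk : forall y, h a <= y <= h b -> a <= k y <= b /\ h (k y) = y).
  { intros y. unfold k. destruct (constructive_indefinite_description _ (EX y)) as [v Hv]. simpl. auto. }
  exists k. split; auto. intros y y' Hy Hy'. destruct (Hk y Hy) as [A1 A2]. destruct (Hk y' Hy') as [B1 B2].
  rewrite <- A2 at 2. rewrite <- B2 at 2. destruct (mvt_between h dh (k y') (k y)) as [c [Hc E]].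
  { intros x Hx. apply Hd. unfold Rmin, Rmax in Hx. destruct Rle_dec; lra. }
  assert (a <= c <= b) by (unfold Rmin, Rmax in Hc; destruct Rle_dec; lra).
  rewrite E, Rabs_mult. apply Rmult_le_compat_r. apply Rabs_pos. rewrite Rabs_pos_eq; auto. specialize (Hp c H). lra.
Qed.

Lemma det2_sub a p q : det2 a (psub p q) = det2 a p - det2 a q.
Proof. unfold det2, psub; simpl; ring. Qed.

Lemma is_derive_det2_sub w p c v t : has_velocity c t v -> is_derive (fun u => det2 w (psub (c u) p)) t (det2 w v).
Proof.
  intros H. apply is_derive_ext with (fun u => det2 w (c u) - det2 w p). { intros. symmetry. apply det2_sub. }
  replace (det2 w v) with (det2 w v - 0) by ring.
  apply (is_derive_minus (fun u => det2 w (c u)) (fun _ => det2 w p)); [|apply is_derive_constR]. apply is_derive_det2; auto.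
Qed.

(** Surjectivity of the flow box without an inverse function theorem: an intermediate value argument
    along each orbit near the arc. *)
Lemma flow_box_onto_pos L B X (g dg : R -> R * R) (r0 vs : R) :
  glip L B X -> 0 < r0 -> C1on (vs - r0) (vs + r0) g dg -> 0 < det2 (dg vs) (X (g vs)) ->
  exists e, 0 < e /\ forall q, d1 q (g vs) < e ->
    exists v tau, Rabs (v - vs) < r0 /\ Rabs tau < r0 /\ flow X tau q = g v.
Proof.
  intros HX Hr HC HD. set (a := dg vs) in *. set (e := X (g vs)) in *. set (D := det2 a e) in *.
  pose proof (glip_L _ _ _ HX) as HL. pose proof (glip_B _ _ _ HX) as HB.
  set (mu := D / 4). assert (Hmu : 0 < mu) by (unfold mu; lra). assert (V0 : vs - r0 <= vs <= vs + r0) by lra.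
  assert (CD : forall w, continuous (fun u => det2 w (dg u)) vs).
  { intros w. unfold det2. destruct (HC vs V0) as [_ [Q1 Q2]]. apply continuous_minusR; apply continuous_multR; try apply continuous_const; assumption. }
  destruct (cont_near _ vs mu (CD a) Hmu) as [k1 [Pk1 K1]]. destruct (cont_near _ vs mu (CD e) Hmu) as [k2 [Pk2 K2]].
  set (W := Rabs a.1 + Rabs a.2 + Rabs e.1 + Rabs e.2 + 1).
  assert (HW : 0 < W). { unfold W. absp a.1. absp a.2. absp e.1. absp e.2. lra. }
  set (nu := mu / (W * (L + 1))). assert (Hnu : 0 < nu). { apply Rdiv_lt_0_compat; auto. apply Rmult_lt_0_compat; lra. }
  set (k4 := nu / (2 * (2 * B + 1))). assert (Pk4 : 0 < k4). { apply Rdiv_lt_0_compat; lra. }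
  set (ka := Rmin r0 (Rmin k1 k2) / 2).
  assert (Pka : 0 < ka). { unfold ka. assert (0 < Rmin r0 (Rmin k1 k2)) by (repeat apply Rmin_pos; auto). lra. }
  assert (Lka : ka < r0 /\ ka < k1 /\ ka < k2).
  { unfold ka in *. mins (Rmin r0 (Rmin k1 k2)). lra. }
  set (eta := Rmin ka k4). assert (Peta : 0 < eta) by (apply Rmin_pos; auto).
  assert (Le1 : eta <= ka) by apply Rmin_l. assert (Le2 : eta <= k4) by apply Rmin_r.
  (* Linear coordinates adapted to the box: [xi] grows along the arc and is nearly constant along
     the flow, while [ze] grows along the flow and is nearly constant along the arc. *)
  set (xi := fun q => det2 (- e.1, - e.2) (psub q (g vs))). set (ze := fun q => det2 a (psub q (g vs))).
  assert (Bxi : forall q, Rabs (xi q) <= W * d1 q (g vs) /\ Rabs (ze q) <= W * d1 q (g vs)).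
  { intros q. unfold xi, ze. rewrite det2_opp, Rabs_Ropp, !det2_sub.
    assert (G : forall w, Rabs w.1 + Rabs w.2 <= W -> Rabs (det2 w q - det2 w (g vs)) <= W * d1 q (g vs)).
    { intros w Hw. eapply Rle_trans. apply det2_diff_bound with (e := d1 q (g vs)).
      unfold d1; absp ((q.2 - (g vs).2)); lra. unfold d1; absp ((q.1 - (g vs).1)); lra.
      apply Rmult_le_compat_r; auto. apply d1_pos. }
    split; apply G; unfold W; absp (a.1); absp (a.2); absp (e.1); absp (e.2); lra. }
  set (h := fun v => xi (g v)). assert (Dh : forall v, vs - ka <= v <= vs + ka -> is_derive h v (- det2 e (dg v))).
  { intros v Hv. rewrite <- det2_opp. apply is_derive_det2_sub. apply HC; lra. }
  assert (Eea : det2 e a = - D) by (unfold D, det2; ring).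
  assert (Hh : forall v, vs - ka <= v <= vs + ka -> 3 * mu <= - det2 e (dg v)).
  { intros v Hv. assert (Q := K2 v). specialize (Q ltac:(apply Rabs_def1; lra)). cbv beta in Q. fold a in Q. rewrite Eea in Q.
    apply Rabs_def2 in Q. unfold mu in *; lra. }
  destruct (inverse_fun h (fun v => - det2 e (dg v)) (vs - ka) (vs + ka) (3 * mu)) as [k [Hk1 Hk2]]; auto; try lra.
  assert (Hh0 : h vs = 0) by (unfold h, xi, det2, psub; simpl; ring).
  assert (Hhb : h (vs + ka) >= 3 * mu * ka /\ h (vs - ka) <= - (3 * mu * ka)).
  { destruct (mvt_between h (fun v => - det2 e (dg v)) vs (vs + ka)) as [c [Hc E]].
    { intros x Hx. apply Dh. rewrite Rmin_left, Rmax_right in Hx; lra. }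
    destruct (mvt_between h (fun v => - det2 e (dg v)) (vs - ka) vs) as [c' [Hc' E']].
    { intros x Hx. apply Dh. rewrite Rmin_left, Rmax_right in Hx; lra. }
    rewrite Rmin_left, Rmax_right in Hc, Hc' by lra. rewrite Hh0 in E, E'.
    pose proof (Hh c !!). pose proof (Hh c' !!). split; nra. }
  set (ep := Rmin (nu / 2) (mu * eta / (4 * W))).
  assert (Pep : 0 < ep). { apply Rmin_pos. lra. apply Rdiv_lt_0_compat; nra. }
  exists ep. split; auto. intros q Hq.
  assert (Lq1 : d1 q (g vs) < nu / 2) by (eapply Rlt_le_trans; [exact Hq|apply Rmin_l]).
  assert (Lq2 : d1 q (g vs) < mu * eta / (4 * W)) by (eapply Rlt_le_trans; [exact Hq|apply Rmin_r]).
  assert (Lq3 : W * d1 q (g vs) <= mu * eta / 4).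
  { apply Rle_trans with (W * (mu * eta / (4 * W))). apply Rmult_le_compat_l; lra. right; field; lra. }
  destruct (Bxi q) as [Bx Bz].
  assert (FX : forall u, - eta <= u <= eta -> forall w, Rabs w.1 + Rabs w.2 <= W -> Rabs (det2 w (X (flow X u q)) - det2 w e) <= mu).
  { intros u Hu w Hw. assert (DD : d1 (flow X u q) (g vs) <= nu).
    { eapply Rle_trans. apply (d1_tri _ q).
      pose proof (flow_time L B X HX u 0 q) as F. rewrite (flow_0 L B) in F by auto. rewrite Rminus_0_r in F.
      assert (Rabs u <= eta) by (apply Rabs_le; lra). absp u. assert (2 * B * Rabs u <= nu / 2).
      { apply Rle_trans with ((2 * B + 1) * k4). apply Rmult_le_compat; lra. unfold k4. right. field. lra. }
      lra. }
    destruct HX as [HX1 _]. destruct (HX1 (flow X u q) (g vs)) as [A1 A2]. fold e in A1, A2.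
    eapply Rle_trans. apply det2_diff_bound with (e := L * nu).
    - eapply Rle_trans. exact A1. apply Rmult_le_compat_l; auto.
    - eapply Rle_trans. exact A2. apply Rmult_le_compat_l; auto.
    - apply Rle_trans with (W * ((L + 1) * nu)).
      + apply Rmult_le_compat. absp (w.1); absp (w.2); lra.
        apply Rmult_le_pos; lra. auto. apply Rmult_le_compat_r; lra.
      + unfold nu. right. field. split; lra. }
  assert (Wa : Rabs a.1 + Rabs a.2 <= W). { unfold W. absp e.1. absp e.2. lra. }
  assert (We : Rabs e.1 + Rabs e.2 <= W). { unfold W. absp a.1. absp a.2. lra. }
  assert (Dxi : forall t, is_derive (fun t => xi (flow X t q)) t (- det2 e (X (flow X t q)))).
  { intros t. rewrite <- det2_opp. apply is_derive_det2_sub. apply (flow_sol L B); auto. }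
  assert (Dze : forall t, is_derive (fun t => ze (flow X t q)) t (det2 a (X (flow X t q)))).
  { intros t. apply is_derive_det2_sub. apply (flow_sol L B); auto. }
  assert (Bxt : forall t, - eta <= t <= eta -> Rabs (xi (flow X t q)) <= mu * eta / 4 + mu * eta).
  { intros t Ht. destruct (mvt_between (fun t => xi (flow X t q)) (fun t => - det2 e (X (flow X t q))) 0 t) as [c [Hc E]]. { intros; auto. }
    assert (Hc' : - eta <= c <= eta) by (unfold Rmin, Rmax in Hc; destruct Rle_dec; lra).
    pose proof (FX c Hc' e We) as Q. replace (det2 e e) with 0 in Q by (unfold det2; ring). rewrite Rminus_0_r in Q.
    rewrite (flow_0 L B) in E by auto.
    replace (xi (flow X t q)) with (xi q + - det2 e (X (flow X c q)) * (t - 0)) by lra.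
    eapply Rle_trans. apply Rabs_triang. apply Rplus_le_compat. lra.
    rewrite Rabs_mult, Rabs_Ropp, Rminus_0_r. apply Rmult_le_compat; auto; try apply Rabs_pos. apply Rabs_le; lra. }
  assert (INr : forall t, - eta <= t <= eta -> h (vs - ka) <= xi (flow X t q) <= h (vs + ka)).
  { intros t Ht. specialize (Bxt t Ht). absle Bxt. nra. }
  (* At time [t] the orbit is compared with the point of the arc having the same [xi]; [F] is the
     difference of their [ze], negative at [- eta] and positive at [eta]. A zero makes both
     coordinates agree. *)
  set (F := fun t => ze (flow X t q) - ze (g (k (xi (flow X (proj (- eta) eta t) q))))).
  assert (CF : forall t, continuous F t).
  { intros t. unfold F. apply continuous_minusR. { eapply is_derive_cont. apply Dze. }
    assert (CK : continuous (fun t => k (xi (flow X (proj (- eta) eta t) q))) t).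
    { apply filterlim_locally. intros eps. assert (CX : continuous (fun t => xi (flow X (proj (- eta) eta t) q)) t).
      { apply (continuous_comp (proj (- eta) eta) (fun t => xi (flow X t q))). apply proj_cont. eapply is_derive_cont. apply Dxi. }
      destruct (cont_near _ t (3 * mu * eps) CX) as [d [Pd Hd]]. { apply Rmult_lt_0_compat. lra. apply cond_pos. }
      exists (mkposreal d Pd). intros u Hu.
      unfold ball in *; simpl in *; unfold AbsRing_ball, abs, minus, plus, opp in *; simpl in *.
      specialize (Hd u Hu). assert (INu := INr _ (proj_in (- eta) eta u !!)). assert (INt := INr _ (proj_in (- eta) eta t !!)).
      pose proof (Hk2 _ _ INu INt) as Q. apply Rmult_lt_reg_l with (3 * mu). lra. unfold Rminus in *. lra. }
    assert (INt := INr _ (proj_in (- eta) eta t !!)). destruct (Hk1 _ INt) as [KI _].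
    apply (continuous_comp (fun t => k (xi (flow X (proj (- eta) eta t) q))) (fun v => ze (g v))); auto.
    eapply is_derive_cont. apply is_derive_det2_sub. apply HC. lra. }
  assert (Bzg : forall v, vs - ka <= v <= vs + ka -> Rabs (ze (g v)) <= mu * Rabs (v - vs)).
  { intros v Hv. unfold ze. rewrite det2_sub.
    destruct (mvt_between (fun u => det2 a (g u)) (fun u => det2 a (dg u)) vs v) as [c [Hc E]].
    { intros x Hx. apply is_derive_det2. apply HC. unfold Rmin, Rmax in Hx. destruct Rle_dec; lra. }
    rewrite E, Rabs_mult. apply Rmult_le_compat_r. apply Rabs_pos.
    assert (Q := K1 c). cbv beta in Q. fold a in Q. replace (det2 a a) with 0 in Q by (unfold det2; ring). rewrite Rminus_0_r in Q.
    left. apply Q. unfold Rmin, Rmax in Hc. apply Rabs_def1; destruct Rle_dec; lra. }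
  assert (Bvk : forall t, - eta <= t <= eta -> Rabs (ze (g (k (xi (flow X t q))))) <= (mu * eta / 4 + mu * eta) / 3).
  { intros t Ht. pose proof (INr t Ht) as I. destruct (Hk1 _ I) as [KI KE]. eapply Rle_trans. apply Bzg; auto.
    destruct (mvt_between h (fun v => - det2 e (dg v)) vs (k (xi (flow X t q)))) as [c [Hc E]].
    { intros x Hx. apply Dh. unfold Rmin, Rmax in Hx. destruct Rle_dec; lra. }
    rewrite Hh0, KE, Rminus_0_r in E. pose proof (Bxt t Ht) as Q. rewrite E, Rabs_mult in Q.
    assert (3 * mu <= Rabs (- det2 e (dg c))).
    { eapply Rle_trans; [|apply Rle_abs]. apply Hh. unfold Rmin, Rmax in Hc. destruct Rle_dec; lra. }
    absp ((k (xi (flow X t q)) - vs)). nra. }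
  assert (Bzt : 3 * mu * eta - mu * eta / 4 <= ze (flow X eta q) /\ ze (flow X (- eta) q) <= - (3 * mu * eta) + mu * eta / 4).
  { absle Bz.
    destruct (mvt_between (fun t => ze (flow X t q)) (fun t => det2 a (X (flow X t q))) 0 eta) as [c [Hc E]]. { intros; auto. }
    destruct (mvt_between (fun t => ze (flow X t q)) (fun t => det2 a (X (flow X t q))) (- eta) 0) as [c' [Hc' E']]. { intros; auto. }
    rewrite Rmin_left, Rmax_right in Hc, Hc' by lra. rewrite (flow_0 L B) in E, E' by auto.
    pose proof (FX c !! a Wa) as Q. pose proof (FX c' !! a Wa) as Q'. fold D in Q, Q'.
    absle Q. absle Q'. unfold mu in *. split; nra. }
  destruct (ivt_incr F (- eta) eta 0) as [t [Ht Et]]; auto; try lra.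
  { unfold F. rewrite !proj_id by lra. pose proof (Bvk eta !!) as Q. pose proof (Bvk (- eta) !!) as Q'.
    absle Q. absle Q'. split; nra. }
  unfold F in Et. rewrite proj_id in Et by lra. pose proof (INr t Ht) as I. destruct (Hk1 _ I) as [KI KE].
  exists (k (xi (flow X t q))), t. split; [apply Rabs_def1; lra|]. split; [apply Rabs_def1; lra|].
  set (v := k (xi (flow X t q))) in *. unfold h, xi in KE. unfold ze in Et. rewrite !det2_opp, !det2_sub in *.
  assert (E1 : det2 e (flow X t q) = det2 e (g v)) by lra. assert (E2 : det2 a (flow X t q) = det2 a (g v)) by lra.
  clear - E1 E2 HD. unfold D, det2 in *. destruct (flow X t q) as [x y], (g v) as [x' y'], a as [a1 a2], e as [e1 e2]; simpl in *.
  f_equal; apply Rmult_eq_reg_r with (a1 * e2 - a2 * e1); try lra.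
  - transitivity (e1 * (a1 * y - a2 * x) - a1 * (e1 * y - e2 * x)); [ring|]. rewrite E1, E2. ring.
  - transitivity (e2 * (a1 * y - a2 * x) - a2 * (e1 * y - e2 * x)); [ring|]. rewrite E1, E2. ring.
Qed.

Lemma flow_box_onto L B X (g dg : R -> R * R) (r0 vs : R) :
  glip L B X -> 0 < r0 -> C1on (vs - r0) (vs + r0) g dg -> det2 (dg vs) (X (g vs)) <> 0 ->
  exists e, 0 < e /\ forall q, d1 q (g vs) < e ->
    exists v tau, Rabs (v - vs) < r0 /\ Rabs tau < r0 /\ flow X tau q = g v.
Proof.
  intros HX Hr HC HD. destruct (Rlt_le_dec 0 (det2 (dg vs) (X (g vs)))).
  - apply (flow_box_onto_pos L B X g dg); auto.
  - destruct (flow_box_onto_pos L B (field_opp X) g dg r0 vs) as [e [Pe He]]; auto.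
    + apply glip_opp; auto.
    + replace (det2 (dg vs) (field_opp X (g vs))) with (- det2 (dg vs) (X (g vs))) by (unfold det2, field_opp; simpl; ring). lra.
    + exists e. split; auto. intros q Hq. destruct (He q Hq) as [v [tau [H1 [H2 H3]]]].
      exists v, (- tau). rewrite Rabs_Ropp. rewrite (flow_opp L B) in H3; auto.
Qed.

Lemma enorm_polar rho th : 0 < rho -> enorm (rho * cos th, rho * sin th) = rho.
Proof.
  intros H. unfold enorm; simpl fst; simpl snd.
  replace ((rho * cos th) ^ 2 + (rho * sin th) ^ 2) with (rho ^ 2 * (Rsqr (sin th) + Rsqr (cos th))) by (unfold Rsqr; ring).
  rewrite sin2_cos2, Rmult_1_r. apply sqrt_pow2. lra.
Qed.

(** * Centers from closed orbits *)

Lemma convex_range (a b m t : R) : 0 < a < m -> 0 < b < m -> 0 <= t <= 1 -> 0 < (1 - t) * a + t * b < m.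
Proof.
  intros Ha Hb Ht. destruct (Req_dec t 1) as [->|H]. lra.
  assert (0 <= t * b) by (apply Rmult_le_pos; lra). assert (0 < (1 - t) * a) by (apply Rmult_lt_0_compat; lra).
  assert (0 <= t * (m - b)) by (apply Rmult_le_pos; lra). assert (0 < (1 - t) * (m - a)) by (apply Rmult_lt_0_compat; lra). lra.
Qed.

(** A path that is linear in polar coordinates joins the two points; its radius stays positive and
    below [m]. *)
Lemma punctured_ball_connected (U : R * R -> Prop) (m : R) :
  (forall p, 0 < enorm p < m -> exists e, 0 < e /\ forall q, d1 q p < e -> (U q <-> U p)) ->
  forall p q, 0 < enorm p < m -> 0 < enorm q < m -> U p -> U q.
Proof.
  intros HU p q Hp Hq Up. assert (NE : forall z, 0 < enorm z -> z <> origin).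
  { intros z Hz E. rewrite E, enorm_origin in Hz. lra. }
  destruct (polar_exists' p) as [th1 H1]. { apply NE; lra. }
  destruct (polar_exists' q) as [th2 H2]. { apply NE; lra. }
  set (rho := fun t => (1 - t) * enorm p + t * enorm q). set (th := fun t => (1 - t) * th1 + t * th2).
  set (ga := fun t => (rho t * cos (th t), rho t * sin (th t))).
  assert (G0 : ga 0 = p). { unfold ga, rho, th. rewrite H1 at 3. f_equal; f_equal; try f_equal; ring. }
  assert (G1 : ga 1 = q). { unfold ga, rho, th. rewrite H2 at 3. f_equal; f_equal; try f_equal; ring. }
  assert (Gn : forall t, 0 <= t <= 1 -> 0 < enorm (ga t) < m).
  { intros t Ht. assert (0 < rho t < m) by (apply convex_range; auto). unfold ga. rewrite enorm_polar; lra. }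
  assert (Cr : forall t, continuous rho t) by (intros; apply (ex_derive_continuous rho); unfold rho; auto_derive; auto).
  assert (Ct : forall t, continuous th t) by (intros; apply (ex_derive_continuous th); unfold th; auto_derive; auto).
  assert (GD : forall t e, 0 < e -> exists d, 0 < d /\ forall u, Rabs (u - t) < d -> d1 (ga u) (ga t) < e).
  { intros t e He. destruct (cont_near (fun t => rho t * cos (th t)) t (e / 2)) as [d [Pd Hd]]; [|lra|].
    { apply continuous_multR; auto. apply (continuous_comp th cos); auto. apply continuous_cos. }
    destruct (cont_near (fun t => rho t * sin (th t)) t (e / 2)) as [d' [Pd' Hd']]; [|lra|].
    { apply continuous_multR; auto. apply (continuous_comp th sin); auto. apply continuous_sin. }
    exists (Rmin d d'). split. apply Rmin_pos; auto. intros u Hu. mins (Rmin d d').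
    specialize (Hd u !!). specialize (Hd' u !!). unfold d1, ga; simpl. lra. }
  assert (E : U (ga 0) <-> U (ga 1)).
  { apply (segment_induction (fun x y => U (ga x) <-> U (ga y)) 0 1); try lra.
    - intros; tauto.
    - intros t Ht. destruct (HU (ga t) (Gn t Ht)) as [e [Pe He]]. destruct (GD t e Pe) as [d [Pd Hd]].
      exists d. split; auto. intros y z Hy1 Hy2 Hz1 Hz2 Hy Hz.
      rewrite (He (ga y)), (He (ga z)); [tauto| |]; apply Hd; apply Rabs_def1; lra. }
  rewrite G0, G1 in E. tauto.
Qed.

Lemma sq_shift_bound (u w : R) : w ^ 2 <= u ^ 2 + 2 * Rabs u * Rabs (u - w) + (Rabs (u - w)) ^ 2.
Proof.
  rewrite <- (pow2_abs w), <- (pow2_abs u). assert (H : Rabs w <= Rabs u + Rabs (u - w)).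
  { replace w with (u + - (u - w)) at 1 by ring. eapply Rle_trans. apply Rabs_triang. rewrite Rabs_Ropp. lra. }
  absp w. generalize dependent (Rabs w). generalize (Rabs u) (Rabs (u - w)). intros; nra.
Qed.

Lemma sqrt_small_coord (p : R * R) : Rabs p.1 <= enorm p /\ Rabs p.2 <= enorm p.
Proof.
  unfold enorm. split; rewrite <- sqrt_Rsqr_abs; apply sqrt_le_1_alt; unfold Rsqr; nra.
Qed.

Lemma enorm_d1_tri (a b : R * R) : enorm a <= enorm b + d1 b a.
Proof.
  pose proof (d1_pos b a) as Pd. pose proof (sqrt_small_coord b) as A.
  assert (N : enorm b ^ 2 = b.1 ^ 2 + b.2 ^ 2).
  { unfold enorm. apply pow2_sqrt. pose proof (pow2_ge_0 b.1); pose proof (pow2_ge_0 b.2); lra. }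
  assert (P : 0 <= enorm b) by (unfold enorm; apply sqrt_pos).
  rewrite <- (sqrt_pow2 (enorm b + d1 b a)) by lra. unfold enorm at 1. apply sqrt_le_1_alt.
  pose proof (sq_shift_bound b.1 a.1). pose proof (sq_shift_bound b.2 a.2).
  unfold d1 in *. absp (b.1 - a.1). absp (b.2 - a.2). absp b.1. absp b.2.
  replace ((enorm b + (Rabs (b.1 - a.1) + Rabs (b.2 - a.2))) ^ 2) with
    (enorm b ^ 2 + 2 * enorm b * (Rabs (b.1 - a.1) + Rabs (b.2 - a.2)) + (Rabs (b.1 - a.1) + Rabs (b.2 - a.2)) ^ 2) by ring.
  rewrite N. destruct A as [A1 A2].
  assert (2 * Rabs b.1 * Rabs (b.1 - a.1) <= 2 * enorm b * Rabs (b.1 - a.1)) by (apply Rmult_le_compat_r; lra).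
  assert (2 * Rabs b.2 * Rabs (b.2 - a.2) <= 2 * enorm b * Rabs (b.2 - a.2)) by (apply Rmult_le_compat_r; lra).
  assert (0 <= Rabs (b.1 - a.1) * Rabs (b.2 - a.2)) by (apply Rmult_le_pos; auto).
  replace ((Rabs (b.1 - a.1) + Rabs (b.2 - a.2)) ^ 2) with (Rabs (b.1 - a.1) ^ 2 + Rabs (b.2 - a.2) ^ 2 + 2 * (Rabs (b.1 - a.1) * Rabs (b.2 - a.2))) by ring.
  lra.
Qed.

(* The orbits through the arc form a relatively open and closed subset of a punctured disc. *)
Lemma center_of_closed_orbits L B X Y (g dg : R -> R * R) (rho0 : R) :
  glip L B Y -> X origin = origin -> 0 < rho0 -> g 0 = origin ->
  C1on 0 rho0 g dg -> (forall s, 0 < s <= rho0 -> det2 (dg s) (Y (g s)) <> 0) ->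
  (forall s t, 0 < s < rho0 -> closed_orbit_around_origin X (flow Y t (g s)) /\ flow Y t (g s) <> origin) ->
  (forall d, 0 < d -> exists r, 0 < r /\ forall s t, 0 < s < r -> s < rho0 -> enorm (flow Y t (g s)) < d) ->
  (forall s0, 0 < s0 < rho0 -> exists k M, 0 < k /\ 0 <= M /\ forall s, Rabs (s - s0) < k -> 0 < s < rho0 ->
     forall t, exists t', 0 <= t' <= M /\ flow Y t (g s) = flow Y t' (g s)) ->
  is_center X.
Proof.
  intros HY HX0 Hr Hg0 HC Htr Hcl Hsh Hper. set (s1 := rho0 / 2). assert (Hs1 : 0 < s1 < rho0) by (unfold s1; lra).
  assert (OC : forall s t, continuous (fun u => (flow Y u (g s)).1) t /\ continuous (fun u => (flow Y u (g s)).2) t).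
  { intros s t. destruct (flow_sol L B Y (g s) t HY). split; eapply is_derive_cont; eauto. }
  (* The orbit through [g s1] is compact and misses the origin. Its distance from the origin is the
     radius of the disc that the inner orbits will be shown to fill. *)
  assert (exists m, 0 < m /\ forall t, m <= enorm (flow Y t (g s1))) as [m [Pm Hm]].
  { destruct (Hper s1 Hs1) as [k [M [Pk [PM HM]]]].
    destruct (avoids_dist 0 M (fun t => flow Y t (g s1)) origin PM) as [m [Pm Hm]].
    - intros; apply OC.
    - intros t _. apply Hcl; auto.
    - exists (m / 2). split. lra. intros t. destruct (HM s1 ltac:(rewrite Rminus_diag, Rabs_R0; auto) Hs1 t) as [t' [Ht' E]].
      rewrite E. specialize (Hm t' Ht'). destruct (enorm_d1 (flow Y t' (g s1))). lra. }
  set (U := fun p => exists s t, 0 < s < s1 /\ p = flow Y t (g s)).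
  assert (LOC : forall p, 0 < enorm p < m -> exists e, 0 < e /\ forall q, d1 q p < e -> (U q <-> U p)).
  { intros p Hp. destruct (classic (U p)) as [Up|Np].
    - destruct Up as [s [t [Hs E]]]. set (r0 := Rmin s (s1 - s) / 2).
      assert (Pr0 : 0 < r0). { unfold r0. assert (0 < Rmin s (s1 - s)) by (apply Rmin_pos; lra). lra. }
      assert (L1 : r0 < s /\ r0 < s1 - s). { unfold r0 in *. mins (Rmin s (s1 - s)). lra. }
      destruct (flow_box_onto L B Y g dg r0 s HY Pr0) as [e [Pe He]].
      + apply (C1on_sub 0 rho0); auto; lra.
      + apply Htr; lra.
      + destruct (flow_const L B Y HY (- t)) as [K [PK HK]]. exists (e / K). split. { apply Rdiv_lt_0_compat; auto. }
        intros q Hq. split. { intros _. exists s, t. auto. } intros _.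
        (* Openness: the point is flowed back to the arc, where the flow box brings every nearby
           point onto a nearby parameter. *)
        destruct (He (flow Y (- t) q)) as [v [tau [Hv [Htau Ev]]]].
        { replace (g s) with (flow Y (- t) p) by (rewrite E; apply (flow_inv L B); auto).
          eapply Rle_lt_trans; [apply HK|].
          apply Rlt_le_trans with (K * (e / K)); [apply Rmult_lt_compat_l; auto|right; field; lra]. }
        exists v, (t - tau). split. { apply Rabs_def2 in Hv; lra. }
        rewrite <- Ev, <- (flow_plus L B Y HY tau (- t) q), <- (flow_plus L B Y HY (t - tau) (tau + - t) q).
        replace (t - tau + (tau + - t)) with 0 by ring. rewrite (flow_0 L B) by auto. reflexivity.
    (* Closedness: orbits with small [s] are nearer to the origin than [p]. For the other parameters
       periods are locally bounded, so each orbit has a positive distance from [p], locally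
       uniformly in [s]; the boundary orbit [s1] is excluded because [p] lies in the disc of radius
       [m]. *)
    - assert (exists e, 0 < e /\ forall s t, 0 < s < s1 -> e <= d1 (flow Y t (g s)) p) as [e [Pe He]].
      { destruct (Hsh (enorm p / 2)) as [r [Pr Hr']]. lra. set (r' := Rmin r s1 / 2).
        assert (Pr' : 0 < r'). { unfold r'. assert (0 < Rmin r s1) by (apply Rmin_pos; lra). lra. }
        assert (L1 : r' < r /\ r' < s1). { unfold r' in *. mins (Rmin r s1). lra. }
        destruct (unif_pos (fun s e => forall t, e <= d1 (flow Y t (g s)) p) r' s1) as [e [Pe He]]; try lra.
        - intros v e e' Hv Hee t. specialize (Hv t). lra.
        - intros s Hs. destruct (Hper s !!) as [k [M [Pk [PM HM]]]].
          destruct (avoids_dist 0 M (fun t => flow Y t (g s)) p PM) as [m' [Pm' Hm']].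
          { intros; apply OC. }
          { intros t _ E. destruct (Req_dec s s1) as [->|Hne].
            - specialize (Hm t). rewrite E in Hm. lra.
            - apply Np. exists s, t. split; auto. lra. }
          set (K := 2 * exp (2 * L * M)). assert (PK : 0 < K) by (unfold K; pose proof (exp_pos (2 * L * M)); lra).
          destruct (arc_d1_near g (dg s) s (m' / (2 * K))) as [d [Pd Hd]]. { apply HC; lra. } { apply Rdiv_lt_0_compat; lra. }
          exists (Rmin (m' / 2) (Rmin k d)). split. { repeat apply Rmin_pos; auto; lra. }
          intros y Hy Hys t. mins (Rmin (m' / 2) (Rmin k d)). destruct (HM y !! !! t) as [t' [Ht' E]]. rewrite E.
          specialize (Hm' t' Ht'). assert (d1 (flow Y t' (g y)) (flow Y t' (g s)) <= m' / 2).
          { eapply Rle_trans. apply (flow_d1 L B); auto. specialize (Hd y !!).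
            apply Rle_trans with (K * (m' / (2 * K))).
            - apply Rmult_le_compat; try lra. pose proof (exp_pos (2 * L * Rabs t')); lra. apply d1_pos.
              unfold K. apply Rmult_le_compat_l. lra. rewrite Rabs_pos_eq by lra. pose proof (glip_L _ _ _ HY) as HL.
              destruct (Rle_lt_or_eq_dec (2 * L * t') (2 * L * M)) as [Q|Q]. { apply Rmult_le_compat_l; lra. }
              left. apply exp_increasing; auto. rewrite Q. lra.
            - right. field. lra. }
          pose proof (d1_tri (flow Y t' (g s)) (flow Y t' (g y)) p). rewrite (d1_sym (flow Y t' (g s)) (flow Y t' (g y))) in H4. lra.
        - exists (Rmin e (enorm p / 2)). split. { apply Rmin_pos; lra. }
          intros s t Hs. destruct (Rlt_le_dec s r') as [Q|Q].
          + eapply Rle_trans. apply Rmin_r. specialize (Hr' s t !! !!). destruct (enorm_d1 p) as [A1 A2].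
            assert (enorm p <= enorm (flow Y t (g s)) + d1 (flow Y t (g s)) p).
            { apply enorm_d1_tri. }
            lra.
          + eapply Rle_trans. apply Rmin_l. apply He. lra. }
      exists e. split; auto. intros q Hq. split; [|tauto]. intros [s [t [Hs E]]]. exfalso.
      specialize (He s t Hs). rewrite <- E in He. lra. }
  split; auto. exists m. split; auto. intros p Hp. assert (Up : U p).
  { destruct (Hsh m Pm) as [r [Pr Hr']]. set (s := Rmin r s1 / 2).
    assert (Ps : 0 < s). { unfold s. assert (0 < Rmin r s1) by (apply Rmin_pos; lra). lra. }
    assert (L1 : s < r /\ s < s1). { unfold s in *. mins (Rmin r s1). lra. }
    apply (punctured_ball_connected U m LOC (flow Y 0 (g s)) p); auto.
    - split. apply enorm_pos. apply Hcl; lra. apply Hr'; lra.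
    - exists s, 0. split; auto. lra. }
  destruct Up as [s [t [Hs E]]]. rewrite E. apply Hcl. lra.
Qed.

(** * Periodic orbits of a global flow *)

Section Periodic.
Variables (L B : R) (Y : R * R -> R * R).
Hypothesis HY : glip L B Y.

Lemma flow_period T p t : flow Y T p = p -> flow Y (t + T) p = flow Y t p.
Proof. intros H. rewrite (flow_plus L B) by auto. rewrite H. auto. Qed.

Lemma flow_period_shift T p t : flow Y T p = p -> flow Y T (flow Y t p) = flow Y t p.
Proof. intros H. rewrite <- (flow_plus L B) by auto. rewrite Rplus_comm. apply flow_period; auto. Qed.

Lemma flow_period_Z T p (n : Z) t : flow Y T p = p -> flow Y (t + IZR n * T) p = flow Y t p.
Proof.
  intros H. assert (N : forall (m : nat) t, flow Y (t + INR m * T) p = flow Y t p).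
  { induction m; intros u.
    - simpl. rewrite Rmult_0_l, Rplus_0_r. auto.
    - rewrite S_INR. replace (u + (INR m + 1) * T) with ((u + INR m * T) + T) by ring. rewrite flow_period; auto. }
  destruct (Z_le_gt_dec 0 n).
  - rewrite <- (Z2Nat.id n) by auto. rewrite <- INR_IZR_INZ. apply N.
  - rewrite <- (N (Z.to_nat (- n)) (t + IZR n * T)). f_equal. rewrite INR_IZR_INZ, Z2Nat.id by lia. rewrite opp_IZR. ring.
Qed.

Lemma flow_mod T p t : 0 < T -> flow Y T p = p -> exists t', 0 <= t' <= T /\ flow Y t p = flow Y t' p.
Proof.
  intros HT H. exists (t + IZR (- Int_part (t / T)) * T). split.
  - destruct (base_Int_part (t / T)) as [A1 A2]. rewrite opp_IZR.
    assert (E : t = T * (t / T)) by (field; lra). set (y := t / T) in *. set (n := IZR (Int_part y)) in *. rewrite E. split; nra.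
  - symmetry. apply flow_period_Z; auto.
Qed.

Lemma polar_psub c th : polar (psub c origin) th <-> polar c th.
Proof. unfold polar, psub, origin; simpl. rewrite !Rminus_0_r. destruct c; simpl. tauto. Qed.

Lemma global_lift p a b th0 : a <= b -> (forall t, a <= t <= b -> flow Y t p <> origin) -> polar (flow Y a p) th0 ->
  exists th, (forall t, continuous th t) /\ th a = th0 /\ (forall t, a <= t <= b -> polar (flow Y t p) (th t)).
Proof.
  intros Hab Hn Hp.
  destruct (var_lift a b (fun t => flow Y t p) (fun t => Y (flow Y t p)) origin th0 Hab) as [th [C1 [C2 [C3 C4]]]].
  - apply (flow_C1on L B); auto.
  - exact Hn.
  - apply polar_psub. auto.
  - exists th. split; auto. split; auto. intros t Ht. apply polar_psub. auto.
Qed.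

(** The increment of a lifted angle over one period does not depend on the starting time, so one
    point with winding number 1 or -1 suffices for the whole orbit. *)
Lemma closed_orbit_flow X T p th : 0 < T -> flow Y T p = p -> (forall t, X (flow Y t p) = Y (flow Y t p)) ->
  angle_along (fun t => 0 <= t <= T) (fun t => flow Y t p) th -> Rabs (th T - th 0) = 2 * PI ->
  forall t0, closed_orbit_around_origin X (flow Y t0 p) /\ flow Y t0 p <> origin.
Proof.
  intros HT HP HXY Hth Hw t0. assert (NO : forall t, flow Y t p <> origin).
  { intros t. destruct (flow_mod T p t HT HP) as [t' [Ht' E]]. rewrite E. apply (Hth t' Ht'). }
  split; auto. set (a := Rmin 0 t0). set (b := Rmax 0 t0 + T).
  assert (Lab : a <= 0 /\ a <= t0 /\ 0 <= b - T /\ t0 <= b - T).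
  { unfold a, b. mins (Rmin 0 t0). pose proof (Rmax_l 0 t0). pose proof (Rmax_r 0 t0). lra. }
  destruct (polar_exists' _ (NO a)) as [tha Ha].
  destruct (global_lift p a b tha !! (fun t _ => NO t) Ha) as [ps [C1 [C2 C3]]].
  assert (E1 : ps T - th T = ps 0 - th 0).
  { apply (lifts_differ_const ps th 0 T); try lra; auto.
    - intros t Ht. apply (Hth t Ht).
    - intros t Ht. apply polar_unique with (flow Y t p); auto. apply C3; lra. apply (Hth t Ht). }
  assert (E2 : ps (t0 + T) - ps t0 = ps (0 + T) - ps 0).
  { destruct (Rle_dec 0 t0).
    - apply (lifts_differ_const (fun t => ps (t + T)) ps 0 t0); auto.
      + intros t Ht. apply (continuous_comp (fun t => t + T) ps); auto. apply (ex_derive_continuous (fun t => t + T)). auto_derive; auto.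
      + intros t Ht. apply polar_unique with (flow Y t p); auto. rewrite <- (flow_period T) by auto. apply C3; lra. apply C3; lra.
    - symmetry. apply (lifts_differ_const (fun t => ps (t + T)) ps t0 0); auto. lra.
      + intros t Ht. apply (continuous_comp (fun t => t + T) ps); auto. apply (ex_derive_continuous (fun t => t + T)). auto_derive; auto.
      + intros t Ht. apply polar_unique with (flow Y t p); auto. rewrite <- (flow_period T) by auto. apply C3; lra. apply C3; lra. }
  exists (fun t => flow Y (t + t0) p), T. split; auto. split; [|split; [|split]].
  - intros t _. rewrite HXY. apply (has_velocity_shift (fun t => flow Y t p)). apply (flow_sol L B); auto.
  - rewrite Rplus_0_l; auto.
  - intros t. replace (t + T + t0) with (t + t0 + T) by ring. apply flow_period; auto.
  - exists (fun t => ps (t + t0)). split.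
    + intros t Ht. split; auto. split.
      * apply (continuous_comp (fun t => t + t0) ps); auto. apply (ex_derive_continuous (fun t => t + t0)). auto_derive; auto.
      * apply C3. lra.
    + rewrite <- Hw. f_equal. rewrite Rplus_0_l. replace (T + t0) with (t0 + T) by ring. rewrite E2, Rplus_0_l. lra.
Qed.
End Periodic.

Lemma inbox_enorm p : enorm p <= 1 -> inbox 2 p.
Proof. intros H. apply inbox_d1. destruct (enorm_d1 p). lra. Qed.

Lemma solution_is_flow L B X c T : glip L B (clipped 2 X) -> 0 <= T -> solution_on X (fun t => 0 <= t <= T) c ->
  (forall t, 0 <= t <= T -> enorm (c t) <= 1) -> forall t, 0 <= t <= T -> c t = flow (clipped 2 X) t (c 0).
Proof.
  intros HG HT Hc Hb t Ht. replace t with (t - 0) at 2 by ring.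
  apply (flow_unique L B (clipped 2 X) HG c 0 T 0); auto; try lra.
  apply solution_clipped; auto. intros u Hu. apply inbox_enorm; auto.
Qed.

Lemma arc_C1on (g dg : R -> R * R) r a b :
  (forall s, - r < s < r -> has_velocity g s (dg s) /\ continuous (fun u => (dg u).1) s /\ continuous (fun u => (dg u).2) s /\ dg s <> origin) ->
  0 <= a -> b < r -> C1on a b g dg.
Proof. intros H Ha Hb t Ht. destruct (H t !!) as [A1 [A2 [A3 A4]]]. auto. Qed.

(** The derivative of [H] along the arc is up to sign the determinant of its tangent with the field,
    which never vanishes inside the arc; so [H] is injective there. Being constant on orbits, it
    makes every first return come back to its starting point. *)
Lemma hamiltonian_center X (H : R * R -> R) : loc_lip X ->
  (forall c t w, has_velocity c t w -> is_derive (fun u => H (c u)) t (det2 (X (c t)) w)) ->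
  monodromic X -> is_center X.
Proof.
  intros HX HH [HX0 [g [r [phi [HG [Hphi Hret]]]]]]. pose proof HG as [Hr [Hg0 [Hinj [dg [Hdg Htr]]]]].
  destruct (clipped_glip 2 X !! HX) as [L [B HY]]. set (Y := clipped 2 X) in *.
  destruct (Hret 1 !!) as [rho [Hrho Hret1]].
  assert (Hinc : forall s s', 0 < s < r -> 0 < s' < r -> H (g s) = H (g s') -> s = s').
  { assert (G : forall s s', 0 < s -> s < s' -> s' < r -> H (g s) <> H (g s')).
    { intros s s' H1 H2 H3 E.
      destruct (MVT_gen (fun u => H (g u)) s s' (fun u => det2 (X (g u)) (dg u))) as [c [Hc Ec]].
      - intros x Hx. rewrite Rmin_left, Rmax_right in Hx by lra. apply HH. apply Hdg. lra.
      - intros x Hx. rewrite Rmin_left, Rmax_right in Hx by lra. apply cont_pt. eapply is_derive_cont. apply HH. apply Hdg. lra.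
      - rewrite Rmin_left, Rmax_right in Hc by lra. rewrite E, Rminus_diag in Ec.
        apply (Htr c). lra. replace (det2 (dg c) (X (g c))) with (- det2 (X (g c)) (dg c)) by (unfold det2; ring).
        assert (det2 (X (g c)) (dg c) = 0); [|lra]. apply Rmult_eq_reg_r with (s' - s); lra. }
    intros s s' H1 H2 E. destruct (Rtotal_order s s') as [Q|[Q|Q]]; auto; exfalso.
      apply (G s s'); auto; lra. apply (G s' s); auto; lra. }
  assert (Hconst : forall c T, 0 <= T -> solution_on X (fun t => 0 <= t <= T) c -> H (c 0) = H (c T)).
  { intros c T HT Hc. apply (is_derive_const_eq (fun t => H (c t)) 0 T); auto. intros t Ht.
    replace 0 with (det2 (X (c t)) (X (c t))) by (unfold det2; ring). apply HH. apply Hc; auto. }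
  assert (RET : forall d, 0 < d -> exists rho', 0 < rho' /\ rho' < r /\ forall s, 0 < s < rho' -> exists T th,
     0 < T /\ flow Y T (g s) = g s /\ angle_along (fun t => 0 <= t <= T) (fun t => flow Y t (g s)) th /\ Rabs (th T - th 0) = 2 * PI /\
     forall t, enorm (flow Y t (g s)) < Rmin d 1).
  { intros d Hd. destruct (Hret (Rmin d 1)) as [rho' [Hrho' Hr']]. { apply Rmin_pos; lra. }
    exists (rho' / 2). split; [lra|]. split; [lra|]. intros s Hs.
    destruct (Hr' s !!) as [s' [T [c [[HT [Hc [Hc0 [Hs' [HcT [Hf [th [Hth [Hth0 Hw]]]]]]]]] Hsm]]]].
    assert (Es : s = s'). { apply Hinc; auto; try lra. rewrite <- Hc0, <- HcT. apply Hconst; auto. lra. }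
    subst s'. assert (EF : forall t, 0 <= t <= T -> c t = flow Y t (g s)).
    { rewrite <- Hc0. apply (solution_is_flow L B X c T HY); auto. lra. intros t Ht. specialize (Hsm t Ht).
      left. eapply Rlt_le_trans. exact Hsm. apply Rmin_r. }
    assert (PT : flow Y T (g s) = g s) by (rewrite <- EF; auto; lra).
    exists T, th. split; auto. split; auto. split; [|split].
    - intros t Ht. destruct (Hth t Ht) as [A1 [A2 A3]]. rewrite <- EF by auto. auto.
    - rewrite Hth0. auto.
    - intros t. destruct (flow_mod L B Y HY T (g s) t HT PT) as [t' [Ht' E]]. rewrite E, <- EF by auto. apply Hsm; auto. }
  destruct (RET 1 !!) as [rho1 [Hr1 [Hr1r R1]]].
  assert (EXY : forall p, enorm p < 1 -> X p = Y p). { intros p Hp. symmetry. apply clipped_in. apply inbox_enorm. lra. }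
  assert (S1 : forall s t, 0 < s < rho1 -> enorm (flow Y t (g s)) < 1).
  { intros s t Hs. destruct (R1 s Hs) as [T [th [_ [_ [_ [_ Q]]]]]]. eapply Rlt_le_trans. apply Q. apply Rmin_r. }
  set (rho0 := rho1 / 2). apply (center_of_closed_orbits L B X Y g dg rho0 HY HX0); auto.
  - unfold rho0; lra.
  - apply (arc_C1on g dg r 0 rho0 Hdg); unfold rho0; lra.
  - intros s Hs. rewrite <- EXY. apply Htr. unfold rho0 in *; lra.
    rewrite <- (flow_0 L B Y (g s) HY). apply S1. unfold rho0 in *; lra.
  - intros s t Hs. destruct (R1 s ltac:(unfold rho0 in *; lra)) as [T [th [A1 [A2 [A3 [A4 A5]]]]]].
    apply (closed_orbit_flow L B Y HY X T (g s) th); auto. intros u. apply EXY. apply S1. unfold rho0 in *; lra.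
  - intros d Hd. destruct (RET d Hd) as [rho' [Hp [Hr' R']]]. exists rho'. split; auto. intros s t Hs _.
    destruct (R' s Hs) as [T [th [_ [_ [_ [_ Q]]]]]]. eapply Rlt_le_trans. apply Q. apply Rmin_l.
  - intros s0 Hs0. unfold rho0 in Hs0. destruct (R1 s0 !!) as [T [th [A1 [A2 [A3 [A4 A5]]]]]].
    (* Local bound on the periods: at time [T] a nearby orbit is close to [g s0], hence within time
       [r0] of the arc, and by injectivity of [H] it meets the arc at its own starting point. *)
    set (r0 := Rmin (Rmin 1 T) (Rmin s0 (rho1 - s0)) / 2).
    assert (Pr0 : 0 < r0). { unfold r0. assert (0 < Rmin (Rmin 1 T) (Rmin s0 (rho1 - s0))) by (repeat apply Rmin_pos; lra). lra. }
    assert (L0 : r0 <= 1/2 /\ r0 < T /\ r0 < s0 /\ r0 < rho1 - s0).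
    { unfold r0 in *. mins (Rmin (Rmin 1 T) (Rmin s0 (rho1 - s0))). lra. }
    destruct (flow_box_onto L B Y g dg r0 s0 HY Pr0) as [e [Pe He]].
    { apply (arc_C1on g dg r (s0 - r0) (s0 + r0) Hdg); lra. }
    { rewrite <- EXY. apply Htr; lra. rewrite <- (flow_0 L B Y (g s0) HY). apply S1. lra. }
    destruct (flow_const L B Y HY T) as [K [PK HK]].
    destruct (arc_d1_near g (dg s0) s0 (e / K)) as [k [Pk Hk]]. { apply Hdg; lra. } { apply Rdiv_lt_0_compat; auto. }
    exists k, (T + 1). split; auto. split; [lra|]. intros s Hs Hs2 t. unfold rho0 in Hs2.
    destruct (He (flow Y T (g s))) as [v [tau [V1 [V2 V3]]]].
    { rewrite <- A2. eapply Rle_lt_trans. apply HK. apply Rlt_le_trans with (K * (e / K)). apply Rmult_lt_compat_l; auto. right; field; lra. }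
    apply Rabs_def2 in V1. apply Rabs_def2 in V2. assert (PP : flow Y (tau + T) (g s) = g s).
      { rewrite (flow_plus L B) by auto. rewrite V3. f_equal. symmetry. apply Hinc; try lra.
        rewrite <- V3, <- (flow_plus L B) by auto. assert (HF : forall u, 0 <= u -> H (g s) = H (flow Y u (g s))).
        { intros u Hu. rewrite <- (flow_0 L B Y (g s) HY) at 1. apply (Hconst (fun u => flow Y u (g s)) u Hu).
          intros w _. rewrite EXY. apply (flow_sol L B); auto. apply S1; lra. }
        apply HF. lra. }
    destruct (flow_mod L B Y HY (tau + T) (g s) t !! PP) as [t' [Ht' E]]. exists t'. split; auto. lra.
Qed.

(** * Reversible systems *)

Lemma neg_derive_local (f : R -> R) (x l : R) : is_derive f x l -> l < 0 ->
  exists d, 0 < d /\ (forall z, x < z < x + d -> f z < f x) /\ (forall y, x - d < y < x -> f x < f y).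
Proof.
  intros H Hl. apply is_derive_Reals in H. destruct (H (- l) !!) as [d Hd]. exists d. split. apply cond_pos.
  assert (G : forall h, h <> 0 -> Rabs h < d -> (f (x + h) - f x) / h < 0).
  { intros h H1 H2. specialize (Hd h H1 H2). apply Rabs_def2 in Hd. lra. }
  split.
  - intros z Hz. specialize (G (z - x) !! ltac:(rewrite Rabs_pos_eq; lra)). replace (x + (z - x)) with z in G by ring.
    assert (f z - f x < 0); [|lra]. replace (f z - f x) with ((f z - f x) / (z - x) * (z - x)) by (field; lra). nra.
  - intros y Hy. specialize (G (y - x) !! ltac:(rewrite Rabs_left; lra)). replace (x + (y - x)) with y in G by ring.
    assert (0 < f y - f x); [|lra]. replace (f y - f x) with ((f y - f x) / (y - x) * (y - x)) by (field; lra). nra.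
Qed.

(** A level at which the derivative is always negative can be crossed only downwards, so a value at
    or below it is followed by values strictly below. *)
Lemma down_crossing (f df : R -> R) (a b v : R) : a <= b -> (forall t, a <= t <= b -> is_derive f t (df t)) ->
  (forall t, a <= t <= b -> f t = v -> df t < 0) ->
  forall t1 t2, a <= t1 -> t1 < t2 -> t2 <= b -> f t1 <= v -> f t2 < v.
Proof.
  intros Hab Hd Hv t1 t2 H1 H12 H2 Hf. enough (G : f t1 <= v -> t1 < t2 -> f t2 < v) by auto.
  apply (segment_induction (fun x y => f x <= v -> x < y -> f y < v) t1 t2). lra.
  - intros x y z A1 A2 A3 A4 B1 B2 C1 C2. destruct (Req_dec x y) as [->|N]; auto.
    specialize (B1 C1 !!). destruct (Req_dec y z) as [->|N']; auto. apply B2; lra.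
  - intros x Hx. destruct (Rtotal_order (f x) v) as [Q|[Q|Q]].
    + destruct (cont_near f x (v - f x) (is_derive_cont _ _ _ (Hd x !!))) as [d [Pd Hdd]]. lra.
      exists d. split; auto. intros y z A1 A2 A3 A4 A5 A6 _ _.
      specialize (Hdd z ltac:(apply Rabs_def1; lra)). apply Rabs_def2 in Hdd. lra.
    + destruct (neg_derive_local f x (df x) (Hd x !!) (Hv x !! Q)) as [d [Pd [D1 D2]]].
      exists d. split; auto. intros y z A1 A2 A3 A4 A5 A6 B1 B2.
      destruct (Req_dec y x) as [->|N]. { rewrite <- Q. apply D1. lra. }
      specialize (D2 y !!). lra.
    + destruct (cont_near f x (f x - v) (is_derive_cont _ _ _ (Hd x !!))) as [d [Pd Hdd]]. lra.
      exists d. split; auto. intros y z A1 A2 A3 A4 A5 A6 B1 _.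
      specialize (Hdd y ltac:(apply Rabs_def1; lra)). apply Rabs_def2 in Hdd. lra.
Qed.

Lemma smooth_lift_rate L B Y p a b th0 : glip L B Y -> a <= b -> (forall t, a <= t <= b -> flow Y t p <> origin) -> polar (flow Y a p) th0 ->
  exists th dth, (forall t, continuous th t) /\ th a = th0 /\ (forall t, a <= t <= b -> polar (flow Y t p) (th t)) /\
   (forall t, a <= t <= b -> is_derive th t (dth t)) /\
   (forall t, a <= t <= b -> dth t * ((flow Y t p).1 ^ 2 + (flow Y t p).2 ^ 2) = det2 (flow Y t p) (Y (flow Y t p))).
Proof.
  intros HY Hab Hn Hp. set (x := fun t => (flow Y t p).1). set (y := fun t => (flow Y t p).2).
  set (dx := fun t => (Y (flow Y t p)).1). set (dy := fun t => (Y (flow Y t p)).2).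
  assert (Dx : forall t, a <= t <= b -> is_derive x t (dx t)) by (intros; apply (flow_sol L B); auto).
  assert (Dy : forall t, a <= t <= b -> is_derive y t (dy t)) by (intros; apply (flow_sol L B); auto).
  assert (CC : forall t, continuous dx t /\ continuous dy t).
  { intros t. destruct (flow_sol L B Y p t HY) as [A1 A2]. apply (glip_cont L B Y (fun t => flow Y t p)); auto; eapply is_derive_cont; eauto. }
  assert (NZ : forall t, a <= t <= b -> x t <> 0 \/ y t <> 0).
  { intros t Ht. destruct (Req_dec (x t) 0); auto. destruct (Req_dec (y t) 0); auto. exfalso. apply (Hn t Ht).
    unfold x, y in *. destruct (flow Y t p); simpl in *; subst; auto. }
  exists (lift x y dx dy a b th0), (fun t => rate x y dx dy (proj a b t)).
  assert (C1 : forall t, a <= t <= b -> continuous dx t) by (intros; apply CC).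
  assert (C2 : forall t, a <= t <= b -> continuous dy t) by (intros; apply CC). split; [|split; [|split; [|split]]].
  - intros t. apply lift_cont; auto.
  - apply lift_a.
  - unfold polar, enorm in Hp. fold (x a) (y a) in Hp.
    assert (E1 : x a = sqrt (x a ^ 2 + y a ^ 2) * cos th0) by (apply (f_equal fst) in Hp; exact Hp).
    assert (E2 : y a = sqrt (x a ^ 2 + y a ^ 2) * sin th0) by (apply (f_equal snd) in Hp; exact Hp).
    intros t Ht. destruct (lift_spec x y dx dy a b th0 Hab Dx Dy C1 C2 NZ E1 E2 t Ht) as [F1 F2].
    unfold polar, enorm. fold (x t) (y t). rewrite <- F1, <- F2. unfold x, y. destruct (flow Y t p); auto.
  - intros t Ht. apply lift_deriv; auto.
  - intros t Ht. rewrite proj_id by auto. unfold rate, det2. fold (x t) (y t) (dx t) (dy t).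
    pose proof (sum_sq_pos _ _ (NZ t Ht)). field. lra.
Qed.

Lemma smooth_lift L B Y p a b th0 : glip L B Y -> a <= b -> (forall t, a <= t <= b -> flow Y t p <> origin) -> polar (flow Y a p) th0 ->
  exists th dth, (forall t, continuous th t) /\ th a = th0 /\ (forall t, a <= t <= b -> polar (flow Y t p) (th t)) /\
   (forall t, a <= t <= b -> is_derive th t (dth t)) /\
   (forall t, a <= t <= b -> det2 (flow Y t p) (Y (flow Y t p)) < 0 -> dth t < 0).
Proof.
  intros HY Hab Hn Hp. destruct (smooth_lift_rate L B Y p a b th0 HY Hab Hn Hp) as [th [dth [H1 [H2 [H3 [H4 H5]]]]]].
  exists th, dth. repeat (split; [assumption|]). intros t Ht Hd. rewrite <- (H5 t Ht) in Hd. nra.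
Qed.

Lemma has_velocity_reverse c t b v : has_velocity c (b - t) v -> has_velocity (fun u => c (b - u)) t (- v.1, - v.2).
Proof.
  intros H. assert (A : has_velocity (fun u => c (- u)) (t + - b) (- v.1, - v.2)).
  { apply has_velocity_opp. replace (- (t + - b)) with (b - t) by ring. auto. }
  apply has_velocity_shift in A as [A1 A2]. split.
  - eapply is_derive_ext; [|exact A1]. intros u; simpl. f_equal. f_equal. ring.
  - eapply is_derive_ext; [|exact A2]. intros u; simpl. f_equal. f_equal. ring.
Qed.

(** The arc has a nonzero tangent at the origin, so near its end it stays in an open half plane; two
    continuous angles in a half plane differ by less than [PI]. *)
Lemma phi_close X g r phi : transversal_half_arc X g r -> angle_along (fun s => 0 < s < r) g phi ->
  exists s2, 0 < s2 < r /\ forall v w, 0 < v < s2 -> 0 < w < s2 -> Rabs (phi v - phi w) < PI.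
Proof.
  intros [Hr [Hg0 [Hinj [dg [Hdg Htr]]]]] Hphi. pose proof PI_RGT_0 as HPI. destruct (Hdg 0 !!) as [V0 [_ [_ N0]]].
  set (a := dg 0) in *. assert (Pa : 0 < dot a a).
  { unfold dot. replace (a.1 * a.1 + a.2 * a.2) with (a.1 ^ 2 + a.2 ^ 2) by ring. apply sum_sq_pos.
    destruct (Req_dec a.1 0); auto. destruct (Req_dec a.2 0); auto. exfalso; apply N0. destruct a; simpl in *; subst; auto. }
  assert (D : is_derive (fun u => - dot a (g u)) 0 (- dot a a)).
  { apply (is_derive_opp (fun u => dot a (g u))). unfold dot.
    apply (is_derive_plus (fun u => a.1 * (g u).1) (fun u => a.2 * (g u).2)); apply is_derive_scal; apply V0. }
  destruct (neg_derive_local _ _ _ D !!) as [d [Pd [D1 _]]].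
  set (s2 := Rmin d (r / 2)). assert (P2 : 0 < s2) by (apply Rmin_pos; lra).
  assert (L1 : s2 <= d) by apply Rmin_l. assert (L2 : s2 <= r / 2) by apply Rmin_r. exists s2. split; [lra|].
  destruct (polar_exists' a N0) as [ph0 Hph0]. destruct (polar_pos a ph0 N0 Hph0) as [ra [Pra Ea]].
  assert (POS : forall v, 0 < v < s2 -> 0 < cos (phi v - ph0)).
  { intros v Hv. specialize (D1 v !!). rewrite Hg0 in D1. unfold dot, origin in D1; simpl in D1.
    destruct (Hphi v !!) as [Nv [_ Pv]]. destruct (polar_pos (g v) (phi v) Nv Pv) as [rv [Prv Ev]].
    rewrite Ev, Ea in D1. simpl in D1. rewrite cos_minus.
    assert (0 < ra * rv * (cos (phi v) * cos ph0 + sin (phi v) * sin ph0)) by lra.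
    destruct (Rlt_le_dec 0 (cos (phi v) * cos ph0 + sin (phi v) * sin ph0)); auto.
    exfalso. assert (0 < ra * rv) by (apply Rmult_lt_0_compat; auto). nra. }
  assert (MID : forall lo, exists z, lo <= z <= lo + PI /\ cos (z - ph0) = 0).
  { intros lo. destruct (floor_2PI (2 * (lo - ph0 - PI / 2))) as [k Hk].
    exists (ph0 + PI / 2 + (PI * IZR k + PI)). split. lra.
    replace (ph0 + PI / 2 + (PI * IZR k + PI) - ph0) with (PI / 2 + (PI * IZR k + PI)) by ring.
    rewrite cos_plus, cos_PI2, sin_PI2. rewrite neg_sin.
    replace (sin (PI * IZR k)) with 0. ring. symmetry. rewrite Rmult_comm. apply sin_eq_0_1. exists k; auto. }
  assert (G : forall v w, 0 < v -> v <= w -> w < s2 -> Rabs (phi v - phi w) < PI).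
  { intros v w H1 H2 H3. destruct (Rlt_le_dec (Rabs (phi v - phi w)) PI) as [Q|Q]; auto. exfalso.
    assert (CP : forall t, v <= t <= w -> continuous phi t) by (intros t Ht; apply (Hphi t); lra).
    destruct (Rle_dec (phi v) (phi w)) as [O|O].
    - rewrite Rabs_left1 in Q by lra. destruct (MID (phi v)) as [z [Hz Ez]].
      destruct (ivt_incr phi v w z H2 CP) as [t [Ht Et]]. lra. pose proof (POS t !!). rewrite Et in *. lra.
    - rewrite Rabs_pos_eq in Q by lra. destruct (MID (phi w)) as [z [Hz Ez]].
      destruct (ivt_decr phi v w z H2 CP) as [t [Ht Et]]. lra. pose proof (POS t !!). rewrite Et in *. lra. }
  intros v w Hv Hw. destruct (Rle_dec v w). apply G; lra. rewrite Rabs_minus_sym. apply G; lra.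
Qed.

(** If every return near the origin is to its own starting point, the claim is immediate. Otherwise
    one nontrivial return keeps the outer part of the arc away from the origin, and a return point
    close to the origin must have a small parameter. *)
Lemma small_returns X g r phi sg : loc_lip X -> transversal_half_arc X g r -> 0 < sg ->
  exists d rho, 0 < d /\ 0 < rho /\ forall s s' T c, 0 < s < rho -> s < r -> first_return X g r phi s s' T c ->
    (forall t, 0 <= t <= T -> enorm (c t) < d) -> s' < sg.
Proof.
  intros HX HG Hsg.
  destruct (classic (exists s s' T c, 0 < s < Rmin sg r /\ first_return X g r phi s s' T c /\ s <> s')) as [[s0 [s0' [T0 [c0 [Hs0 [F0 N0]]]]]]|NE].
  - assert (Lr : s0 < r). { mins (Rmin sg r). lra. }
    destruct (arc_tail X g r phi s0 s0' T0 c0 HX HG !! F0 N0) as [m [Pm Hm]].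
    assert (Hs0' : 0 < s0' < r) by (destruct F0 as [_ [_ [_ [Q _]]]]; auto).
    set (u0 := Rmax s0 s0'). assert (Hu0 : 0 < u0 < r). { unfold u0, Rmax. destruct Rle_dec; lra. }
    assert (exists m', 0 < m' /\ forall u, sg <= u <= u0 -> m' <= enorm (g u)) as [m' [Pm' Hm']].
    { destruct (Rle_dec sg u0). apply (arc_away g X r); auto; lra. exists 1. split. lra. intros; lra. }
    exists (Rmin m m'), 1. split. apply Rmin_pos; auto. split. lra.
    intros s s' T c Hs Hsr [HT [_ [_ [Hs' [HcT _]]]]] Hsm. destruct (Rlt_le_dec s' sg); auto. exfalso.
    specialize (Hsm T !!). rewrite HcT in Hsm. mins (Rmin m m').
    destruct (Rle_dec s' u0). { specialize (Hm' s' !!). lra. } specialize (Hm s' ltac:(unfold u0 in *; lra)). lra.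
  - exists 1, (Rmin sg r). destruct HG as [Hr _]. split. lra. split. apply Rmin_pos; lra.
    intros s s' T c Hs Hsr F _. destruct (Req_dec s s') as [<-|N]. { mins (Rmin sg r). lra. }
    exfalso. apply NE. exists s, s', T, c. auto.
Qed.

Lemma floor_PI (x : R) : exists k : Z, PI * IZR k < x <= PI * IZR k + PI.
Proof.
  destruct (floor_2PI (- (2 * x))) as [k Hk]. exists (- k - 1)%Z. rewrite minus_IZR, opp_IZR. lra.
Qed.

Lemma sin_kPI (k : Z) : sin (PI * IZR k) = 0.
Proof. rewrite Rmult_comm. apply sin_eq_0_1. exists k; auto. Qed.

Lemma sin_between (x : R) (k : Z) : PI * IZR k < x < PI * IZR k + PI -> sin x <> 0.
Proof.
  intros H E. destruct (sin_eq_0_0 _ E) as [j Hj]. pose proof PI_RGT_0. rewrite Hj in H.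
  assert (IZR k < IZR j) by nra. assert (IZR j < IZR (k + 1)) by (rewrite plus_IZR; nra).
  apply lt_IZR in H1. apply lt_IZR in H2. lia.
Qed.

Section Reversible.
(** [n] spans the axis, [Rv] is the reflection and [k] the factor of the time change: [HR1] says
    that [Rv] carries orbits to orbits run backwards with speed [k]. By [Haxis] the axis is crossed
    clockwise. Keeping [Rv] abstract, smooth along orbits only, allows for a reflection that is
    merely implicitly defined. *)
Variables (X : R * R -> R * R) (n : R * R) (Rv : R * R -> R * R) (k : R * R -> R) (d0 Mk : R).
Hypothesis HX : loc_lip X.
Hypothesis HX0 : X origin = origin.
Hypothesis Hd0 : 0 < d0 <= 1.
Hypothesis Hn : n <> origin.
Hypothesis Haxis : forall p, det2 n p = 0 -> p <> origin -> enorm p < d0 -> det2 p (X p) < 0.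
Hypothesis HR1 : forall (c : R -> R * R) (t : R), enorm (c t) < d0 -> has_velocity c t (X (c t)) ->
  has_velocity (fun u => Rv (c u)) t (- (k (c t) * (X (Rv (c t))).1), - (k (c t) * (X (Rv (c t))).2)).
Hypothesis Hk : forall p, enorm p < d0 -> 0 < k p <= Mk.
Hypothesis Hkc : forall (c : R -> R * R) (t : R), enorm (c t) < d0 -> continuous (fun u => (c u).1) t -> continuous (fun u => (c u).2) t ->
  continuous (fun u => k (c u)) t.
Hypothesis HR2 : forall p, det2 n p = 0 -> enorm p < d0 -> Rv p = p.
Hypothesis HR3 : forall p, enorm p < d0 -> det2 n p <> 0 -> det2 n (Rv p) <> 0.
Hypothesis HR4 : forall d, 0 < d -> exists d', 0 < d' /\ forall p, enorm p < d' -> enorm (Rv p) < d.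
Hypothesis HR5 : forall p, enorm p < d0 -> enorm (Rv p) < 1.

Variables (L B : R).
Notation Y := (clipped 2 X).
Hypothesis HY : glip L B Y.
Notation Phi := (flow Y).

Lemma rev_XY p : enorm p < 1 -> Y p = X p.
Proof. intros H. apply clipped_in. apply inbox_enorm. lra. Qed.

Lemma rev_cont t q : continuous (fun u => (Phi u q).1) t /\ continuous (fun u => (Phi u q).2) t.
Proof. destruct (flow_sol L B Y q t HY). split; eapply is_derive_cont; eauto. Qed.

(** The mirror image of an arc with both ends on the axis, run backwards, is an orbit from the
    second end to the first one. Its own time is the integral [sg] of [k], which also gives the
    bound on the return time. *)
Lemma reflect_segment q a b : a < b -> (forall t, a <= t <= b -> enorm (Phi t q) < d0) ->
  det2 n (Phi a q) = 0 -> det2 n (Phi b q) = 0 ->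
  exists S, 0 < S <= Mk * (b - a) /\ Phi S (Phi b q) = Phi a q /\
    forall tau, 0 <= tau <= S -> exists u, a <= u <= b /\ Phi tau (Phi b q) = Rv (Phi u q) /\ (0 < tau < S -> a < u < b).
Proof.
  intros Hab Hb Ha0 Hb0. set (h := b - a). assert (Hh : 0 < h) by (unfold h; lra).
  set (e := fun u => Rv (Phi (b - u) q)). set (kf := fun u => k (Phi (b - proj 0 h u) q)).
  assert (IN : forall u, 0 <= u <= h -> a <= b - u <= b) by (unfold h; intros; lra).
  assert (Ck : forall u, continuous kf u).
  { intros u. unfold kf. apply (frozen_cont (fun u => k (Phi (b - u) q)) 0 h). lra.
    intros t Ht. apply (Hkc (fun u => Phi (b - u) q)). apply Hb; auto.
    - apply (continuous_comp (fun u => b - u) (fun u => (Phi u q).1) t); [|exact (proj1 (rev_cont (b - t) q))].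
      apply (ex_derive_continuous (fun u => b - u)). auto_derive; auto.
    - apply (continuous_comp (fun u => b - u) (fun u => (Phi u q).2) t); [|exact (proj2 (rev_cont (b - t) q))].
      apply (ex_derive_continuous (fun u => b - u)). auto_derive; auto. }
  assert (Bk : forall u, 0 < kf u <= Mk).
  { intros u. apply Hk. apply Hb. apply IN. apply proj_in. lra. }
  set (sg := fun u => RInt kf 0 u).
  assert (Dsg : forall u, is_derive sg u (kf u)) by (intros; apply (RInt_deriv kf 0); auto).
  assert (S0 : sg 0 = 0) by (unfold sg; rewrite RInt_point; reflexivity).
  assert (MON : forall u v, u < v -> sg u < sg v) by (intros; apply (pos_derive_lt sg kf); auto; intros; apply Bk).
  (* The reflected curve and the reparametrized orbit solve the same equation with time-dependent
     factor [kf] and have the same initial point, which [Rv] fixes. *)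
  set (dd := fun u => Phi (sg u) (Phi b q)). assert (EQ : forall u, 0 <= u <= h -> e u = dd u).
  { intros u Hu. apply Ed_le_0. replace 0 with (Ed (e 0) (dd 0) * exp (4 * L * Mk * (u - 0))).
    2:{ unfold e, dd. rewrite S0, (flow_0 L B), Rminus_0_r by auto. rewrite HR2; auto. rewrite Ed_refl. ring. apply Hb; lra. }
    apply (solutions_Ed L B Y kf Mk); auto; try lra.
    - destruct (Bk 0); lra.
    - intros t Ht. destruct (Bk t). rewrite Rabs_pos_eq; lra.
    - intros t Ht. unfold e. unfold kf. rewrite proj_id by lra.
      eapply has_velocity_ext; [|apply (has_velocity_reverse (fun u => Rv (Phi u q)) t b); apply (HR1 (fun u => Phi u q))].
      + simpl. rewrite !Ropp_involutive. rewrite rev_XY; auto. apply HR5. apply Hb. apply IN; lra.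
      + apply Hb. apply IN; lra.
      + rewrite <- rev_XY. apply (flow_sol L B); auto. assert (enorm (Phi (b - t) q) < d0) by (apply Hb, IN; lra). lra.
    - intros t Ht. destruct (flow_sol L B Y (Phi b q) (sg t) HY) as [A1 A2]. split; simpl; unfold dd.
      + apply (is_derive_comp (fun u => (Phi u (Phi b q)).1) sg); auto.
      + apply (is_derive_comp (fun u => (Phi u (Phi b q)).2) sg); auto. }
  exists (sg h). split; [|split].
  - split. { rewrite <- S0. apply MON. auto. }
    assert (PS : 0 < sg h) by (rewrite <- S0; apply MON; auto). assert (G : Rabs (RInt kf 0 h) <= Mk * Rabs (h - 0)).
    { apply RInt_bounded; auto. intros u _. destruct (Bk u). rewrite Rabs_pos_eq; lra. }
    fold (sg h) in G. rewrite Rminus_0_r, !Rabs_pos_eq in G by lra. exact G.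
  - change (Phi (sg h) (Phi b q)) with (dd h). rewrite <- EQ by lra. unfold e. replace (b - h) with a by (unfold h; ring).
    apply HR2; auto. apply Hb; lra.
  - intros tau Ht. destruct (ivt_incr sg 0 h tau) as [u [Hu Eu]]; try lra.
    { intros t _. eapply is_derive_cont. apply Dsg. }
    exists (b - u). split. { apply IN; auto. } split.
    + rewrite <- Eu. change (Phi (sg u) (Phi b q)) with (dd u). rewrite <- EQ by auto. reflexivity.
    + intros Hi. assert (u <> 0) by (intros ->; lra). assert (u <> h) by (intros ->; lra). unfold h in *; lra.
Qed.

Lemma rev_nonzero q t : q <> origin -> Phi t q <> origin.
Proof.
  intros Hq E. apply Hq. assert (O : Phi t origin = origin).
  { symmetry. replace t with (t - 0) by ring. apply (flow_unique L B Y HY (fun _ => origin) (Rmin 0 t) (Rmax 0 t) 0).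
    - intros u _. rewrite rev_XY, HX0. split; simpl; apply is_derive_constR. rewrite enorm_origin. lra.
    - split; [apply Rmin_l|apply Rmax_l].
    - split; [apply Rmin_r|apply Rmax_r]. }
  apply (flow_inj L B Y HY t). rewrite O. auto.
Qed.

(* An orbit turning by more than three half turns crosses the axis twice;
   reflecting the arc in between closes it up. *)
Lemma closed_by_reflection q T th dth d : 0 < T -> 0 < d <= d0 -> q <> origin ->
  (forall p, enorm p < d -> enorm (Rv p) < d0) ->
  (forall t, 0 <= t <= T -> enorm (Phi t q) < d) ->
  (forall t, continuous th t) -> (forall t, 0 <= t <= T -> polar (Phi t q) (th t)) ->
  (forall t, 0 <= t <= T -> is_derive th t (dth t)) ->
  (forall t, 0 <= t <= T -> det2 (Phi t q) (Y (Phi t q)) < 0 -> dth t < 0) ->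
  th T < th 0 - 3 * PI ->
  (exists t0 t1, 0 <= t0 /\ t0 < t1 /\ t1 <= T /\ det2 n (Phi t0 q) = 0 /\ det2 n (Phi t1 q) = 0) /\
  (forall t, closed_orbit_around_origin X (Phi t q) /\ Phi t q <> origin) /\
  (forall t, (exists u, 0 <= u <= T /\ Phi t q = Phi u q) \/ (exists u, 0 <= u <= T /\ Phi t q = Rv (Phi u q))).
Proof.
  intros HT Hd Hq HRd Hb Cth Pth Dth Nth Hbig. pose proof PI_RGT_0 as HPI.
  destruct (polar_exists' n Hn) as [nu Hnu]. destruct (polar_pos n nu Hn Hnu) as [rn [Prn En]].
  assert (NO : forall t, Phi t q <> origin) by (intros; apply rev_nonzero; auto).
  assert (AX : forall p ph, p <> origin -> polar p ph -> exists rho, 0 < rho /\ det2 n p = rho * sin (ph - nu)).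
  { intros p ph Hp Hph. destruct (polar_pos p ph Hp Hph) as [rp [Prp Ep]]. exists (rn * rp). split. apply Rmult_lt_0_compat; auto.
    rewrite Ep, En. unfold det2; simpl. rewrite sin_minus. ring. }
  assert (ON : forall p ph (j : Z), p <> origin -> polar p ph -> ph = nu + PI * IZR j -> det2 n p = 0).
  { intros p ph j Hp Hph E. destruct (AX p ph Hp Hph) as [rho [_ Er]]. rewrite Er, E. replace (nu + PI * IZR j - nu) with (PI * IZR j) by ring. rewrite sin_kPI. ring. }
  assert (OFFX : forall p ph (j : Z), p <> origin -> polar p ph -> nu + PI * IZR j < ph < nu + PI * IZR j + PI -> det2 n p <> 0).
  { intros p ph j Hp Hph E. destruct (AX p ph Hp Hph) as [rho [Pr Er]]. rewrite Er. apply Rmult_integral_contrapositive. split. lra. apply (sin_between _ j). lra. }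
  (* The axis corresponds to the angles [nu + PI * j], and each of these is passed only
     downwards. *)
  assert (DC : forall j : Z, forall t1 t2, 0 <= t1 -> t1 < t2 -> t2 <= T -> th t1 <= nu + PI * IZR j -> th t2 < nu + PI * IZR j).
  { intros j. apply (down_crossing th dth 0 T); auto. lra. intros t Ht E. apply Nth; auto.
    pose proof (Hb t Ht). rewrite rev_XY by lra. apply Haxis; auto; try lra. apply (ON _ (th t) j); auto. }
  destruct (floor_PI (th 0 - nu)) as [j Hj]. assert (EZ : IZR (j - 1) = IZR j - 1) by (rewrite minus_IZR; ring).
  assert (EZ2 : IZR (j - 2) = IZR j - 2) by (rewrite minus_IZR; ring).
  (* [t0] and [t1] are consecutive crossings of the axis, half a turn apart, with no crossing in
     between. *)
  destruct (ivt_decr th 0 T (nu + PI * IZR j)) as [t0 [Ht0 E0]]; auto; try lra.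
  destruct (ivt_decr th 0 T (nu + PI * IZR (j - 1))) as [t1 [Ht1 E1]]; auto; try (rewrite ?EZ; lra).
  assert (L01 : t0 < t1).
  { destruct (Rlt_le_dec t0 t1); auto. exfalso. destruct (Req_dec t0 t1) as [Q|Q].
    - rewrite Q in E0. rewrite EZ in E1. lra.
    - pose proof (DC j t1 t0 !! !! !!) as W. rewrite E1, EZ in W. specialize (W !!). lra. }
  assert (A0 : det2 n (Phi t0 q) = 0) by (apply (ON _ (th t0) j); auto).
  assert (A1 : det2 n (Phi t1 q) = 0) by (apply (ON _ (th t1) (j - 1)%Z); auto).
  split. { exists t0, t1. repeat split; auto; lra. }
  destruct (reflect_segment q t0 t1 L01) as [S [HS [ES RS]]]; auto.
  { intros t Ht. pose proof (Hb t !!). lra. }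
  set (h := t1 - t0). set (p0 := Phi t0 q) in *. set (P := h + S).
  assert (Hh : 0 < h) by (unfold h; lra). assert (HP : 0 < P) by (unfold P; lra).
  assert (F1 : forall t, Phi t p0 = Phi (t + t0) q) by (intros; unfold p0; symmetry; apply (flow_plus L B); auto).
  assert (F2 : forall t, Phi (t + h) p0 = Phi t (Phi t1 q)).
  { intros t. rewrite (flow_plus L B) by auto. rewrite F1. f_equal. f_equal. unfold h; ring. }
  assert (PP : Phi P p0 = p0). { unfold P. rewrite Rplus_comm, F2. exact ES. }
  assert (ALL : forall t, 0 <= t <= P -> (0 <= t <= h /\ exists u, t0 <= u <= t1 /\ Phi t p0 = Phi u q) \/
      (h <= t /\ exists u, t0 <= u <= t1 /\ Phi t p0 = Rv (Phi u q) /\ (h < t < P -> t0 < u < t1))).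
  { intros t Ht. destruct (Rle_dec t h).
    - left. split. lra. exists (t + t0). split; [unfold h in *; lra|apply F1].
    - right. split. lra. destruct (RS (t - h)) as [u [Hu [Eu Iu]]]. unfold P in Ht; lra.
      exists u. split; auto. split. rewrite <- Eu, <- F2. f_equal. ring. intros; apply Iu. unfold P in *; lra. }
  assert (BALL : forall t, 0 <= t <= P -> enorm (Phi t p0) < d0).
  { intros t Ht. destruct (ALL t Ht) as [[_ [u [Hu Eu]]]|[_ [u [Hu [Eu _]]]]]; rewrite Eu.
    - pose proof (Hb u !!). lra.
    - apply HRd. apply Hb. lra. }
  assert (NO' : forall t, Phi t p0 <> origin) by (intros t; rewrite F1; auto).
  destruct (smooth_lift L B Y p0 0 P (th t0) HY !! (fun t _ => NO' t)) as [ps [dps [Cps [Z0 [Pps [Dps Nps]]]]]].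
  { rewrite F1, Rplus_0_l. apply Pth; lra. }
  assert (PSh : ps h = nu + PI * IZR (j - 1)).
  { assert (Q : ps h - th (h + t0) = ps 0 - th (0 + t0)).
    { apply (lifts_differ_const ps (fun t => th (t + t0)) 0 h); auto. lra.
      - intros t Ht. apply (continuous_comp (fun t => t + t0) th); auto. apply (ex_derive_continuous (fun t => t + t0)). auto_derive; auto.
      - intros t Ht. apply polar_unique with (Phi t p0); auto. apply Pps; unfold P; lra. rewrite F1. apply Pth. unfold h in *; lra. }
    rewrite Z0, Rplus_0_l in Q. replace (h + t0) with t1 in Q by (unfold h; ring). lra. }
  assert (DC' : forall i : Z, forall u1 u2, 0 <= u1 -> u1 < u2 -> u2 <= P -> ps u1 <= nu + PI * IZR i -> ps u2 < nu + PI * IZR i).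
  { intros i. apply (down_crossing ps dps 0 P); auto. lra. intros t Ht E. apply Nps; auto.
    pose proof (BALL t Ht). rewrite rev_XY by lra. apply Haxis; auto. apply (ON _ (ps t) i); auto. }
  assert (LP : ps P < nu + PI * IZR (j - 1)) by (apply (DC' (j - 1)%Z h P); unfold P; lra).
  destruct (polar_unique p0 (ps P) (th t0)) as [Q1 Q2]. { unfold p0; auto. } { rewrite <- PP at 1. apply Pps; lra. } { apply Pth; lra. }
  (* The closed curve makes exactly one clockwise turn. With two or more, the reflected half would
     meet the axis strictly between its ends, although it consists there of images of points off the
     axis. *)
  destruct (cos_sin_eq_2kPI _ _ Q1 Q2) as [i Hi]. assert (Ii : (i = -1)%Z).
  { assert (IZR i < 0). { rewrite Hi, E0, EZ in LP. nra. }
    assert (i < 0)%Z by (apply lt_IZR; auto). destruct (Z.eq_dec i (-1)) as [|Ni]; auto. exfalso.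
    assert (IZR i <= -2) by (apply IZR_le; lia).
    destruct (ivt_decr ps h P (nu + PI * IZR (j - 2))) as [tau [Htau Etau]]; auto. unfold P; lra.
    { rewrite PSh, Hi, E0, EZ, EZ2. split; nra. }
    assert (tau <> h). { intros ->. rewrite PSh, EZ, EZ2 in Etau. lra. }
    assert (tau <> P). { intros ->. rewrite Hi, E0, EZ2 in Etau. nra. }
    destruct (ALL tau !!) as [[Q _]|[_ [u [Hu [Eu Iu]]]]]. lra. specialize (Iu !!).
    assert (NZ : det2 n (Phi u q) <> 0).
    { apply (OFFX _ (th u) (j - 1)%Z); auto. apply Pth; lra. split.
      - destruct (Rlt_le_dec (nu + PI * IZR (j - 1)) (th u)); auto. exfalso.
        pose proof (DC (j - 1)%Z u t1 !! !! !! r). lra.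
      - pose proof (DC j t0 u !! !! !! !!). rewrite EZ. lra. }
    apply (HR3 (Phi u q)); auto. pose proof (Hb u !!); lra.
    rewrite <- Eu. apply (ON _ (ps tau) (j - 2)%Z); auto. apply Pps; lra. }
  assert (CO := closed_orbit_flow L B Y HY X P p0 ps HP PP).
  assert (RE : forall t, Phi t q = Phi (t - t0) p0) by (intros t; rewrite F1; f_equal; ring). split.
  - intros t. rewrite RE. apply CO.
    + intros u. symmetry. apply rev_XY. destruct (flow_mod L B Y HY P p0 u HP PP) as [u' [Hu' Eu']]. rewrite Eu'. pose proof (BALL u' Hu'). lra.
    + intros u Hu. split; auto. split; auto. apply Pps; auto.
    + rewrite Hi, Z0, Ii. replace (th t0 + 2 * PI * -1 - th t0) with (- (2 * PI)) by ring. rewrite Rabs_Ropp, Rabs_pos_eq; lra.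
  - intros t. rewrite RE. destruct (flow_mod L B Y HY P p0 (t - t0) HP PP) as [u' [Hu' Eu']]. rewrite Eu'.
    destruct (ALL u' Hu') as [[_ [u [Hu Eu]]]|[_ [u [Hu [Eu _]]]]]; rewrite Eu; [left|right]; exists u; split; auto; lra.
Qed.

(** On the axis the field is not parallel to [n], as it turns clockwise there. So [det2 n] changes
    sign along the orbit at [t0], and does so on nearby orbits too. *)
Lemma crossing_persists g w s0 t0 eta : has_velocity g s0 w -> 0 < eta -> det2 n (Phi t0 (g s0)) = 0 -> Phi t0 (g s0) <> origin ->
  enorm (Phi t0 (g s0)) < d0 ->
  exists kp, 0 < kp /\ forall s, Rabs (s - s0) < kp -> exists t, Rabs (t - t0) <= eta /\ det2 n (Phi t (g s)) = 0.
Proof.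
  intros Hg Heta A0 N0 B0. set (q := g s0) in *. set (p := Phi t0 q) in *. assert (NZ : det2 n (X p) <> 0).
  { pose proof (Haxis p A0 N0 B0) as Q. intros E. assert (exists l, p = (l * n.1, l * n.2)) as [l El].
    { unfold det2 in A0. destruct (Req_dec n.1 0) as [Z|Z].
      - assert (Z' : n.2 <> 0). { intros Z'. apply Hn. destruct n; simpl in *; subst; auto. }
        exists (p.2 / n.2). rewrite Z in *. assert (n.2 * p.1 = 0) by lra. apply Rmult_integral in H.
        destruct p as [px py]; simpl in *. f_equal. destruct H; lra. field; auto.
      - exists (p.1 / n.1). destruct p as [px py]; simpl in *. f_equal. field; auto.
        apply Rmult_eq_reg_l with n.1; auto. field_simplify; auto. lra. }
    rewrite El in Q at 1. unfold det2 in Q, E; simpl in Q. assert (l * (n.1 * (X p).2 - n.2 * (X p).1) < 0) by lra. rewrite E in H. lra. }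
  set (G := fun t => det2 n (Phi t q)). assert (DG : is_derive G t0 (det2 n (X p))).
  { unfold G. rewrite <- rev_XY by lra. apply is_derive_det2. apply (flow_sol L B); auto. }
  assert (exists e sgn, 0 < e <= eta /\ (sgn = 1 \/ sgn = -1) /\ sgn * G (t0 + e) < 0 /\ 0 < sgn * G (t0 - e)) as [e [sgn [He [Hsgn [G1 G2]]]]].
  { destruct (Rlt_le_dec (det2 n (X p)) 0) as [Q|Q].
    - destruct (neg_derive_local G t0 _ DG Q) as [d [Pd [D1 D2]]].
      assert (M1 := Rmin_l d eta). assert (M2 := Rmin_r d eta). assert (M3 : 0 < Rmin d eta) by (apply Rmin_pos; auto).
      exists (Rmin d eta / 2), 1. split. lra. split; auto.
      specialize (D1 (t0 + Rmin d eta / 2) !!). specialize (D2 (t0 - Rmin d eta / 2) !!).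
      change (G t0) with (det2 n p) in *. rewrite A0 in *. lra.
    - assert (DG' : is_derive (fun t => - G t) t0 (- det2 n (X p))) by (apply (is_derive_opp G); auto).
      destruct (neg_derive_local _ t0 _ DG' !!) as [d [Pd [D1 D2]]].
      assert (M1 := Rmin_l d eta). assert (M2 := Rmin_r d eta). assert (M3 : 0 < Rmin d eta) by (apply Rmin_pos; auto).
      exists (Rmin d eta / 2), (-1). split. lra. split; auto.
      specialize (D1 (t0 + Rmin d eta / 2) !!). specialize (D2 (t0 - Rmin d eta / 2) !!).
      change (G t0) with (det2 n p) in *. rewrite A0 in *. lra. }
  assert (NEAR : forall t sg', (sg' = 1 \/ sg' = -1) -> 0 < sg' * G t -> exists kp, 0 < kp /\ forall s, Rabs (s - s0) < kp -> 0 < sg' * det2 n (Phi t (g s))).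
  { intros t sg' Hsg' HG'. destruct (flow_const L B Y HY t) as [K [PK HK]].
    destruct (det2_cont_pos (sg' * n.1, sg' * n.2) (Phi t q)) as [dd [Pdd Hdd]].
    { replace (det2 (sg' * n.1, sg' * n.2) (Phi t q)) with (sg' * G t) by (unfold G, det2; cbn [fst snd]; ring). auto. }
    destruct (arc_d1_near g w s0 (dd / K) Hg) as [kp [Pkp Hkp]]. { apply Rdiv_lt_0_compat; auto. }
    exists kp. split; auto. intros s Hs. specialize (Hdd (Phi t (g s))). assert (d1 (Phi t (g s)) (Phi t q) < dd).
    { eapply Rle_lt_trans. apply HK. apply Rlt_le_trans with (K * (dd / K)). apply Rmult_lt_compat_l; auto. right; field; lra. }
    specialize (Hdd H). unfold det2 in *; simpl in *. lra. }
  destruct (NEAR (t0 + e) (- sgn)) as [k1 [Pk1 Hk1]]. { destruct Hsgn as [->| ->]; lra. } { lra. }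
  destruct (NEAR (t0 - e) sgn) as [k2 [Pk2 Hk2]]; auto.
  exists (Rmin k1 k2). split. apply Rmin_pos; auto. intros s Hs. mins (Rmin k1 k2).
  specialize (Hk1 s !!). specialize (Hk2 s !!). assert (CG : forall t, continuous (fun t => det2 n (Phi t (g s))) t).
  { intros t. eapply is_derive_cont. apply is_derive_det2. apply (flow_sol L B); auto. }
  destruct Hsgn as [->| ->].
  - destruct (ivt_decr (fun t => det2 n (Phi t (g s))) (t0 - e) (t0 + e) 0) as [t [Ht Et]]; auto; try lra.
    exists t. split; auto. apply Rabs_le. lra.
  - destruct (ivt_incr (fun t => det2 n (Phi t (g s))) (t0 - e) (t0 + e) 0) as [t [Ht Et]]; auto; try lra.
    exists t. split; auto. apply Rabs_le. lra.
Qed.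

Lemma reversible_center_aux : monodromic X -> is_center X.
Proof.
  intros [_ [g [r [phi [HG [Hphi Hret]]]]]]. pose proof PI_RGT_0 as HPI.
  pose proof HG as [Hr [Hg0 [Hinj [dg [Hdg Htr]]]]].
  assert (GN : forall s, 0 < s < r -> g s <> origin) by (intros s Hs; apply (Hphi s); auto).
  destruct (polar_exists' n Hn) as [nu Hnu]. destruct (polar_pos n nu Hn Hnu) as [rn [Prn En]].
  (* Two successive returns are followed. Each changes the angle by 2 PI in one direction, up to the
     difference of two angles of the arc, which is below [PI]. *)
  assert (TURN : forall d, 0 < d <= d0 -> exists rho', 0 < rho' /\ rho' < r /\ forall s, 0 < s < rho' -> exists T th dth,
     0 < T /\ (forall t, 0 <= t <= T -> enorm (Phi t (g s)) < d) /\
     (forall t, continuous th t) /\ (forall t, 0 <= t <= T -> polar (Phi t (g s)) (th t)) /\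
     (forall t, 0 <= t <= T -> is_derive th t (dth t)) /\
     (forall t, 0 <= t <= T -> det2 (Phi t (g s)) (Y (Phi t (g s))) < 0 -> dth t < 0) /\ th T < th 0 - 3 * PI).
  { intros d Hd. destruct (phi_close X g r phi HG Hphi) as [s2 [Hs2 Hcl]].
    destruct (small_returns X g r phi s2 HX HG !!) as [dA [rA [PdA [PrA HA]]]].
    set (dd := Rmin d dA). assert (Pdd : 0 < dd) by (apply Rmin_pos; lra).
    assert (Ld1 : dd <= d) by apply Rmin_l. assert (Ld2 : dd <= dA) by apply Rmin_r.
    destruct (Hret dd Pdd) as [ra [Hra Ra]].
    set (s0 := Rmin ra (Rmin rA s2)). assert (Ps0 : 0 < s0) by (unfold s0; repeat apply Rmin_pos; lra).
    assert (Ls0 : s0 <= ra /\ s0 <= rA /\ s0 <= s2).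
    { unfold s0. mins (Rmin ra (Rmin rA s2)). lra. }
    destruct (small_returns X g r phi s0 HX HG Ps0) as [dB [rB [PdB [PrB HB]]]].
    set (db := Rmin dd dB). assert (Pdb : 0 < db) by (apply Rmin_pos; lra).
    assert (Lb1 : db <= dd) by apply Rmin_l. assert (Lb2 : db <= dB) by apply Rmin_r.
    destruct (Hret db Pdb) as [rb [Hrb Rb]].
    set (rho := Rmin rb (Rmin rB s2)). assert (Prho : 0 < rho) by (unfold rho; repeat apply Rmin_pos; lra).
    assert (Lrho : rho <= rb /\ rho <= rB /\ rho <= s2).
    { unfold rho. mins (Rmin rb (Rmin rB s2)). lra. }
    exists rho. split; auto. split; [lra|]. intros s Hs. destruct (Rb s !!) as [s' [T1 [c1 [F1 Sm1]]]].
    assert (Hs'0 : s' < s0). { apply (HB s s' T1 c1); auto; try lra. intros t Ht. specialize (Sm1 t Ht). lra. }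
    destruct F1 as [PT1 [Sol1 [C10 [Hs' [C1T [_ [th1 [Ath1 [Th10 Th1T]]]]]]]]].
    destruct (Ra s' !!) as [s'' [T2 [c2 [F2 Sm2]]]].
    assert (Hs''2 : s'' < s2). { apply (HA s' s'' T2 c2); auto; try lra. intros t Ht. specialize (Sm2 t Ht). lra. }
    destruct F2 as [PT2 [Sol2 [C20 [Hs'' [C2T [_ [th2 [Ath2 [Th20 Th2T]]]]]]]]].
    assert (EF1 : forall t, 0 <= t <= T1 -> c1 t = Phi t (g s)).
    { rewrite <- C10. apply (solution_is_flow L B X c1 T1 HY); auto. lra. intros t Ht. specialize (Sm1 t Ht). lra. }
    assert (EF2 : forall t, 0 <= t <= T2 -> c2 t = Phi t (g s')).
    { rewrite <- C20. apply (solution_is_flow L B X c2 T2 HY); auto. lra. intros t Ht. specialize (Sm2 t Ht). lra. }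
    assert (EP : Phi T1 (g s) = g s') by (rewrite <- EF1; auto; lra).
    assert (NO : forall t, Phi t (g s) <> origin) by (intros; apply rev_nonzero; apply GN; lra).
    destruct (smooth_lift L B Y (g s) 0 (T1 + T2) (phi s) HY !! (fun t _ => NO t)) as [th [dth [Cth [Z0 [Pth [Dth Nth]]]]]].
    { rewrite (flow_0 L B) by auto. apply (Hphi s). lra. }
    assert (SH : forall t, Phi (t + T1) (g s) = Phi t (g s')) by (intros; rewrite (flow_plus L B), EP; auto).
    assert (BALL : forall t, 0 <= t <= T1 + T2 -> enorm (Phi t (g s)) < d).
    { intros t Ht. destruct (Rle_dec t T1).
      - rewrite <- EF1 by lra. specialize (Sm1 t !!). lra.
      - replace t with ((t - T1) + T1) by ring. rewrite SH, <- EF2 by lra. specialize (Sm2 (t - T1) !!). lra. }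
    assert (V1 : th T1 = th1 T1).
    { assert (Q : th T1 - th1 T1 = th 0 - th1 0). apply (lifts_differ_const th th1 0 T1); auto. lra.
      - intros t Ht. apply (Ath1 t Ht).
      - intros t Ht. apply polar_unique with (Phi t (g s)); auto. apply Pth; lra. rewrite <- EF1 by auto. apply (Ath1 t Ht).
      - lra. }
    assert (V2 : th (T2 + T1) - th2 T2 = th T1 - phi s').
    { rewrite <- Th20. replace (th T1) with (th (0 + T1)) by (f_equal; ring).
      apply (lifts_differ_const (fun t => th (t + T1)) th2 0 T2); auto. lra.
      - intros t Ht. apply (continuous_comp (fun t => t + T1) th); auto. apply (ex_derive_continuous (fun t => t + T1)). auto_derive; auto.
      - intros t Ht. apply (Ath2 t Ht).
      - intros t Ht. apply polar_unique with (Phi (t + T1) (g s)); auto. apply Pth; lra. rewrite SH, <- EF2 by auto. apply (Ath2 t Ht). }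
    assert (DC : forall j : Z, forall t1 t2, 0 <= t1 -> t1 < t2 -> t2 <= T1 + T2 -> th t1 <= nu + PI * IZR j -> th t2 < nu + PI * IZR j).
    { intros j. apply (down_crossing th dth 0 (T1 + T2)); auto. lra. intros t Ht E. apply Nth; auto.
      pose proof (BALL t Ht). rewrite rev_XY by lra. apply Haxis; auto; try lra.
      destruct (polar_pos _ _ (NO t) (Pth t Ht)) as [rp [Prp Ep]]. rewrite Ep, En, E. unfold det2; simpl.
      replace (rn * cos nu * (rp * sin (nu + PI * IZR j)) - rn * sin nu * (rp * cos (nu + PI * IZR j))) with
        (rn * rp * (sin (nu + PI * IZR j) * cos nu - cos (nu + PI * IZR j) * sin nu)) by ring.
      rewrite <- sin_minus. replace (nu + PI * IZR j - nu) with (PI * IZR j) by ring. rewrite sin_kPI. ring. }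
    (* A rise by more than [PI] would cross an angle of the axis upwards. So both returns turn
       clockwise, and together they lower the angle by more than [4 PI - PI]. *)
    assert (NUP : forall t1 t2, 0 <= t1 -> t1 < t2 -> t2 <= T1 + T2 -> th t2 <= th t1 + PI).
    { intros t1 t2 H1 H2 H3. destruct (Rle_lt_dec (th t2) (th t1 + PI)); auto. exfalso.
      destruct (floor_PI (th t2 - nu)) as [j Hj]. pose proof (DC j t1 t2 H1 H2 H3 !!). lra. }
    pose proof (NUP 0 T1 !! !! !!) as U1. pose proof (NUP T1 (T2 + T1) !! !! !!) as U2.
    pose proof (Hcl s s' !! !!) as K1. pose proof (Hcl s' s'' !! !!) as K2. pose proof (Hcl s s'' !! !!) as K3.
    apply Rabs_def2 in K1. apply Rabs_def2 in K2. apply Rabs_def2 in K3.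
    assert (W1 : th1 T1 = phi s' - 2 * PI). { unfold Rabs in Th1T. destruct Rcase_abs in Th1T; lra. }
    assert (W2 : th2 T2 = phi s'' - 2 * PI). { unfold Rabs in Th2T. destruct Rcase_abs in Th2T; lra. }
    exists (T1 + T2), th, dth. split; [lra|]. split; auto. split; auto. split; auto. split; auto. split; auto.
    replace (T1 + T2) with (T2 + T1) by ring. lra. }
  assert (FAM : forall d, 0 < d <= d0 -> exists rho', 0 < rho' /\ rho' < r /\ forall s, 0 < s < rho' ->
     (forall t, closed_orbit_around_origin X (Phi t (g s)) /\ Phi t (g s) <> origin) /\ (forall t, enorm (Phi t (g s)) < d) /\
     exists t0 t1, t0 < t1 /\ det2 n (Phi t0 (g s)) = 0 /\ det2 n (Phi t1 (g s)) = 0).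
  { intros d Hd. destruct (HR4 d !!) as [d' [Pd' Hd']].
    set (de := Rmin d d'). assert (Pde : 0 < de) by (apply Rmin_pos; lra).
    assert (Le1 : de <= d) by apply Rmin_l. assert (Le2 : de <= d') by apply Rmin_r.
    destruct (TURN de !!) as [rho' [Pr' [Lr' HT]]]. exists rho'. split; auto. split; auto. intros s Hs.
    destruct (HT s Hs) as [T [th [dth [PT [Hb [Cth [Pth [Dth [Nth Hbig]]]]]]]]].
    destruct (closed_by_reflection (g s) T th dth de) as [[t0 [t1 [H0 [H1 [H2 [H3 H4]]]]]] [Q1 Q2]]; auto; try lra.
    { apply GN; lra. }
    { intros p Hp. specialize (Hd' p !!). lra. }
    split; auto. split.
    - intros t. destruct (Q2 t) as [[u [Hu Eu]]|[u [Hu Eu]]]; rewrite Eu.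
      + specialize (Hb u Hu). lra.
      + apply Hd'. specialize (Hb u Hu). lra.
    - exists t0, t1. auto. }
  destruct (FAM d0 !!) as [rho1 [Pr1 [Lr1 F1]]]. set (rho0 := rho1 / 2).
  apply (center_of_closed_orbits L B X Y g dg rho0 HY HX0); auto.
  - unfold rho0; lra.
  - apply (arc_C1on g dg r 0 rho0 Hdg); unfold rho0; lra.
  - intros s Hs. rewrite rev_XY. apply Htr. unfold rho0 in *; lra.
    destruct (F1 s ltac:(unfold rho0 in *; lra)) as [_ [Q _]]. specialize (Q 0). rewrite (flow_0 L B) in Q by auto. lra.
  - intros s t Hs. apply F1. unfold rho0 in *; lra.
  - intros d Hd. destruct (FAM (Rmin d d0)) as [rho' [Pr' [Lr' F']]]. { split. apply Rmin_pos; lra. apply Rmin_r. }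
    exists rho'. split; auto. intros s t Hs _. destruct (F' s Hs) as [_ [Q _]]. eapply Rlt_le_trans. apply Q. apply Rmin_l.
  - intros s0 Hs0. unfold rho0 in Hs0. destruct (F1 s0 !!) as [Q1 [Q2 [t0 [t1 [L01 [A0 A1]]]]]].
    (* Windows of this width around the two crossings are disjoint, so nearby orbits keep two
       ordered crossings [a < b]; reflection bounds their return time by [(b - a) * (1 + Mk)]. *)
    set (eta := (t1 - t0) / 3). assert (Peta : 0 < eta) by (unfold eta; lra).
    assert (Vg : has_velocity g s0 (dg s0)) by (apply Hdg; lra).
    destruct (crossing_persists g (dg s0) s0 t0 eta Vg Peta A0) as [k1 [Pk1 Hk1]]. { apply Q1. } { apply Q2. }
    destruct (crossing_persists g (dg s0) s0 t1 eta Vg Peta A1) as [k2 [Pk2 Hk2]]. { apply Q1. } { apply Q2. }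
    assert (PMk : 0 < Mk). { destruct (Hk (Phi 0 (g s0)) (Q2 0)). lra. }
    exists (Rmin k1 k2), ((t1 - t0 + 2 * eta) * (1 + Mk)). split. apply Rmin_pos; auto.
    split. { apply Rmult_le_pos; lra. }
    intros s Hs Hs' t. unfold rho0 in Hs'. mins (Rmin k1 k2).
    destruct (Hk1 s !!) as [a [Ha Ea]]. destruct (Hk2 s !!) as [b [Hb Eb]]. absle Ha. absle Hb.
    assert (Lab : a < b) by (unfold eta in *; lra). destruct (F1 s !!) as [_ [B2 _]].
    destruct (reflect_segment (g s) a b Lab) as [S [HS [ES _]]]; auto.
    assert (PP : Phi (b - a + S) (Phi a (g s)) = Phi a (g s)).
    { rewrite <- ES at 2. rewrite Rplus_comm, (flow_plus L B) by auto. f_equal. rewrite <- (flow_plus L B) by auto. f_equal. ring. }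
    assert (PQ : Phi (b - a + S) (g s) = g s).
    { rewrite <- (flow_inv L B Y HY a (g s)) at 1. rewrite (flow_period_shift L B Y HY). apply (flow_inv L B); auto. auto. }
    destruct (flow_mod L B Y HY (b - a + S) (g s) t !! PQ) as [t' [Ht' E]]. exists t'. split; auto.
    split; [lra|]. eapply Rle_trans. apply Ht'. assert (b - a <= t1 - t0 + 2 * eta) by lra. nra.
Qed.
End Reversible.

Lemma reversible_center X n Rv k d0 Mk K : loc_lip X -> X origin = origin -> 0 < d0 <= 1 -> 0 < K -> K * d0 <= 1 -> n <> origin ->
  (forall p, det2 n p = 0 -> p <> origin -> enorm p < d0 -> det2 p (X p) < 0) ->
  (forall (c : R -> R * R) (t : R), enorm (c t) < d0 -> has_velocity c t (X (c t)) ->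
     has_velocity (fun u => Rv (c u)) t (- (k (c t) * (X (Rv (c t))).1), - (k (c t) * (X (Rv (c t))).2))) ->
  (forall p, enorm p < d0 -> 0 < k p <= Mk) ->
  (forall (c : R -> R * R) (t : R), enorm (c t) < d0 -> continuous (fun u => (c u).1) t -> continuous (fun u => (c u).2) t ->
     continuous (fun u => k (c u)) t) ->
  (forall p, det2 n p = 0 -> enorm p < d0 -> Rv p = p) ->
  (forall p, enorm p < d0 -> det2 n p <> 0 -> det2 n (Rv p) <> 0) ->
  (forall p, enorm p < d0 -> enorm (Rv p) <= K * enorm p) -> monodromic X -> is_center X.
Proof.
  intros HX HX0 Hd0 PK HK Hn H1 H2 H3 H4 H5 H6 H7. destruct (clipped_glip 2 X !! HX) as [L [B HY]].
  apply (reversible_center_aux X n Rv k d0 Mk) with (L := L) (B := B); auto.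
  - intros d Hd. exists (Rmin d0 (d / K)). split. { apply Rmin_pos; [lra|apply Rdiv_lt_0_compat; lra]. }
    intros p Hp. mins (Rmin d0 (d / K)). eapply Rle_lt_trans. apply H7; lra.
    apply Rlt_le_trans with (K * (d / K)). apply Rmult_lt_compat_l; lra. right; field; lra.
  - intros p Hp. specialize (H7 p Hp). nra.
Qed.

(** * Sufficiency *)

Lemma cubic_loc_lip a20 a11 a02 a30 a21 a12 a03 b11 b02 b21 b12 b03 eps :
  loc_lip (cubic_system a20 a11 a02 a30 a21 a12 a03 b11 b02 b21 b12 b03 eps).
Proof.
  apply loc_lip_of_box; intros K HK.
  - apply box_lip_ext with (fun p => p.2 + eps * (a20 * p.1 ^ 2 + a11 * p.1 * p.2 + a02 * p.2 ^ 2
              + a30 * p.1 ^ 3 + a21 * p.1 ^ 2 * p.2 + a12 * p.1 * p.2 ^ 2 + a03 * p.2 ^ 3)).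
    { intros [x y]; reflexivity. }
    repeat first [apply box_lip_plus | apply box_lip_mult | apply box_lip_pow | apply box_lip_const | apply box_lip_fst; exact HK | apply box_lip_snd; exact HK].
  - apply box_lip_ext with (fun p => (-1) * p.1 ^ 3 + eps * (b11 * p.1 * p.2 + b02 * p.2 ^ 2
              + b21 * p.1 ^ 2 * p.2 + b12 * p.1 * p.2 ^ 2 + b03 * p.2 ^ 3)).
    { intros [x y]; simpl; ring. }
    repeat first [apply box_lip_plus | apply box_lip_mult | apply box_lip_pow | apply box_lip_const | apply box_lip_fst; exact HK | apply box_lip_snd; exact HK].
Qed.

(* Differentiates a polynomial (or exponential) expression along a curve, given the velocities of its coordinates. *)
Ltac use_velocity H := match type of H with is_derive ?f ?t ?v =>
  replace (Derive (fun u => f u) t) with v by (symmetry; exact (is_derive_unique _ _ _ H)) end.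
Ltac along Hx Hy :=
  evar_last; [auto_derive; [repeat split; first [exact I | eexists; exact Hx | eexists; exact Hy] | reflexivity]
             | try use_velocity Hx; try use_velocity Hy].

(* Replaces the coordinates of the curve [c], with velocity given by [H1] and [H2], by functions [x] and [y]. *)
Ltac coords c t H1 H2 x y :=
  set (x := fun u : R => (c u).1) in *; set (y := fun u : R => (c u).2) in *;
  change (c t).1 with (x t) in *; change (c t).2 with (y t) in *;
  match type of H1 with is_derive _ _ ?v => change (is_derive x t v) in H1 end;
  match type of H2 with is_derive _ _ ?v => change (is_derive y t v) in H2 end;
  replace (c t) with (x t, y t) in * by (unfold x, y; destruct (c t); reflexivity).

Lemma enorm_small_of_coord (p : R * R) : enorm p <= Rabs p.1 + Rabs p.2.
Proof.
  destruct (enorm_d1 p) as [A _]. unfold d1, origin in A; simpl in A. rewrite !Rminus_0_r in A. exact A.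
Qed.

(** [(x, y) -> (- x, y + m x^3)] is an involution fixing the line [x = 0]; the identity on [X] is
    exactly the statement that it reverses the flow, with [k = 1]. *)
Lemma shear_reversible_center X m d : loc_lip X -> X origin = origin -> 0 < d <= 1 ->
  (forall y, y <> 0 -> Rabs y < d -> 0 < y * (X (0, y)).1) ->
  (forall x y, X (- x, y + m * x ^ 3) = ((X (x, y)).1, - ((X (x, y)).2 + 3 * m * x ^ 2 * (X (x, y)).1))) ->
  monodromic X -> is_center X.
Proof.
  intros HX HX0 Hd Hy Hs. set (K := 2 + Rabs m). absp m. assert (PK : 2 <= K) by (unfold K; lra).
  set (d0 := Rmin d (/ (2 * K))). assert (Pi : 0 < / (2 * K)) by (apply Rinv_0_lt_compat; lra).
  assert (Pd0 : 0 < d0) by (apply Rmin_pos; lra). assert (Ld1 : d0 <= d) by apply Rmin_l. assert (Ld2 : d0 <= / (2 * K)) by apply Rmin_r.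
  apply (reversible_center X (0, 1) (fun p => (- p.1, p.2 + m * p.1 ^ 3)) (fun _ => 1) d0 1 (2 * K)); auto; try lra.
  - apply Rle_trans with (2 * K * / (2 * K)). apply Rmult_le_compat_l; lra. right; field; lra.
  - unfold origin. intros E. inversion E. lra.
  - intros [x y] H' N Hp. pose proof (sqrt_small_coord (x, y)) as [_ E2]. unfold det2 in *; cbn [fst snd] in *. assert (x = 0) by lra. subst x.
    assert (N' : y <> 0) by (intros ->; apply N; reflexivity). specialize (Hy y N' !!). lra.
  - intros c t _ [H1 H2]. cbn [fst snd]. coords c t H1 H2 x y. rewrite Hs. split; cbn [fst snd].
    + apply (is_derive_ext (fun u => - x u)). reflexivity. along H1 H2. eqR. ring.
    + apply (is_derive_ext (fun u => y u + m * x u ^ 3)). reflexivity. along H1 H2. eqR. ring.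
  - intros p _. lra.
  - intros c t _ _ _. apply continuous_const.
  - intros [x y] H' _. unfold det2 in H'; cbn [fst snd] in *. assert (x = 0) by lra. subst x. f_equal; ring.
  - intros [x y] _ H'. unfold det2 in *; cbn [fst snd] in *. lra.
  - intros p Hp. pose proof (sqrt_small_coord p) as [E1 E2]. eapply Rle_trans. apply enorm_small_of_coord. cbn [fst snd]. rewrite Rabs_Ropp.
    pose proof (Rabs_triang p.2 (m * p.1 ^ 3)) as T. rewrite Rabs_mult, <- RPow_abs in T.
    absp p.1. set (z := Rabs p.1) in *. assert (z ^ 3 <= z) by (assert (z <= 1) by lra; nra).
    assert (Rabs m * z ^ 3 <= Rabs m * z) by (apply Rmult_le_compat_l; auto).
    assert (Rabs m * z <= Rabs m * enorm p) by (apply Rmult_le_compat_l; auto). unfold K. nra.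
Qed.

Section Cases.
Variables a20 a11 a02 a30 a21 a12 a03 b11 b02 b21 b12 b03 eps : R.

Lemma hamiltonian_case :
  b11 = - 2 * a20 -> b02 = - a11 / 2 -> b21 = - 3 * a30 -> b03 = - a12 / 3 -> b12 = - a21 ->
  let X := cubic_system a20 a11 a02 a30 a21 a12 a03 b11 b02 b21 b12 b03 eps in monodromic X -> is_center X.
Proof.
  intros -> -> -> -> -> X.
  apply (hamiltonian_center X (fun p => (p.2 ^ 2 / 2 + p.1 ^ 4 / 4 + eps * (a20 * p.1 ^ 2 * p.2
    + a11 * p.1 * p.2 ^ 2 / 2 + a02 * p.2 ^ 3 / 3 + a30 * p.1 ^ 3 * p.2 + a21 * p.1 ^ 2 * p.2 ^ 2 / 2
    + a12 * p.1 * p.2 ^ 3 / 3 + a03 * p.2 ^ 4 / 4)))).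
  { apply cubic_loc_lip. }
  intros c t w [H1 H2]. coords c t H1 H2 x y.
  apply (is_derive_ext (fun u => (y u ^ 2 / 2 + x u ^ 4 / 4 + eps * (a20 * x u ^ 2 * y u
    + a11 * x u * y u ^ 2 / 2 + a02 * y u ^ 3 / 3 + a30 * x u ^ 3 * y u + a21 * x u ^ 2 * y u ^ 2 / 2
    + a12 * x u * y u ^ 3 / 3 + a03 * y u ^ 4 / 4)))). { reflexivity. }
  along H1 H2. unfold X, cubic_system, det2; cbn [fst snd]. eqR. field.
Qed.

Lemma C1_case :
  b02 = 0 -> b11 = 3 * a20 -> b21 = - 3 * a30 -> a02 = 0 -> a12 = 0 -> a21 = 0 -> b03 = 0 -> b12 = 0 -> a11 = 0 -> a03 = 0 ->
  let X := cubic_system a20 a11 a02 a30 a21 a12 a03 b11 b02 b21 b12 b03 eps in monodromic X -> is_center X.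
Proof.
  (* In the first component the reflection turns [eps a30 x^3] into [m x^3 - eps a30 x^3]; equality
     forces this [m]. *)
  intros -> -> -> -> -> -> -> -> -> -> X. apply (shear_reversible_center X (2 * eps * a30) 1); try lra.
  - apply cubic_loc_lip.
  - unfold X, cubic_system, origin. f_equal; ring.
  - intros y N _. assert (0 < y * y) by nra. unfold X, cubic_system; cbn [fst snd].
    match goal with |- 0 < ?g => replace g with (y * y) by ring end. lra.
  - intros x y. unfold X, cubic_system; cbn [fst snd]. f_equal; ring.
Qed.

Lemma C3_case :
  a11 = 0 -> a30 = 0 -> b02 = 0 -> b21 = 0 -> a12 = 0 -> b03 = 0 ->
  let X := cubic_system a20 a11 a02 a30 a21 a12 a03 b11 b02 b21 b12 b03 eps in monodromic X -> is_center X.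
Proof.
  intros -> -> -> -> -> -> X. set (M := 1 + Rabs (eps * a02) + Rabs (eps * a03)).
  assert (PM : 1 <= M) by (unfold M; absp (eps * a02); absp (eps * a03); lra).
  assert (HM : 0 < / (2 * M) <= 1 / 2).
  { split. apply Rinv_0_lt_compat; lra. replace (1 / 2) with (/ 2) by field. apply Rinv_le_contravar; lra. }
  apply (shear_reversible_center X 0 (/ (2 * M))); try lra.
  - apply cubic_loc_lip.
  - unfold X, cubic_system, origin. f_equal; ring.
  - intros y N Hy. assert (0 < y * y) by nra. unfold X, cubic_system; cbn [fst snd].
    assert (Q : Rabs (eps * a02 * y + eps * a03 * y ^ 2) <= M * Rabs y).
    { eapply Rle_trans. apply Rabs_triang. rewrite (Rabs_mult _ y), (Rabs_mult _ (y ^ 2)), <- RPow_abs.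
      absp (eps * a02). absp (eps * a03). absp y. assert (Rabs y ^ 2 <= Rabs y) by nra. unfold M.
      assert (Rabs (eps * a03) * Rabs y ^ 2 <= Rabs (eps * a03) * Rabs y) by (apply Rmult_le_compat_l; auto). nra. }
    assert (J : M * Rabs y < M * / (2 * M)) by (apply Rmult_lt_compat_l; lra).
    replace (M * / (2 * M)) with (1 / 2) in J by (field; lra). absle Q.
    match goal with |- 0 < ?g => replace g with (y * y * (1 + (eps * a02 * y + eps * a03 * y ^ 2))) by ring end. nra.
  - intros x y. unfold X, cubic_system; cbn [fst snd]. f_equal; ring.
Qed.

Lemma C4_case :
  b11 = 0 -> a20 = 0 -> b21 = 0 -> a02 = 0 -> a30 = 0 -> b03 = 0 -> a12 = 0 ->
  let X := cubic_system a20 a11 a02 a30 a21 a12 a03 b11 b02 b21 b12 b03 eps in monodromic X -> is_center X.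
Proof.
  intros -> -> -> -> -> -> -> X.
  apply (reversible_center X (1, 0) (fun p => (p.1, - p.2)) (fun _ => 1) (1 / 2) 1 1); try lra.
  - apply cubic_loc_lip.
  - unfold X, cubic_system, origin. f_equal; ring.
  - unfold origin. intros E. inversion E. lra.
  - intros [x y] H N _. unfold det2 in *; cbn [fst snd] in *. assert (y = 0) by lra. subst y. unfold X, cubic_system.
    assert (x <> 0) by (intros ->; apply N; reflexivity). assert (0 < x * x) by nra. cbn [fst snd].
    match goal with |- ?g < 0 => replace g with (- ((x * x) * (x * x))) by ring end. nra.
  - intros c t _ [H1 H2]. cbn [fst snd]. coords c t H1 H2 x y.
    unfold X, cubic_system in *; cbn [fst snd] in *. split; cbn [fst snd].
    + evar_last. exact H1. eqR. ring.
    + apply (is_derive_ext (fun u => - y u)). reflexivity. along H1 H2. eqR. ring.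
  - intros p _. lra.
  - intros c t _ _ _. apply continuous_const.
  - intros [x y] H _. unfold det2 in H; cbn [fst snd] in *. assert (y = 0) by lra. subst y. f_equal; ring.
  - intros [x y] _ H. unfold det2 in *; cbn [fst snd] in *. lra.
  - intros p _. unfold enorm; cbn [fst snd]. right. rewrite Rmult_1_l. f_equal. ring.
Qed.
End Cases.

(** The Lipschitz bound makes the increments [dv] of the inverse small and, as [h] recovers the
    argument, nonzero; its difference quotient is then the reciprocal of that of [h]. *)
Lemma inverse_derive (h dh k : R -> R) (a b m w0 : R) : 0 < m -> a < w0 < b ->
  (forall y, a <= y <= b -> h (k y) = y) ->
  (forall y y', a <= y <= b -> a <= y' <= b -> m * Rabs (k y - k y') <= Rabs (y - y')) ->
  is_derive h (k w0) (dh (k w0)) -> m <= dh (k w0) -> is_derive k w0 (/ dh (k w0)).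
Proof.
  intros Hm Hw Hk Hl Hd Hdm. set (v0 := k w0) in *. set (D := dh v0) in *.
  apply is_derive_Reals in Hd. apply is_derive_Reals. intros e Pe.
  destruct (Hd (e * (m * m))) as [d Hdd]. { apply Rmult_lt_0_compat; auto. nra. }
  assert (Pd := cond_pos d). set (eta := Rmin (m * d) (Rmin (w0 - a) (b - w0))).
  assert (Peta : 0 < eta). { unfold eta. repeat apply Rmin_pos; try lra. apply Rmult_lt_0_compat; auto. }
  assert (L1 : eta <= m * d) by apply Rmin_l.
  assert (L2 : eta <= w0 - a). { unfold eta. eapply Rle_trans. apply Rmin_r. apply Rmin_l. }
  assert (L3 : eta <= b - w0). { unfold eta. eapply Rle_trans. apply Rmin_r. apply Rmin_r. }
  exists (mkposreal eta Peta). simpl. intros t Ht Hte. apply Rabs_def2 in Hte. set (dv := k (w0 + t) - v0).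
  assert (HL : m * Rabs dv <= Rabs t).
  { unfold dv, v0. replace (Rabs t) with (Rabs (w0 + t - w0)) by (f_equal; ring). apply Hl; lra. }
  assert (E : h (v0 + dv) - h v0 = t).
  { unfold dv. replace (v0 + (k (w0 + t) - v0)) with (k (w0 + t)) by ring. unfold v0. rewrite !Hk; lra. }
  assert (N : dv <> 0). { intros Z. rewrite Z, Rplus_0_r in E. lra. }
  assert (PT : 0 < Rabs t) by (apply Rabs_pos_lt; auto). assert (PV : 0 < Rabs dv) by (apply Rabs_pos_lt; auto).
  specialize (Hdd dv N). rewrite E in Hdd.
  assert (Rabs dv < d). { apply Rmult_lt_reg_l with m; auto. assert (Rabs t < eta) by (apply Rabs_def1; lra). lra. }
  specialize (Hdd H). change (Rabs (dv / t - / D) < e).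
  replace (dv / t - / D) with ((t / dv - D) * - (dv / t * / D)) by (field; repeat split; auto; lra).
  rewrite Rabs_mult, Rabs_Ropp, Rabs_mult. assert (J1 : Rabs (dv / t) <= / m).
  { unfold Rdiv. rewrite Rabs_mult, Rabs_inv. apply Rmult_le_reg_r with (m * Rabs t). apply Rmult_lt_0_compat; auto.
    field_simplify; lra. }
  assert (J2 : Rabs (/ D) <= / m). { rewrite Rabs_pos_eq. apply Rinv_le_contravar; auto. left; apply Rinv_0_lt_compat; lra. }
  assert (Pm : 0 < / m) by (apply Rinv_0_lt_compat; auto).
  assert (J3 : Rabs (dv / t) * Rabs (/ D) <= / m * / m) by (apply Rmult_le_compat; auto; apply Rabs_pos).
  apply Rle_lt_trans with (Rabs (t / dv - D) * (/ m * / m)). apply Rmult_le_compat_l; auto. apply Rabs_pos.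
  apply Rlt_le_trans with (e * (m * m) * (/ m * / m)). apply Rmult_lt_compat_r; auto. apply Rmult_lt_0_compat; auto.
  right; field; lra.
Qed.

Lemma exp_third (x : R) : Rabs x <= 1 / 3 -> 1 / 3 <= exp x <= 3.
Proof.
  intros H. absle H. assert (E3 := exp_le_3). assert (G : forall y, y <= 1 -> exp y <= 3).
  { intros y Hy. destruct (Req_dec y 1) as [->|N]; auto. assert (exp y < exp 1) by (apply exp_increasing; lra). lra. }
  split; [|apply G; lra]. assert (exp (- x) <= 3) by (apply G; lra).
  assert (P := exp_pos (- x)). assert (Q := exp_pos x).
  assert (exp x * exp (- x) = 1). { rewrite <- exp_plus. replace (x + - x) with 0 by ring. apply exp_0. }
  nra.
Qed.

Section C2.
Variables b11 a11 a21 eps : R.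
Let be := eps * b11.
Let qf (x : R) := eps * (a11 + a21 * x).
Let pf (x : R) := 1 + x * qf x.

(** With [h' = qf / pf] the variables [u = x exp (- h)] and [w = y exp (- 2 h)] satisfy
    [u' = exp h * w] and [w' = exp h * (- u^3 + be u w)]: up to a time change a system symmetric
    under [u -> - u]. Here [rho] is this symmetry written in the variable [x]. *)
Lemma C2_data : exists (r : R) (h rho : R -> R), 0 < r /\
  (forall x, Rabs x <= r -> is_derive h x (qf x / pf x) /\ / 2 <= pf x /\ Rabs (h x) <= 1 / 6) /\
  (forall x, Rabs x <= r / 9 -> Rabs (rho x) <= r /\ Rabs (rho x) <= 9 * Rabs x /\
     rho x * exp (- h (rho x)) = - (x * exp (- h x))) /\
  (forall x, Rabs x < r / 9 -> is_derive rho x (- (exp (h (rho x) - h x) * pf (rho x) / pf x))).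
Proof.
  (* [r = 1 / (8 (M + 1))] gives [|x qf x| <= 1/8], so [pf] is near 1 and [|h| <= 1/6]. Then [u]
     lies between [|x| / 3] and [3 |x|] in absolute value, whence the radius [r / 9] and the factor
     9 for [rho]. *)
  set (M := Rabs (eps * a11) + Rabs (eps * a21)).
  assert (PM : 0 <= M) by (unfold M; absp (eps * a11); absp (eps * a21); lra). set (r := / (8 * (M + 1))).
  assert (Pr : 0 < r <= 1 / 8). { unfold r. split. apply Rinv_0_lt_compat; lra. replace (1 / 8) with (/ 8) by field. apply Rinv_le_contravar; lra. }
  assert (Er : r * (M + 1) = 1 / 8) by (unfold r; field; lra). assert (HMr : M * r <= 1 / 8) by nra.
  assert (BQ : forall x, Rabs x <= r -> Rabs (qf x) <= M).
  { intros x Hx. unfold qf. replace (eps * (a11 + a21 * x)) with (eps * a11 + eps * a21 * x) by ring.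
    eapply Rle_trans. apply Rabs_triang. rewrite (Rabs_mult _ x). absp (eps * a21). unfold M.
    assert (Rabs (eps * a21) * Rabs x <= Rabs (eps * a21) * 1) by (apply Rmult_le_compat_l; lra). lra. }
  assert (BP : forall x, Rabs x <= r -> 7 / 8 <= pf x <= 9 / 8).
  { intros x Hx. unfold pf. assert (Rabs (x * qf x) <= r * M). { rewrite Rabs_mult. apply Rmult_le_compat; auto; apply Rabs_pos. }
    absle H. lra. }
  assert (BF : forall x, Rabs x <= r -> Rabs (qf x / pf x) <= 8 / 7 * M).
  { intros x Hx. specialize (BQ x Hx). specialize (BP x Hx). unfold Rdiv at 1. rewrite Rabs_mult, (Rabs_pos_eq (/ pf x)) by (left; apply Rinv_0_lt_compat; lra).
    assert (/ pf x <= 8 / 7). { replace (8 / 7) with (/ (7 / 8)) by field. apply Rinv_le_contravar; lra. }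
    rewrite Rmult_comm. apply Rmult_le_compat; auto. left; apply Rinv_0_lt_compat; lra. apply Rabs_pos. }
  assert (QC : forall x, continuous qf x). { intros x. apply (ex_derive_continuous qf). unfold qf. auto_derive; auto. }
  assert (PC : forall x, continuous pf x). { intros x. apply (ex_derive_continuous pf). unfold pf, qf. auto_derive; auto. }
  set (f := fun x => qf (proj (- r) r x) / pf (proj (- r) r x)). assert (FC : forall x, continuous f x).
  { apply (frozen_cont (fun x => qf x / pf x)). lra. intros x Hx. apply (continuous_multR qf (fun x => / pf x)); auto.
    apply continuous_invR; auto. assert (Rabs x <= r) by (apply Rabs_le; lra). specialize (BP x H). lra. }
  assert (FE : forall x, Rabs x <= r -> f x = qf x / pf x).
  { intros x Hx. unfold f. rewrite proj_id; auto. absle Hx. lra. }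
  set (h := fun x => RInt f 0 x).
  assert (Dh : forall x, is_derive h x (f x)) by (intros; apply (RInt_deriv f 0); auto).
  assert (Bh : forall x, Rabs x <= r -> Rabs (h x) <= 1 / 6).
  { intros x Hx. assert (G : Rabs (RInt f 0 x) <= 8 / 7 * M * Rabs (x - 0)).
    { apply RInt_bounded; auto. intros u Hu. unfold f. apply BF. apply Rabs_le. apply proj_in. lra. }
    fold (h x) in G. rewrite Rminus_0_r in G. eapply Rle_trans. apply G.
    assert (8 / 7 * M * Rabs x <= 8 / 7 * M * r) by (apply Rmult_le_compat_l; lra). lra. }
  set (u := fun x => x * exp (- h x)). set (du := fun x => exp (- h x) * (1 - x * f x)).
  assert (Du : forall x, is_derive u x (du x)).
  { intros x. unfold u. evar_last. auto_derive. exists (f x); apply Dh. reflexivity.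
    replace (Derive (fun u => h u) x) with (f x) by (symmetry; exact (is_derive_unique _ _ _ (Dh x))). unfold du. eqR. ring. }
  assert (Xf : forall x, Rabs x <= r -> 1 - x * f x = / pf x).
  { intros x Hx. rewrite FE by auto. specialize (BP x Hx). unfold pf in *. field. lra. }
  assert (Bu : forall x, Rabs x <= r -> 1 / 3 * (8 / 9) <= du x <= 3 * (8 / 7)).
  { intros x Hx. unfold du. rewrite Xf by auto. specialize (BP x Hx).
    assert (E := exp_third (- h x)). rewrite Rabs_Ropp in E. specialize (Bh x Hx). specialize (E !!).
    assert (8 / 9 <= / pf x). { replace (8 / 9) with (/ (9 / 8)) by field. apply Rinv_le_contravar; lra. }
    assert (/ pf x <= 8 / 7). { replace (8 / 7) with (/ (7 / 8)) by field. apply Rinv_le_contravar; lra. }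
    split; apply Rmult_le_compat; lra. }
  assert (Bux : forall x, Rabs x <= r -> Rabs x * (1 / 3) <= Rabs (u x) <= 3 * Rabs x).
  { intros x Hx. unfold u. rewrite Rabs_mult, (Rabs_pos_eq (exp _)) by (left; apply exp_pos).
    assert (E := exp_third (- h x)). rewrite Rabs_Ropp in E. specialize (Bh x Hx). specialize (E !!). absp x. nra. }
  destruct (inverse_fun u du (- r) r (8 / 27)) as [k [K1 K2]]; try lra.
  { intros v _. apply Du. } { intros v Hv. assert (Rabs v <= r) by (apply Rabs_le; lra). specialize (Bu v H). lra. }
  assert (Ur : r / 3 <= u r). { unfold u. assert (Rabs r <= r) by (rewrite Rabs_pos_eq; lra). assert (E := exp_third (- h r)). rewrite Rabs_Ropp in E. specialize (Bh r H). specialize (E !!). nra. }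
  assert (Ur' : u (- r) <= - (r / 3)). { unfold u. assert (Rabs (- r) <= r) by (rewrite Rabs_Ropp, Rabs_pos_eq; lra). assert (E := exp_third (- h (- r))). rewrite Rabs_Ropp in E. specialize (Bh (- r) H). specialize (E !!). nra. }
  set (rho := fun x => k (- u x)). assert (IN : forall x, Rabs x < r / 9 -> u (- r) < - u x < u r).
  { intros x Hx. destruct (Bux x !!) as [_ G]. assert (Rabs (u x) < r / 3) by lra. apply Rabs_def2 in H. lra. }
  assert (IN' : forall x, Rabs x <= r / 9 -> u (- r) <= - u x <= u r).
  { intros x Hx. destruct (Bux x !!) as [_ G]. assert (Rabs (u x) <= r / 3) by lra. absle H. lra. }
  assert (RR : forall x, Rabs x <= r / 9 -> Rabs (rho x) <= r /\ Rabs (rho x) <= 9 * Rabs x /\ u (rho x) = - u x).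
  { intros x Hx. destruct (K1 (- u x) (IN' x Hx)) as [A1 A2]. fold (rho x) in A1, A2.
    assert (Q : Rabs (rho x) <= r) by (apply Rabs_le; lra). split; auto. split; auto.
    destruct (Bux x !!) as [_ G]. destruct (Bux (rho x) Q) as [G' _]. rewrite A2, Rabs_Ropp in G'. lra. }
  exists r, h, rho. split; [lra|]. split; [|split].
  - intros x Hx. split. rewrite <- FE by auto. apply Dh. specialize (BP x Hx). split; [lra|]. apply Bh; auto.
  - exact RR.
  - intros x Hx. destruct (RR x !!) as [R1 [R2 R3]]. assert (DK : is_derive k (- u x) (/ du (rho x))).
    { apply (inverse_derive u du k (u (- r)) (u r) (8 / 27)); try lra.
      apply IN; auto. intros; apply K1; auto. auto. apply Du. specialize (Bu (rho x) R1). unfold rho in Bu. lra. }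
    assert (DR : is_derive rho x (- du x * / du (rho x))).
    { apply (is_derive_comp k (fun x => - u x)). exact DK. apply (is_derive_opp u). apply Du. }
    evar_last. exact DR. unfold du. rewrite !Xf by (auto; lra). pose proof (BP x !!). pose proof (BP (rho x) R1).
    replace (h (rho x) - h x) with (h (rho x) + - h x) by ring. rewrite exp_plus, (exp_Ropp (h (rho x))).
    pose proof (exp_pos (h (rho x))). eqR. field. repeat split; lra.
Qed.

(** [Rv] is the reflection [(u, w) -> (- u, w)] in the original variables, and [kf] is the quotient
    of the two time factors [exp h]. *)
Lemma C2_case :
  let X := cubic_system 0 a11 0 0 a21 0 0 b11 (2 * a11) 0 (2 * a21) 0 eps in monodromic X -> is_center X.
Proof.
  intros X. destruct C2_data as [r [h [rho [Pr [H1 [H2 H3]]]]]].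
  set (kf := fun p : R * R => exp (h p.1 - h (rho p.1))).
  set (Rv := fun p : R * R => (rho p.1, p.2 * exp (2 * (h (rho p.1) - h p.1)))). set (d0 := Rmin (r / 9) (1 / 24)).
  assert (Pd0 : 0 < d0) by (apply Rmin_pos; lra). assert (Ld1 : d0 <= r / 9) by apply Rmin_l. assert (Ld2 : d0 <= 1 / 24) by apply Rmin_r.
  assert (XE : forall p, X p = (p.2 * pf p.1, - p.1 ^ 3 + be * p.1 * p.2 + 2 * p.2 ^ 2 * qf p.1)).
  { intros [x y]. unfold X, cubic_system, pf, qf, be; cbn [fst snd]. f_equal; ring. }
  assert (SM : forall p, enorm p < d0 -> Rabs p.1 < r / 9). { intros p Hp. destruct (sqrt_small_coord p). lra. }
  assert (EH : forall x, Rabs x < r / 9 -> Rabs (h x - h (rho x)) <= 1 / 3 /\ Rabs (h (rho x) - h x) <= 1 / 3).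
  { intros x Hx. destruct (H1 x !!) as [_ [_ B1]]. destruct (H2 x !!) as [R1 _]. destruct (H1 (rho x) R1) as [_ [_ B2]].
    absle B1. absle B2. split; apply Rabs_le; lra. }
  assert (EB : forall p, enorm p < d0 -> enorm (Rv p) <= 18 * enorm p).
  { intros p Hp. specialize (SM p Hp). destruct (sqrt_small_coord p) as [S1 S2].
    eapply Rle_trans. apply enorm_small_of_coord. unfold Rv; cbn [fst snd]. destruct (H2 p.1 !!) as [_ [R2 _]].
    destruct (EH _ SM) as [_ E2]. rewrite Rabs_mult. rewrite (Rabs_pos_eq (exp _)) by (left; apply exp_pos).
    replace (2 * (h (rho p.1) - h p.1)) with ((h (rho p.1) - h p.1) + (h (rho p.1) - h p.1)) by ring.
    rewrite exp_plus. apply exp_third in E2. absp p.2. set (E := exp _) in *.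
    assert (E * E <= 9) by nra. assert (Rabs p.2 * (E * E) <= Rabs p.2 * 9) by (apply Rmult_le_compat_l; auto). lra. }
  apply (reversible_center X (0, 1) Rv kf d0 3 18); try lra.
  - apply cubic_loc_lip.
  - rewrite XE. unfold origin; cbn [fst snd]. f_equal; ring.
  - unfold origin. intros E. inversion E. lra.
  - intros [x y] H N _. rewrite XE. unfold det2 in *; cbn [fst snd] in *. assert (x = 0) by lra. subst x.
    assert (y <> 0) by (intros ->; apply N; reflexivity). assert (0 < y * y) by nra. unfold pf.
    match goal with |- ?g < 0 => replace g with (- (y * y)) by ring end. lra.
  - intros c t Hs [V1 V2]. rewrite XE in *. cbn [fst snd] in *.
    pose proof (SM _ Hs) as Sx. coords c t V1 V2 x y.
    destruct (H2 (x t) !!) as [R1 [R2 R3]].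
    destruct (H1 (x t) !!) as [Dh [Pp _]]. destruct (H1 (rho (x t)) R1) as [Dhr [Ppr _]].
    pose proof (H3 (x t) Sx) as Drho.
    assert (DX : is_derive (fun u => rho (x u)) t (- (exp (h (rho (x t)) - h (x t)) * pf (rho (x t)) / pf (x t)) * (y t * pf (x t)))).
    { evar_last. apply (is_derive_comp rho x). exact Drho. exact V1. unfold scal; simpl; unfold mult; simpl. eqR. ring. }
    assert (D1 : is_derive (fun u => h (rho (x u))) t (qf (rho (x t)) / pf (rho (x t)) * (- (exp (h (rho (x t)) - h (x t)) * pf (rho (x t)) / pf (x t)) * (y t * pf (x t))))).
    { evar_last. apply (is_derive_comp h (fun u => rho (x u))). exact Dhr. exact DX. unfold scal; simpl; unfold mult; simpl. eqR. ring. }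
    assert (D2 : is_derive (fun u => h (x u)) t (qf (x t) / pf (x t) * (y t * pf (x t)))).
    { evar_last. apply (is_derive_comp h x). exact Dh. exact V1. unfold scal; simpl; unfold mult; simpl. eqR. ring. }
    set (hr := fun u => h (rho (x u))) in *. set (hx := fun u => h (x u)) in *.
    match type of D1 with is_derive _ _ ?v => change (is_derive hr t v) in D1 end.
    match type of D2 with is_derive _ _ ?v => change (is_derive hx t v) in D2 end.
    assert (E1 : exp (h (rho (x t)) - h (x t)) * exp (h (x t) - h (rho (x t))) = 1).
    { rewrite <- exp_plus. replace (_ + _) with 0 by ring. apply exp_0. }
    assert (E2 : exp (2 * (h (rho (x t)) - h (x t))) = exp (h (rho (x t)) - h (x t)) * exp (h (rho (x t)) - h (x t))).
    { rewrite <- exp_plus. f_equal. ring. }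
    assert (E3 : x t = - (rho (x t) * exp (h (x t) - h (rho (x t))))).
    { unfold Rminus. rewrite exp_plus. rewrite <- (Ropp_involutive (x t)) at 1. f_equal.
      apply Rmult_eq_reg_r with (exp (- h (x t))). 2:{ pose proof (exp_pos (- h (x t))). lra. }
      rewrite Rmult_comm, <- Ropp_mult_distr_r, Rmult_comm, <- R3.
      rewrite (exp_Ropp (h (x t))). pose proof (exp_pos (h (x t))). field. lra. }
    unfold kf, Rv; cbn [fst snd]. split; cbn [fst snd].
    + apply (is_derive_ext (fun u => rho (x u))). reflexivity. evar_last. exact DX. eqR.
      rewrite E2. set (F := exp (h (rho (x t)) - h (x t))) in *. set (G := exp (h (x t) - h (rho (x t)))) in *.
      transitivity (- (F * pf (rho (x t)) * y t)). field; lra.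
      transitivity (- (F * (F * G) * pf (rho (x t)) * y t)). rewrite E1; ring. ring.
    + apply (is_derive_ext (fun u => y u * exp (2 * (hr u - hx u)))). reflexivity.
      evar_last. auto_derive. repeat split; eexists; eassumption. reflexivity.
      use_velocity V2; use_velocity D1; use_velocity D2.
      change (hr t) with (h (rho (x t))). change (hx t) with (h (x t)). eqR.
      replace (h (rho (x t)) + - h (x t)) with (h (rho (x t)) - h (x t)) by ring.
      rewrite E2. set (F := exp (h (rho (x t)) - h (x t))) in *. set (G := exp (h (x t) - h (rho (x t)))) in *.
      set (z := rho (x t)) in *.
      transitivity (F * F * (- x t ^ 3 + be * x t * y t - 2 * y t ^ 2 * qf z * F)). field; lra.
      assert (E4 : x t = - (z * G)) by exact E3. rewrite E4.
      transitivity (z ^ 3 * G * ((F * G) ^ 2) - be * z * y t * F * (F * G) - 2 * y t ^ 2 * qf z * F ^ 3). ring.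
      transitivity (z ^ 3 * G - be * z * y t * F * (F * G) - 2 * y t ^ 2 * qf z * F ^ 3 * (F * G)). rewrite E1; ring. ring.
  - intros p Hp. unfold kf. destruct (EH _ (SM p Hp)) as [A _]. apply exp_third in A. lra.
  - intros c t Hs C1 C2. unfold kf. set (x := fun u => (c u).1) in *. pose proof (SM _ Hs) as Sx. change (c t).1 with (x t) in Sx.
    destruct (H2 (x t) !!) as [R1 _]. destruct (H1 (x t) !!) as [Dh _]. destruct (H1 (rho (x t)) R1) as [Dhr _]. pose proof (H3 (x t) Sx) as Drho.
    apply (continuous_comp x (fun z => exp (h z - h (rho z)))). exact C1.
    apply (continuous_comp (fun z => h z - h (rho z)) exp). 2:{ apply (ex_derive_continuous exp). auto_derive; auto. }
    apply continuous_minusR. eapply is_derive_cont; eauto.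
    apply (continuous_comp rho h). eapply is_derive_cont; exact Drho. eapply is_derive_cont; exact Dhr.
  - intros p H Hs. unfold det2 in H; cbn [fst snd] in H. assert (Z : p.1 = 0) by lra. unfold Rv. rewrite Z.
    destruct (H2 0) as [_ [R2 _]]. rewrite Rabs_R0; lra. rewrite Rabs_R0 in R2.
    assert (rho 0 = 0). { destruct (Req_dec (rho 0) 0); auto. apply Rabs_pos_lt in H0. lra. }
    rewrite H0. replace (2 * (h 0 - h 0)) with 0 by ring. rewrite exp_0. destruct p as [px py]; simpl in *; subst; f_equal; ring.
  - intros p Hs H. unfold det2, Rv in *; cbn [fst snd] in *. intros Z. apply H.
    pose proof (SM _ Hs) as Sx. destruct (H2 p.1 !!) as [_ [_ R3]].
    assert (rho p.1 = 0) by lra. rewrite H0 in R3. pose proof (exp_pos (- h p.1)).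
    assert (p.1 * exp (- h p.1) = 0) by lra. apply Rmult_integral in H5. destruct H5; lra.
  - exact EB.
Qed.
End C2.

(** * Monodromy for small coefficients *)

(** The speed bound is known only while [f] is within 1/2 of 1. As [k T < 1/2], the bound
    [|f - 1| <= k t] that it implies never lets [f] reach the limit of that range. *)
Lemma bootstrap (f df : R -> R) (T k : R) : 0 <= T -> (forall t, 0 <= t <= T -> is_derive f t (df t)) -> f 0 = 1 -> 0 <= k ->
  k * T < 1 / 2 -> (forall t, 0 <= t <= T -> Rabs (f t - 1) <= 1 / 2 -> Rabs (df t) <= k) ->
  forall t, 0 <= t <= T -> Rabs (f t - 1) <= 1 / 2.
Proof.
  intros HT Hd H0 Hk HkT Hb t Ht. enough (G : Rabs (f 0 - 1) <= k * 0 -> Rabs (f t - 1) <= k * t).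
  { rewrite H0, Rminus_diag, Rabs_R0 in G. specialize (G !!). nra. }
  apply (segment_induction (fun x y => Rabs (f x - 1) <= k * x -> Rabs (f y - 1) <= k * y) 0 t). lra. auto.
  intros x Hx. pose proof (is_derive_cont _ _ _ (Hd x !!)) as Cx.
  destruct (Rlt_le_dec (Rabs (f x - 1)) (1 / 2)) as [Q|Q].
  - destruct (cont_near f x (1 / 2 - Rabs (f x - 1)) Cx) as [d [Pd Hdd]]. lra.
    exists d. split; auto. intros y z A1 A2 A3 A4 A5 A6 B. destruct (mvt_between f df y z) as [c [Hc E]].
    { intros u. rewrite Rmin_left, Rmax_right by lra. intros Hu. apply Hd. lra. }
    rewrite Rmin_left, Rmax_right in Hc by lra. assert (Bc : Rabs (df c) <= k).
    { apply Hb. lra. specialize (Hdd c ltac:(apply Rabs_def1; lra)).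
      pose proof (Rabs_triang (f c - f x) (f x - 1)) as Tr. replace (f c - f x + (f x - 1)) with (f c - 1) in Tr by ring. lra. }
    pose proof (Rabs_triang (f z - f y) (f y - 1)) as Tr. replace (f z - f y + (f y - 1)) with (f z - 1) in Tr by ring.
    rewrite E, Rabs_mult, (Rabs_pos_eq (z - y)) in Tr by lra.
    assert (Rabs (df c) * (z - y) <= k * (z - y)) by (apply Rmult_le_compat_r; lra). lra.
  - assert (KT : forall u, u <= t -> k * u <= k * T) by (intros; apply Rmult_le_compat_l; lra).
    destruct (cont_near f x (1 / 2 - k * T) Cx) as [d [Pd Hdd]]. lra.
    exists d. split; auto. intros y z A1 A2 A3 A4 A5 A6 B. exfalso.
    specialize (Hdd y ltac:(apply Rabs_def1; lra)). specialize (KT y !!).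
    pose proof (Rabs_triang (f x - f y) (f y - 1)) as Tr. replace (f x - f y + (f y - 1)) with (f x - 1) in Tr by ring.
    rewrite Rabs_minus_sym in Hdd. lra.
Qed.

Lemma abs_mult_le (u v A B : R) : Rabs u <= A -> Rabs v <= B -> Rabs (u * v) <= A * B.
Proof. intros. rewrite Rabs_mult. apply Rmult_le_compat; auto; apply Rabs_pos. Qed.

Lemma abs_mult_between (u v A B : R) : Rabs u <= A -> Rabs v <= B -> - (A * B) <= u * v <= A * B.
Proof. intros. apply Rabs_le_between, abs_mult_le; auto. Qed.

Definition small_coefs eta (a20 a11 a02 a30 a21 a12 a03 b11 b02 b21 b12 b03 : R) : Prop :=
  (Rabs a20 <= eta /\ Rabs a11 <= eta /\ Rabs a02 <= eta /\ Rabs a30 <= eta /\ Rabs a21 <= eta /\ Rabs a12 <= eta /\ Rabs a03 <= eta) /\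
  (Rabs b11 <= eta /\ Rabs b02 <= eta /\ Rabs b21 <= eta /\ Rabs b12 <= eta /\ Rabs b03 <= eta).

(* The conclusion concerns the region [|x^4 + 2 y^2 - 1| <= 1/2], which the orbit of (1,0) does not leave before one turn. *)
Lemma annulus_bounds a20 a11 a02 a30 a21 a12 a03 b11 b02 b21 b12 b03 x y :
  small_coefs (/ 40000) a20 a11 a02 a30 a21 a12 a03 b11 b02 b21 b12 b03 -> Rabs (x ^ 4 + 2 * y ^ 2 - 1) <= 1 / 2 ->
  let X := cubic_system a20 a11 a02 a30 a21 a12 a03 b11 b02 b21 b12 b03 1 (x, y) in
  Rabs x <= 6 / 5 /\ Rabs y <= 1 /\ Rabs (4 * x ^ 3 * X.1 + 4 * y * X.2) <= 3 / 1000 /\ det2 (x, y) X <= - (1 / 5).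
Proof.
  intros [[A1 [A2 [A3 [A4 [A5 [A6 A7]]]]]] [B1 [B2 [B3 [B4 B5]]]]] HV X. absle HV. assert (Hx : Rabs x <= 6 / 5).
  { assert (x ^ 4 <= 3 / 2) by nra. apply Rabs_le. assert (x ^ 2 <= 36 / 25) by nra. nra. }
  assert (Hy : Rabs y <= 1). { assert (y ^ 2 <= 3 / 4) by nra. apply Rabs_le. nra. }
  split; auto. split; auto.
  assert (M2 : Rabs (x ^ 2) <= 36 / 25) by (replace (x ^ 2) with (x * x) by ring; replace (36 / 25) with (6 / 5 * (6 / 5)) by field; apply abs_mult_le; auto).
  assert (M11 : Rabs (x * y) <= 6 / 5) by (replace (6 / 5) with (6 / 5 * 1) by ring; apply abs_mult_le; auto).
  assert (M02 : Rabs (y ^ 2) <= 1) by (replace (y ^ 2) with (y * y) by ring; replace 1 with (1 * 1) by ring; apply abs_mult_le; auto).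
  assert (M3 : Rabs (x ^ 3) <= 216 / 125) by (replace (x ^ 3) with (x * x ^ 2) by ring; replace (216 / 125) with (6 / 5 * (36 / 25)) by field; apply abs_mult_le; auto).
  assert (M21 : Rabs (x ^ 2 * y) <= 36 / 25) by (replace (36 / 25) with (36 / 25 * 1) by ring; apply abs_mult_le; auto).
  assert (M12 : Rabs (x * y ^ 2) <= 6 / 5) by (replace (6 / 5) with (6 / 5 * 1) by ring; apply abs_mult_le; auto).
  assert (M03 : Rabs (y ^ 3) <= 1) by (replace (y ^ 3) with (y * y ^ 2) by ring; replace 1 with (1 * 1) by ring; apply abs_mult_le; auto).
  pose proof (abs_mult_between _ _ _ _ A1 M2). pose proof (abs_mult_between _ _ _ _ A2 M11). pose proof (abs_mult_between _ _ _ _ A3 M02).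
  pose proof (abs_mult_between _ _ _ _ A4 M3). pose proof (abs_mult_between _ _ _ _ A5 M21). pose proof (abs_mult_between _ _ _ _ A6 M12).
  pose proof (abs_mult_between _ _ _ _ A7 M03). pose proof (abs_mult_between _ _ _ _ B1 M11). pose proof (abs_mult_between _ _ _ _ B2 M02).
  pose proof (abs_mult_between _ _ _ _ B3 M21). pose proof (abs_mult_between _ _ _ _ B4 M12). pose proof (abs_mult_between _ _ _ _ B5 M03).
  set (p := X.1 - y). set (q := X.2 + x ^ 3).
  (* The bounds of the seven monomials add up to less than 10, those of the five monomials in [q] to
     less than 7. *)
  assert (Hp : Rabs p <= 10 / 40000). { unfold p, X, cubic_system; cbn [fst snd]. apply Rabs_le. split; lra. }
  assert (Hq : Rabs q <= 7 / 40000). { unfold q, X, cubic_system; cbn [fst snd]. apply Rabs_le. split; lra. }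
  replace X.1 with (y + p) by (unfold p; ring).
  assert (ED : det2 (x, y) X = - (x ^ 4 + 2 * y ^ 2) / 2 - x ^ 4 / 2 + (x * q - y * p)).
  { unfold det2, p, q; cbn [fst snd]. field. }
  replace X.2 with (- x ^ 3 + q) by (unfold q; ring).
  pose proof (abs_mult_between _ _ _ _ M3 Hp). pose proof (abs_mult_between _ _ _ _ Hy Hq).
  pose proof (abs_mult_between _ _ _ _ Hy Hp). pose proof (abs_mult_between _ _ _ _ Hx Hq). split.
  - replace (4 * x ^ 3 * (y + p) + 4 * y * (- x ^ 3 + q)) with (4 * (x ^ 3 * p) + 4 * (y * q)) by ring. apply Rabs_le. split; lra.
  - rewrite ED. assert (0 <= x ^ 4) by (replace (x ^ 4) with ((x ^ 2) ^ 2) by ring; apply pow2_ge_0). lra.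
Qed.

(** For the unperturbed leading system [x^4 + 2 y^2] is constant; with small coefficients it drifts
    slowly, and the orbit of [(1, 0)] completes a turn before it has drifted far. *)
Lemma full_turn a20 a11 a02 a30 a21 a12 a03 b11 b02 b21 b12 b03 :
  small_coefs (/ 40000) a20 a11 a02 a30 a21 a12 a03 b11 b02 b21 b12 b03 ->
  let X := cubic_system a20 a11 a02 a30 a21 a12 a03 b11 b02 b21 b12 b03 1 in
  exists T c th, 0 < T /\ c 0 = (1, 0) /\ solution_on X (fun t => 0 <= t <= T) c /\
    (forall t, 0 <= t <= T -> Rabs (c t).1 <= 6 / 5 /\ Rabs (c t).2 <= 1 /\ c t <> origin /\ polar (c t) (th t)) /\
    (forall t, continuous th t) /\ th 0 = 0 /\ th T = - (2 * PI) /\ forall t, 0 < t < T -> - (2 * PI) < th t < 0.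
Proof.
  intros HC X. pose proof PI_RGT_0 as HPI. pose proof PI_4 as HPI4.
  destruct (clipped_glip 2 X !! (cubic_loc_lip _ _ _ _ _ _ _ _ _ _ _ _ _)) as [L [B HY]].
  set (Y := clipped 2 X) in *. set (c := fun t => flow Y t (1, 0)).
  set (x := fun t => (c t).1). set (y := fun t => (c t).2).
  set (V := fun t => x t ^ 4 + 2 * y t ^ 2). set (dV := fun t => 4 * x t ^ 3 * (Y (c t)).1 + 4 * y t * (Y (c t)).2).
  assert (c0 : c 0 = (1, 0)) by (apply (flow_0 L B); auto).
  assert (Dx : forall t, is_derive x t (Y (c t)).1) by (intros; apply (flow_sol L B); auto).
  assert (Dy : forall t, is_derive y t (Y (c t)).2) by (intros; apply (flow_sol L B); auto).
  assert (DV : forall t, is_derive V t (dV t)).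
  { intros t. unfold V. pose proof (Dx t) as D1. pose proof (Dy t) as D2. along D1 D2. unfold dV. eqR. ring. }
  assert (AB : forall t, Rabs (V t - 1) <= 1 / 2 -> Y (c t) = X (c t) /\ Rabs (x t) <= 6 / 5 /\ Rabs (y t) <= 1 /\ Rabs (dV t) <= 3 / 1000 /\ det2 (c t) (X (c t)) <= - (1 / 5)).
  { intros t Ht. destruct (annulus_bounds _ _ _ _ _ _ _ _ _ _ _ _ (x t) (y t) HC Ht) as [E1 [E2 [E3 E4]]]. fold X in E3, E4.
    replace (x t, y t) with (c t) in E3, E4 by (unfold x, y; destruct (c t); auto).
    assert (EY : Y (c t) = X (c t)). { apply clipped_in. split. change (Rabs (x t) <= 2); lra. change (Rabs (y t) <= 2); lra. }
    split; auto. split; auto. split; auto. split; auto. unfold dV. rewrite EY. exact E3. }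
  (* Within time 160 the drift is at most [160 * 3 / 1000 < 1/2]. In the annulus the angle decreases
     at a rate of at least [1/13], which over this time exceeds [2 * PI]. *)
  assert (BV : forall t, 0 <= t <= 160 -> Rabs (V t - 1) <= 1 / 2).
  { apply (bootstrap V dV 160 (3 / 1000)); try lra; auto.
    - unfold V, x, y. rewrite c0. cbn [fst snd]. ring.
    - intros t _ Ht. apply AB; auto. }
  assert (NZ : forall t, 0 <= t <= 160 -> c t <> origin).
  { intros t Ht E. specialize (BV t Ht). unfold V, x, y in BV. rewrite E in BV. unfold origin in BV; cbn [fst snd] in BV. absle BV. lra. }
  destruct (smooth_lift_rate L B Y (1, 0) 0 160 0 HY !! NZ) as [th [dth [Cth [Z0 [Pth [Dth Eth]]]]]].
  { change (polar (c 0) 0). rewrite c0. unfold polar, enorm; cbn [fst snd]. rewrite cos_0, sin_0.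
    replace (1 ^ 2 + 0 ^ 2) with 1 by ring. rewrite sqrt_1. f_equal; ring. }
  assert (ND : forall t, 0 <= t <= 160 -> dth t <= - (1 / 13)).
  { intros t Ht. specialize (Eth t Ht). change (flow Y t (1, 0)) with (c t) in Eth.
    destruct (AB t (BV t Ht)) as [E1 [E2 [E3 [_ E5]]]]. rewrite E1 in Eth. fold (x t) (y t) in Eth.
    absle E2. absle E3. assert (x t ^ 2 + y t ^ 2 <= 5 / 2) by nra. assert (0 <= x t ^ 2 + y t ^ 2) by nra.
    destruct (Rle_lt_dec (dth t) (- (1 / 13))); auto. exfalso.
    assert (- (1 / 13) * (x t ^ 2 + y t ^ 2) <= dth t * (x t ^ 2 + y t ^ 2)) by (apply Rmult_le_compat_r; lra). lra. }
  assert (MON : forall u v, 0 <= u -> u < v -> v <= 160 -> th v <= th u - 1 / 13 * (v - u)).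
  { intros u v H1 H2 H3. destruct (mvt_between th dth u v) as [w [Hw E]].
    { intros w. rewrite Rmin_left, Rmax_right by lra. intros Hw. apply Dth. lra. }
    rewrite Rmin_left, Rmax_right in Hw by lra. specialize (ND w !!). nra. }
  destruct (ivt_decr th 0 160 (- (2 * PI))) as [T [HT ET]]; auto; try lra.
  { rewrite Z0. specialize (MON 0 160). lra. }
  assert (PT : 0 < T). { destruct (Req_dec T 0) as [E|]; [|lra]. rewrite E in ET. lra. }
  exists T, c, th. split; auto. split; auto. split; [|split; [|split; [|split; [|split]]]]; auto.
  - intros t Ht. destruct (AB t (BV t !!)) as [E1 _]. rewrite <- E1. apply (flow_sol L B); auto.
  - intros t Ht. destruct (AB t (BV t !!)) as [_ [E2 [E3 _]]]. split; auto. split; auto. split. apply NZ; lra. apply Pth; lra.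
  - intros t Ht. pose proof (MON 0 t). pose proof (MON t T). lra.
Qed.

(* The angle from [p'] to [p] is less than a right angle, so it is an arctangent. *)
Lemma polar_turn (p p' : R * R) th : p <> origin -> p' <> origin -> polar p' th -> 0 < dot p' p ->
  polar p (th + atan (det2 p' p / dot p' p)).
Proof.
  intros Hp Hp' H HD. destruct (polar_pos p' th Hp' H) as [r [Pr E]]. set (D := dot p' p) in *. set (W := det2 p' p).
  assert (EN : enorm p * enorm p = p.1 ^ 2 + p.2 ^ 2).
  { unfold enorm. apply sqrt_sqrt. nra. }
  pose proof (enorm_pos p Hp) as PN.
  assert (SC : cos th ^ 2 + sin th ^ 2 = 1). { pose proof (sin2_cos2 th) as Q. unfold Rsqr in Q. lra. }
  assert (DW : D ^ 2 + W ^ 2 = (r * enorm p) ^ 2).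
  { replace ((r * enorm p) ^ 2) with (r ^ 2 * (enorm p * enorm p)) by ring. rewrite EN. unfold D, W, dot, det2. rewrite E; cbn [fst snd].
    transitivity (r ^ 2 * (p.1 ^ 2 + p.2 ^ 2) * (cos th ^ 2 + sin th ^ 2)). ring. rewrite SC. ring. }
  assert (PRN : 0 < r * enorm p) by (apply Rmult_lt_0_compat; auto).
  assert (SQ : sqrt (1 + (W / D)²) = r * enorm p / D).
  { replace (1 + (W / D)²) with ((r * enorm p / D)²). apply sqrt_Rsqr. left. apply Rdiv_lt_0_compat; auto.
    unfold Rsqr. replace (r * enorm p / D * (r * enorm p / D)) with ((r * enorm p) ^ 2 / D ^ 2) by (field; lra). rewrite <- DW. field. lra. }
  assert (CA : cos (atan (W / D)) = D / (r * enorm p)). { rewrite cos_atan, SQ. field. split; lra. }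
  assert (SA : sin (atan (W / D)) = W / (r * enorm p)). { rewrite sin_atan, SQ. field. repeat split; lra. }
  unfold polar. rewrite cos_plus, sin_plus, CA, SA. assert (F1 : p.1 = cos th * (D / r) - sin th * (W / r)).
  { unfold D, W, dot, det2. rewrite E; cbn [fst snd]. transitivity (p.1 * (cos th ^ 2 + sin th ^ 2)). rewrite SC; ring. field. lra. }
  assert (F2 : p.2 = sin th * (D / r) + cos th * (W / r)).
  { unfold D, W, dot, det2. rewrite E; cbn [fst snd]. transitivity (p.2 * (cos th ^ 2 + sin th ^ 2)). rewrite SC; ring. field. lra. }
  destruct p as [px py]; cbn [fst snd] in *. f_equal.
  - rewrite F1 at 1. field. split; lra.
  - rewrite F2 at 1. field. split; lra.
Qed.

(** The rescaling [x -> s x], [y -> s^2 y], [t -> t / s] carries a system of the same form, with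
    coefficients that are not larger, to the given one; the turn of [(1, 0)] there becomes a first
    return of [(s, 0)] to the positive axis. *)
Lemma small_coefs_monodromic a20 a11 a02 a30 a21 a12 a03 b11 b02 b21 b12 b03 :
  small_coefs (/ 40000) a20 a11 a02 a30 a21 a12 a03 b11 b02 b21 b12 b03 ->
  monodromic (cubic_system a20 a11 a02 a30 a21 a12 a03 b11 b02 b21 b12 b03 1).
Proof.
  intros HC. set (X := cubic_system a20 a11 a02 a30 a21 a12 a03 b11 b02 b21 b12 b03 1).
  split. { unfold X, cubic_system, origin. f_equal; ring. }
  exists (fun s => (s, 0)), 1, (fun _ => 0). split; [|split].
  - split. lra. split. reflexivity. split. { intros s1 s2 _ _ E. inversion E; auto. }
    exists (fun _ => (1, 0)). split.
    + intros s _. split; [|split; [|split]].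
      * split; cbn [fst snd]. apply is_derive_idR. apply is_derive_constR.
      * apply continuous_const.
      * apply continuous_const.
      * unfold origin. intros E. inversion E. lra.
    + intros s Hs. unfold det2, X, cubic_system; cbn [fst snd].
      match goal with |- ?e <> 0 => replace e with (- (s * s * s)) by ring end.
      assert (0 < s * s) by nra. assert (0 < s * s * s) by nra. lra.
  - intros s Hs. split; [|split].
    + unfold origin. intros E. inversion E. lra.
    + apply continuous_const.
    + unfold enorm; cbn [fst snd]. rewrite cos_0, sin_0. replace (s ^ 2 + 0 ^ 2) with (s ^ 2) by ring. rewrite sqrt_pow2 by lra. f_equal; ring.
  (* Rescaled orbits have norm at most [6/5 s + s^2], below [3 s]; and [s <= 1/2] keeps the return
     point [s * rT], with [rT <= 6/5], below the end 1 of the arc. *)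
  - intros delta Pd. exists (Rmin (1 / 2) (delta / 3)). split. { split. apply Rmin_pos; lra. mins (Rmin (1 / 2) (delta / 3)). lra. }
    intros s Hs. mins (Rmin (1 / 2) (delta / 3)).
    assert (PW : forall n, 0 <= s ^ n <= 1). { intros n. split. apply pow_le; lra. rewrite <- (pow1 n). apply pow_incr. lra. }
    assert (HC' : small_coefs (/ 40000) a20 (s * a11) (s ^ 2 * a02) (s * a30) (s ^ 2 * a21) (s ^ 3 * a12) (s ^ 4 * a03) b11 (s * b02) (s * b21) (s ^ 2 * b12) (s ^ 3 * b03)).
    { assert (G : forall n a, Rabs a <= / 40000 -> Rabs (s ^ n * a) <= / 40000).
      { intros n a Ha. rewrite <- (Rmult_1_l (/ 40000)). apply abs_mult_le; auto. rewrite Rabs_pos_eq; apply PW. }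
      assert (G1 : forall a, Rabs a <= / 40000 -> Rabs (s * a) <= / 40000) by (intros a Ha; rewrite <- (pow_1 s); apply G; auto).
      destruct HC as [[A1 [A2 [A3 [A4 [A5 [A6 A7]]]]]] [B1 [B2 [B3 [B4 B5]]]]]. repeat split; auto. }
    destruct (full_turn _ _ _ _ _ _ _ _ _ _ _ _ HC') as [T [c [th [PT [c0 [Sol [Bd [Cth [Th0 [ThT Thb]]]]]]]]]].
    pose proof PI_RGT_0 as HPI. set (e := fun t => (s * (c (s * t)).1, s ^ 2 * (c (s * t)).2)).
    set (T1 := T / s). assert (PT1 : 0 < T1) by (apply Rdiv_lt_0_compat; lra).
    assert (IN : forall t, 0 <= t <= T1 -> 0 <= s * t <= T).
    { intros t Ht. split. apply Rmult_le_pos; lra. replace T with (s * T1) by (unfold T1; field; lra). apply Rmult_le_compat_l; lra. }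
    assert (ET : s * T1 = T) by (unfold T1; field; lra). assert (NE : forall t, 0 <= t <= T1 -> e t <> origin).
    { intros t Ht E. destruct (Bd (s * t) (IN t Ht)) as [_ [_ [N _]]]. apply N.
      assert (E1 : s * (c (s * t)).1 = 0) by exact (f_equal fst E). assert (E2 : s ^ 2 * (c (s * t)).2 = 0) by exact (f_equal snd E).
      apply Rmult_integral in E1. apply Rmult_integral in E2. assert (0 < s ^ 2) by (apply pow_lt; lra).
      unfold origin. destruct (c (s * t)); cbn [fst snd] in *. f_equal. destruct E1; lra. destruct E2; lra. }
    assert (PD : forall t, 0 <= t <= T1 -> 0 < dot (c (s * t)) (e t)).
    { intros t Ht. destruct (Bd (s * t) (IN t Ht)) as [_ [_ [N _]]]. unfold dot, e; cbn [fst snd].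
      assert (0 < (c (s * t)).1 ^ 2 + (c (s * t)).2 ^ 2).
      { apply sum_sq_pos. destruct (Req_dec (c (s * t)).1 0); auto. destruct (Req_dec (c (s * t)).2 0); auto. exfalso. apply N. unfold origin. destruct (c (s * t)); cbn [fst snd] in *; congruence. }
      assert (0 < s ^ 2) by (apply pow_lt; lra). assert (s ^ 2 <= s) by nra.
      replace ((c (s * t)).1 * (s * (c (s * t)).1) + (c (s * t)).2 * (s ^ 2 * (c (s * t)).2)) with
        (s ^ 2 * ((c (s * t)).1 ^ 2 + (c (s * t)).2 ^ 2) + (s - s ^ 2) * (c (s * t)).1 ^ 2) by ring.
      pose proof (pow2_ge_0 (c (s * t)).1). assert (0 <= (s - s ^ 2) * (c (s * t)).1 ^ 2) by (apply Rmult_le_pos; lra).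
      assert (0 < s ^ 2 * ((c (s * t)).1 ^ 2 + (c (s * t)).2 ^ 2)) by (apply Rmult_lt_0_compat; auto). lra. }
    (* The anisotropic scaling turns a vector by less than a right angle and not at all on the
       horizontal axis, so it does not affect the total turn. *)
    set (th' := fun t => th (s * t) + atan (det2 (c (s * t)) (e t) / dot (c (s * t)) (e t))).
    assert (PO : forall t, 0 <= t <= T1 -> polar (e t) (th' t)).
    { intros t Ht. destruct (Bd (s * t) (IN t Ht)) as [_ [_ [N P]]]. apply polar_turn; auto. }
    assert (SOL : solution_on X (fun t => 0 <= t <= T1) e).
    { intros t Ht. destruct (Sol (s * t) (IN t Ht)) as [D1 D2].
      assert (LIN : is_derive (fun u => s * u) t s) by (auto_derive; auto; ring).
      assert (E1 : is_derive (fun u => s * (c (s * u)).1) t (s * (s * (cubic_system a20 (s * a11) (s ^ 2 * a02) (s * a30) (s ^ 2 * a21) (s ^ 3 * a12) (s ^ 4 * a03) b11 (s * b02) (s * b21) (s ^ 2 * b12) (s ^ 3 * b03) 1 (c (s * t))).1))).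
      { apply (is_derive_scal (fun u => (c (s * u)).1)). apply (is_derive_comp (fun u => (c u).1) (fun u => s * u)); auto. }
      assert (E2 : is_derive (fun u => s ^ 2 * (c (s * u)).2) t (s ^ 2 * (s * (cubic_system a20 (s * a11) (s ^ 2 * a02) (s * a30) (s ^ 2 * a21) (s ^ 3 * a12) (s ^ 4 * a03) b11 (s * b02) (s * b21) (s ^ 2 * b12) (s ^ 3 * b03) 1 (c (s * t))).2))).
      { apply (is_derive_scal (fun u => (c (s * u)).2)). apply (is_derive_comp (fun u => (c u).2) (fun u => s * u)); auto. }
      split; unfold e; cbn [fst snd]; evar_last; [exact E1| |exact E2|]; unfold X, cubic_system; destruct (c (s * t)) as [cx cy]; cbn [fst snd]; eqR; ring. }
    assert (F0 : forall t, (c (s * t)).2 = 0 -> det2 (c (s * t)) (e t) = 0).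
    { intros t E. unfold det2, e; cbn [fst snd]. rewrite E. ring. }
    destruct (Bd T !!) as [BxT [_ [NT PoT]]]. destruct (polar_pos _ _ NT PoT) as [rT [PrT ErT]].
    rewrite ThT, cos_neg, sin_neg, cos_2PI, sin_2PI in ErT. exists (s * rT), T1, e. split.
    + split; auto. split; auto. split. { unfold e. rewrite Rmult_0_r, c0. cbn [fst snd]. f_equal; ring. }
      rewrite ErT in BxT; cbn [fst] in BxT. rewrite Rmult_1_r, Rabs_pos_eq in BxT by lra.
      split. { split. apply Rmult_lt_0_compat; lra. nra. }
      split. { unfold e. rewrite ET, ErT; cbn [fst snd]. f_equal; ring. }
      split.
      { intros t u Ht Hu E. assert (Ht' : 0 < s * t < T). { split. apply Rmult_lt_0_compat; lra. rewrite <- ET. apply Rmult_lt_compat_l; lra. }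
        assert (E1 : s * (c (s * t)).1 = u) by exact (f_equal fst E). assert (E2 : s ^ 2 * (c (s * t)).2 = 0) by exact (f_equal snd E).
        destruct (Bd (s * t) !!) as [_ [_ [N P]]].
        destruct (polar_pos _ _ N P) as [r [Pr Er]]. rewrite Er in E1, E2; cbn [fst snd] in E1, E2.
        assert (S0 : sin (th (s * t)) = 0).
        { cancel E2. assert (0 < s ^ 2) by (apply pow_lt; lra). lra. apply Rmult_integral in E2. destruct E2; lra. }
        assert (C0 : 0 < cos (th (s * t))).
        { destruct (Rlt_le_dec 0 (cos (th (s * t)))); auto. exfalso. assert (0 < s * r) by (apply Rmult_lt_0_compat; lra).
          assert (s * r * cos (th (s * t)) = u) by lra. nra. }
        specialize (Thb (s * t) Ht').
        assert (C1 : cos (th (s * t)) = 1). { pose proof (sin2_cos2 (th (s * t))) as Q. rewrite S0 in Q. unfold Rsqr in Q. nra. }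
        destruct (cos_sin_eq_2kPI (th (s * t)) 0) as [k Hk]. rewrite cos_0; auto. rewrite sin_0; auto.
        assert (-1 < IZR k) by nra. assert (IZR k < 0) by nra. apply lt_IZR in H1. apply lt_IZR in H2. lia. }
      exists th'. split; [|split].
      * intros t Ht. split; auto. split; [|apply PO; auto]. destruct (Sol (s * t) (IN t Ht)) as [D1 D2].
        assert (LC : continuous (fun u => s * u) t) by (apply (ex_derive_continuous (fun u => s * u)); auto_derive; auto).
        assert (CX : continuous (fun u => (c (s * u)).1) t).
        { apply (continuous_comp (fun u => s * u) (fun u => (c u).1)); auto. eapply is_derive_cont; exact D1. }
        assert (CY : continuous (fun u => (c (s * u)).2) t).
        { apply (continuous_comp (fun u => s * u) (fun u => (c u).2)); auto. eapply is_derive_cont; exact D2. }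
        assert (CE1 : continuous (fun u => s * (c (s * u)).1) t) by (apply continuous_multR; auto; apply continuous_const).
        assert (CE2 : continuous (fun u => s ^ 2 * (c (s * u)).2) t) by (apply continuous_multR; auto; apply continuous_const).
        unfold th'. apply continuous_plusR.
        -- apply (continuous_comp (fun u => s * u) th); auto.
        -- apply (continuous_comp (fun u => det2 (c (s * u)) (e u) / dot (c (s * u)) (e u)) atan).
           2:{ apply (ex_derive_continuous atan). auto_derive; auto. }
           apply (continuous_multR (fun u => det2 (c (s * u)) (e u)) (fun u => / dot (c (s * u)) (e u))).
           ++ unfold det2, e; cbn [fst snd]. apply continuous_minusR; apply continuous_multR; auto.
           ++ apply (continuous_invR (fun u => dot (c (s * u)) (e u))). unfold dot, e; cbn [fst snd]. apply continuous_plusR; apply continuous_multR; auto.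
              specialize (PD t Ht). lra.
      * unfold th'. rewrite F0. rewrite Rmult_0_r, Th0. unfold Rdiv. rewrite Rmult_0_l, atan_0. ring.
        rewrite Rmult_0_r, c0. reflexivity.
      * unfold th'. rewrite F0. rewrite ET, ThT. unfold Rdiv. rewrite Rmult_0_l, atan_0.
        rewrite Rplus_0_r, Rminus_0_r, Rabs_Ropp, Rabs_pos_eq; lra. rewrite ET, ErT. cbn [fst snd]. ring.
    + intros t Ht. destruct (Bd (s * t) (IN t Ht)) as [B1 [B2 _]]. eapply Rle_lt_trans. apply enorm_small_of_coord. unfold e; cbn [fst snd].
      pose proof (abs_mult_le s _ s _ ltac:(rewrite Rabs_pos_eq; lra) B1). pose proof (abs_mult_le (s ^ 2) _ (s ^ 2) _ ltac:(rewrite Rabs_pos_eq; [lra|apply PW]) B2).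
      assert (s ^ 2 <= s) by nra. lra.
Qed.

(** * Lyapunov functions exclude a center *)

Lemma enorm_cont (c : R -> R * R) t : continuous (fun u => (c u).1) t -> continuous (fun u => (c u).2) t ->
  continuous (fun u => enorm (c u)) t.
Proof.
  intros H1 H2. unfold enorm. apply (continuous_comp (fun u => (c u).1 ^ 2 + (c u).2 ^ 2) sqrt).
  - apply continuous_plusR; apply continuous_powR; auto.
  - apply continuous_sqrt.
Qed.

(* Up to its last passage through the circle of radius [r1], [L] would have to drop from above [m] to [L (c T) < m]. *)
Lemma trapped_below (c : R -> R * R) (L : R * R -> R) (dl : R -> R) (T r1 m : R) : 0 <= T -> 0 < r1 ->
  (forall t, 0 <= t <= T -> continuous (fun u => enorm (c u)) t) ->
  (forall t, 0 <= t <= T -> enorm (c t) <= r1 -> is_derive (fun u => L (c u)) t (dl t) /\ 0 < dl t) ->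
  (forall p, enorm p = r1 -> m <= L p) -> enorm (c T) < r1 -> L (c T) < m ->
  forall t, 0 <= t <= T -> enorm (c t) < r1.
Proof.
  intros HT Hr Cn Hd Hm HcT HLT.
  assert (INC : forall a b, 0 <= a -> a < b -> b <= T -> (forall t, a <= t <= b -> enorm (c t) <= r1) -> L (c a) < L (c b)).
  { intros a b H1 H2 H3 H4. destruct (mvt_between (fun u => L (c u)) dl a b) as [w [Hw E]].
    { intros w. rewrite Rmin_left, Rmax_right by lra. intros Hw. apply Hd. lra. apply H4. lra. }
    rewrite Rmin_left, Rmax_right in Hw by lra. destruct (Hd w !! (H4 w Hw)) as [_ P]. nra. }
  intros t Ht. destruct (Rlt_le_dec (enorm (c t)) r1) as [|Q]; auto. exfalso.
  set (E := fun u => t <= u <= T /\ r1 <= enorm (c u)).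
  destruct (completeness E) as [u0 [U1 U2]]. { exists T. intros u [Hu _]. lra. } { exists t. split; auto; lra. }
  assert (Ht0 : t <= u0) by (apply U1; split; auto; lra). assert (Hu0 : u0 <= T) by (apply U2; intros u [Hu _]; lra).
  assert (GE : r1 <= enorm (c u0)).
  { destruct (Rle_lt_dec r1 (enorm (c u0))) as [|Q']; auto. exfalso.
    destruct (cont_near (fun u => enorm (c u)) u0 (r1 - enorm (c u0)) (Cn u0 !!)) as [d [Pd Hdd]]. lra.
    assert (u0 <= u0 - d); [|lra]. apply U2. intros u [Hu Eu]. destruct (Rle_lt_dec u (u0 - d)); auto. exfalso.
    assert (u <= u0) by (apply U1; split; auto). specialize (Hdd u ltac:(apply Rabs_def1; lra)). apply Rabs_def2 in Hdd. lra. }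
  assert (LT : forall u, u0 < u -> u <= T -> enorm (c u) < r1).
  { intros u H1 H2. destruct (Rlt_le_dec (enorm (c u)) r1); auto. assert (u <= u0); [|lra]. apply U1. split; auto. lra. }
  assert (NT : u0 < T). { destruct (Req_dec u0 T) as [EE|]; [|lra]. rewrite EE in GE. lra. }
  assert (EQ : enorm (c u0) = r1).
  { destruct (Req_dec (enorm (c u0)) r1) as [|N]; auto. exfalso.
    destruct (cont_near (fun u => enorm (c u)) u0 (enorm (c u0) - r1) (Cn u0 !!)) as [d [Pd Hdd]]. lra.
    set (v := Rmin (u0 + d / 2) T). assert (u0 < v) by (apply Rmin_glb_lt; lra). assert (v <= T) by apply Rmin_r. assert (v <= u0 + d / 2) by apply Rmin_l.
    specialize (Hdd v ltac:(apply Rabs_def1; lra)). apply Rabs_def2 in Hdd. specialize (LT v !! !!). lra. }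
  specialize (Hm (c u0) EQ). assert (L (c u0) < L (c T)); [|lra].
  apply INC; try lra. intros u Hu. destruct (Req_dec u u0) as [->|]. lra. left. apply LT; lra.
Qed.

(** A closed orbit starting where [L < m] might leave the ball where the sign of [dL] is known;
    [trapped_below] prevents this. Inside, [L] is strictly monotone along an orbit that returns to
    its start. For [s = -1] the trapping argument is applied to the reversed orbit. *)
Lemma center_no_lyapunov X (L dL : R * R -> R) (r1 m s : R) : is_center X -> 0 < r1 -> (s = 1 \/ s = -1) ->
  (forall c t, has_velocity c t (X (c t)) -> c t <> origin -> enorm (c t) <= r1 -> is_derive (fun u => L (c u)) t (dL (c t))) ->
  (forall p, p <> origin -> enorm p <= r1 -> 0 < s * dL p) ->
  (forall p, enorm p = r1 -> m <= L p) ->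
  (exists d, 0 < d /\ forall p, 0 < enorm p < d -> L p < m) -> False.
Proof.
  intros [_ [delta [Pd Hc]]] Hr Hs HD HP Hm [d [Pdd Hl]]. set (p := (Rmin (delta / 2) (Rmin (d / 2) (r1 / 2)), 0)).
  assert (Q0 : 0 < p.1) by (unfold p; cbn [fst]; repeat apply Rmin_pos; lra).
  assert (Q1 : p.1 <= delta / 2) by apply Rmin_l.
  assert (Q2 : p.1 <= d / 2) by (unfold p; cbn [fst]; eapply Rle_trans; [apply Rmin_r|apply Rmin_l]).
  assert (Q3 : p.1 <= r1 / 2) by (unfold p; cbn [fst]; eapply Rle_trans; [apply Rmin_r|apply Rmin_r]).
  assert (EP : enorm p = p.1).
  { unfold enorm. replace p.2 with 0 by reflexivity. replace (p.1 ^ 2 + 0 ^ 2) with (p.1 ^ 2) by ring. apply sqrt_pow2. lra. }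
  destruct (Hc p !!) as [c [T [HT [Sol [c0 [Per [th [Ath _]]]]]]]].
  assert (NZ : forall t, 0 <= t <= T -> c t <> origin) by (intros t Ht; apply (Ath t Ht)).
  assert (cT : c T = p). { rewrite <- c0, <- (Rplus_0_l T). apply Per. }
  assert (CC : forall t, continuous (fun u => enorm (c u)) t).
  { intros t. destruct (Sol t I) as [D1 D2]. apply enorm_cont; eapply is_derive_cont; eauto. }
  assert (Lp : L p < m) by (apply Hl; lra).
  assert (DL : forall t, 0 <= t <= T -> enorm (c t) <= r1 -> is_derive (fun u => L (c u)) t (dL (c t)) /\ 0 < s * dL (c t)).
  { intros t Ht Hb. split. apply HD; auto. apply HP; auto. }
  assert (IN : forall t, 0 <= t <= T -> enorm (c t) < r1).
  { destruct Hs as [-> | ->].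
    - apply (trapped_below c L (fun t => 1 * dL (c t)) T r1 m); auto; try lra.
      + intros t Ht Hb. destruct (DL t Ht Hb) as [A B]. split; auto. rewrite Rmult_1_l. auto.
      + rewrite cT. lra.
      + rewrite cT. auto.
    - intros t Ht. replace t with (T - (T - t)) by ring.
      apply (trapped_below (fun u => c (T - u)) L (fun t => - dL (c (T - t))) T r1 m); auto; try lra.
      + intros u Hu. apply (continuous_comp (fun u => T - u) (fun u => enorm (c u))); auto.
        apply (ex_derive_continuous (fun u => T - u)). auto_derive; auto.
      + intros u Hu Hb. destruct (DL (T - u) !! Hb) as [A B]. split; [|lra].
        evar_last. apply (is_derive_comp (fun u => L (c u)) (fun u => T - u)). exact A. auto_derive; auto.
        unfold scal; simpl; unfold mult; simpl. eqR. ring.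
      + replace (T - T) with 0 by ring. rewrite c0. lra.
      + replace (T - T) with 0 by ring. rewrite c0. auto. }
  destruct (mvt_between (fun u => L (c u)) (fun t => dL (c t)) 0 T) as [w [Hw E]].
  { intros w. rewrite Rmin_left, Rmax_right by lra. intros Hw. apply DL; auto. left. apply IN; lra. }
  rewrite Rmin_left, Rmax_right in Hw by lra. rewrite cT, c0 in E.
  destruct (DL w Hw) as [_ B]. { left. apply IN; auto. }
  assert (dL (c w) * (T - 0) = 0) by lra. apply Rmult_integral in H. destruct H as [H|H]; [rewrite H in B; lra|lra].
Qed.

(** * Sparse polynomials *)

(* A term is [c * x^i * y^j] times a product of powers of parameters. *)
Definition term : Type := nat * nat * list nat * Q.
Definition poly : Type := list term.

Fixpoint mon_ev (env : nat -> R) (i : nat) (l : list nat) : R :=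
  match l with [] => 1 | e :: l' => env i ^ e * mon_ev env (S i) l' end.
Definition term_ev (x y : R) (env : nat -> R) (t : term) : R :=
  let '(i, j, l, c) := t in Q2R c * (x ^ i * y ^ j * mon_ev env 0 l).
Fixpoint ev (x y : R) (env : nat -> R) (p : poly) : R :=
  match p with [] => 0 | t :: p' => term_ev x y env t + ev x y env p' end.

Fixpoint list_cmp (l m : list nat) : comparison :=
  match l, m with
  | [], [] => Eq | [], _ => Lt | _, [] => Gt
  | a :: l', b :: m' => match Nat.compare a b with Eq => list_cmp l' m' | c => c end
  end.
Definition term_cmp (s t : term) : comparison :=
  let '(i, j, l, _) := s in let '(i', j', l', _) := t in list_cmp (i :: j :: l) (i' :: j' :: l').

(** A merge of sorted lists. Soundness of evaluation does not depend on the order; sorting and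
    dropping zero coefficients makes cancelling polynomials empty, which is all that [is_zero]
    recognizes. *)
Fixpoint padd (p : poly) : poly -> poly :=
  match p with
  | [] => fun q => q
  | s :: p' => fix aux (q : poly) : poly :=
      match q with
      | [] => p
      | t :: q' =>
          match term_cmp s t with
          | Eq => let c := Qred (s.2 + t.2) in
                  if Qeq_bool c 0 then padd p' q' else (s.1, c) :: padd p' q'
          | Lt => s :: padd p' q
          | Gt => t :: aux q'
          end
      end
  end.

(** Exponent lists of different lengths occur; missing exponents count as 0. *)
Fixpoint mon_mul (l m : list nat) : list nat :=
  match l, m with [], _ => m | _, [] => l | a :: l', b :: m' => (a + b)%nat :: mon_mul l' m' end.
Definition term_mul (s t : term) : term :=
  let '(i, j, l, c) := s in let '(i', j', l', c') := t in ((i + i')%nat, (j + j')%nat, mon_mul l l', Qred (c * c')).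
Fixpoint pmul (p q : poly) : poly :=
  match p with [] => [] | s :: p' => padd (map (term_mul s) q) (pmul p' q) end.
Definition pscale (c : Q) (p : poly) : poly := map (fun t : term => (t.1, Qred (c * t.2))) p.
Definition shift (i j : nat) (p : poly) : poly :=
  map (fun t : term => let '(i', j', l, c) := t in ((i + i')%nat, (j + j')%nat, l, c)) p.
Fixpoint ppow (p : poly) (n : nat) : poly := match n with O => [(0%nat, 0%nat, [], 1%Q)] | S n' => pmul p (ppow p n') end.
Definition poly_sub (p q : poly) : poly := padd p (pscale (-1) q).

Fixpoint dx (p : poly) : poly :=
  match p with
  | [] => []
  | (O, _, _, _) :: p' => dx p'
  | (S i, j, l, c) :: p' => (i, j, l, Qred (inject_Z (Z.of_nat (S i)) * c)) :: dx p'
  end.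
Fixpoint dy (p : poly) : poly :=
  match p with
  | [] => []
  | (_, O, _, _) :: p' => dy p'
  | (i, S j, l, c) :: p' => (i, j, l, Qred (inject_Z (Z.of_nat (S j)) * c)) :: dy p'
  end.

Lemma Q2R_Qred c : Q2R (Qred c) = Q2R c.
Proof. apply Qeq_eqR. apply Qred_correct. Qed.
Lemma Q2R_nat n : Q2R (inject_Z (Z.of_nat n)) = INR n.
Proof. unfold Q2R, inject_Z; simpl. rewrite Rinv_1, Rmult_1_r, <- INR_IZR_INZ. reflexivity. Qed.
Lemma Q2R_1 : Q2R 1 = 1. Proof. unfold Q2R; simpl. lra. Qed.

Lemma list_cmp_eq l m : list_cmp l m = Eq -> l = m.
Proof.
  revert m. induction l as [|a l IH]; destruct m as [|b m]; simpl; try discriminate; auto.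
  destruct (Nat.compare a b) eqn:E; try discriminate. intros H. apply Nat.compare_eq in E. f_equal; auto.
Qed.
Lemma term_cmp_eq s t : term_cmp s t = Eq -> s.1 = t.1.
Proof.
  destruct s as [[[i j] l] c], t as [[[i' j'] l'] c']. unfold term_cmp. intros H. apply list_cmp_eq in H.
  injection H as -> -> ->. reflexivity.
Qed.

Section Ev.
Variables (x y : R) (env : nat -> R).
Notation E := (ev x y env).

Lemma term_ev_add (s t : term) : s.1 = t.1 -> term_ev x y env s + term_ev x y env t = term_ev x y env (s.1, (s.2 + t.2)%Q).
Proof.
  destruct s as [[[i j] l] c], t as [[[i' j'] l'] c']. unfold term_ev, fst, snd. intros [= -> -> ->]. rewrite Q2R_plus. ring.
Qed.

Lemma ev_add p q : E (padd p q) = E p + E q.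
Proof.
  revert q. induction p as [|s p IH]; intros q. { simpl. ring. }
  induction q as [|t q IHq]. { simpl. ring. }
  change (padd (s :: p) (t :: q)) with
   (match term_cmp s t with
          | Eq => let c := Qred (s.2 + t.2) in
                  if Qeq_bool c 0 then padd p q else (s.1, c) :: padd p q
          | Lt => s :: padd p (t :: q)
          | Gt => t :: padd (s :: p) q
          end).
  destruct (term_cmp s t) eqn:C.
  - apply term_cmp_eq in C. pose proof (term_ev_add s t C) as TA. cbv zeta.
    assert (EC : term_ev x y env (s.1, Qred (s.2 + t.2)) = term_ev x y env s + term_ev x y env t).
    { rewrite TA. destruct s as [[[i j] l] c]. unfold term_ev, fst, snd. rewrite Q2R_Qred. reflexivity. }
    destruct (Qeq_bool (Qred (s.2 + t.2)) 0) eqn:Z.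
    + apply Qeq_bool_eq in Z. apply Qeq_eqR in Z. rewrite RMicromega.Q2R_0 in Z.
      assert (term_ev x y env s + term_ev x y env t = 0). { rewrite <- EC. destruct s as [[[i j] l] c]. unfold term_ev, fst, snd in *. rewrite Z. ring. }
      cbn [ev]. rewrite IH. lra.
    + cbn [ev]. rewrite IH, EC. ring.
  - cbn [ev]. rewrite IH. cbn [ev]. ring.
  - cbn [ev]. rewrite IHq. cbn [ev]. ring.
Qed.

Lemma mon_mul_ev l m i : mon_ev env i (mon_mul l m) = mon_ev env i l * mon_ev env i m.
Proof.
  revert m i. induction l as [|a l IH]; intros [|b m] i; simpl; try ring. rewrite IH, pow_add. ring.
Qed.
Lemma term_mul_ev s t : term_ev x y env (term_mul s t) = term_ev x y env s * term_ev x y env t.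
Proof.
  destruct s as [[[i j] l] c], t as [[[i' j'] l'] c']. unfold term_mul, term_ev. rewrite Q2R_Qred, Q2R_mult, mon_mul_ev, !pow_add. ring.
Qed.
Lemma ev_map_mul s q : E (map (term_mul s) q) = term_ev x y env s * E q.
Proof. induction q as [|t q IH]; cbn [map ev]. ring. rewrite IH, term_mul_ev. ring. Qed.
Lemma ev_mul p q : E (pmul p q) = E p * E q.
Proof. induction p as [|s p IH]; cbn [pmul ev]. ring. rewrite ev_add, IH, ev_map_mul. ring. Qed.
Lemma ev_scale c p : E (pscale c p) = Q2R c * E p.
Proof.
  induction p as [|t p IH]; unfold pscale in *; cbn [map ev]. ring. rewrite IH. destruct t as [[[i j] l] d]. unfold term_ev, fst, snd.
  rewrite Q2R_Qred, Q2R_mult. ring.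
Qed.
Lemma ev_shift i j p : E (shift i j p) = x ^ i * y ^ j * E p.
Proof.
  induction p as [|t p IH]; unfold shift in *; cbn [map ev]. ring. rewrite IH. destruct t as [[[i' j'] l] d]. unfold term_ev.
  rewrite !pow_add. ring.
Qed.
Lemma ev_pow p n : E (ppow p n) = E p ^ n.
Proof. induction n as [|n IH]; cbn [ppow]. simpl. rewrite Q2R_1. ring. rewrite ev_mul, IH. simpl. ring. Qed.
Lemma ev_sub p q : E (poly_sub p q) = E p - E q.
Proof. unfold poly_sub. rewrite ev_add, ev_scale. replace (Q2R (-1)) with (-1). ring. unfold Q2R; simpl. lra. Qed.
End Ev.

Lemma term_derive (X Y : R -> R) env t vx vy i j l c : is_derive X t vx -> is_derive Y t vy ->
  is_derive (fun u => term_ev (X u) (Y u) env (i, j, l, c)) t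
    (Q2R c * mon_ev env 0 l * (INR i * X t ^ pred i * Y t ^ j * vx + INR j * X t ^ i * Y t ^ pred j * vy)).
Proof.
  intros HX HY. unfold term_ev. set (m := mon_ev env 0 l).
  evar_last. auto_derive. repeat split; eexists; eassumption. reflexivity.
  replace (Derive (fun u => X u) t) with vx by (symmetry; exact (is_derive_unique _ _ _ HX)).
  replace (Derive (fun u => Y u) t) with vy by (symmetry; exact (is_derive_unique _ _ _ HY)). eqR. ring.
Qed.

Lemma ev_derive (X Y : R -> R) env t vx vy p : is_derive X t vx -> is_derive Y t vy ->
  is_derive (fun u => ev (X u) (Y u) env p) t (ev (X t) (Y t) env (dx p) * vx + ev (X t) (Y t) env (dy p) * vy).
Proof.
  intros HX HY. induction p as [|s p IH].
  - simpl. replace (0 * vx + 0 * vy) with 0 by ring. apply is_derive_constR.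
  - destruct s as [[[i j] l] c].
    assert (E1 : ev (X t) (Y t) env (dx ((i, j, l, c) :: p)) = Q2R c * mon_ev env 0 l * (INR i * X t ^ pred i * Y t ^ j) + ev (X t) (Y t) env (dx p)).
    { destruct i as [|i]; cbn [dx]. simpl INR. ring. cbn [ev]. unfold term_ev. rewrite Q2R_Qred, Q2R_mult, Q2R_nat. cbn [Nat.pred]. ring. }
    assert (E2 : ev (X t) (Y t) env (dy ((i, j, l, c) :: p)) = Q2R c * mon_ev env 0 l * (INR j * X t ^ i * Y t ^ pred j) + ev (X t) (Y t) env (dy p)).
    { destruct j as [|j]; cbn [dy]. simpl INR. ring. cbn [ev]. unfold term_ev. rewrite Q2R_Qred, Q2R_mult, Q2R_nat. cbn [Nat.pred]. ring. }
    apply (is_derive_ext (fun u => term_ev (X u) (Y u) env (i, j, l, c) + ev (X u) (Y u) env p)). reflexivity.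
    evar_last. apply (is_derive_plus (fun u => term_ev (X u) (Y u) env (i, j, l, c)) (fun u => ev (X u) (Y u) env p)).
    apply term_derive; eassumption. exact IH. match goal with |- plus ?a ?b = ?c => change (a + b = c) end.
    transitivity (ev (X t) (Y t) env (dx ((i, j, l, c) :: p)) * vx + ev (X t) (Y t) env (dy ((i, j, l, c) :: p)) * vy); [|reflexivity].
    rewrite E1, E2. ring.
Qed.

Definition weighted (w : nat) (p : poly) : bool :=
  forallb (fun t : term => let '(i, j, _, _) := t in Nat.eqb (i + 2 * j) w) p.

(** Here [q] stands for the fourth root of [Q], and the factors 2 are those by which the coordinates
    are bounded in [rad_coords]. *)
Lemma weighted_bound env w p : weighted w p = true -> exists C, 0 <= C /\
  forall x y q, 0 <= q -> Rabs x <= 2 * q -> Rabs y <= 2 * q ^ 2 -> Rabs (ev x y env p) <= C * q ^ w.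
Proof.
  induction p as [|t p IH]; intros H.
  - exists 0. split. lra. intros. simpl. rewrite Rabs_R0. lra.
  - destruct t as [[[i j] l] c]. simpl in H. apply andb_true_iff in H as [H1 H2]. apply Nat.eqb_eq in H1.
    destruct (IH H2) as [C [PC HC]]. set (m := Rabs (Q2R c * mon_ev env 0 l)).
    assert (P2 : forall n, 0 <= 2 ^ n) by (intros; apply pow_le; lra). exists (m * (2 ^ i * 2 ^ j) + C). split.
    { assert (0 <= m * (2 ^ i * 2 ^ j)). apply Rmult_le_pos. apply Rabs_pos. apply Rmult_le_pos; auto. lra. }
    intros x y q Hq Hx Hy. cbn [ev]. eapply Rle_trans. apply Rabs_triang. rewrite Rmult_plus_distr_r. apply Rplus_le_compat; auto.
    unfold term_ev. replace (Q2R c * (x ^ i * y ^ j * mon_ev env 0 l)) with (Q2R c * mon_ev env 0 l * (x ^ i * y ^ j)) by ring.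
    rewrite Rabs_mult. fold m. rewrite (Rmult_assoc m). apply Rmult_le_compat_l. apply Rabs_pos.
    rewrite Rabs_mult, <- !RPow_abs. replace (2 ^ i * 2 ^ j * q ^ w) with ((2 * q) ^ i * (2 * q ^ 2) ^ j).
    apply Rmult_le_compat; try (apply pow_le; apply Rabs_pos); apply pow_incr; split; auto; apply Rabs_pos.
    replace w with (i + 2 * j)%nat by lia. rewrite !Rpow_mult_distr, <- pow_mult, pow_add. ring.
Qed.

Definition constant (p : poly) : bool := weighted 0 p.

Lemma constant_ev x y x' y' env p : constant p = true -> ev x y env p = ev x' y' env p.
Proof.
  induction p as [|t p IH]; intros H; auto. destruct t as [[[i j] l] c]. simpl in H. apply andb_true_iff in H as [H1 H2]. apply Nat.eqb_eq in H1.
  cbn [ev]. rewrite (IH H2). replace i with 0%nat by lia. replace j with 0%nat by lia. simpl. reflexivity.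
Qed.

Definition is_zero (p : poly) : bool := match p with [] => true | _ => false end.
Lemma is_zero_ev x y env p : is_zero p = true -> ev x y env p = 0.
Proof. destruct p; simpl; [auto|discriminate]. Qed.

Definition pvar (k : nat) : poly := [(0%nat, 0%nat, repeat 0%nat k ++ [1%nat], 1%Q)].
Definition pone : poly := [(0%nat, 0%nat, [], 1%Q)].

(** * The formal first integral *)

Record coefs : Type := { p20 : poly; p11 : poly; p02 : poly; p30 : poly; p21 : poly; p12 : poly; p03 : poly;
  q11 : poly; q02 : poly; q21 : poly; q12 : poly; q03 : poly }.
Definition coef_list (f : coefs) : list poly := [p20 f; p11 f; p02 f; p30 f; p21 f; p12 f; p03 f; q11 f; q02 f; q21 f; q12 f; q03 f].

(* Component of weight [k] of the vector field, for the weights 1 of x and 2 of y. *)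
Definition comp (f : coefs) (k : nat) : poly * poly :=
  match k with
  | 1%nat => (padd (shift 0 1 pone) (shift 2 0 (p20 f)), padd (pscale (-1) (shift 3 0 pone)) (shift 1 1 (q11 f)))
  | 2%nat => (padd (shift 1 1 (p11 f)) (shift 3 0 (p30 f)), padd (shift 0 2 (q02 f)) (shift 2 1 (q21 f)))
  | 3%nat => (padd (shift 0 2 (p02 f)) (shift 2 1 (p21 f)), shift 1 2 (q12 f))
  | 4%nat => (shift 1 2 (p12 f), shift 0 3 (q03 f))
  | 5%nat => (shift 0 3 (p03 f), [])
  | _ => ([], [])
  end.

Section Engine.
Variable f : coefs.
Definition tt : poly := padd (pscale 2 (p20 f)) (q11 f).
(** The inverse integrating factor [x^4 + 2 y^2 + (2 a20 - b11) x^2 y] of the component of weight 1;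
    [tt] is its cofactor divided by [x]. *)
Definition qq : poly := padd (padd (shift 4 0 pone) (pscale 2 (shift 0 2 pone))) (shift 2 1 (poly_sub (pscale 2 (p20 f)) (q11 f))).
Definition lie (k : nat) (p : poly) : poly := padd (pmul (comp f k).1 (dx p)) (pmul (comp f k).2 (dy p)).
(** The derivative of [sigma] along the component of weight [k], multiplied by [Q]; for [k = 1] it
    is [x Q]. *)
Definition sk (k : nat) : poly := poly_sub (pscale 2 (shift 1 1 (comp f k).1)) (shift 2 0 (comp f k).2).

(* [(n, A, B)] stands for [(A + B sigma) / Q^(n-1)]; [log_item k] and [w_item j (A, B) k] are the derivatives of
   [ln Q - tau sigma] and of [w_j = (A + B sigma) / Q^j] along the component of weight [k]. *)
Definition item : Type := nat * poly * poly.

Definition log_item (k : nat) : item := (k, pmul (poly_sub (lie k qq) (pmul tt (sk k))) (ppow qq (k - 2)), []).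
Definition w_item (j : nat) (w : poly * poly) (k : nat) : item :=
  let (A, B) := w in
  match k with
  | 1%nat => (S j, padd (poly_sub (lie 1 A) (pscale (inject_Z (Z.of_nat j)) (shift 1 0 (pmul tt A)))) (shift 1 0 B),
             poly_sub (lie 1 B) (pscale (inject_Z (Z.of_nat j)) (shift 1 0 (pmul tt B))))
  | _ => ((j + k)%nat,
     pmul (padd (poly_sub (pmul (lie k A) qq) (pscale (inject_Z (Z.of_nat j)) (pmul A (lie k qq)))) (pmul B (sk k))) (ppow qq (k - 2)),
     pmul (poly_sub (pmul (lie k B) qq) (pscale (inject_Z (Z.of_nat j)) (pmul B (lie k qq)))) (ppow qq (k - 2)))
  end.

Definition tag : Type := nat * (poly * poly) * nat.
Definition tag_index (t : tag) : nat := let '(j, _, k) := t in (j + k)%nat.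
Definition tag_item (t : tag) : item := let '(j, w, k) := t in match j with O => log_item k | _ => w_item j w k end.
Fixpoint w_tags (j : nat) (ws : list (poly * poly)) : list tag :=
  match ws with
  | [] => []
  | w :: ws' => (j, w, 1%nat) :: (j, w, 2%nat) :: (j, w, 3%nat) :: (j, w, 4%nat) :: (j, w, 5%nat) :: w_tags (S j) ws'
  end.
Definition tags (ws : list (poly * poly)) : list tag :=
  let t k := (0%nat, ([], []), k) in t 2%nat :: t 3%nat :: t 4%nat :: t 5%nat :: w_tags 1 ws.
Definition items (ws : list (poly * poly)) : list item := map tag_item (tags ws).

(* Total numerators of index [n]; only the items of that index are computed. *)
Definition collect (n : nat) (ts : list tag) : poly * poly :=
  fold_right (fun t ab => if Nat.eqb (tag_index t) n
    then let '(_, A, B) := tag_item t in (padd A ab.1, padd B ab.2) else ab) ([], []) ts.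

(* Solves [X_1 w = f] for [w] of weight [m], row by row in the powers of [y]; the row [y^0] is left over. *)
Definition row (j : nat) (p : poly) : poly :=
  flat_map (fun t : term => let '(_, j', l, c) := t in if Nat.eqb j j' then [(0%nat, 0%nat, l, c)] else []) p.
Fixpoint solve_rows (d m : nat) (g : poly) (n : nat) (c1 c2 acc : poly) : poly * poly :=
  let kap j := padd (padd (pscale (inject_Z (Z.of_nat (d - 2 * j))) (p20 f)) (pscale (inject_Z (Z.of_nat j)) (q11 f)))
                    (pscale (inject_Z (- Z.of_nat m)) tt) in
  let r := padd (poly_sub (row n g) (pmul (kap n) c1)) (pscale (inject_Z (Z.of_nat (n + 1))) c2) in
  match n with
  | O => (acc, r)
  | S j => let c := pscale (/ inject_Z (Z.of_nat (d - 2 * j))) r in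
           solve_rows d m g j c c1 (padd acc (shift (d - 2 * j) j c))
  end.
Definition solve (m : nat) (g free : poly) : poly * poly :=
  let d := (5 * m)%nat in let J := Nat.div d 2 in
  if Nat.odd d then solve_rows d m g (S J) [] [] [] else solve_rows d m g J free [] (shift 0 J free).

(* [free m] is the free coefficient of [y^(5m/2)] in [w_m] for even [m];
   [sig m] is the coefficient of [sigma Q^(m/4)] in [w_m]. *)
Variables free sig : nat -> poly.
(** The part with [sigma] is solved first, since [X_1 sigma = x] sends it into the other part as
    [x wB']. The residual of the first solution is dropped here: the result is only a proposal, and
    [check] tests whether the whole [sigma] part vanishes. *)
Fixpoint run (fuel m : nat) (ws : list (poly * poly)) (rs : list poly) : list (poly * poly) * list poly :=
  match fuel with
  | O => (ws, rs)
  | S fuel' =>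
      let '(A, B) := collect (S m) (tags ws) in
      let '(wB, _) := solve m (pscale (-1) B) [] in
      let wB' := padd wB (match sig m with [] => [] | s => pmul s (ppow qq (m + Nat.div m 4)) end) in
      let '(wA, r) := solve m (poly_sub (pscale (-1) A) (shift 1 0 wB')) (free m) in
      run fuel' (S m) (ws ++ [(wA, wB')]) (rs ++ [r])
  end.
End Engine.

Lemma ev_dx x y env p : is_derive (fun u => ev u y env p) x (ev x y env (dx p)).
Proof.
  evar_last. apply (ev_derive (fun u => u) (fun _ => y) env x 1 0). apply is_derive_idR. apply is_derive_constR. eqR. ring.
Qed.
Lemma ev_dy x y env p : is_derive (fun u => ev x u env p) y (ev x y env (dy p)).
Proof.
  evar_last. apply (ev_derive (fun _ => x) (fun u => u) env y 0 1). apply is_derive_constR. apply is_derive_idR. eqR. ring.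
Qed.

Lemma is_derive_inv_pow (Qf : R -> R) t dq j : is_derive Qf t dq -> Qf t <> 0 ->
  is_derive (fun u => / Qf u ^ j) t (- (INR j * dq / Qf t ^ S j)).
Proof.
  intros H N. induction j as [|j IH].
  - simpl. replace (- (0 * dq / (Qf t * 1))) with 0 by (field; auto). apply (is_derive_ext (fun _ => / 1)). reflexivity. apply is_derive_constR.
  - apply (is_derive_ext (fun u => / Qf u * / Qf u ^ j)).
    { intros u. simpl. rewrite Rinv_mult. reflexivity. }
    evar_last. apply (is_derive_mult (fun u => / Qf u) (fun u => / Qf u ^ j)).
    apply (is_derive_inv Qf); eassumption. exact IH. intros; apply Rmult_comm.
    match goal with |- plus (mult ?a ?b) (mult ?c ?d) = ?e => change (a * b + c * d = e) end.
    rewrite S_INR. assert (Qf t ^ j <> 0) by (apply pow_nonzero; auto). simpl. field. auto.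
Qed.

Section Sigma.
Variable kap : R.
Hypothesis Hkap : Rabs kap <= 1.
Definition Qr (x y : R) : R := x ^ 4 + 2 * y ^ 2 + kap * (x ^ 2 * y).
Definition sdel : R := sqrt (1 - kap ^ 2 / 8).
Definition sigma (x y : R) : R :=
  - (sqrt 2 / sdel) * atan (sqrt 2 * (y + kap / 4 * x ^ 2) / (sdel * x ^ 2 + sqrt (Qr x y))).

Lemma kap_sq : kap ^ 2 <= 1.
Proof. absle Hkap. nra. Qed.
Lemma sdel_sq : sdel * sdel = 1 - kap ^ 2 / 8.
Proof. unfold sdel. apply sqrt_sqrt. pose proof kap_sq. lra. Qed.
Lemma sdel_pos : 0 < sdel.
Proof. unfold sdel. apply sqrt_lt_R0. pose proof kap_sq. lra. Qed.

(** [2 |x^2 y| <= x^4 + y^2] and [|kap| <= 1]: the mixed term costs at most half of each square. *)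
Lemma Qr_lower x y : x ^ 4 / 2 + y ^ 2 <= Qr x y.
Proof.
  unfold Qr. absle Hkap. assert (- (x ^ 4 / 2 + y ^ 2 / 2) <= kap * (x ^ 2 * y)).
  { assert (Rabs (kap * (x ^ 2 * y)) <= 1 * (x ^ 4 / 2 + y ^ 2 / 2)).
    { rewrite Rabs_mult. apply Rmult_le_compat; try apply Rabs_pos. apply Rabs_le; lra.
      apply Rabs_le. pose proof (pow2_ge_0 (x ^ 2 + y)). pose proof (pow2_ge_0 (x ^ 2 - y)). lra. }
    absle H. lra. }
  pose proof (pow2_ge_0 y). lra.
Qed.
Lemma Qr_pos x y : x <> 0 \/ y <> 0 -> 0 < Qr x y.
Proof.
  intros H. pose proof (Qr_lower x y) as L. assert (0 < x ^ 4 / 2 + y ^ 2); [|lra].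
  replace (x ^ 4) with ((x ^ 2) ^ 2) by ring. destruct H as [H|H].
  - assert (0 < x ^ 2) by nra. nra.
  - assert (0 < y ^ 2) by nra. nra.
Qed.
Lemma Qr_upper x y : Qr x y <= 2 * x ^ 4 + 3 * y ^ 2.
Proof.
  unfold Qr. absle Hkap. assert (Rabs (kap * (x ^ 2 * y)) <= 1 * (x ^ 4 / 2 + y ^ 2 / 2)).
  { rewrite Rabs_mult. apply Rmult_le_compat; try apply Rabs_pos. apply Rabs_le; lra.
    apply Rabs_le. pose proof (pow2_ge_0 (x ^ 2 + y)). pose proof (pow2_ge_0 (x ^ 2 - y)). lra. }
  absle H. assert (0 <= x ^ 4) by (replace (x ^ 4) with ((x ^ 2) ^ 2) by ring; apply pow2_ge_0). pose proof (pow2_ge_0 y). lra.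
Qed.

Lemma sigma_bound x y : Rabs (sigma x y) <= sqrt 2 / sdel * 2.
Proof.
  unfold sigma. pose proof sdel_pos. assert (0 < sqrt 2) by (apply sqrt_lt_R0; lra).
  assert (0 < sqrt 2 / sdel) by (apply Rdiv_lt_0_compat; auto).
  rewrite Rabs_mult, Rabs_Ropp, Rabs_pos_eq by lra. apply Rmult_le_compat_l. lra.
  match goal with |- Rabs (atan ?z) <= _ => pose proof (atan_bound z) end. pose proof PI_4. apply Rabs_le. lra.
Qed.

(* [Q = 2 (y + kap x^2 / 4)^2 + sdel^2 x^4], and [sigma] is the half-angle form of an arctangent of
   [(y + kap x^2 / 4) / x^2]: this form is also defined on the line [x = 0]. *)
Lemma sigma_derive (X Y : R -> R) t vx vy : is_derive X t vx -> is_derive Y t vy -> X t <> 0 \/ Y t <> 0 ->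
  is_derive (fun u => sigma (X u) (Y u)) t (X t * (2 * Y t * vx - X t * vy) / Qr (X t) (Y t)).
Proof.
  intros HX HY N. pose proof (Qr_pos _ _ N) as QP. pose proof sdel_pos as DP. pose proof sdel_sq as DS.
  set (S := sqrt (Qr (X t) (Y t))). assert (SP : 0 < S) by (apply sqrt_lt_R0; auto).
  assert (SS : S * S = Qr (X t) (Y t)) by (apply sqrt_sqrt; lra).
  set (r2 := sqrt 2). assert (R2P : 0 < r2) by (apply sqrt_lt_R0; lra). assert (R2 : r2 * r2 = 2) by (apply sqrt_sqrt; lra).
  set (D := sdel * X t ^ 2 + S). assert (PD : 0 < D) by (unfold D; pose proof (pow2_ge_0 (X t)); nra).
  set (Y1 := Y t + kap / 4 * X t ^ 2).
  set (dY1 := vy + kap / 4 * (2 * X t * vx)). set (dQ := 4 * Y1 * dY1 + 4 * sdel ^ 2 * X t ^ 3 * vx).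
  set (dD := sdel * (2 * X t * vx) + dQ / (2 * S)). assert (QE : Qr (X t) (Y t) = 2 * Y1 ^ 2 + sdel ^ 2 * X t ^ 4).
  { unfold Qr, Y1. replace (sdel ^ 2) with (1 - kap ^ 2 / 8) by lra. field. }
  assert (H1 : is_derive (fun u => Qr (X u) (Y u)) t dQ).
  { unfold Qr. evar_last. auto_derive. repeat split; eexists; eassumption. reflexivity. use_velocity HX. use_velocity HY.
    unfold dQ, Y1, dY1. replace (sdel ^ 2) with (1 - kap ^ 2 / 8) by lra. eqR. field. }
  assert (H2 : is_derive (fun u => sqrt (Qr (X u) (Y u))) t (dQ / (2 * S))).
  { exact (is_derive_sqrt _ _ _ H1 QP). }
  assert (H3 : is_derive (fun u => sdel * X u ^ 2 + sqrt (Qr (X u) (Y u))) t dD).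
  { evar_last. apply (is_derive_plus (fun u => sdel * X u ^ 2) (fun u => sqrt (Qr (X u) (Y u)))).
    - auto_derive. eexists; eassumption. reflexivity.
    - exact H2.
    - use_velocity HX. match goal with |- plus ?a ?b = ?e => change (a + b = e) end. unfold dD. ring. }
  assert (H4 : is_derive (fun u => r2 * (Y u + kap / 4 * X u ^ 2)) t (r2 * dY1)).
  { evar_last. auto_derive. repeat split; eexists; eassumption. reflexivity. use_velocity HX. use_velocity HY. unfold dY1. eqR. field. }
  assert (H5 : is_derive (fun u => r2 * (Y u + kap / 4 * X u ^ 2) / (sdel * X u ^ 2 + sqrt (Qr (X u) (Y u)))) t ((r2 * dY1 * D - r2 * Y1 * dD) / D ^ 2)).
  { evar_last. apply (is_derive_div (fun u => r2 * (Y u + kap / 4 * X u ^ 2)) (fun u => sdel * X u ^ 2 + sqrt (Qr (X u) (Y u)))).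
    exact H4. exact H3. fold S. fold D. lra. fold S. fold D. fold Y1. reflexivity. }
  evar_last. apply is_derive_scal. apply (is_derive_comp atan). apply is_derive_atan. exact H5.
  match goal with |- ?c * scal ?a ?b = ?e => change (c * (a * b) = e) end. fold S. fold D. fold Y1. fold r2.
  assert (E1 : 1 + (r2 * Y1 / D)² = 2 * S / D).
  { unfold Rsqr. apply Rmult_eq_reg_r with (D * D). 2:{ nra. }
    replace ((1 + r2 * Y1 / D * (r2 * Y1 / D)) * (D * D)) with (D * D + (r2 * r2) * Y1 ^ 2) by (field; lra).
    replace (2 * S / D * (D * D)) with (2 * S * D) by (field; lra). rewrite R2.
    unfold D. replace (2 * S * (sdel * X t ^ 2 + S)) with (2 * S * sdel * X t ^ 2 + 2 * (S * S)) by ring.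
    replace ((sdel * X t ^ 2 + S) * (sdel * X t ^ 2 + S)) with (sdel ^ 2 * X t ^ 4 + 2 * S * sdel * X t ^ 2 + S * S) by ring.
    rewrite SS, QE. ring. }
  rewrite E1. unfold dD.
  assert (E2 : X t * (2 * Y t * vx - X t * vy) = - (X t ^ 2 * dY1 - 2 * X t * vx * Y1)) by (unfold dY1, Y1; field).
  rewrite E2, <- SS. clearbody S.
  assert (E3 : (S * S) * dY1 - Y1 * dQ / 2 = sdel ^ 2 * X t ^ 2 * (X t ^ 2 * dY1 - 2 * X t * vx * Y1)).
  { rewrite SS, QE. unfold dQ. field. }
  assert (E4 : dY1 * D - Y1 * (sdel * (2 * X t * vx) + dQ / (2 * S)) = sdel * (X t ^ 2 * dY1 - 2 * X t * vx * Y1) * D / S).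
  { apply Rmult_eq_reg_r with S; [|lra]. replace ((dY1 * D - Y1 * (sdel * (2 * X t * vx) + dQ / (2 * S))) * S) with
      (S * sdel * (X t ^ 2 * dY1 - 2 * X t * vx * Y1) + ((S * S) * dY1 - Y1 * dQ / 2)) by (unfold D; field; lra).
    rewrite E3. replace (sdel * (X t ^ 2 * dY1 - 2 * X t * vx * Y1) * D / S * S) with (sdel * (X t ^ 2 * dY1 - 2 * X t * vx * Y1) * D) by (field; lra). unfold D. ring. }
  replace (r2 * dY1 * D - r2 * Y1 * (sdel * (2 * X t * vx) + dQ / (2 * S))) with (r2 * (dY1 * D - Y1 * (sdel * (2 * X t * vx) + dQ / (2 * S)))) by ring.
  rewrite E4. set (Z := X t ^ 2 * dY1 - 2 * X t * vx * Y1).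
  transitivity (- (r2 * r2) * Z / (2 * (S * S))). field. repeat split; lra. rewrite R2. field. lra.
Qed.
End Sigma.

Lemma ev_one x y env : ev x y env pone = 1.
Proof. unfold pone; simpl. rewrite Q2R_1. ring. Qed.
Lemma Q2R_2 : Q2R 2 = 2. Proof. unfold Q2R; simpl. lra. Qed.
Lemma Q2R_m1 : Q2R (-1) = -1. Proof. unfold Q2R; simpl. lra. Qed.
Ltac evs := repeat first [rewrite ev_add | rewrite ev_mul | rewrite ev_sub | rewrite ev_scale | rewrite ev_shift | rewrite ev_pow | rewrite ev_one | rewrite Q2R_2 | rewrite Q2R_m1 | rewrite Q2R_nat].

Definition all_constant (f : coefs) : bool :=
  forallb constant (coef_list f).

(** Intended for polynomials in the parameters only, for which the point [(1, 1)] is arbitrary. *)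
Definition cst (env : nat -> R) (p : poly) : R := ev 1 1 env p.
Definition field_of (f : coefs) (env : nat -> R) : R * R -> R * R :=
  cubic_system (cst env (p20 f)) (cst env (p11 f)) (cst env (p02 f)) (cst env (p30 f)) (cst env (p21 f)) (cst env (p12 f)) (cst env (p03 f))
    (cst env (q11 f)) (cst env (q02 f)) (cst env (q21 f)) (cst env (q12 f)) (cst env (q03 f)) 1.

Section Eval.
Variables (f : coefs) (env : nat -> R).
Hypothesis Hc : all_constant f = true.
Notation al := (cst env (p20 f)).
Notation be := (cst env (q11 f)).
Notation kap := (2 * al - be).
Notation tau := (2 * al + be).
Definition Px k x y := ev x y env (comp f k).1.
Definition Py k x y := ev x y env (comp f k).2.

Lemma all_constant_in p : In p (coef_list f) ->
  forall x y, ev x y env p = cst env p.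
Proof.
  intros Hi x y. apply constant_ev. unfold all_constant in Hc. rewrite forallb_forall in Hc. apply Hc; auto.
Qed.
Ltac cs := repeat match goal with |- context [ev ?x ?y env (?g f)] => rewrite (all_constant_in (g f) ltac:(simpl; tauto) x y) end.

Lemma Px1 x y : Px 1 x y = y + al * x ^ 2.
Proof. unfold Px, comp, fst. evs. cs. ring. Qed.
Lemma Py1 x y : Py 1 x y = - x ^ 3 + be * (x * y).
Proof. unfold Py, comp, snd. evs. cs. ring. Qed.

Lemma field_split x y : field_of f env (x, y) =
  (Px 1 x y + Px 2 x y + Px 3 x y + Px 4 x y + Px 5 x y, Py 1 x y + Py 2 x y + Py 3 x y + Py 4 x y + Py 5 x y).
Proof.
  rewrite Px1, Py1. unfold Px, Py, comp, fst, snd. evs. cs. change (ev x y env []) with 0.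
  unfold field_of, cubic_system. f_equal; ring.
Qed.

Lemma ev_tt x y : ev x y env (tt f) = tau.
Proof. unfold tt. evs. cs. ring. Qed.
Lemma ev_qq x y : ev x y env (qq f) = Qr kap x y.
Proof. unfold qq, Qr. evs. cs. ring. Qed.
Lemma ev_dx_qq x y : ev x y env (dx (qq f)) = 4 * x ^ 3 + 2 * kap * x * y.
Proof.
  assert (D : is_derive (fun u => Qr kap u y) x (4 * x ^ 3 + 2 * kap * x * y)).
  { unfold Qr. auto_derive; auto. ring. }
  rewrite <- (is_derive_unique _ _ _ D). symmetry. apply is_derive_unique.
  apply (is_derive_ext (fun u => ev u y env (qq f))). intros; apply ev_qq. apply ev_dx.
Qed.
Lemma ev_dy_qq x y : ev x y env (dy (qq f)) = 4 * y + kap * x ^ 2.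
Proof.
  assert (D : is_derive (fun u => Qr kap x u) y (4 * y + kap * x ^ 2)).
  { unfold Qr. auto_derive; auto. ring. }
  rewrite <- (is_derive_unique _ _ _ D). symmetry. apply is_derive_unique.
  apply (is_derive_ext (fun u => ev x u env (qq f))). intros; apply ev_qq. apply ev_dy.
Qed.
Lemma ev_lie k p x y : ev x y env (lie f k p) = Px k x y * ev x y env (dx p) + Py k x y * ev x y env (dy p).
Proof. unfold lie. evs. reflexivity. Qed.
Lemma ev_lie_qq k x y : ev x y env (lie f k (qq f)) = Px k x y * (4 * x ^ 3 + 2 * kap * x * y) + Py k x y * (4 * y + kap * x ^ 2).
Proof. rewrite ev_lie, ev_dx_qq, ev_dy_qq. reflexivity. Qed.
Lemma ev_sk k x y : ev x y env (sk f k) = x * (2 * y * Px k x y - x * Py k x y).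
Proof. unfold sk. evs. unfold Px, Py. ring. Qed.
(** The cofactor [tau x] is the divergence of the leading part, so [Q] is an inverse integrating
    factor. *)
Lemma lie1_qq x y : ev x y env (lie f 1 (qq f)) = tau * x * Qr kap x y.
Proof. rewrite ev_lie_qq, Px1, Py1. unfold Qr. ring. Qed.

Definition sg := sigma kap.
Definition pair_val (A B : poly) (j : nat) (x y : R) : R := (ev x y env A + sg x y * ev x y env B) / Qr kap x y ^ j.
Definition ival (it : item) x y : R := let '(n, A, B) := it in pair_val A B (n - 1) x y.
Fixpoint isum (its : list item) x y : R := match its with [] => 0 | it :: its' => ival it x y + isum its' x y end.
Fixpoint wsum (j : nat) (ws : list (poly * poly)) x y : R :=
  match ws with [] => 0 | w :: ws' => pair_val w.1 w.2 j x y + wsum (S j) ws' x y end.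

Hypothesis Hkap : Rabs kap <= 1.

(** The directional derivative of [pair_val] as an expression linear in the velocity, so that it
    splits over the components of the field by weight. *)
Definition lin (A B : poly) (j : nat) x y vx vy : R :=
  (ev x y env (dx A) * vx + ev x y env (dy A) * vy + (x * (2 * y * vx - x * vy) / Qr kap x y) * ev x y env B
   + sg x y * (ev x y env (dx B) * vx + ev x y env (dy B) * vy)) / Qr kap x y ^ j
  - INR j * (ev x y env A + sg x y * ev x y env B) * ((4 * x ^ 3 + 2 * kap * x * y) * vx + (4 * y + kap * x ^ 2) * vy) / Qr kap x y ^ S j.

Lemma Qr_derive (X Y : R -> R) t vx vy : is_derive X t vx -> is_derive Y t vy ->
  is_derive (fun u => Qr kap (X u) (Y u)) t ((4 * X t ^ 3 + 2 * kap * X t * Y t) * vx + (4 * Y t + kap * X t ^ 2) * vy).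
Proof.
  intros HX HY. unfold Qr. evar_last. auto_derive. repeat split; eexists; eassumption. reflexivity. use_velocity HX. use_velocity HY. eqR. ring.
Qed.

Lemma pair_val_derive A B j (X Y : R -> R) t vx vy : is_derive X t vx -> is_derive Y t vy -> X t <> 0 \/ Y t <> 0 ->
  is_derive (fun u => pair_val A B j (X u) (Y u)) t (lin A B j (X t) (Y t) vx vy).
Proof.
  intros HX HY N. pose proof (Qr_pos kap Hkap _ _ N) as QP.
  pose proof (ev_derive X Y env t vx vy A HX HY) as DA. pose proof (ev_derive X Y env t vx vy B HX HY) as DB.
  pose proof (sigma_derive kap Hkap X Y t vx vy HX HY N) as DS. fold sg in DS.
  pose proof (is_derive_inv_pow _ t _ j (Qr_derive X Y t vx vy HX HY) !!) as DQ.
  set (a := fun u => ev (X u) (Y u) env A) in *. set (b := fun u => ev (X u) (Y u) env B) in *.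
  set (s := fun u => sg (X u) (Y u)) in *. set (iq := fun u => / Qr kap (X u) (Y u) ^ j) in *.
  apply (is_derive_ext (fun u => (a u + s u * b u) * iq u)). { reflexivity. }
  evar_last. auto_derive. repeat split; eexists; eassumption. reflexivity.
  match type of DA with is_derive _ _ ?v => replace (Derive (fun x => a x) t) with v by (symmetry; exact (is_derive_unique _ _ _ DA)) end.
  match type of DB with is_derive _ _ ?v => replace (Derive (fun x => b x) t) with v by (symmetry; exact (is_derive_unique _ _ _ DB)) end.
  match type of DS with is_derive _ _ ?v => replace (Derive (fun x => s x) t) with v by (symmetry; exact (is_derive_unique _ _ _ DS)) end.
  match type of DQ with is_derive _ _ ?v => replace (Derive (fun x => iq x) t) with v by (symmetry; exact (is_derive_unique _ _ _ DQ)) end.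
  unfold lin. unfold iq, a, b, s. assert (Qr kap (X t) (Y t) ^ j <> 0) by (apply pow_nonzero; lra). change (Qr kap (X t) (Y t) ^ S j) with (Qr kap (X t) (Y t) * Qr kap (X t) (Y t) ^ j). eqR. field. repeat (apply conj); first [assumption | apply Rgt_not_eq; assumption].
Qed.

Lemma ival_w1 A B j x y : x <> 0 \/ y <> 0 -> ival (w_item f j (A, B) 1) x y = lin A B j x y (Px 1 x y) (Py 1 x y).
Proof.
  intros N. pose proof (Qr_pos kap Hkap _ _ N) as QP. assert (QJ : Qr kap x y ^ j <> 0) by (apply pow_nonzero; lra).
  unfold ival, w_item, pair_val. replace (S j - 1)%nat with j by lia. evs. rewrite !ev_lie, ev_tt.
  pose proof (lie1_qq x y) as L. rewrite ev_lie_qq in L. unfold lin.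
  replace ((4 * x ^ 3 + 2 * kap * x * y) * Px 1 x y + (4 * y + kap * x ^ 2) * Py 1 x y) with (tau * x * Qr kap x y) by (rewrite <- L; ring).
  replace (x * (2 * y * Px 1 x y - x * Py 1 x y)) with (x * Qr kap x y) by (rewrite Px1, Py1; unfold Qr; ring).
  simpl pow. field. repeat (apply conj); first [assumption | apply Rgt_not_eq; assumption].
Qed.

Lemma ival_wk A B j k x y : (2 <= k)%nat -> x <> 0 \/ y <> 0 -> ival (w_item f j (A, B) k) x y = lin A B j x y (Px k x y) (Py k x y).
Proof.
  intros Hk N. pose proof (Qr_pos kap Hkap _ _ N) as QP.
  assert (QJ : Qr kap x y ^ j <> 0) by (apply pow_nonzero; lra). assert (QK : Qr kap x y ^ (k - 2) <> 0) by (apply pow_nonzero; lra).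
  assert (E : ival (w_item f j (A, B) k) x y = pair_val
     (pmul (padd (poly_sub (pmul (lie f k A) (qq f)) (pscale (inject_Z (Z.of_nat j)) (pmul A (lie f k (qq f))))) (pmul B (sk f k))) (ppow (qq f) (k - 2)))
     (pmul (poly_sub (pmul (lie f k B) (qq f)) (pscale (inject_Z (Z.of_nat j)) (pmul B (lie f k (qq f))))) (ppow (qq f) (k - 2))) (j + k - 1) x y).
  { destruct k as [|[|k]]; try lia. reflexivity. }
  rewrite E. unfold pair_val. evs. rewrite ev_lie_qq, !ev_lie, ev_qq, ev_sk. unfold lin.
  replace (j + k - 1)%nat with ((k - 2) + S j)%nat by lia. rewrite pow_add. simpl pow. field. repeat (apply conj); first [assumption | apply Rgt_not_eq; assumption].
Qed.

Lemma lin_sum A B j x y v1 u1 v2 u2 v3 u3 v4 u4 v5 u5 : x <> 0 \/ y <> 0 ->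
  lin A B j x y (v1 + v2 + v3 + v4 + v5) (u1 + u2 + u3 + u4 + u5) =
  lin A B j x y v1 u1 + lin A B j x y v2 u2 + lin A B j x y v3 u3 + lin A B j x y v4 u4 + lin A B j x y v5 u5.
Proof.
  intros N. pose proof (Qr_pos kap Hkap _ _ N) as QP. assert (QJ : Qr kap x y ^ j <> 0) by (apply pow_nonzero; lra).
  unfold lin. simpl pow. field. repeat (apply conj); first [assumption | apply Rgt_not_eq; assumption].
Qed.

Lemma wsum_derive ws j (X Y : R -> R) t (Hj : (1 <= j)%nat) : X t <> 0 \/ Y t <> 0 ->
  has_velocity (fun u => (X u, Y u)) t (field_of f env (X t, Y t)) ->
  is_derive (fun u => wsum j ws (X u) (Y u)) t (isum (map (tag_item f) (w_tags j ws)) (X t) (Y t)).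
Proof.
  intros N [HX HY]. rewrite field_split in HX, HY. cbn [fst snd] in HX, HY. revert j Hj. induction ws as [|w ws IH]; intros j Hj.
  - simpl. apply is_derive_constR.
  - cbn [wsum w_tags map isum]. destruct j as [|j]; [lia|]. cbn [tag_item]. evar_last.
    apply (is_derive_plus (fun u => pair_val w.1 w.2 (S j) (X u) (Y u)) (fun u => wsum (S (S j)) ws (X u) (Y u))).
    apply pair_val_derive; eassumption. apply IH; lia. match goal with |- plus ?a ?b = ?c => change (a + b = c) end.
    rewrite lin_sum by auto. destruct w as [A B]. rewrite ival_w1, !ival_wk by (auto; lia). cbn [fst snd]. ring.
Qed.

Definition base x y : R := ln (Qr kap x y) - tau * sg x y.

Lemma ival_log k x y : (2 <= k)%nat -> x <> 0 \/ y <> 0 ->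
  ival (log_item f k) x y = (Px k x y * (4 * x ^ 3 + 2 * kap * x * y) + Py k x y * (4 * y + kap * x ^ 2) - tau * (x * (2 * y * Px k x y - x * Py k x y))) / Qr kap x y.
Proof.
  intros Hk N. pose proof (Qr_pos kap Hkap _ _ N) as QP. assert (QK : Qr kap x y ^ (k - 2) <> 0) by (apply pow_nonzero; lra).
  unfold ival, log_item, pair_val. evs. rewrite ev_lie_qq, ev_tt, ev_qq, ev_sk. change (ev x y env []) with 0.
  replace (k - 1)%nat with (S (k - 2)) by lia. simpl pow. field. repeat (apply conj); first [assumption | apply Rgt_not_eq; assumption].
Qed.

(** The component of weight 1 contributes [tau x - tau x = 0]; only the weights 2 to 5 remain. *)
Lemma base_derive (X Y : R -> R) t : X t <> 0 \/ Y t <> 0 ->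
  has_velocity (fun u => (X u, Y u)) t (field_of f env (X t, Y t)) ->
  is_derive (fun u => base (X u) (Y u)) t (isum [log_item f 2; log_item f 3; log_item f 4; log_item f 5] (X t) (Y t)).
Proof.
  intros N [HX HY]. rewrite field_split in HX, HY. cbn [fst snd] in HX, HY. pose proof (Qr_pos kap Hkap _ _ N) as QP.
  pose proof (Qr_derive X Y t _ _ HX HY) as DQ. pose proof (sigma_derive kap Hkap X Y t _ _ HX HY N) as DS. fold sg in DS.
  unfold base. evar_last. apply (is_derive_minus (fun u => ln (Qr kap (X u) (Y u))) (fun u => tau * sg (X u) (Y u))).
  apply (is_derive_comp ln (fun u => Qr kap (X u) (Y u))). apply is_derive_ln; exact QP. exact DQ.
  apply is_derive_scal. exact DS. match goal with |- minus (scal ?a ?b) ?c = ?e => change (a * b - c = e) end.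
  cbn [isum]. rewrite !ival_log by (auto; lia).
  pose proof (lie1_qq (X t) (Y t)) as L. rewrite ev_lie_qq, Px1, Py1 in L. rewrite Px1, Py1.
  match goal with |- ?a = ?b => assert (E : a - b = ((Y t + al * X t ^ 2) * (4 * X t ^ 3 + 2 * kap * X t * Y t) +
      (- X t ^ 3 + be * (X t * Y t)) * (4 * Y t + kap * X t ^ 2) - tau * (X t * (2 * Y t * (Y t + al * X t ^ 2) - X t * (- X t ^ 3 + be * (X t * Y t))))) / Qr kap (X t) (Y t)) by (field; lra) end.
  rewrite L in E.
  replace (X t * (2 * Y t * (Y t + al * X t ^ 2) - X t * (- X t ^ 3 + be * (X t * Y t)))) with (X t * Qr kap (X t) (Y t)) in E by (unfold Qr; ring).
  replace ((tau * X t * Qr kap (X t) (Y t) - tau * (X t * Qr kap (X t) (Y t))) / Qr kap (X t) (Y t)) with 0 in E by (field; lra). lra.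
Qed.
End Eval.

(** * Obstructions to a center *)

Definition weighted_ws (j : nat) (ws : list (poly * poly)) : bool :=
  forallb (fun jw : nat * (poly * poly) => weighted (5 * jw.1) jw.2.1 && weighted (5 * jw.1) jw.2.2) (combine (seq j (length ws)) ws).

(** The certificate test. Up to index [M + 1] the collected derivative must be exactly
    [- r_n x^(5n-4)], without [sigma]; beyond, up to the maximal index [M + 5], no identity is
    required, since the weights of the [w_j] give the size of what is left. *)
Definition check (f : coefs) (M : nat) (ws : list (poly * poly)) (rs : list poly) : bool :=
  all_constant f &&
  forallb constant rs &&
  forallb (fun t => Nat.leb (tag_index t) (M + 5)) (tags ws) &&
  forallb (fun n => let '(A, B) := collect f n (tags ws) in
     is_zero (padd A (shift (5 * n - 4) 0 (nth n rs []))) && is_zero B) (seq 0 (M + 2)) &&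
  weighted_ws 1 ws.

Lemma weighted_add w p q : weighted w p = true -> weighted w q = true -> weighted w (padd p q) = true.
Proof.
  revert q. induction p as [|s p IH]; intros q Hp Hq; auto. induction q as [|t q IHq]; auto.
  change (padd (s :: p) (t :: q)) with
   (match term_cmp s t with
          | Eq => let c := Qred (s.2 + t.2) in
                  if Qeq_bool c 0 then padd p q else (s.1, c) :: padd p q
          | Lt => s :: padd p (t :: q)
          | Gt => t :: padd (s :: p) q
          end).
  pose proof Hp as Hp'. pose proof Hq as Hq'. unfold weighted in Hp', Hq'. cbn [forallb] in Hp', Hq'. apply andb_true_iff in Hp'. apply andb_true_iff in Hq'.
  destruct Hp' as [P1 P2]. destruct Hq' as [Q1 Q2]. destruct (term_cmp s t).
  - cbv zeta. destruct (Qeq_bool _ 0). apply IH; auto. unfold weighted. cbn [forallb]. apply andb_true_iff. split; [|apply IH; auto].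
    destruct s as [[[i j] l] c]. exact P1.
  - unfold weighted. cbn [forallb]. apply andb_true_iff. split; auto. apply IH; auto.
  - unfold weighted. cbn [forallb]. apply andb_true_iff. split; auto.
Qed.
Lemma weighted_map w w' (g : term -> term) p :
  (forall i j l c, (i + 2 * j = w)%nat -> let '(i', j', _, _) := g (i, j, l, c) in (i' + 2 * j' = w')%nat) ->
  weighted w p = true -> weighted w' (map g p) = true.
Proof.
  intros Hg. induction p as [|t p IH]; intros H; auto. unfold weighted in *. cbn [map forallb] in *. apply andb_true_iff in H as [H1 H2].
  apply andb_true_iff. split; auto. destruct t as [[[i j] l] c]. apply Nat.eqb_eq in H1. specialize (Hg i j l c H1).
  destruct (g (i, j, l, c)) as [[[i' j'] l'] c']. apply Nat.eqb_eq. auto.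
Qed.
Lemma weighted_scale w c p : weighted w p = true -> weighted w (pscale c p) = true.
Proof. apply weighted_map. intros i j l d H. simpl. lia. Qed.
Lemma weighted_shift w w' a b p : weighted w p = true -> (w' = w + a + 2 * b)%nat -> weighted w' (shift a b p) = true.
Proof. intros H ->. revert H. apply weighted_map. intros i j l d H. lia. Qed.
Lemma weighted_sub w p q : weighted w p = true -> weighted w q = true -> weighted w (poly_sub p q) = true.
Proof. intros. apply weighted_add; auto. apply weighted_scale; auto. Qed.
Lemma weighted_mul w w' w'' p q : weighted w p = true -> weighted w' q = true -> (w'' = w + w')%nat -> weighted w'' (pmul p q) = true.
Proof.
  intros Hp Hq ->. induction p as [|t p IH]; auto. pose proof Hp as Hp'. unfold weighted in Hp'. cbn [forallb] in Hp'. apply andb_true_iff in Hp'. destruct Hp' as [P1 P2].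
  cbn [pmul]. apply weighted_add; auto. revert Hq. apply weighted_map. intros i j l d H. destruct t as [[[i' j'] l'] c']. apply Nat.eqb_eq in P1. simpl. lia.
Qed.
Lemma weighted_pow w w' p n : weighted w p = true -> (w' = n * w)%nat -> weighted w' (ppow p n) = true.
Proof.
  intros H ->. induction n as [|n IH]. reflexivity. cbn [ppow]. eapply weighted_mul; [exact H|exact IH|]. lia.
Qed.
Lemma weighted_dx w p : weighted (S w) p = true -> weighted w (dx p) = true.
Proof.
  induction p as [|t p IH]; intros H; auto. destruct t as [[[i j] l] c]. pose proof H as H'. unfold weighted in H'. cbn [forallb] in H'. apply andb_true_iff in H'. destruct H' as [P1 P2].
  destruct i as [|i]; cbn [dx]; auto. unfold weighted. cbn [forallb]. apply andb_true_iff. split; [|apply IH; auto]. apply Nat.eqb_eq in P1. apply Nat.eqb_eq. lia.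
Qed.
Lemma weighted_dy w p : weighted (S (S w)) p = true -> weighted w (dy p) = true.
Proof.
  induction p as [|t p IH]; intros H; auto. destruct t as [[[i j] l] c]. pose proof H as H'. unfold weighted in H'. cbn [forallb] in H'. apply andb_true_iff in H'. destruct H' as [P1 P2].
  destruct j as [|j]; cbn [dy]; auto. unfold weighted. cbn [forallb]. apply andb_true_iff. split; [|apply IH; auto]. apply Nat.eqb_eq in P1. apply Nat.eqb_eq. lia.
Qed.

Section Weights.
Variable f : coefs.
Hypothesis Hc : all_constant f = true.

Lemma weighted_coef p : In p (coef_list f) -> weighted 0 p = true.
Proof. intros H. unfold all_constant in Hc. rewrite forallb_forall in Hc. apply Hc; auto. Qed.
Lemma weighted_one : weighted 0 pone = true. Proof. reflexivity. Qed.
Ltac wc := first [apply weighted_one | apply weighted_coef; simpl; tauto].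

Lemma weighted_comp k : weighted (k + 1) (comp f k).1 = true /\ weighted (k + 2) (comp f k).2 = true.
Proof.
  destruct k as [|[|[|[|[|[|k]]]]]]; split; cbn [comp fst snd]; try reflexivity;
  repeat first [apply weighted_add | apply weighted_scale | eapply weighted_shift; [wc|reflexivity]].
Qed.
Lemma weighted_tt : weighted 0 (tt f) = true.
Proof. apply weighted_add. apply weighted_scale. wc. wc. Qed.
Lemma weighted_qq : weighted 4 (qq f) = true.
Proof.
  repeat apply weighted_add. reflexivity. apply weighted_scale. reflexivity.
  eapply weighted_shift; [apply weighted_sub; [apply weighted_scale|]; wc|reflexivity].
Qed.
Lemma weighted_lie k w w' p : weighted w p = true -> (2 <= w)%nat -> (w' = w + k)%nat -> weighted w' (lie f k p) = true.
Proof.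
  intros H Hw ->. destruct (weighted_comp k) as [H1 H2]. destruct w as [|[|w]]; try lia. unfold lie. apply weighted_add.
  - eapply weighted_mul; [exact H1|apply weighted_dx; exact H|lia].
  - eapply weighted_mul; [exact H2|apply weighted_dy; exact H|lia].
Qed.
Lemma weighted_sk k : weighted (k + 4) (sk f k) = true.
Proof.
  destruct (weighted_comp k) as [H1 H2]. apply weighted_sub. apply weighted_scale.
  eapply weighted_shift; [exact H1|lia]. eapply weighted_shift; [exact H2|lia].
Qed.

Lemma weighted_item j A B k : (1 <= j)%nat -> (1 <= k)%nat -> weighted (5 * j) A = true -> weighted (5 * j) B = true ->
  let '(_, A', B') := w_item f j (A, B) k in weighted (5 * (j + k) - 4) A' = true /\ weighted (5 * (j + k) - 4) B' = true.
Proof.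
  intros Hj Hk HA HB. destruct k as [|[|k]]; [lia| |]; unfold w_item; split.
  - apply weighted_add. apply weighted_sub. eapply weighted_lie; [exact HA|lia|lia].
    apply weighted_scale. eapply weighted_shift; [eapply weighted_mul; [apply weighted_tt|exact HA|reflexivity]|lia].
    eapply weighted_shift; [exact HB|lia].
  - apply weighted_sub. eapply weighted_lie; [exact HB|lia|lia].
    apply weighted_scale. eapply weighted_shift; [eapply weighted_mul; [apply weighted_tt|exact HB|reflexivity]|lia].
  - eapply weighted_mul; [|eapply weighted_pow; [apply weighted_qq|reflexivity]|].
    apply weighted_add. apply weighted_sub.
    eapply weighted_mul; [eapply weighted_lie; [exact HA|lia|reflexivity]|apply weighted_qq|reflexivity].
    apply weighted_scale. eapply weighted_mul; [exact HA|eapply weighted_lie; [apply weighted_qq|lia|reflexivity]|lia].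
    eapply weighted_mul; [exact HB|apply weighted_sk|lia]. lia.
  - eapply weighted_mul; [|eapply weighted_pow; [apply weighted_qq|reflexivity]|]. apply weighted_sub.
    eapply weighted_mul; [eapply weighted_lie; [exact HB|lia|reflexivity]|apply weighted_qq|reflexivity].
    apply weighted_scale. eapply weighted_mul; [exact HB|eapply weighted_lie; [apply weighted_qq|lia|reflexivity]|lia]. lia.
Qed.

Lemma weighted_log k : (2 <= k)%nat -> let '(_, A', B') := log_item f k in weighted (5 * k - 4) A' = true /\ weighted (5 * k - 4) B' = true.
Proof.
  intros Hk. unfold log_item. split; [|reflexivity]. eapply weighted_mul; [|eapply weighted_pow; [apply weighted_qq|reflexivity]|].
  apply weighted_sub. eapply weighted_lie; [apply weighted_qq|lia|reflexivity]. eapply weighted_mul; [apply weighted_tt|apply weighted_sk|lia]. lia.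
Qed.

(** Weights are followed symbolically through every item, so that the large numerators of index
    above [M + 1] never have to be expanded. *)
Lemma weighted_tags ws : weighted_ws 1 ws = true -> forall t, In t (tags ws) ->
  let '(_, A, B) := tag_item f t in weighted (5 * tag_index t - 4) A = true /\ weighted (5 * tag_index t - 4) B = true.
Proof.
  intros H t Ht. assert (G : forall l j, (1 <= j)%nat -> weighted_ws j l = true -> forall t, In t (w_tags j l) ->
    let '(_, A, B) := tag_item f t in weighted (5 * tag_index t - 4) A = true /\ weighted (5 * tag_index t - 4) B = true).
  { clear - Hc. intros l. induction l as [|[A B] l IH]; intros j Hj H t Ht. destruct Ht.
    unfold weighted_ws in H. cbn [length seq combine forallb fst snd] in H. apply andb_true_iff in H as [H H2]. apply andb_true_iff in H as [HA HB].
    cbn [w_tags In] in Ht.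
    assert (W : forall k, (1 <= k)%nat -> let '(_, A', B') := tag_item f (j, (A, B), k) in weighted (5 * tag_index (j, (A, B), k) - 4) A' = true /\ weighted (5 * tag_index (j, (A, B), k) - 4) B' = true).
    { intros k Hk. destruct j as [|j]; [lia|]. apply (weighted_item (S j) A B k); auto. }
    destruct Ht as [<-|[<-|[<-|[<-|[<-|Ht]]]]]; try (apply W; lia). apply (IH (S j)); auto. }
  unfold tags in Ht. cbn [In] in Ht. destruct Ht as [<-|[<-|[<-|[<-|Ht]]]]; [apply (weighted_log 2); lia|apply (weighted_log 3); lia|apply (weighted_log 4); lia|apply (weighted_log 5); lia|].
  apply (G ws 1%nat); auto.
Qed.

Lemma weighted_collect ws n : weighted_ws 1 ws = true ->
  weighted (5 * n - 4) (collect f n (tags ws)).1 = true /\ weighted (5 * n - 4) (collect f n (tags ws)).2 = true.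
Proof.
  intros H. pose proof (weighted_tags ws H) as W. induction (tags ws) as [|t ts IH]. split; reflexivity.
  assert (IH' : weighted (5 * n - 4) (collect f n ts).1 = true /\ weighted (5 * n - 4) (collect f n ts).2 = true).
  { apply IH. intros t' Ht'. apply W. right; auto. }
  unfold collect. cbn [fold_right]. fold (collect f n ts). destruct (Nat.eqb_spec (tag_index t) n) as [E|]; auto.
  specialize (W t (or_introl eq_refl)). destruct (tag_item f t) as [[m A] B]. rewrite E in W. destruct W as [WA WB]. destruct IH' as [IA IB].
  cbn [fst snd]. split; apply weighted_add; auto.
Qed.
End Weights.

(* [Q^(1/4)], with [x] of weight 1 and [y] of weight 2 *)
Definition rad kap x y : R := sqrt (sqrt (Qr kap x y)).

Lemma pow_incr_inv (a b : R) n : 0 <= b -> a ^ S n <= b ^ S n -> a <= b.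
Proof.
  intros Hb H. destruct (Rle_lt_dec a b) as [|C]; auto. exfalso. assert (G : forall m, b ^ S m < a ^ S m).
  { induction m as [|m IH]. simpl. lra. change (b * b ^ S m < a * a ^ S m).
    assert (0 <= b ^ S m) by (apply pow_le; auto). nra. }
  specialize (G n). lra.
Qed.

Section Rad.
Variable kap : R.
Hypothesis Hkap : Rabs kap <= 1.

Lemma rad_4 x y : rad kap x y ^ 4 = Qr kap x y.
Proof.
  unfold rad. assert (0 <= Qr kap x y).
  { pose proof (Qr_lower kap Hkap x y). pose proof (pow2_ge_0 y). assert (0 <= x ^ 4) by (replace (x ^ 4) with ((x ^ 2) ^ 2) by ring; apply pow2_ge_0). lra. }
  replace (sqrt (sqrt (Qr kap x y)) ^ 4) with ((sqrt (sqrt (Qr kap x y)) * sqrt (sqrt (Qr kap x y))) ^ 2) by ring.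
  rewrite sqrt_sqrt by apply sqrt_pos. replace (sqrt (Qr kap x y) ^ 2) with (sqrt (Qr kap x y) * sqrt (Qr kap x y)) by ring. apply sqrt_sqrt; auto.
Qed.
Lemma rad_pos x y : x <> 0 \/ y <> 0 -> 0 < rad kap x y.
Proof. intros N. unfold rad. apply sqrt_lt_R0, sqrt_lt_R0, Qr_pos; auto. Qed.
Lemma rad_nonneg x y : 0 <= rad kap x y.
Proof. apply sqrt_pos. Qed.

Lemma rad_coords x y : Rabs x <= 2 * rad kap x y /\ Rabs y <= 2 * rad kap x y ^ 2.
Proof.
  pose proof (Qr_lower kap Hkap x y) as L. rewrite <- rad_4 in L. set (q := rad kap x y) in *.
  assert (Hq : 0 <= q) by apply rad_nonneg.
  assert (P4 : 0 <= x ^ 4) by (replace (x ^ 4) with ((x ^ 2) ^ 2) by ring; apply pow2_ge_0). pose proof (pow2_ge_0 y) as P2.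
  split.
  - apply pow_incr_inv with 3%nat. lra. replace ((2 * q) ^ 4) with (16 * q ^ 4) by ring. rewrite RPow_abs, Rabs_pos_eq; lra.
  - apply pow_incr_inv with 1%nat. pose proof (pow2_ge_0 q). lra. rewrite RPow_abs, Rabs_pos_eq by lra.
    replace ((2 * q ^ 2) ^ 2) with (4 * q ^ 4) by ring. assert (0 <= q ^ 4) by (apply pow_le; auto). lra.
Qed.

(** The derivative of the correction [x y q^N / Q], which has the weight [N - 1] that its derivative
    along the leading part raises to [N]. *)
Lemma rad_derive (X Y : R -> R) t vx vy N : is_derive X t vx -> is_derive Y t vy -> X t <> 0 \/ Y t <> 0 ->
  let q := rad kap (X t) (Y t) in let dq := (4 * X t ^ 3 + 2 * kap * X t * Y t) * vx + (4 * Y t + kap * X t ^ 2) * vy in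
  is_derive (fun u => X u * Y u * rad kap (X u) (Y u) ^ N / Qr kap (X u) (Y u)) t
    (q ^ N / q ^ 4 * (vx * Y t + X t * vy + X t * Y t * (INR N / 4 - 1) * (dq / q ^ 4))).
Proof.
  intros HX HY NZ q dq. pose proof (Qr_pos kap Hkap _ _ NZ) as QP. assert (HR : 0 < q) by (apply rad_pos; auto).
  assert (DQ : is_derive (fun u => Qr kap (X u) (Y u)) t dq).
  { unfold Qr. evar_last. auto_derive. repeat split; eexists; eassumption. reflexivity. use_velocity HX. use_velocity HY. unfold dq. eqR. ring. }
  pose proof (is_derive_sqrt _ _ _ DQ QP) as D1. pose proof (is_derive_sqrt _ _ _ D1 ltac:(apply sqrt_lt_R0; auto)) as D2.
  assert (SQ : sqrt (Qr kap (X t) (Y t)) = q ^ 2).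
  { unfold q, rad. simpl. rewrite Rmult_1_r, sqrt_sqrt; auto. apply sqrt_pos. }
  cbv beta in D2. change (sqrt (sqrt (Qr kap (X t) (Y t)))) with q in D2. rewrite SQ in D2.
  set (r := fun u => rad kap (X u) (Y u)). change (is_derive r t (dq / (2 * q ^ 2) / (2 * q))) in D2.
  set (Qf := fun u => Qr kap (X u) (Y u)) in *.
  apply (is_derive_ext (fun u => X u * Y u * r u ^ N / Qf u)). { reflexivity. }
  evar_last. auto_derive. repeat split; first [eexists; eassumption | unfold Qf; lra]. reflexivity.
  use_velocity HX. use_velocity HY.
  match type of D2 with is_derive _ _ ?v => replace (Derive (fun x => r x) t) with v by (symmetry; exact (is_derive_unique _ _ _ D2)) end.
  match type of DQ with is_derive _ _ ?v => replace (Derive (fun x => Qf x) t) with v by (symmetry; exact (is_derive_unique _ _ _ DQ)) end.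
  replace (Qf t) with (q ^ 4) by (unfold Qf, q; rewrite rad_4; auto). change (r t) with q. destruct N as [|N].
  - simpl. eqR. field. lra.
  - cbn [Nat.pred pow]. eqR. rewrite S_INR. field. lra.
Qed.

(** The even power of [x] vanishes only on [x = 0], where the added form reduces to [eta y^2 > 0] on
    [Q = 1]. That form is the derivative of the correction along the leading part. *)
Lemma hom_positive h : exists eta c, 0 < eta /\ 0 < c /\ forall x y k, Rabs k <= 1 / 2 -> Qr kap x y = 1 ->
  c <= x ^ (2 * h) + eta * (y ^ 2 - x ^ 4 + k * (x ^ 2 * y)).
Proof.
  assert (PH : 0 < (/ 4) ^ h) by (apply pow_lt; lra).
  assert (PH1 : (/ 4) ^ h <= 1). { rewrite <- (pow1 h). apply pow_incr. lra. }
  exists ((/ 4) ^ h / 8), ((/ 4) ^ h / 32). split; [lra|]. split; [lra|].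
  intros x y k Hk HQ. pose proof (Qr_lower kap Hkap x y) as L. rewrite HQ in L. unfold Qr in HQ.
  absle Hk. pose proof Hkap as Hk'. absle Hk'.
  rewrite pow_mult. replace (x ^ 4) with ((x ^ 2) ^ 2) in * by ring. set (u := x ^ 2) in *. assert (Hu : 0 <= u) by apply pow2_ge_0.
  assert (PU : 0 <= u ^ h) by (apply pow_le; auto). assert (By : Rabs y <= 1) by (apply Rabs_le; nra).
  assert (Bk : - (u * Rabs y / 2) <= k * (u * y)).
  { assert (G : Rabs (k * (u * y)) <= 1 / 2 * (u * Rabs y)). { rewrite !Rabs_mult, (Rabs_pos_eq u) by auto. apply Rmult_le_compat_r. apply Rmult_le_pos; auto; apply Rabs_pos. apply Rabs_le; lra. }
    absle G. lra. }
  assert (E2 : Rabs y ^ 2 = y ^ 2) by apply pow2_abs. pose proof (Rabs_pos y) as Py0.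
  (* For [x^2 <= 1/4] the equation [Q = 1] forces [|y| >= 5/8] and the added form is at least 1/4.
     For larger [x^2] the power is at least [(1/4)^h], and [eta] is small enough not to spoil
     this. *)
  destruct (Rle_lt_dec u (/ 4)) as [C|C].
  - assert (G : 2 * y ^ 2 + u * Rabs y >= 1 - u ^ 2).
    { assert (kap * (u * y) <= u * Rabs y). { eapply Rle_trans. apply Rle_abs. rewrite !Rabs_mult, (Rabs_pos_eq u) by auto. rewrite <- (Rmult_1_l (u * Rabs y)) at 2. apply Rmult_le_compat_r. apply Rmult_le_pos; auto. apply Rabs_le; lra. }
      lra. }
    rewrite <- E2 in *. set (z := Rabs y) in *. assert (u ^ 2 <= / 16) by nra. assert (u * z <= z / 4) by nra.
    assert (5 / 8 <= z) by nra. assert (1 / 4 <= z ^ 2 - u ^ 2 - u * z / 2) by nra.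
    assert ((/ 4) ^ h / 8 * (1 / 4) <= (/ 4) ^ h / 8 * (z ^ 2 - u ^ 2 + k * (u * y))) by (apply Rmult_le_compat_l; lra). lra.
  - assert (G : (/ 4) ^ h <= u ^ h) by (apply pow_incr; lra).
    assert (u ^ 2 <= 2) by (pose proof (pow2_ge_0 y); lra). assert (u <= 3 / 2) by nra. assert (u * Rabs y <= 3 / 2) by nra.
    assert ((/ 4) ^ h / 8 * (- 4) <= (/ 4) ^ h / 8 * (y ^ 2 - u ^ 2 + k * (u * y))) by (apply Rmult_le_compat_l; [lra|]; pose proof (pow2_ge_0 y); lra). lra.
Qed.
End Rad.

Section Collect.
Variables (f : coefs) (env : nat -> R).
Hypothesis Hc : all_constant f = true.
Notation al := (cst env (p20 f)).
Notation be := (cst env (q11 f)).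
Notation kap := (2 * al - be).
Notation tau := (2 * al + be).
Hypothesis Hal : Rabs al <= / 100.
Hypothesis Hbe : Rabs be <= / 100.

Lemma kap_small : Rabs kap <= 1.
Proof. absle Hal. absle Hbe. apply Rabs_le. lra. Qed.
Let Hkap := kap_small.

Definition cval ts n x y := let '(A, B) := collect f n ts in pair_val f env A B (n - 1) x y.
Fixpoint csum its K x y : R := match K with O => cval its 0 x y | S K' => csum its K' x y + cval its (S K') x y end.

Lemma pair_val_add A B A' B' j x y : x <> 0 \/ y <> 0 ->
  pair_val f env (padd A A') (padd B B') j x y = pair_val f env A B j x y + pair_val f env A' B' j x y.
Proof.
  intros N. pose proof (Qr_pos kap Hkap _ _ N) as QP. assert (Qr kap x y ^ j <> 0) by (apply pow_nonzero; lra).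
  unfold pair_val. rewrite !ev_add. field. auto.
Qed.

Lemma tag_item_index t : (tag_item f t).1.1 = tag_index t.
Proof. destruct t as [[[|j] [A B]] [|[|k]]]; simpl; lia. Qed.

Lemma csum_cons t ts K x y : x <> 0 \/ y <> 0 ->
  csum (t :: ts) K x y = (if Nat.leb (tag_index t) K then ival f env (tag_item f t) x y else 0) + csum ts K x y.
Proof.
  intros N. pose proof (tag_item_index t) as TI.
  assert (G : forall m, cval (t :: ts) m x y = (if Nat.eqb (tag_index t) m then ival f env (tag_item f t) x y else 0) + cval ts m x y).
  { intros m. unfold cval, collect. cbn [fold_right]. fold (collect f m ts).
    destruct (Nat.eqb_spec (tag_index t) m) as [<-|Hn]; [|ring]. destruct (tag_item f t) as [[n A] B]. cbn [fst] in TI. subst n.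
    destruct (collect f (tag_index t) ts) as [A' B']. cbn [fst snd]. rewrite pair_val_add by auto. reflexivity. }
  induction K as [|K IH]; cbn [csum]; rewrite G.
  - destruct (tag_index t); reflexivity.
  - rewrite IH. set (n := tag_index t) in *. destruct (Nat.eqb_spec n (S K)) as [->|Hn].
    + replace (Nat.leb (S K) K) with false by (symmetry; apply Nat.leb_gt; lia). rewrite Nat.leb_refl. ring.
    + destruct (Nat.leb_spec n K); destruct (Nat.leb_spec n (S K)); try lia; ring.
Qed.

Lemma csum_nil K x y : csum [] K x y = 0.
Proof.
  assert (G : forall m, cval [] m x y = 0). { intros m. unfold cval, collect, fold_right, pair_val. simpl ev. unfold Rdiv. ring. }
  induction K as [|K IH]; cbn [csum]. apply G. rewrite IH, G. ring.
Qed.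

Lemma isum_csum ts K x y : x <> 0 \/ y <> 0 -> forallb (fun t => Nat.leb (tag_index t) K) ts = true ->
  isum f env (map (tag_item f) ts) x y = csum ts K x y.
Proof.
  intros N. induction ts as [|t ts IH]; intros H.
  - rewrite csum_nil. reflexivity.
  - cbn [forallb] in H. apply andb_true_iff in H as [H1 H2]. rewrite csum_cons, H1 by auto. cbn [map isum]. rewrite IH; auto.
Qed.

(** As [sigma] is bounded, only the weight of the numerators over [Q^j] counts. *)
Lemma weighted_pair A B j e : weighted (4 * j + e) A = true -> weighted (4 * j + e) B = true ->
  exists C, 0 <= C /\ forall x y, x <> 0 \/ y <> 0 -> Rabs (pair_val f env A B j x y) <= C * rad kap x y ^ e.
Proof.
  intros HA HB. destruct (weighted_bound env _ _ HA) as [CA [PA BA]]. destruct (weighted_bound env _ _ HB) as [CB [PB BB]].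
  set (s := sqrt 2 / sdel kap * 2). assert (Ps : 0 <= s). { eapply Rle_trans. apply Rabs_pos. apply (sigma_bound kap Hkap 0 0). }
  exists (CA + s * CB). split. { assert (0 <= s * CB) by (apply Rmult_le_pos; auto). lra. }
  intros x y N. pose proof (rad_pos kap Hkap x y N) as PR. destruct (rad_coords kap Hkap x y) as [Bx By]. set (q := rad kap x y) in *.
  specialize (BA x y q !! Bx By). specialize (BB x y q !! Bx By).
  unfold pair_val. rewrite <- (rad_4 kap Hkap). fold q. rewrite <- pow_mult.
  unfold Rdiv. rewrite Rabs_mult. assert (P4 : 0 < q ^ (4 * j)) by (apply pow_lt; auto).
  rewrite (Rabs_pos_eq (/ _)) by (left; apply Rinv_0_lt_compat; auto).
  apply Rmult_le_reg_r with (q ^ (4 * j)); auto. rewrite Rmult_assoc, Rinv_l, Rmult_1_r by lra.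
  replace ((CA + s * CB) * q ^ e * q ^ (4 * j)) with (CA * q ^ (4 * j + e) + s * (CB * q ^ (4 * j + e))) by (rewrite pow_add; ring).
  eapply Rle_trans. apply Rabs_triang. apply Rplus_le_compat; auto. rewrite Rabs_mult. apply Rmult_le_compat; auto; try apply Rabs_pos.
  apply (sigma_bound kap Hkap).
Qed.

(** What remains has the four indices [M + 2] to [M + 5], each of order at least [q^(M+2)]. *)
Lemma csum_high ws M : weighted_ws 1 ws = true ->
  exists C, 0 <= C /\ forall x y, x <> 0 \/ y <> 0 -> rad kap x y <= 1 ->
    Rabs (csum (tags ws) (M + 5) x y - csum (tags ws) (M + 1) x y) <= C * rad kap x y ^ (M + 2).
Proof.
  intros H. set (its := tags ws).
  assert (G : forall i, (i < 4)%nat -> exists C, 0 <= C /\ forall x y, x <> 0 \/ y <> 0 -> rad kap x y <= 1 -> Rabs (cval its (M + 2 + i) x y) <= C * rad kap x y ^ (M + 2)).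
  { intros i Hi. destruct (weighted_collect f Hc ws (M + 2 + i) H) as [H1 H2]. fold its in H1, H2.
    unfold cval. destruct (collect f (M + 2 + i) its) as [A B]. cbn [fst snd] in H1, H2.
    replace (5 * (M + 2 + i) - 4)%nat with (4 * (M + 2 + i - 1) + (M + 2 + i))%nat in H1, H2 by lia.
    destruct (weighted_pair A B _ _ H1 H2) as [C [PC HC]]. exists C. split; auto. intros x y N Hq. eapply Rle_trans. apply HC; auto.
    apply Rmult_le_compat_l; auto. pose proof (rad_pos kap Hkap x y N) as PR. rewrite (pow_add _ (M + 2) i).
    rewrite <- (Rmult_1_r (rad kap x y ^ (M + 2))) at 2. apply Rmult_le_compat_l. apply pow_le; lra. rewrite <- (pow1 i). apply pow_incr; lra. }
  destruct (G 0%nat ltac:(lia)) as [C0 [P0 B0]]. destruct (G 1%nat ltac:(lia)) as [C1 [P1 B1]].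
  destruct (G 2%nat ltac:(lia)) as [C2 [P2 B2]]. destruct (G 3%nat ltac:(lia)) as [C3 [P3 B3]].
  exists (C0 + C1 + C2 + C3). split; [lra|]. intros x y N Hq.
  replace (M + 5)%nat with (S (S (S (S (M + 1))))) by lia. cbn [csum].
  replace (S (M + 1)) with (M + 2 + 0)%nat by lia. replace (S (M + 2 + 0)) with (M + 2 + 1)%nat by lia.
  replace (S (M + 2 + 1)) with (M + 2 + 2)%nat by lia. replace (S (M + 2 + 2)) with (M + 2 + 3)%nat by lia.
  specialize (B0 x y N Hq). specialize (B1 x y N Hq). specialize (B2 x y N Hq). specialize (B3 x y N Hq).
  absle B0. absle B1. absle B2. absle B3. apply Rabs_le. lra.
Qed.

(** Once the earlier residuals vanish, the last one is the only low-order term left. *)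
Lemma csum_low its M rs x y : x <> 0 \/ y <> 0 -> forallb constant rs = true ->
  forallb (fun n => let '(A, B) := collect f n its in is_zero (padd A (shift (5 * n - 4) 0 (nth n rs []))) && is_zero B) (seq 0 (M + 2)) = true ->
  (forall n, (n <= M)%nat -> cst env (nth n rs []) = 0) ->
  csum its (M + 1) x y = - cst env (nth (M + 1) rs []) * (x ^ (5 * (M + 1) - 4) / Qr kap x y ^ M).
Proof.
  intros N HR H Hz. rewrite forallb_forall in H.
  assert (CR : forall n, ev x y env (nth n rs []) = cst env (nth n rs [])).
  { intros n. apply constant_ev. destruct (Nat.lt_ge_cases n (length rs)) as [L|L].
    - rewrite forallb_forall in HR. apply HR. apply nth_In; auto.
    - rewrite nth_overflow by auto. reflexivity. }
  assert (G : forall n, (n <= M + 1)%nat -> cval its n x y = - cst env (nth n rs []) * (x ^ (5 * n - 4) / Qr kap x y ^ (n - 1))).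
  { intros n Hn. specialize (H n). assert (In n (seq 0 (M + 2))) by (apply in_seq; lia). specialize (H H0).
    unfold cval. destruct (collect f n its) as [A B]. apply andb_true_iff in H as [H1 H2].
    apply (is_zero_ev x y env) in H1. apply (is_zero_ev x y env) in H2. rewrite ev_add, ev_shift, CR in H1.
    unfold pair_val. rewrite H2. replace (ev x y env A) with (- cst env (nth n rs []) * x ^ (5 * n - 4)) by (simpl pow in H1 at 2; lra).
    unfold Rdiv. ring. }
  assert (Z : forall n, (n <= M)%nat -> csum its n x y = 0).
  { induction n as [|n IH]; intros Hn; cbn [csum]; rewrite G, Hz by lia. ring. rewrite IH by lia. ring. }
  replace (M + 1)%nat with (S M) by lia. cbn [csum]. rewrite Z, G by lia. replace (S M - 1)%nat with M by lia. ring.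
Qed.

Lemma wsum_bound ws : forall j0, weighted_ws j0 ws = true ->
  exists C, 0 <= C /\ forall x y, x <> 0 \/ y <> 0 -> rad kap x y <= 1 -> Rabs (wsum f env j0 ws x y) <= C.
Proof.
  induction ws as [|w ws IH]; intros j0 H.
  - exists 0. split. lra. intros. simpl. rewrite Rabs_R0. lra.
  - unfold weighted_ws in H. cbn [length seq combine forallb fst snd] in H. apply andb_true_iff in H as [H H2]. apply andb_true_iff in H as [HA HB].
    destruct (IH _ H2) as [C [PC HC]]. replace (5 * j0)%nat with (4 * j0 + j0)%nat in HA, HB by lia.
    destruct (weighted_pair _ _ _ _ HA HB) as [C' [PC' HC']]. exists (C' + C). split. lra.
    intros x y N Hq. cbn [wsum]. eapply Rle_trans. apply Rabs_triang. apply Rplus_le_compat; auto.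
    eapply Rle_trans. apply HC'; auto. rewrite <- (Rmult_1_r C') at 2. apply Rmult_le_compat_l; auto.
    rewrite <- (pow1 j0). apply pow_incr. split; auto. apply rad_nonneg.
Qed.
End Collect.

Section Obstruction.
Variables (f : coefs) (env : nat -> R) (M : nat) (ws : list (poly * poly)) (rs : list poly).
Hypothesis Hcheck : check f M ws rs = true.
Notation al := (cst env (p20 f)).
Notation be := (cst env (q11 f)).
Notation kap := (2 * al - be).
Notation tau := (2 * al + be).
Hypothesis Hal : Rabs al <= / 100.
Hypothesis Hbe : Rabs be <= / 100.
Hypothesis HM : Nat.odd M = true.
Hypothesis HM8 : (M <= 8)%nat.

Let Hkap : Rabs kap <= 1 := kap_small f env Hal Hbe.
Notation q := (rad kap).
Notation N := (M + 1)%nat.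

Lemma higher_terms : all_constant f = true ->
  exists C, 0 <= C /\ forall x y, x <> 0 \/ y <> 0 -> q x y <= 1 ->
    Rabs (Px f env 2 x y * y + x * Py f env 2 x y + (Px f env 3 x y * y + x * Py f env 3 x y) + (Px f env 4 x y * y + x * Py f env 4 x y) + (Px f env 5 x y * y + x * Py f env 5 x y)) <= C * q x y ^ 5 /\
    Rabs (ev x y env (lie f 2 (qq f)) + ev x y env (lie f 3 (qq f)) + ev x y env (lie f 4 (qq f)) + ev x y env (lie f 5 (qq f))) <= C * q x y ^ 6.
Proof.
  intros Hc.
  assert (G : forall k, (2 <= k <= 5)%nat -> exists C, 0 <= C /\ forall x y, x <> 0 \/ y <> 0 -> q x y <= 1 ->
    Rabs (Px f env k x y * y + x * Py f env k x y) <= C * q x y ^ 5 /\ Rabs (ev x y env (lie f k (qq f))) <= C * q x y ^ 6).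
  { intros k Hk. destruct (weighted_comp f Hc k) as [W1 W2].
    assert (H1 : weighted (k + 3) (padd (shift 0 1 (comp f k).1) (shift 1 0 (comp f k).2)) = true).
    { apply weighted_add; eapply weighted_shift; [exact W1|lia|exact W2|lia]. }
    assert (H2 : weighted (k + 4) (lie f k (qq f)) = true) by (eapply weighted_lie; [auto|apply weighted_qq; auto|lia|lia]).
    destruct (weighted_bound env _ _ H1) as [C1 [P1 B1]]. destruct (weighted_bound env _ _ H2) as [C2 [P2 B2]].
    exists (C1 + C2). split; [lra|]. intros x y NZ Hq. destruct (rad_coords kap Hkap x y) as [Bx By]. pose proof (rad_pos kap Hkap x y NZ) as PR.
    specialize (B1 x y (q x y) !! Bx By). specialize (B2 x y (q x y) !! Bx By).
    assert (PW : forall a b, (a <= b)%nat -> q x y ^ b <= q x y ^ a).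
    { intros a b Hab. replace b with (a + (b - a))%nat by lia. rewrite pow_add. rewrite <- (Rmult_1_r (q x y ^ a)) at 2.
      apply Rmult_le_compat_l. apply pow_le; lra. rewrite <- (pow1 (b - a)). apply pow_incr; lra. }
    assert (PN : forall a, 0 <= q x y ^ a) by (intros; apply pow_le; lra). split.
    - rewrite ev_add, !ev_shift in B1. replace (Px f env k x y * y + x * Py f env k x y) with (x ^ 0 * y ^ 1 * ev x y env (comp f k).1 + x ^ 1 * y ^ 0 * ev x y env (comp f k).2) by (unfold Px, Py; ring).
      eapply Rle_trans. apply B1. apply Rle_trans with (C1 * q x y ^ 5). apply Rmult_le_compat_l; auto. apply PW; lia. apply Rmult_le_compat_r; auto; lra.
    - eapply Rle_trans. apply B2. apply Rle_trans with (C2 * q x y ^ 6). apply Rmult_le_compat_l; auto. apply PW; lia. apply Rmult_le_compat_r; auto; lra. }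
  destruct (G 2%nat ltac:(lia)) as [C2 [P2 B2]]. destruct (G 3%nat ltac:(lia)) as [C3 [P3 B3]].
  destruct (G 4%nat ltac:(lia)) as [C4 [P4 B4]]. destruct (G 5%nat ltac:(lia)) as [C5 [P5 B5]].
  exists (C2 + C3 + C4 + C5). split; [lra|]. intros x y NZ Hq.
  destruct (B2 x y NZ Hq) as [E2 F2]. destruct (B3 x y NZ Hq) as [E3 F3]. destruct (B4 x y NZ Hq) as [E4 F4]. destruct (B5 x y NZ Hq) as [E5 F5].
  absle E2. absle E3. absle E4. absle E5. absle F2. absle F3. absle F4. absle F5. split; apply Rabs_le; lra.
Qed.

(** The weighted scaling [(x / r, y / r^2)] with [r = q x y] reduces the estimate to the curve
    [Q = 1]. The exponent [5 N - 4] is even because [M] is odd. *)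
Lemma main_part_positive : exists eta c, 0 < eta /\ 0 < c /\ forall x y k, Rabs k <= 1 / 2 -> x <> 0 \/ y <> 0 ->
  c * q x y ^ N <= x ^ (5 * N - 4) / Qr kap x y ^ M + eta * (q x y ^ N / q x y ^ 4 * (y ^ 2 - x ^ 4 + k * (x ^ 2 * y))).
Proof.
  assert (Ev : exists h, (5 * N - 4 = 2 * h)%nat).
  { apply Nat.odd_spec in HM as [m Hm]. exists (5 * m + 3)%nat. lia. }
  destruct Ev as [h Eh]. destruct (hom_positive kap Hkap h) as [eta [c [Pe [Pc H]]]].
  exists eta, c. split; auto. split; auto. intros x y k Hk NZ. pose proof (rad_pos kap Hkap x y NZ) as PR. pose proof (rad_4 kap Hkap x y) as R4.
  set (r := q x y) in *. specialize (H (x / r) (y / r ^ 2) k Hk). assert (E1 : Qr kap (x / r) (y / r ^ 2) = 1).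
  { replace (Qr kap (x / r) (y / r ^ 2)) with (Qr kap x y / r ^ 4) by (unfold Qr; field; lra). rewrite <- R4. field. lra. }
  specialize (H E1). rewrite <- Eh in H. rewrite <- R4, <- pow_mult.
  replace (5 * N - 4)%nat with (N + 4 * M)%nat in * by lia. assert (PP : 0 < r ^ N) by (apply pow_lt; auto).
  assert (P4 : r ^ (4 * M) <> 0) by (apply pow_nonzero; lra). apply Rmult_le_compat_r with (r := r ^ N) in H; [|lra].
  eapply Rle_trans. apply H. right. unfold Rdiv at 1. rewrite Rpow_mult_distr, pow_inv, (pow_add r N (4 * M)). field. repeat split; auto; lra.
Qed.

(* A nonzero last residual would make [ln Q - tau sigma + w_1 + ... + w_M], after the correction that makes its
   derivative definite on the line [x = 0], a strict Lyapunov function tending to minus infinity at the origin. *)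
Theorem center_residual_zero : is_center (field_of f env) -> (forall n, (n <= M)%nat -> cst env (nth n rs []) = 0) ->
  cst env (nth N rs []) = 0.
Proof.
  intros Hcen Hz. destruct (Req_dec (cst env (nth N rs [])) 0) as [|Hr]; auto. exfalso. set (r := cst env (nth N rs [])) in *.
  unfold check in Hcheck. apply andb_true_iff in Hcheck as [HA H6]. apply andb_true_iff in HA as [HA H4].
  apply andb_true_iff in HA as [HA H3]. apply andb_true_iff in HA as [H1 H2].
  destruct (csum_high f env H1 Hal Hbe ws M H6) as [Ch [Pch Bh]]. destruct (wsum_bound f env Hal Hbe ws 1 H6) as [Cw [Pcw Bw]].
  destruct (higher_terms H1) as [Cr [Pcr Br]]. destruct main_part_positive as [eta [c [Pe [Pc Hpos]]]].
  (* Along the leading part [(x y)' = y^2 - x^4 + (al + be) x^2 y], and the factor [q^N / Q] adds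
     [(N / 4 - 1) tau x^2 y]. *)
  set (kk := al + be + (INR N / 4 - 1) * tau).
  assert (IN : 0 <= INR N <= 9). { split. apply pos_INR. replace 9 with (INR 9) by (simpl; ring). apply le_INR. lia. }
  assert (Hkk : Rabs kk <= 1 / 2).
  { pose proof Hal as A. pose proof Hbe as B. absle A. absle B.
    assert (Rabs ((INR N / 4 - 1) * tau) <= 5 / 4 * (3 / 100)).
    { apply abs_mult_le; apply Rabs_le; lra. }
    absle H. unfold kk. apply Rabs_le. lra. }
  (* The residual enters the derivative as [- r x^(5N-4) / Q^M]; [s] is the sign that makes this
     nonnegative. *)
  set (s := if Rlt_dec 0 r then -1 else 1). assert (Hs : s = 1 \/ s = -1) by (unfold s; destruct (Rlt_dec 0 r); auto).
  assert (Hsr : s * r = - Rabs r). { unfold s. destruct (Rlt_dec 0 r). rewrite Rabs_pos_eq; lra. rewrite Rabs_left; lra. }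
  assert (Pr : 0 < Rabs r) by (apply Rabs_pos_lt; auto). set (G := fun x y => x * y * q x y ^ N / Qr kap x y).
  set (L := fun p : R * R => base f env p.1 p.2 + wsum f env 1 ws p.1 p.2 - r * eta * G p.1 p.2).
  set (V := fun p => field_of f env p).
  set (dG := fun x y => q x y ^ N / q x y ^ 4 * ((V (x, y)).1 * y + x * (V (x, y)).2 +
     x * y * (INR N / 4 - 1) * (((4 * x ^ 3 + 2 * kap * x * y) * (V (x, y)).1 + (4 * y + kap * x ^ 2) * (V (x, y)).2) / q x y ^ 4))).
  set (dL := fun p : R * R => isum f env (items f ws) p.1 p.2 - r * eta * dG p.1 p.2).
  assert (NZ : forall p : R * R, p <> origin -> p.1 <> 0 \/ p.2 <> 0).
  { intros [x y] H. cbn [fst snd]. destruct (Req_dec x 0) as [->|]; auto. destruct (Req_dec y 0) as [->|]; auto. }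
  (* [K1] collects all errors of order [q^(M+2)]: the high indices, and the effect of the higher
     components on the correction, where 4 bounds [|x y| / q^3] and 5/4 bounds [N / 4 - 1]. *)
  set (K1 := Ch + Rabs r * eta * (Cr + 4 * (5 / 4) * Cr)).
  assert (PK1 : 0 <= K1). { unfold K1. assert (0 <= Rabs r * eta * (Cr + 4 * (5 / 4) * Cr)). apply Rmult_le_pos. apply Rmult_le_pos; lra. lra. lra. }
  assert (DLP : forall x y, x <> 0 \/ y <> 0 -> q x y <= 1 -> Rabs r * c * q x y ^ N - K1 * q x y ^ (M + 2) <= s * dL (x, y)).
  { intros x y Nz Hq. pose proof (rad_pos kap Hkap x y Nz) as PR. specialize (Bh x y Nz Hq). destruct (Br x y Nz Hq) as [Br1 Br2]. specialize (Hpos x y kk Hkk Nz).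
    destruct (rad_coords kap Hkap x y) as [Bx By].
    unfold dL, items; cbn [fst snd]. rewrite (isum_csum f env Hal Hbe _ (M + 5)) by auto.
    pose proof (csum_low f env (tags ws) M rs x y Nz H2 H4 Hz) as Lo. fold r in Lo.
    set (hi := csum f env (tags ws) (M + 5) x y - csum f env (tags ws) (M + 1) x y) in *.
    replace (csum f env (tags ws) (M + 5) x y) with (csum f env (tags ws) (M + 1) x y + hi) by (unfold hi; ring). rewrite Lo.
    set (Rm := Px f env 2 x y * y + x * Py f env 2 x y + (Px f env 3 x y * y + x * Py f env 3 x y) + (Px f env 4 x y * y + x * Py f env 4 x y) + (Px f env 5 x y * y + x * Py f env 5 x y)) in *.
    set (Rq := ev x y env (lie f 2 (qq f)) + ev x y env (lie f 3 (qq f)) + ev x y env (lie f 4 (qq f)) + ev x y env (lie f 5 (qq f))) in *.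
    set (z := q x y) in *.
    assert (EG : dG x y = z ^ N / z ^ 4 * (y ^ 2 - x ^ 4 + kk * (x ^ 2 * y)) + z ^ N / z ^ 4 * (Rm + x * y * (INR N / 4 - 1) * (Rq / z ^ 4))).
    { unfold dG, V. rewrite (field_split f env H1). cbn [fst snd]. fold z.
      pose proof (lie1_qq f env H1 x y) as L1. rewrite (ev_lie_qq f env H1) in L1. rewrite <- (rad_4 kap Hkap x y) in L1. fold z in L1.
      unfold Rq. rewrite !(ev_lie_qq f env H1). unfold Rm.
      set (P1 := Px f env 1 x y) in *. set (Q1 := Py f env 1 x y) in *.
      assert (E0 : P1 * y + x * Q1 = y ^ 2 - x ^ 4 + (al + be) * (x ^ 2 * y)). { unfold P1, Q1. rewrite (Px1 f env H1), (Py1 f env H1). ring. }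
      match goal with |- _ * (?A + _ * (?B / _)) = _ =>
        replace A with ((P1 * y + x * Q1) + Rm) by (unfold Rm; ring);
        replace B with ((P1 * (4 * x ^ 3 + 2 * kap * x * y) + Q1 * (4 * y + kap * x ^ 2)) + Rq) by (unfold Rq; rewrite !(ev_lie_qq f env H1); ring) end.
      rewrite L1, E0. unfold Rq. rewrite !(ev_lie_qq f env H1). unfold Rm, kk. field. lra. }
    rewrite EG.
    assert (BR : Rabs (z ^ N / z ^ 4 * (Rm + x * y * (INR N / 4 - 1) * (Rq / z ^ 4))) <= (Cr + 4 * (5 / 4) * Cr) * z ^ (M + 2)).
    { assert (PZ : 0 < z ^ N) by (apply pow_lt; auto). assert (P4 : 0 < z ^ 4) by (apply pow_lt; auto).
      rewrite Rabs_mult, (Rabs_pos_eq (z ^ N / z ^ 4)) by (left; apply Rdiv_lt_0_compat; auto).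
      assert (X : Rabs (Rm + x * y * (INR N / 4 - 1) * (Rq / z ^ 4)) <= (Cr + 4 * (5 / 4) * Cr) * z ^ 5).
      { eapply Rle_trans. apply Rabs_triang. rewrite Rmult_plus_distr_r. apply Rplus_le_compat; auto.
        replace (4 * (5 / 4) * Cr * z ^ 5) with ((2 * z * (2 * z ^ 2)) * (5 / 4) * (Cr * z ^ 6 / z ^ 4)) by (field; lra).
        apply abs_mult_le. apply abs_mult_le. apply abs_mult_le; auto. apply Rabs_le. lra.
        unfold Rdiv. rewrite Rabs_mult, (Rabs_pos_eq (/ z ^ 4)) by (left; apply Rinv_0_lt_compat; auto). apply Rmult_le_compat_r; auto. left; apply Rinv_0_lt_compat; auto. }
      replace ((Cr + 4 * (5 / 4) * Cr) * z ^ (M + 2)) with (z ^ N / z ^ 4 * ((Cr + 4 * (5 / 4) * Cr) * z ^ 5)).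
      apply Rmult_le_compat_l; auto. left; apply Rdiv_lt_0_compat; auto.
      replace (M + 2)%nat with (S (M + 1)) by lia. change (z ^ S (M + 1)) with (z * z ^ (M + 1)). field. lra. }
    set (Rr := z ^ N / z ^ 4 * (Rm + x * y * (INR N / 4 - 1) * (Rq / z ^ 4))) in *.
    set (F := x ^ (5 * N - 4) / Qr kap x y ^ M) in *. set (E := z ^ N / z ^ 4 * (y ^ 2 - x ^ 4 + kk * (x ^ 2 * y))) in *.
    replace (s * (- r * F + hi - r * eta * (E + Rr))) with (- (s * r) * (F + eta * E) + (s * hi + - (s * r) * eta * Rr)) by ring.
    rewrite Hsr, Ropp_involutive.
    assert (M1 : Rabs r * (c * z ^ N) <= Rabs r * (F + eta * E)) by (apply Rmult_le_compat_l; lra).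
    assert (M2 : Rabs (s * hi + Rabs r * eta * Rr) <= K1 * z ^ (M + 2)).
    { eapply Rle_trans. apply Rabs_triang. unfold K1. rewrite Rmult_plus_distr_r. apply Rplus_le_compat.
      - rewrite Rabs_mult. replace (Rabs s) with 1 by (destruct Hs as [-> | ->]; [rewrite Rabs_R1; auto|rewrite Rabs_left; lra]). lra.
      - rewrite Rabs_mult, (Rabs_pos_eq (Rabs r * eta)) by (apply Rmult_le_pos; lra). rewrite (Rmult_assoc (Rabs r * eta)). apply Rmult_le_compat_l; auto. apply Rmult_le_pos; lra. }
    absle M2. lra. }
  assert (QSL : forall p, enorm p <= 1 -> q p.1 p.2 ^ 4 <= 5 * enorm p ^ 2 /\ enorm p ^ 4 / 4 <= Qr kap p.1 p.2).
  { intros [x y] Hp. cbn [fst snd]. rewrite (rad_4 kap Hkap). pose proof (Qr_upper kap Hkap x y) as U. pose proof (Qr_lower kap Hkap x y) as U'.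
    assert (E2 : enorm (x, y) ^ 2 = x ^ 2 + y ^ 2). { unfold enorm; cbn [fst snd]. rewrite <- Rsqr_pow2, Rsqr_sqrt; auto. nra. }
    assert (E1 : enorm (x, y) ^ 2 <= 1). { rewrite <- (pow1 2). apply pow_incr. split; auto. apply sqrt_pos. }
    replace (enorm (x, y) ^ 4) with ((enorm (x, y) ^ 2) ^ 2) by ring. rewrite E2 in *.
    replace (x ^ 4) with ((x ^ 2) ^ 2) in * by ring. pose proof (pow2_ge_0 x). pose proof (pow2_ge_0 y).
    assert ((y ^ 2) ^ 2 <= y ^ 2) by nra. assert ((x ^ 2) ^ 2 <= x ^ 2) by nra. split; nra. }
  assert (QS := fun p Hp => proj1 (QSL p Hp)). assert (QL := fun p Hp => proj2 (QSL p Hp)). clear QSL.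
  (* For [q <= q0] the errors amount to at most half of the main term. *)
  set (q0 := Rmin 1 (Rabs r * c / (2 * (K1 + 1)))).
  assert (Pq0 : 0 < q0). { apply Rmin_pos; [lra|]. apply Rdiv_lt_0_compat; [|lra]. apply Rmult_lt_0_compat; auto. }
  assert (Lq1 : q0 <= 1) by apply Rmin_l. assert (Lq2 : q0 <= Rabs r * c / (2 * (K1 + 1))) by apply Rmin_r.
  set (r1 := Rmin 1 (q0 ^ 4 / 5)). assert (Pq4 : 0 < q0 ^ 4) by (apply pow_lt; auto).
  assert (Pr1 : 0 < r1) by (apply Rmin_pos; lra). assert (Lr1 : r1 <= 1) by apply Rmin_l. assert (Lr2 : r1 <= q0 ^ 4 / 5) by apply Rmin_r.
  assert (QB : forall p, enorm p <= r1 -> q p.1 p.2 <= q0).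
  { intros p Hp. specialize (QS p !!). assert (0 <= enorm p) by apply sqrt_pos. apply pow_incr_inv with 3%nat. lra.
    eapply Rle_trans. apply QS. assert (enorm p ^ 2 <= enorm p) by nra. lra. }
  (* All of [L] except [ln Q] is bounded by [K2], so [L] tends to minus infinity at the origin and
     is bounded below on the circle of radius [r1]. *)
  set (K2 := Rabs tau * (sqrt 2 / sdel kap * 2) + Cw + Rabs r * eta * 4).
  assert (LB : forall p, p <> origin -> enorm p <= r1 -> Rabs (L p - ln (Qr kap p.1 p.2)) <= K2).
  { intros [x y] Hp He. pose proof (NZ _ Hp) as Nz. cbn [fst snd] in *. pose proof (QB _ He) as Hq. cbn [fst snd] in Hq.
    specialize (Bw x y Nz !!). destruct (rad_coords kap Hkap x y) as [Bx By]. pose proof (rad_pos kap Hkap x y Nz) as PR.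
    unfold L, base, G; cbn [fst snd]. assert (BG : Rabs (x * y * q x y ^ N / Qr kap x y) <= 4).
    { rewrite <- (rad_4 kap Hkap x y). set (z := q x y) in *. apply Nat.odd_spec in HM as [m Hm]. replace N with (S (S (2 * m))) by lia.
      replace (x * y * z ^ S (S (2 * m)) / z ^ 4) with (x * y * (z ^ (2 * m) * / z ^ 2)) by (simpl pow; field; lra).
      replace 4 with (2 * z * (2 * z ^ 2) * (1 * / z ^ 3)) by (field; lra).
      assert (P3 : 0 < / z ^ 3) by (apply Rinv_0_lt_compat, pow_lt; auto). assert (P2 : 0 < / z ^ 2) by (apply Rinv_0_lt_compat, pow_lt; auto).
      assert (PM : 0 <= z ^ (2 * m) <= 1) by (split; [apply pow_le; lra|rewrite <- (pow1 (2 * m)); apply pow_incr; lra]).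
      apply abs_mult_le. apply abs_mult_le; auto. rewrite Rabs_pos_eq by (apply Rmult_le_pos; lra). apply Rmult_le_compat; try lra.
      apply Rinv_le_contravar. apply pow_lt; auto. simpl. assert (z * z <= 1) by nra. nra. }
    replace (ln (Qr kap x y) - tau * sg f env x y + wsum f env 1 ws x y - r * eta * (x * y * q x y ^ N / Qr kap x y) - ln (Qr kap x y)) with
      (- (tau * sg f env x y) + wsum f env 1 ws x y + - (r * eta * (x * y * q x y ^ N / Qr kap x y))) by ring.
    unfold K2. eapply Rle_trans. apply Rabs_triang. apply Rplus_le_compat. eapply Rle_trans. apply Rabs_triang. apply Rplus_le_compat; auto.
    - rewrite Rabs_Ropp, Rabs_mult. apply Rmult_le_compat_l. apply Rabs_pos. apply (sigma_bound kap Hkap).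
    - rewrite Rabs_Ropp, Rabs_mult, Rabs_mult, (Rabs_pos_eq eta) by lra. apply Rmult_le_compat_l; auto. apply Rmult_le_pos; lra. }
  set (m := ln (r1 ^ 4 / 4) - K2). apply (center_no_lyapunov (field_of f env) L dL r1 m s Hcen Pr1 Hs).
  - intros cu t Hv Hno Hen. pose proof (NZ _ Hno) as Nz. destruct Hv as [HX HY].
    set (X := fun u => (cu u).1) in *. set (Y := fun u => (cu u).2) in *.
    replace (cu t) with (X t, Y t) in * by (unfold X, Y; destruct (cu t); auto). cbn [fst snd] in Nz.
    assert (HV : has_velocity (fun u => (X u, Y u)) t (field_of f env (X t, Y t))) by (split; assumption).
    pose proof (base_derive f env H1 Hkap X Y t Nz HV) as D1. pose proof (wsum_derive f env H1 Hkap ws 1 X Y t (le_n 1) Nz HV) as D2.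
    pose proof (rad_derive kap Hkap X Y t _ _ N HX HY Nz) as D3. cbv zeta in D3.
    set (v1 := fun u => base f env (X u) (Y u)) in *. set (v2 := fun u => wsum f env 1 ws (X u) (Y u)) in *.
    apply (is_derive_ext (fun u => v1 u + v2 u - r * eta * (X u * Y u * rad kap (X u) (Y u) ^ N / Qr kap (X u) (Y u)))). { reflexivity. }
    evar_last. apply (is_derive_minus (fun u => v1 u + v2 u)). apply (is_derive_plus v1 v2). exact D1. exact D2. apply is_derive_scal. exact D3.
    match goal with |- minus (plus ?a ?b) ?c = ?d => change (a + b - c = d) end.
    unfold dL, dG, V, items, tags; cbn [fst snd map isum tag_item]. ring.
  - intros [x y] Hno Hen. pose proof (NZ _ Hno) as Nz. cbn [fst snd] in Nz. pose proof (QB _ Hen) as Hq. cbn [fst snd] in Hq.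
    pose proof (rad_pos kap Hkap x y Nz) as PR. specialize (DLP x y Nz !!).
    eapply Rlt_le_trans; [|apply DLP]. replace (q x y ^ (M + 2)) with (q x y ^ N * q x y) by (replace (M + 2)%nat with (S N) by lia; simpl pow; ring).
    assert (PZ : 0 < q x y ^ N) by (apply pow_lt; auto). assert (K1 * q x y <= Rabs r * c / 2).
    { apply Rle_trans with ((K1 + 1) * (Rabs r * c / (2 * (K1 + 1)))). apply Rmult_le_compat; lra. right. field. lra. }
    assert (0 < Rabs r * c) by (apply Rmult_lt_0_compat; auto).
    replace (Rabs r * c * q x y ^ N - K1 * (q x y ^ N * q x y)) with (q x y ^ N * (Rabs r * c - K1 * q x y)) by ring.
    apply Rmult_lt_0_compat; lra.
  - intros p Hp. assert (No : p <> origin). { intros ->. rewrite enorm_origin in Hp. lra. }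
    specialize (LB p No !!). specialize (QL p !!). rewrite Hp in QL. absle LB. unfold m.
    assert (0 < r1 ^ 4 / 4) by (apply Rdiv_lt_0_compat; [apply pow_lt; auto|lra]).
    assert (ln (r1 ^ 4 / 4) <= ln (Qr kap p.1 p.2)).
    { destruct (Req_dec (r1 ^ 4 / 4) (Qr kap p.1 p.2)) as [<-|]; [lra|]. left. apply ln_increasing; lra. }
    lra.
  - set (d := Rmin r1 (exp (m - K2 - 1) / 5)). pose proof (exp_pos (m - K2 - 1)) as PE.
    assert (Pd : 0 < d) by (apply Rmin_pos; lra). assert (Ld1 : d <= r1) by apply Rmin_l. assert (Ld2 : d <= exp (m - K2 - 1) / 5) by apply Rmin_r.
    exists d. split; auto. intros p Hp. assert (No : p <> origin). { intros ->. rewrite enorm_origin in Hp. lra. }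
    specialize (LB p No !!). specialize (QS p !!). rewrite (rad_4 kap Hkap) in QS. absle LB.
    pose proof (Qr_pos kap Hkap _ _ (NZ p No)) as QP. assert (Qr kap p.1 p.2 < exp (m - K2 - 1)) by nra.
    assert (ln (Qr kap p.1 p.2) < m - K2 - 1). { rewrite <- (ln_exp (m - K2 - 1)). apply ln_increasing; auto. }
    lra.
Qed.
End Obstruction.

(** * Focal values *)

Fixpoint horner (cs : list R) (e : R) : R := match cs with [] => 0 | c :: cs' => c + e * horner cs' e end.

Lemma horner_bounded cs : exists K, 0 <= K /\ forall e, 0 < e < 1 -> Rabs (horner cs e) <= K.
Proof.
  induction cs as [|c cs [K [PK HK]]].
  - exists 0. split. lra. intros. simpl. rewrite Rabs_R0. lra.
  - exists (Rabs c + K). split. absp c. lra. intros e He. cbn [horner]. eapply Rle_trans. apply Rabs_triang.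
    apply Rplus_le_compat_l. rewrite Rabs_mult, (Rabs_pos_eq e) by lra. specialize (HK e He). absp (horner cs e). nra.
Qed.

(** The lowest nonzero coefficient dominates for small positive [e]. *)
Lemma horner_nonzero cs c : In c cs -> c <> 0 -> exists e0, 0 < e0 /\ forall e, 0 < e < e0 -> horner cs e <> 0.
Proof.
  induction cs as [|c0 cs IH]; intros Hi Hc. destruct Hi. destruct (Req_dec c0 0) as [->|N].
  - destruct Hi as [<-|Hi]; [contradiction|]. destruct (IH Hi Hc) as [e0 [P0 H0]]. exists e0. split; auto.
    intros e He E. cbn [horner] in E. rewrite Rplus_0_l in E. apply Rmult_integral in E. destruct E; [lra|]. apply (H0 e He); auto.
  - destruct (horner_bounded cs) as [K [PK HK]]. exists (Rmin 1 (Rabs c0 / (K + 1))).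
    assert (Pc : 0 < Rabs c0) by (apply Rabs_pos_lt; auto). split. apply Rmin_pos; [lra|apply Rdiv_lt_0_compat; lra].
    intros e He E. mins (Rmin 1 (Rabs c0 / (K + 1))).
    cbn [horner] in E. assert (EC : Rabs c0 = Rabs (e * horner cs e)). { replace c0 with (- (e * horner cs e)) by lra. apply Rabs_Ropp. }
    rewrite Rabs_mult, (Rabs_pos_eq e) in EC by lra. specialize (HK e !!).
    assert (e * Rabs (horner cs e) <= e * K) by (apply Rmult_le_compat_l; lra).
    assert (e * (K + 1) < Rabs c0). { apply Rlt_le_trans with (Rabs c0 / (K + 1) * (K + 1)). apply Rmult_lt_compat_r; lra. right; field; lra. }
    nra.
Qed.

Lemma horner_all_zero cs e0 : 0 < e0 -> (forall e, 0 < e < e0 -> horner cs e = 0) -> forall c, In c cs -> c = 0.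
Proof.
  intros P0 H c Hi. destruct (Req_dec c 0) as [|N]; auto. exfalso. destruct (horner_nonzero cs c Hi N) as [e1 [P1 H1]].
  assert (0 < Rmin e0 e1) by (apply Rmin_pos; auto). mins (Rmin e0 e1).
  apply (H1 (Rmin e0 e1 / 2)); [lra|]. apply H; lra.
Qed.

Definition degree (l : list nat) : nat := fold_right Nat.add 0%nat l.
Definition hom (d : nat) (p : poly) : poly := filter (fun t : term => let '(_, _, l, _) := t in Nat.eqb (degree l) d) p.

Lemma mon_ev_scale e a l : forall i, mon_ev (fun k => e * a k) i l = e ^ degree l * mon_ev a i l.
Proof.
  induction l as [|n l IH]; intros i; simpl. ring. rewrite IH, Rpow_mult_distr. unfold degree; simpl. rewrite pow_add. ring.
Qed.

(** Scaling all parameters by [e] makes the value a polynomial in [e] whose coefficients are the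
    values of the homogeneous components. *)
Lemma ev_hom x y e a p D : forallb (fun t : term => let '(_, _, l, _) := t in Nat.leb (degree l) D) p = true ->
  ev x y (fun k => e * a k) p = horner (map (fun d => ev x y a (hom d p)) (seq 0 (S D))) e.
Proof.
  assert (G : forall m s, horner (map (fun d => ev x y a (hom d [])) (seq s m)) e = 0).
  { induction m as [|m IH]; intros s; simpl. auto. rewrite IH. ring. }
  induction p as [|t p IH]; intros H.
  - rewrite G. reflexivity.
  - cbn [forallb] in H. apply andb_true_iff in H as [H1 H2]. cbn [ev]. rewrite (IH H2). destruct t as [[[i j] l] c].
    apply Nat.leb_le in H1.
    assert (S1 : forall m s, horner (map (fun d => ev x y a (hom d ((i, j, l, c) :: p))) (seq s m)) e =
       horner (map (fun d => ev x y a (hom d p)) (seq s m)) e + (if andb (Nat.leb s (degree l)) (Nat.ltb (degree l) (s + m)) then e ^ (degree l - s) * term_ev x y a (i, j, l, c) else 0)).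
    { induction m as [|m IHm]; intros s.
      - simpl. replace (Nat.ltb (degree l) (s + 0)) with (Nat.ltb (degree l) s) by (f_equal; lia).
        destruct (Nat.leb_spec s (degree l)); destruct (Nat.ltb_spec (degree l) s); simpl; try lia; ring.
      - cbn [seq map horner]. rewrite IHm. unfold hom at 1. cbn [filter]. fold (hom s p).
        destruct (Nat.eqb_spec (degree l) s) as [E|E].
        + cbn [ev]. fold (hom s p). rewrite <- E, Nat.sub_diag, pow_O, Nat.leb_refl.
          replace (Nat.leb (S (degree l)) (degree l)) with false by (symmetry; apply Nat.leb_gt; lia).
          replace (Nat.ltb (degree l) (degree l + S m)) with true by (symmetry; apply Nat.ltb_lt; lia). cbn [andb]; cbv iota. ring.
        + fold (hom s p). destruct (Nat.leb_spec s (degree l)).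
          * replace (Nat.leb (S s) (degree l)) with true by (symmetry; apply Nat.leb_le; lia).
            replace (S s + m)%nat with (s + S m)%nat by lia. destruct (Nat.ltb (degree l) (s + S m)); cbn [andb]; cbv iota; [|ring].
            replace (degree l - s)%nat with (S (degree l - S s)) by lia. simpl pow. ring.
          * replace (Nat.leb (S s) (degree l)) with false by (symmetry; apply Nat.leb_gt; lia). cbn [andb]; cbv iota. ring. }
    rewrite S1. simpl Nat.leb. replace (Nat.ltb (degree l) (0 + S D)) with true by (symmetry; apply Nat.ltb_lt; lia). cbn [andb]; cbv iota.
    rewrite Nat.sub_0_r. unfold term_ev. rewrite mon_ev_scale. ring.
Qed.

Fixpoint erase (i : nat) (l : list nat) : list nat :=
  match l with [] => [] | n :: l' => match i with O => 0%nat :: l' | S i' => n :: erase i' l' end end.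
Definition coef (i e : nat) (p : poly) : poly :=
  flat_map (fun t : term => let '(a, b, l, c) := t in if Nat.eqb (nth i l 0%nat) e then [(a, b, erase i l, c)] else []) p.
Definition var_le (i K : nat) (p : poly) : bool := forallb (fun t : term => let '(_, _, l, _) := t in Nat.leb (nth i l 0%nat) K) p.

Lemma mon_ev_erase env l : forall i k, mon_ev env k l = env (k + i)%nat ^ nth i l 0%nat * mon_ev env k (erase i l).
Proof.
  induction l as [|n l IH]; intros [|i] k; simpl; try ring.
  - rewrite Nat.add_0_r. ring.
  - rewrite (IH i (S k)). replace (S k + i)%nat with (k + S i)%nat by lia. ring.
Qed.

Fixpoint rsum (n : nat) (g : nat -> R) : R := match n with O => g 0%nat | S n' => rsum n' g + g (S n') end.
Lemma rsum_ext n g h : (forall e, (e <= n)%nat -> g e = h e) -> rsum n g = rsum n h.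
Proof. induction n; intros H; simpl. apply H; lia. rewrite IHn, H; auto. Qed.
Lemma rsum_pick n m (r : R) g : (m <= n)%nat -> rsum n (fun e => (if Nat.eqb m e then r else 0) + g e) = r + rsum n g.
Proof.
  revert m. assert (Z : forall n m, (n < m)%nat -> rsum n (fun e => (if Nat.eqb m e then r else 0) + g e) = rsum n g).
  { induction n0; intros m H; simpl. destruct m; [lia|]. simpl. ring. rewrite IHn0 by lia. destruct (Nat.eqb_spec m (S n0)); [lia|]. ring. }
  induction n; intros m H; simpl. replace m with 0%nat by lia. simpl. ring.
  destruct (Nat.eqb_spec m (S n)) as [->|N]. rewrite Z by lia. ring. rewrite IHn by lia. ring.
Qed.

Lemma ev_coef x y env i K p : var_le i K p = true -> ev x y env p = rsum K (fun e => ev x y env (coef i e p) * env i ^ e).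
Proof.
  induction p as [|t p IH]; intros H.
  - simpl. clear H. induction K; simpl. ring. rewrite <- IHK. ring.
  - cbn [var_le forallb] in H. apply andb_true_iff in H as [H1 H2]. cbn [ev]. rewrite (IH H2).
    destruct t as [[[a b] l] c]. apply Nat.leb_le in H1.
    rewrite <- (rsum_pick K (nth i l 0%nat) (term_ev x y env (a, b, l, c))) by auto. apply rsum_ext. intros e He.
    unfold coef at 2. cbn [flat_map]. fold (coef i e p). destruct (Nat.eqb_spec (nth i l 0%nat) e) as [<-|N].
    + cbn [app ev]. fold (coef i (nth i l 0%nat) p). unfold term_ev. rewrite (mon_ev_erase env l i 0). simpl Nat.add. ring.
    + cbn [app]. fold (coef i e p). ring.
Qed.

(** A resultant: with [r = F + D z] in the variable [z] of index [i] and [p] of degree at most [K]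
    in it, this is the sum of [p_e (- F)^e D^(K-e)], equal to [D^K p] wherever [r] vanishes. *)
Definition elim (i K : nat) (r p : poly) : poly :=
  fold_right (fun e s => padd (pmul (coef i e p) (pmul (ppow (pscale (-1) (coef i 0 r)) e) (ppow (coef i 1 r) (K - e)))) s) [] (rev (seq 0 (S K))).

Lemma ev_elim x y env i K r p : var_le i K p = true -> var_le i 1 r = true -> ev x y env r = 0 ->
  ev x y env (elim i K r p) = ev x y env (coef i 1 r) ^ K * ev x y env p.
Proof.
  intros Hp Hr H0. rewrite (ev_coef x y env i 1 r Hr) in H0. simpl in H0. rewrite (ev_coef x y env i K p Hp).
  set (D := ev x y env (coef i 1 r)) in *. set (F := ev x y env (coef i 0 r)) in *.
  unfold elim. set (g := fun e => ev x y env (coef i e p) * env i ^ e).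
  assert (G : forall n, (n <= K)%nat -> ev x y env (fold_right (fun e s => padd (pmul (coef i e p) (pmul (ppow (pscale (-1) (coef i 0 r)) e) (ppow (coef i 1 r) (K - e)))) s) [] (rev (seq 0 (S n)))) = D ^ K * rsum n g).
  { assert (T : forall e, (e <= K)%nat -> ev x y env (pmul (coef i e p) (pmul (ppow (pscale (-1) (coef i 0 r)) e) (ppow (coef i 1 r) (K - e)))) = D ^ K * g e).
    { intros e He. evs. fold D F. unfold g. replace (-1 * F) with (D * env i) by lra. rewrite Rpow_mult_distr.
      replace K with (e + (K - e))%nat at 2 by lia. rewrite pow_add. ring. }
    induction n as [|n IH]; intros Hn.
    - cbn [seq rev app fold_right rsum]. rewrite ev_add, T by lia. simpl ev. ring.
    - rewrite seq_S, rev_app_distr. cbn [rev app fold_right rsum]. rewrite ev_add, T, IH by lia. simpl Nat.add. ring. }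
  apply G. lia.
Qed.

Definition upd (env : nat -> R) (i : nat) (z : R) (k : nat) : R := if Nat.eqb k i then z else env k.

Lemma mon_ev_upd env i z l : forall k, nth i l 0%nat = 0%nat -> mon_ev (upd env (k + i) z) k l = mon_ev env k l.
Proof.
  revert i. induction l as [|n l IH]; intros i k H; simpl; auto. destruct i as [|i]; simpl in H.
  - subst n. simpl. f_equal. rewrite Nat.add_0_r.
    assert (G : forall j m, (k < m)%nat -> mon_ev (upd env k z) m j = mon_ev env m j).
    { induction j as [|n j IHj]; intros m Hm; simpl; auto. rewrite IHj by lia. unfold upd. destruct (Nat.eqb_spec m k); [lia|auto]. }
    apply G. lia.
  - replace (k + S i)%nat with (S k + i)%nat by lia. rewrite IH by auto. unfold upd at 1. destruct (Nat.eqb_spec k (S k + i)); [lia|auto].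
Qed.

Lemma ev_upd x y env i z p : var_le i 0 p = true -> ev x y (upd env i z) p = ev x y env p.
Proof.
  induction p as [|t p IH]; intros H; auto. cbn [var_le forallb] in H. apply andb_true_iff in H as [H1 H2].
  cbn [ev]. rewrite (IH H2). f_equal. destruct t as [[[a b] l] c]. apply Nat.leb_le in H1. unfold term_ev.
  rewrite <- (mon_ev_upd env i z l 0) by lia. reflexivity.
Qed.

Lemma coef_free i e p : var_le i 0 (coef i e p) = true.
Proof.
  induction p as [|t p IH]; auto. destruct t as [[[a b] l] c]. unfold coef. cbn [flat_map]. fold (coef i e p).
  destruct (Nat.eqb (nth i l 0%nat) e); cbn [app]; auto.
  change (andb (Nat.leb (nth i (erase i l) 0%nat) 0) (var_le i 0 (coef i e p)) = true). rewrite IH, andb_true_r. apply Nat.leb_le.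
  clear. revert i. induction l as [|n l IHl]; intros [|i]; simpl; auto.
Qed.

Lemma solve_free x y env i r : var_le i 1 r = true -> ev x y env (coef i 1 r) <> 0 -> exists z, ev x y (upd env i z) r = 0.
Proof.
  intros Hr HD. set (D := ev x y env (coef i 1 r)) in *. set (F := ev x y env (coef i 0 r)).
  exists (- F / D). rewrite (ev_coef _ _ _ i 1 r Hr). simpl. rewrite !ev_upd by apply coef_free. fold D F.
  unfold upd. rewrite Nat.eqb_refl. field. auto.
Qed.

Definition solution : Type := list (poly * poly) * list poly.
Definition res (sol : solution) (n : nat) : poly := nth (n - 2) sol.2 [].
(** A stored solution may be longer than the order [M] considered. The two empty polynomials in
    front align the list so that entry [n] is the residual of index [n], the first being of index
    2. *)
Definition chk (f : coefs) (M : nat) (sol : solution) : bool :=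
  check f M (firstn M sol.1) ([] :: [] :: firstn M sol.2).

(* The variables 12, 13, 14 are the free coefficients of [run]; all others are the coefficients of the system. *)
Definition no_free (p : poly) : bool := var_le 12 0 p && var_le 13 0 p && var_le 14 0 p.
Definition no_free_coefs (f : coefs) : bool :=
  forallb no_free (coef_list f).

Definition max_exp (i : nat) (p : poly) : nat := fold_right (fun (t : term) m => let '(_, _, l, _) := t in Nat.max (nth i l 0%nat) m) 0%nat p.
Lemma var_le_mono i K K' p : (K <= K')%nat -> var_le i K p = true -> var_le i K' p = true.
Proof.
  intros HK H. unfold var_le in *. rewrite forallb_forall in *. intros t Ht. specialize (H t Ht). destruct t as [[[a b] l] c].
  apply Nat.leb_le in H. apply Nat.leb_le. lia.
Qed.
Lemma var_le_max i p : var_le i (max_exp i p) p = true.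
Proof.
  induction p as [|t p IH]; auto. destruct t as [[[a b] l] c].
  change (andb (Nat.leb (nth i l 0%nat) (Nat.max (nth i l 0%nat) (max_exp i p))) (var_le i (Nat.max (nth i l 0%nat) (max_exp i p)) p) = true).
  apply andb_true_iff. split. apply Nat.leb_le. lia. eapply var_le_mono; [|exact IH]. lia.
Qed.
Definition elim_var (i : nat) (r p : poly) : poly := elim i (max_exp i p) r p.
Lemma elim_var_zero env i r p : var_le i 1 r = true -> cst env r = 0 -> cst env p = 0 -> cst env (elim_var i r p) = 0.
Proof.
  intros Hr H0 Hp. unfold cst, elim_var in *. rewrite ev_elim; auto. rewrite Hp. ring. apply var_le_max.
Qed.

Lemma degree_bound p : exists D, forallb (fun t : term => let '(_, _, l, _) := t in Nat.leb (degree l) D) p = true.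
Proof.
  induction p as [|t p [D IH]]. exists 0%nat. reflexivity. destruct t as [[[a b] l] c]. exists (Nat.max (degree l) D). cbn [forallb].
  apply andb_true_iff. split. apply Nat.leb_le. lia. rewrite forallb_forall in *. intros t Ht. specialize (IH t Ht). destruct t as [[[a' b'] l'] c'].
  apply Nat.leb_le in IH. apply Nat.leb_le. lia.
Qed.
Lemma hom_beyond p D d : forallb (fun t : term => let '(_, _, l, _) := t in Nat.leb (degree l) D) p = true -> (D < d)%nat -> hom d p = [].
Proof.
  intros H Hd. induction p as [|t p IH]; auto. cbn [forallb] in H. apply andb_true_iff in H as [H1 H2].
  destruct t as [[[a b] l] c]. apply Nat.leb_le in H1. unfold hom. cbn [filter]. fold (hom d p).
  destruct (Nat.eqb_spec (degree l) d); [lia|]. apply IH; auto.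
Qed.

Notation scaled e a := (fun k : nat => e * a k).

Lemma hom_zero a p e0 : 0 < e0 -> (forall e, 0 < e < e0 -> cst (scaled e a) p = 0) -> forall d, cst a (hom d p) = 0.
Proof.
  intros P0 H d. destruct (degree_bound p) as [D HD]. destruct (Nat.lt_ge_cases D d) as [L|L]. { rewrite (hom_beyond p D d HD L). reflexivity. }
  apply (horner_all_zero (map (fun d => ev 1 1 a (hom d p)) (seq 0 (S D))) e0 P0).
  - intros e He. rewrite <- (ev_hom 1 1 e a p D HD). apply H; auto.
  - apply in_map_iff. exists d. split; auto. apply in_seq. lia.
Qed.
Lemma hom_nonzero a p d : cst a (hom d p) <> 0 -> exists e0, 0 < e0 /\ forall e, 0 < e < e0 -> cst (scaled e a) p <> 0.
Proof.
  intros N. destruct (degree_bound p) as [D HD]. destruct (Nat.lt_ge_cases D d) as [L|L]. { exfalso. apply N. rewrite (hom_beyond p D d HD L). reflexivity. }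
  destruct (horner_nonzero (map (fun d => ev 1 1 a (hom d p)) (seq 0 (S D))) (ev 1 1 a (hom d p))) as [e0 [P0 H0]]; auto.
  { apply in_map_iff. exists d. split; auto. apply in_seq. lia. }
  exists e0. split; auto. intros e He. unfold cst. rewrite (ev_hom 1 1 e a p D HD). apply H0; auto.
Qed.

Section Stages.
Variables (f : coefs) (sol : solution).
Hypothesis Hf : no_free_coefs f = true.

(** [env] differs from the parameters [env0] of the system by a choice of the free coefficients that
    cancels all residuals up to [n]. *)
Definition good (env0 env : nat -> R) (n : nat) : Prop :=
  (forall p, no_free p = true -> cst env p = cst env0 p) /\ forall m, (2 <= m <= n)%nat -> cst env (res sol m) = 0.

Lemma coefs_agree env0 env n : good env0 env n -> field_of f env = field_of f env0 /\ cst env (p20 f) = cst env0 (p20 f) /\ cst env (q11 f) = cst env0 (q11 f).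
Proof.
  intros [H _]. unfold no_free_coefs in Hf. rewrite forallb_forall in Hf.
  assert (G : forall p, In p (coef_list f) -> cst env p = cst env0 p) by (intros; apply H; auto).
  unfold field_of. rewrite !G by (cbn; tauto). auto.
Qed.

Lemma good_center env0 env M : good env0 env M -> chk f M sol = true -> Nat.odd M = true -> (M <= 8)%nat ->
  is_center (field_of f env0) -> Rabs (cst env0 (p20 f)) <= / 100 -> Rabs (cst env0 (q11 f)) <= / 100 -> good env0 env (M + 1).
Proof.
  intros HG Hc Ho H8 Hcen Ha Hb. destruct (coefs_agree _ _ _ HG) as [E1 [E2 E3]]. destruct HG as [G1 G2]. split; auto.
  assert (PM : (1 <= M)%nat) by (destruct M; [discriminate|lia]).
  intros m Hm. destruct (Nat.eq_dec m (M + 1)) as [->|Nm]. 2:{ apply G2. lia. }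
  assert (EN : forall n, (2 <= n <= M + 1)%nat -> nth n ([] :: [] :: firstn M sol.2) [] = res sol n).
  { intros n Hn. unfold res. destruct n as [|[|n]]; try lia. cbn [nth]. replace (S (S n) - 2)%nat with n by lia.
    rewrite nth_firstn. replace (n <? M)%nat with true; auto. symmetry. apply Nat.ltb_lt. lia. }
  rewrite <- (EN (M + 1)%nat) by lia. apply (center_residual_zero f env M _ _ Hc); auto.
  - rewrite E2; auto.
  - rewrite E3; auto.
  - rewrite E1; auto.
  - intros n Hn. destruct (Nat.lt_ge_cases n 2) as [L|L]. destruct n as [|[|n]]; try lia; reflexivity.
    rewrite EN by lia. apply G2. lia.
Qed.

(** The residual is affine in a free coefficient absent from the earlier ones, so it can be solved
    for without disturbing them; its multiplier contains no free coefficient and can be judged from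
    the system alone. *)
Lemma good_free env0 env n i : good env0 env n -> (i = 12 \/ i = 13 \/ i = 14)%nat -> (1 <= n)%nat ->
  forallb (fun m => var_le i 0 (res sol m)) (seq 2 (n - 1)) = true -> var_le i 1 (res sol (n + 1)) = true ->
  no_free (coef i 1 (res sol (n + 1))) = true -> cst env0 (coef i 1 (res sol (n + 1))) <> 0 -> exists env', good env0 env' (n + 1).
Proof.
  intros [G1 G2] Hi Hn Hv H1 Hnf HD. rewrite <- G1 in HD by auto.
  destruct (solve_free 1 1 env i (res sol (n + 1)) H1 HD) as [z Hz]. exists (upd env i z). split.
  - intros p Hp. rewrite <- G1 by auto. unfold cst. apply ev_upd. unfold no_free in Hp.
    apply andb_true_iff in Hp as [Hp H14]. apply andb_true_iff in Hp as [H12 H13]. destruct Hi as [->|[->| ->]]; auto.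
  - intros m Hm. destruct (Nat.eq_dec m (n + 1)) as [->|Nm]; auto.
    unfold cst. rewrite ev_upd. apply G2. lia. rewrite forallb_forall in Hv. apply Hv. apply in_seq. lia.
Qed.

Variable a : nat -> R.
Definition centers : Prop := exists e0, 0 < e0 /\ forall e, 0 < e < e0 ->
  is_center (field_of f (scaled e a)) /\ Rabs (cst (scaled e a) (p20 f)) <= / 100 /\ Rabs (cst (scaled e a) (q11 f)) <= / 100.
Hypothesis Hcen : centers.

(** The choice of free coefficients may vary with [e]; only its existence for each small [e] is
    recorded. *)
Definition goods (n : nat) : Prop := exists e0, 0 < e0 /\ forall e, 0 < e < e0 -> exists env, good (scaled e a) env n.

Lemma goods_center M : goods M -> chk f M sol = true -> Nat.odd M = true -> (M <= 8)%nat -> goods (M + 1).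
Proof.
  intros [e1 [P1 H1]] Hc Ho H8. destruct Hcen as [e0 [P0 H0]]. exists (Rmin e0 e1). split. apply Rmin_pos; auto.
  intros e He. mins (Rmin e0 e1). destruct (H1 e !!) as [env HG]. destruct (H0 e !!) as [A [B C]].
  exists env. apply good_center; auto.
Qed.
Lemma goods_free n i d : goods n -> (i = 12 \/ i = 13 \/ i = 14)%nat -> (1 <= n)%nat ->
  (forallb (fun m => var_le i 0 (res sol m)) (seq 2 (n - 1)) && var_le i 1 (res sol (n + 1)) && no_free (coef i 1 (res sol (n + 1)))) = true ->
  cst a (hom d (coef i 1 (res sol (n + 1)))) <> 0 -> goods (n + 1).
Proof.
  intros [e1 [P1 H1]] Hi Hn Hb HD. apply andb_true_iff in Hb as [Hb B3]. apply andb_true_iff in Hb as [B1 B2].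
  destruct (hom_nonzero a _ d HD) as [e0 [P0 H0]]. exists (Rmin e0 e1). split. apply Rmin_pos; auto.
  intros e He. mins (Rmin e0 e1). destruct (H1 e !!) as [env HG]. apply (good_free _ env n i); auto. apply H0. lra.
Qed.
Lemma goods_1 : goods 1.
Proof. exists 1. split. lra. intros e _. exists (scaled e a). split; auto. intros m Hm. lia. Qed.

(** The choice of free coefficients disappears from a polynomial that does not contain them. It
    vanishes for all small [e], hence each of its homogeneous components does. *)
Lemma goods_hom n p : goods n -> no_free p = true -> (forall env, (forall m, (2 <= m <= n)%nat -> cst env (res sol m) = 0) -> cst env p = 0) ->
  forall d, cst a (hom d p) = 0.
Proof.
  intros [e1 [P1 H1]] Hp H. apply (hom_zero a p e1 P1). intros e He. destruct (H1 e He) as [env [G1 G2]]. rewrite <- G1 by auto. apply H; auto.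
Qed.
End Stages.

(** The last free coefficient goes first: the odd residual that determines it may still contain the
    earlier ones, which are removed afterwards. *)
Fixpoint elims (sol : solution) (k : nat) (p : poly) : poly :=
  match k with O => p | S j => elims sol j (elim_var (12 + j) (res sol (2 * j + 2 + 1)) p) end.

(* The focal value of order [2 k + 1], with the free coefficients eliminated. *)
Definition focal (sol : solution) (k : nat) : poly := elims sol k (res sol (2 * k + 2)).

Definition free_ok (sol : solution) (n i : nat) : bool :=
  forallb (fun m => var_le i 0 (res sol m)) (seq 2 (n - 1)) && var_le i 1 (res sol (n + 1)) && no_free (coef i 1 (res sol (n + 1))).
(** Orders alternate: an even residual vanishes because there is a center, the next odd one by the
    choice of a free coefficient. *)
Fixpoint ladder (f : coefs) (sol : solution) (k : nat) : bool := match k with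
  | O => no_free_coefs f && chk f 1 sol
  | S j => ladder f sol j && free_ok sol (2 * j + 2) (12 + j) && chk f (2 * j + 2 + 1) sol end.
(* The multiplier of the [j]-th free coefficient has a nonzero component of degree [nth j ds]. *)
Fixpoint nondeg (sol : solution) (a : nat -> R) (ds : list nat) (k : nat) : Prop := match k with
  | O => True
  | S j => nondeg sol a ds j /\ cst a (hom (nth j ds 0%nat) (coef (12 + j) 1 (res sol (2 * j + 2 + 1)))) <> 0 end.

Section Focal.
Variables (f : coefs) (sol : solution) (a : nat -> R).
Hypothesis Hcen : centers f a.

Lemma goods_even ds k : (k <= 3)%nat -> ladder f sol k = true -> nondeg sol a ds k -> goods sol a (2 * k + 2).
Proof.
  induction k as [|j IH]; intros Hk H D.
  - apply andb_true_iff in H as [H1 H2]. apply (goods_center f sol H1 a Hcen 1); auto. apply goods_1. lia.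
  - cbn [ladder nondeg] in *. rewrite !andb_true_iff in H. destruct H as [[H1 H2] H3], D as [D1 D2].
    assert (NF : no_free_coefs f = true) by (clear - H1; induction j; cbn [ladder] in H1; rewrite !andb_true_iff in H1; tauto).
    replace (2 * S j + 2)%nat with (2 * j + 2 + 1 + 1)%nat by lia. apply (goods_center f sol NF a Hcen); auto; try lia.
    + apply (goods_free sol a _ (12 + j) (nth j ds 0%nat)); auto; try lia. apply IH; auto; lia.
    + apply Nat.odd_spec. exists (j + 1)%nat. lia.
Qed.

Lemma elims_zero env k : ladder f sol k = true -> (forall m, (2 <= m <= 2 * k + 2)%nat -> cst env (res sol m) = 0) ->
  forall p, cst env p = 0 -> cst env (elims sol k p) = 0.
Proof.
  induction k as [|j IH]; intros H Hm p Hp; auto. cbn [ladder elims] in *. unfold free_ok in H. rewrite !andb_true_iff in H.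
  apply IH; try tauto. { intros; apply Hm; lia. } apply elim_var_zero; try tauto. apply Hm; lia.
Qed.

Lemma focal_zero ds : let k := length ds in Nat.leb k 3 && ladder f sol k && no_free (focal sol k) = true ->
  nondeg sol a ds k -> forall d, cst a (hom d (focal sol k)) = 0.
Proof.
  intros k H D. rewrite !andb_true_iff in H. destruct H as [[H3 H] HN]. apply Nat.leb_le in H3. apply (goods_hom sol a (2 * k + 2)); auto.
  - eapply goods_even; eauto.
  - intros env Hm. apply elims_zero; auto. apply Hm; lia.
Qed.
End Focal.

(** * The case analysis *)

Notation v := pvar.
Definition free_general (m : nat) : poly := match m with 2%nat => v 12 | 4%nat => v 13 | 6%nat => v 14 | _ => [] end.
(* When [2 a20 + b11 = 0], [Q] is a first integral of the leading part, and the free coefficient of weight 4 is that of [sigma Q]. *)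
Definition free_flat (m : nat) : poly := match m with 2%nat => v 12 | 6%nat => v 14 | _ => [] end.
Definition sig_flat (m : nat) : poly := match m with 4%nat => v 13 | _ => [] end.
Definition no_sig (m : nat) : poly := [].

(* The subfamilies met in the case analysis; [v k] is the [k]-th coefficient, in the order of [coefs]. *)
Definition f_gen : coefs := Build_coefs (v 0) (v 1) (v 2) (v 3) (v 4) (v 5) (v 6) (v 7) (v 8) (v 9) (v 10) (v 11).
Definition f_x2 : coefs := Build_coefs (v 0) [] (v 2) [] (v 4) (v 5) (v 6) (v 7) [] [] (v 10) (v 11).
Definition f_3a : coefs := Build_coefs [] (v 1) (v 2) [] (v 4) (v 5) (v 6) (v 7) (pscale 2 (v 1)) [] (v 10) (v 11).
Definition f_3a5 : coefs := Build_coefs [] (v 1) [] [] (v 4) (v 5) (v 6) (v 7) (pscale 2 (v 1)) [] (v 10) (pscale (- (1 # 3)) (v 5)).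
Definition f_1 : coefs := Build_coefs (v 0) (v 1) (v 2) (v 3) (v 4) (v 5) (v 6) (pscale 3 (v 0)) (pscale (-3) (v 1)) (pscale (-3) (v 3)) (v 10) (v 11).
Definition f_15 : coefs := Build_coefs (v 0) (v 1) (v 2) (v 3) (v 4) (v 5) (v 6) (pscale 3 (v 0)) (pscale (-3) (v 1)) (pscale (-3) (v 3)) (v 10) (pscale (- (1 # 3)) (v 5)).
Definition f_2 : coefs := Build_coefs (v 0) (v 1) (v 2) (v 3) (v 4) (v 5) (v 6) (pscale (-2) (v 0)) (pscale (- (1 # 2)) (v 1)) (pscale (-3) (v 3)) (v 10) (v 11).
Definition f_0 : coefs := Build_coefs [] (v 1) (v 2) (v 3) (v 4) (v 5) (v 6) [] (v 8) (pscale (-3) (v 3)) (v 10) (v 11).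

Definition f_25 : coefs := Build_coefs (v 0) [] (v 2) [] (v 4) (v 5) (v 6) (pscale (-2) (v 0)) [] [] (v 10) (pscale (- (1 # 3)) (v 5)).
Definition f_05 : coefs := Build_coefs [] (v 1) (v 2) (v 3) (v 4) (v 5) (v 6) [] (v 8) (pscale (-3) (v 3)) (v 10) (pscale (- (1 # 3)) (v 5)).
Definition f_07 : coefs := Build_coefs [] (v 1) [] [] (v 4) (v 5) (v 6) [] (pscale (7 # 11) (v 1)) [] (pscale (-1) (v 4)) (pscale (- (1 # 3)) (v 5)).
Definition f_1c : coefs := Build_coefs (v 0) [] [] (v 3) [] [] (v 6) (pscale 3 (v 0)) [] (pscale (-3) (v 3)) [] [].

Definition run_general f n := run f free_general no_sig n 1 [] [].
Definition run_flat f n := run f free_flat sig_flat n 1 [] [].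
Definition s_gen : solution := Eval vm_compute in run_general f_gen 1.
Definition s_x2 : solution := Eval vm_compute in run_general f_x2 3.
Definition s_3a : solution := Eval vm_compute in run_general f_3a 3.
Definition s_3a5 : solution := Eval vm_compute in run_general f_3a5 5.
Definition s_1 : solution := Eval vm_compute in run_general f_1 3.
Definition s_2 : solution := Eval vm_compute in run_general f_2 3.
Definition s_0 : solution := Eval vm_compute in run_general f_0 3.
Definition s_15 : solution := Eval vm_compute in run_general f_15 5.
Definition s_1c : solution := Eval vm_compute in run_general f_1c 5.
Definition s_25 : solution := Eval vm_compute in run_flat f_25 5.
Definition s_05 : solution := Eval vm_compute in run_flat f_05 5.
Definition s_07 : solution := Eval vm_compute in run_flat f_07 7.

Definition linear_coefs (f : coefs) : bool :=
  forallb (fun p => forallb (fun t : term => let '(_, _, l, _) := t in Nat.eqb (degree l) 1) p)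
   (coef_list f).
Lemma linear_ev e a p : forallb (fun t : term => let '(_, _, l, _) := t in Nat.eqb (degree l) 1) p = true ->
  cst (fun k => e * a k) p = e * cst a p.
Proof.
  unfold cst. induction p as [|t p IH]; intros H; cbn [ev]. ring. cbn [forallb] in H. apply andb_true_iff in H as [H1 H2].
  rewrite (IH H2). destruct t as [[[i j] l] c]. apply Nat.eqb_eq in H1. unfold term_ev. rewrite mon_ev_scale, H1. ring.
Qed.

Section Branches.
Variables a20 a11 a02 a30 a21 a12 a03 b11 b02 b21 b12 b03 : R.
Definition par (k : nat) : R := match k with
  | 0%nat => a20 | 1%nat => a11 | 2%nat => a02 | 3%nat => a30 | 4%nat => a21 | 5%nat => a12 | 6%nat => a03
  | 7%nat => b11 | 8%nat => b02 | 9%nat => b21 | 10%nat => b12 | 11%nat => b03 | _ => 0 end.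
Hypothesis Hw : weakly_persistent_center (cubic_system a20 a11 a02 a30 a21 a12 a03 b11 b02 b21 b12 b03).

(** Weak persistence is used for small positive values of the parameter only, absorbed into the
    coefficients; for these the system is monodromic and hence has a center. *)
Lemma small_centers : exists e0, 0 < e0 /\ forall e, 0 < e < e0 ->
  is_center (cubic_system (e * a20) (e * a11) (e * a02) (e * a30) (e * a21) (e * a12) (e * a03) (e * b11) (e * b02) (e * b21) (e * b12) (e * b03) 1) /\
  Rabs (e * a20) <= / 100 /\ Rabs (e * b11) <= / 100.
Proof.
  set (S := Rabs a20 + Rabs a11 + Rabs a02 + Rabs a30 + Rabs a21 + Rabs a12 + Rabs a03 + Rabs b11 + Rabs b02 + Rabs b21 + Rabs b12 + Rabs b03).
  absp a20. absp a11. absp a02. absp a30. absp a21. absp a12.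
  absp a03. absp b11. absp b02. absp b21. absp b12. absp b03. assert (PS : 0 <= S) by (unfold S; lra).
  exists (/ (40000 * (1 + S))). split. { apply Rinv_0_lt_compat. lra. }
  intros e He. assert (B : forall c, Rabs c <= S -> Rabs (e * c) <= / 40000).
  { intros c Hc. rewrite Rabs_mult, (Rabs_pos_eq e) by lra. apply Rle_trans with (/ (40000 * (1 + S)) * (1 + S)).
    apply Rmult_le_compat; try lra. apply Rabs_pos. right. field. lra. }
  assert (SC : small_coefs (/ 40000) (e * a20) (e * a11) (e * a02) (e * a30) (e * a21) (e * a12) (e * a03) (e * b11) (e * b02) (e * b21) (e * b12) (e * b03)).
  { unfold small_coefs. repeat (apply conj); apply B; unfold S; lra. }
  assert (EQ : cubic_system (e * a20) (e * a11) (e * a02) (e * a30) (e * a21) (e * a12) (e * a03) (e * b11) (e * b02) (e * b21) (e * b12) (e * b03) 1 =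
    cubic_system a20 a11 a02 a30 a21 a12 a03 b11 b02 b21 b12 b03 e).
  { apply functional_extensionality. intros [x y]. unfold cubic_system. f_equal; ring. }
  split.
  - rewrite EQ. apply Hw. rewrite <- EQ. apply small_coefs_monodromic. exact SC.
  - destruct SC as [[A1 _] [A2 _]]. lra.
Qed.

Lemma branch_centers f : linear_coefs f = true ->
  cst par (p20 f) = a20 /\ cst par (p11 f) = a11 /\ cst par (p02 f) = a02 /\ cst par (p30 f) = a30 /\ cst par (p21 f) = a21 /\
  cst par (p12 f) = a12 /\ cst par (p03 f) = a03 /\ cst par (q11 f) = b11 /\ cst par (q02 f) = b02 /\ cst par (q21 f) = b21 /\
  cst par (q12 f) = b12 /\ cst par (q03 f) = b03 -> centers f par.
Proof.
  intros HL [E1 [E2 [E3 [E4 [E5 [E6 [E7 [E8 [E9 [E10 [E11 E12]]]]]]]]]]].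
  destruct small_centers as [e0 [P0 H0]]. exists e0. split; auto. intros e He. specialize (H0 e He).
  unfold linear_coefs in HL. rewrite forallb_forall in HL.
  assert (LE : forall p, In p (coef_list f) -> cst (fun k => e * par k) p = e * cst par p).
  { intros p Hp. apply linear_ev. apply HL; auto. }
  unfold field_of. rewrite !LE by (cbn; tauto). rewrite E1, E2, E3, E4, E5, E6, E7, E8, E9, E10, E11, E12. exact H0.
Qed.

Ltac poly_eval H := cbv [cst ev term_ev mon_ev Q2R Qnum Qden par] in H.
Ltac poly_goal := cbv [cst ev term_ev mon_ev Q2R Qnum Qden par p20 p11 p02 p30 p21 p12 p03 q11 q02 q21 q12 q03 pscale map fst snd pvar repeat app].
(** Extracts the component of degree [d] of a focal value as an explicit equation between the real
    coefficients. *)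
Ltac read H d name :=
  match type of (H d) with cst _ ?h = _ => let P := eval vm_compute in h in
    assert (name : cst par P = 0) by (pose proof (H d) as T; replace h with P in T by (vm_compute; reflexivity); exact T) end;
  poly_eval name.
Ltac branch f := apply (branch_centers f); [vm_compute; reflexivity | unfold f; poly_goal; repeat (apply conj); cbn; lra].
Ltac nonzero :=
  match goal with |- cst _ ?h <> 0 => let P := eval vm_compute in h in replace h with P by (vm_compute; reflexivity) end;
  poly_goal; cbn [Z.to_nat]; try lra; try nra.
Ltac focal_values f s ds H :=
  assert (H : forall d, cst par (hom d (focal s (length ds))) = 0) by
    (apply (focal_zero f); [branch f | vm_compute; reflexivity | cbn [length nondeg]; repeat apply conj; try exact I; nonzero]).

(** The first focal value, on the full family: its components of degree 1 to 4. *)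
Lemma general_facts : b21 + 3 * a30 = 0 /\ 4 * b02 * (8 * a20 - b11) + a11 * (8 * b11 + 36 * a20) = 0 /\
  a30 * (b11 - 3 * a20) * (b11 + 2 * a20) = 0 /\ a20 * (b11 - 3 * a20) * (b02 * (b11 - 2 * a20) + b11 * a11) = 0.
Proof.
  focal_values f_gen s_gen (@nil nat) H.
  read H 1%nat F1. read H 2%nat F2. read H 3%nat F3. read H 4%nat F4.
  assert (E1 : b21 = - 3 * a30) by lra. rewrite E1 in F3. repeat split; lra.
Qed.
(** The way from [a11 = a30 = b02 = b21 = 0] to (C3). The third focal value leaves the exceptional
    ratio [b11 = 19 a20], which its component of degree 5 excludes. *)
Lemma x2_case : a11 = 0 -> a30 = 0 -> b02 = 0 -> b21 = 0 -> b11 + 2 * a20 <> 0 -> a12 = 0 /\ b03 = 0.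
Proof.
  intros A1 A2 A3 A4 Hb. focal_values f_x2 s_x2 [0]%nat H.
  read H 1%nat F1. read H 3%nat F3. read H 5%nat F5.
  assert (E1 : b03 = - a12 / 3) by lra. rewrite E1 in F3, F5.
  assert (G3 : (b11 + 2 * a20) * (a12 * (b11 - 19 * a20)) = 0) by lra. cancel G3. assert (Z : a12 = 0); [|split; lra].
  apply Rmult_integral in G3. destruct G3 as [G3|G3]; auto. assert (Eb : b11 = 19 * a20) by lra. rewrite Eb in F5.
  assert (G5 : a12 * (a20 ^ 4) = 0) by lra. apply Rmult_integral in G5. destruct G5 as [G5|G5]; auto.
  exfalso. apply Hb. assert (a20 = 0); [|lra]. destruct (Req_dec a20 0); auto. exfalso. apply (pow_nonzero a20 4); auto.
Qed.

(** Here [2 a20 + b11 = 0], so [Q] is a first integral of the leading part; (C5) is missed by at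
    most the relations for [b03] and [b12]. *)
Lemma flat_case : b11 = - 2 * a20 -> b02 = - a11 / 2 -> b21 = - 3 * a30 ->
  b03 = - a12 / 3 /\ (b12 + a21 = 0 \/ (a30 = 0 /\ (a20 = 0 \/ a11 = 0))).
Proof.
  intros A1 A2 A3. focal_values f_2 s_2 [0]%nat H.
  read H 1%nat F1. read H 2%nat F2. read H 3%nat F3.
  assert (E1 : b03 = - a12 / 3) by lra. split; auto. rewrite E1 in F3.
  destruct (Req_dec (b12 + a21) 0) as [|N]; auto. right.
  assert (G2 : (b12 + a21) * a30 = 0) by lra. cancel G2. split; auto.
  assert (G3 : (b12 + a21) * (a20 * a11) = 0) by lra. cancel G3. apply Rmult_integral in G3. auto.
Qed.

Lemma flat_case5 : b11 = - 2 * a20 -> a11 = 0 -> a30 = 0 -> b02 = 0 -> b21 = 0 -> b03 = - a12 / 3 -> a12 * (b12 + a21) = 0.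
Proof.
  (* With [sigma Q] in place of [Q] the second multiplier has a nonzero constant term, because
     [X_1 (sigma Q) = x Q] when [tau = 0]. *)
  intros A1 A2 A3 A4 A5 A6. focal_values f_25 s_25 [0; 0]%nat H.
  read H 2%nat F2. lra.
Qed.

(** The way to (C2): now [tau] is a multiple of [b11], which is not 0. The third focal value leaves
    a single relation between [a12] and [b12 - 2 a21], which the fifth one splits. *)
Lemma a20_zero_case : a20 = 0 -> b11 <> 0 -> a30 = 0 -> b21 = 0 -> b02 = 2 * a11 -> a11 <> 0 ->
  a12 = 0 /\ b03 = 0 /\ a02 = 0 /\ b12 = 2 * a21 /\ a03 = 0.
Proof.
  intros A1 Nb A3 A4 A5 Na. focal_values f_3a s_3a [0]%nat H.
  read H 1%nat F1. read H 2%nat F2. read H 3%nat F3.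
  assert (E1 : b03 = - a12 / 3) by lra. rewrite E1 in F3.
  assert (E2 : a11 * a02 = 0) by lra. cancel E2. rewrite E2 in F3.
  assert (G3 : b11 * (b11 * a12 - 6 * a11 * (b12 - 2 * a21)) = 0) by lra. cancel G3.
  (* The multiplier of the first free coefficient has a nonzero constant term. That of the second is
     divisible by [tau], since for [tau = 0] the first integral [Q] is a homogeneous solution; hence
     degree 1 is used. *)
  focal_values f_3a5 s_3a5 [0; 1]%nat H5.
  read H5 3%nat K3. read H5 4%nat K4. read H5 5%nat K5.
  assert (J3 : b11 * (a12 * (a21 + b12)) = 0) by lra. cancel J3.
  assert (PB : b11 * b11 <> 0) by (apply Rmult_integral_contrapositive; auto). assert (Z : a12 = 0).
  { apply Rmult_integral in J3. destruct J3 as [J3|J3]; auto. assert (Ea : a21 = - b12) by lra. rewrite Ea in K5, G3.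
    (* In the other factor [a21 = - b12], the relation from order 3 expresses [a12] by [b12], and
       the fifth focal value then gives [b12 = 0]. *)
    assert (Eb : b11 * a12 = 18 * a11 * b12) by lra. assert (Ec : b11 ^ 3 * a12 * b12 = 18 * a11 * b12 ^ 2 * b11 ^ 2).
    { replace (b11 ^ 3 * a12 * b12) with (b11 ^ 2 * b12 * (b11 * a12)) by ring. rewrite Eb. ring. }
    assert (J5 : b11 * b11 * (a11 * (b12 * b12)) = 0) by lra. cancel J5. cancel J5.
    assert (b12 = 0) by nra. assert (J : b11 * a12 = 0) by (rewrite Eb, H0; ring). apply Rmult_integral in J. destruct J; [contradiction|auto]. }
  rewrite Z in *. assert (J : a11 * (b12 - 2 * a21) = 0) by lra. cancel J.
  assert (J4 : b11 * b11 * (a11 * a03) = 0) by lra. cancel J4. cancel J4. repeat split; lra.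
Qed.

(** The ratio [b11 = 3 a20] is the one at which the first focal value lets [a30] survive; it leads
    to (C1) or back to the hypotheses of (C3). *)
Lemma triple_case : b11 = 3 * a20 -> a20 <> 0 -> b02 = - 3 * a11 -> b21 = - 3 * a30 ->
  a11 = 0 /\ (a30 = 0 \/ (a21 = 0 /\ b12 = 0 /\ a02 = 0 /\ a12 = 0 /\ b03 = 0 /\ a03 = 0)).
Proof.
  intros A1 Na A2 A3. focal_values f_1 s_1 [0]%nat H.
  read H 1%nat F1. read H 2%nat F2. read H 3%nat F3. read H 4%nat F4. read H 5%nat F5. clear H.
  assert (E1 : b03 = - a12 / 3) by lra. rewrite E1 in F3, F5.
  (* The components of degree 2 to 5 are combined into four relations that are solved for [a30 b12],
     [a30 a21], [a12] and [a02 a30]. *)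
  assert (R1 : a20 * (a20 * (a30 * b12) - 3 / 2 * a20 * (a11 * a02) - 6 * a11 * a30 ^ 2 + 2 * a11 ^ 3) = 0).
  { assert (F2' : a20 * a20 * (a30 * b12 + a30 * a21 - 5 / 2 * (a11 * a02)) = 0) by (replace (a30 * b12 + a30 * a21 - 5 / 2 * (a11 * a02)) with 0 by lra; ring). lra. }
  assert (R2 : a20 * (a20 * (a30 * a21) - a20 * (a11 * a02) + 6 * a11 * a30 ^ 2 - 2 * a11 ^ 3) = 0).
  { assert (F2' : a20 * a20 * (a30 * b12 + a30 * a21 - 5 / 2 * (a11 * a02)) = 0) by (replace (a30 * b12 + a30 * a21 - 5 / 2 * (a11 * a02)) with 0 by lra; ring). lra. }
  pose proof (f_equal (fun z => a20 * a20 * z) F3) as F3'. cbv beta in F3'.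
  assert (R4 : a20 ^ 2 * (a20 ^ 2 * a12 + 12 / 5 * (a20 * (a11 * b12)) + 9 / 10 * (a20 * (a11 * a21)) - 63 / 2 * (a11 ^ 2 * a30)) = 0) by lra.
  assert (R5 : a20 ^ 2 * (a20 * (a02 * a30) - 4 / 5 * (a20 * (a11 * b12)) + 6 / 5 * (a20 * (a11 * a21)) + 20 * (a11 ^ 2 * a30)) = 0) by lra.
  assert (N2 : a20 ^ 2 <> 0) by (apply pow_nonzero; auto).
  assert (S2 : a30 * b12 + a30 * a21 = 5 / 2 * (a11 * a02)) by lra. cancel R1. cancel R2. cancel R4. cancel R5.
  clear F1 F2 F3 F4 F5 F3'. assert (Z11 : a11 = 0).
  { destruct (Req_dec a11 0) as [|N11]; auto. exfalso. focal_values f_15 s_15 [0; 1]%nat H5.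
    read H5 3%nat K3. clear H5. assert (J : a20 * (a12 * (b12 + a21)) = 0) by lra. clear K3.
    assert (P11 : 0 < a11 ^ 2) by nra. pose proof (pow2_ge_0 a30) as P30. cancel J. cancel J.
    (* With [a12 = 0] the products containing [b12] and [a21] are eliminated. This expresses
       [a20 a02] by squares and then equates a nonnegative quantity with a negative one. *)
    - rewrite J in R4. assert (A1' : a11 ^ 2 * (- (9 / 2) * (a20 * a02) + 45 / 2 * a30 ^ 2 + 3 * a11 ^ 2) = 0).
      { replace (a11 ^ 2 * (- (9 / 2) * (a20 * a02) + 45 / 2 * a30 ^ 2 + 3 * a11 ^ 2)) with
         (- a30 * (a11 * (a20 ^ 2 * 0 + 12 / 5 * (a20 * (a11 * b12)) + 9 / 10 * (a20 * (a11 * a21)) - 63 / 2 * (a11 ^ 2 * a30)) / a11)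
          + a11 * (12 / 5 * (a20 * (a30 * b12) - 3 / 2 * a20 * (a11 * a02) - 6 * a11 * a30 ^ 2 + 2 * a11 ^ 3)
          + 9 / 10 * (a20 * (a30 * a21) - a20 * (a11 * a02) + 6 * a11 * a30 ^ 2 - 2 * a11 ^ 3))) by (field; auto).
        rewrite R1, R2, R4. field; auto. }
      assert (A2' : a20 * (a02 * a30 ^ 2) = - 8 * (a11 ^ 2 * a30 ^ 2) - 4 * a11 ^ 4).
      { assert (T : a20 * (a02 * a30 ^ 2) + 8 * (a11 ^ 2 * a30 ^ 2) + 4 * a11 ^ 4 =
          a30 * (a20 * (a02 * a30) - 4 / 5 * (a20 * (a11 * b12)) + 6 / 5 * (a20 * (a11 * a21)) + 20 * (a11 ^ 2 * a30))
          + 4 / 5 * a11 * (a20 * (a30 * b12) - 3 / 2 * a20 * (a11 * a02) - 6 * a11 * a30 ^ 2 + 2 * a11 ^ 3)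
          - 6 / 5 * a11 * (a20 * (a30 * a21) - a20 * (a11 * a02) + 6 * a11 * a30 ^ 2 - 2 * a11 ^ 3)) by field.
        rewrite R1, R2, R5 in T. lra. }
      apply Rmult_integral in A1'. destruct A1' as [A1'|A1']; [lra|].
      assert (A3' : a20 * a02 = 5 * a30 ^ 2 + 2 / 3 * a11 ^ 2) by lra.
      assert (A4' : (5 * a30 ^ 2 + 2 / 3 * a11 ^ 2) * a30 ^ 2 = - 8 * (a11 ^ 2 * a30 ^ 2) - 4 * a11 ^ 4) by (rewrite <- A3', <- A2'; ring).
      assert (0 <= a11 ^ 2 * a30 ^ 2) by (apply Rmult_le_pos; lra). assert (0 < a11 ^ 4) by (replace (a11 ^ 4) with (a11 ^ 2 * a11 ^ 2) by ring; apply Rmult_lt_0_compat; auto).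
      assert (0 <= a30 ^ 2 * a30 ^ 2) by (apply Rmult_le_pos; auto). lra.
    - assert (Eb : b12 = - a21) by lra. rewrite Eb in *. assert (Q : a11 * a02 = 0) by lra. cancel Q. rewrite Q in *.
      assert (A1' : a11 * (a20 * a21 + 10 * (a11 * a30)) = 0) by lra. cancel A1'.
      assert (A2' : a11 * (4 * a30 ^ 2 + 2 * a11 ^ 2) = 0).
      { replace (a11 * (4 * a30 ^ 2 + 2 * a11 ^ 2)) with (a30 * (a20 * a21 + 10 * (a11 * a30)) - (a20 * (a30 * a21) - a20 * (a11 * 0) + 6 * a11 * a30 ^ 2 - 2 * a11 ^ 3)) by ring. rewrite A1', R2. ring. }
      apply Rmult_integral in A2'. destruct A2' as [|]; [contradiction|]. lra. }
  split; auto. destruct (Req_dec a30 0) as [|N30]; auto. right. rewrite Z11 in R1, R2, R4, R5.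
  assert (J1 : a20 * (a30 * b12) = 0) by lra. assert (J2 : a20 * (a30 * a21) = 0) by lra.
  assert (J4 : a20 ^ 2 * a12 = 0) by lra. assert (J5 : a20 * (a02 * a30) = 0) by lra. cancel J1. cancel J1.
  cancel J2. cancel J2. cancel J4. cancel J5. cancel J5. assert (E2 : b03 = 0) by lra.
  (* Only [a03] is left to be excluded, and it first appears at order 5 in this family. *)
  focal_values f_1c s_1c [0; 1]%nat Hc.
  read Hc 5%nat K5.
  assert (J : a20 ^ 3 * (a30 * a03) = 0) by lra. cancel J. { exfalso. apply (pow_nonzero a20 3); auto. }
  cancel J. repeat split; auto.
Qed.

(** The leading part is [x' = y], [y' = - x^3]. The outcomes are (C5), (C4), and the relations of
    (C3). *)
Lemma zero_case : a20 = 0 -> b11 = 0 -> b21 = - 3 * a30 ->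
  b03 = - a12 / 3 /\ ((a11 + 2 * b02 = 0 /\ a21 + b12 = 0) \/ (a12 = 0 /\ a30 = 0 /\ (a02 = 0 \/ (a11 = 0 /\ b02 = 0)))).
Proof.
  intros A1 A2 A3. focal_values f_0 s_0 [0]%nat H.
  read H 1%nat F1. read H 2%nat F2. read H 3%nat F3. clear H.
  assert (E1 : b03 = - a12 / 3) by lra. split; auto.
  assert (E2 : 2 * (a30 * (a21 + b12)) + a02 * (a11 + 2 * b02) = 0) by lra.
  assert (E3 : a30 * ((a11 + 2 * b02) * (b02 - a11)) = 0) by lra. clear F1 F2 F3.
  focal_values f_05 s_05 [0; 0]%nat H5.
  read H5 2%nat K2. read H5 3%nat K3. read H5 4%nat K4. read H5 5%nat K5. clear H5.
  destruct (Req_dec (a11 + 2 * b02) 0) as [A|A].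
  - destruct (Req_dec (a21 + b12) 0) as [K|K]; auto. right.
    assert (Eb : b02 = - a11 / 2) by lra. rewrite Eb in E2, K2, K3. clear K4 K5.
    assert (J : a30 * (a21 + b12) = 0) by lra. cancel J. rewrite J in K2, K3.
    assert (J2 : a12 * (a21 + b12) = 0) by lra. cancel J2. rewrite J2 in K3.
    assert (J3 : a11 * a02 * (a21 + b12) = 0) by lra. cancel J3.
    apply Rmult_integral in J3. split; auto. split; auto. destruct J3 as [J3|J3]; auto. right. split; lra.
  - destruct (Req_dec a30 0) as [Z|Z].
    + right. rewrite Z in E2, K2, K3. clear K4 K5.
      assert (J : a02 * (a11 + 2 * b02) = 0) by lra. cancel J. rewrite J in K2, K3.
      enough (G : a12 = 0) by auto. destruct (Req_dec a12 0) as [|Z12]; auto. exfalso.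
      assert (J2 : a12 * (a21 + b12) = 0) by lra. cancel J2. assert (Eb : b12 = - a21) by lra. rewrite Eb in K3.
      assert (J3 : a12 * ((a11 + 2 * b02) * (11 * (a11 + 2 * b02) - 25 * a11)) = 0) by lra. cancel J3. cancel J3.
      (* The ratio [b02 = 7/11 a11] survives the fifth focal value; the seventh one excludes it. *)
      assert (N11 : a11 <> 0) by (intros N; apply A; lra). focal_values f_07 s_07 [0; 0; 0]%nat H7.
      read H7 5%nat L5. clear H7.
      assert (J4 : a11 ^ 4 * a12 = 0) by lra. cancel J4. apply (pow_nonzero a11 4); auto.
    + exfalso. cancel E3. cancel E3. assert (Eb : b02 = a11) by lra. rewrite Eb in K5.
      assert (J : a30 ^ 3 * a11 ^ 2 = 0) by lra. cancel J. apply (pow_nonzero a30 3); auto.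
      apply A. assert (a11 = 0); [|lra]. destruct (Req_dec a11 0); auto. exfalso. apply (pow_nonzero a11 2); auto.
Qed.

Lemma necessary :
    (b02 = 0 /\ b11 - 3 * a20 = 0 /\ b21 + 3 * a30 = 0 /\ a02 = 0 /\ a12 = 0 /\
     a21 = 0 /\ b03 = 0 /\ b12 = 0 /\ a11 = 0 /\ a03 = 0)
  \/ (a20 = 0 /\ a30 = 0 /\ b02 - 2 * a11 = 0 /\ b21 = 0 /\ a02 = 0 /\ b03 = 0 /\
     b12 - 2 * a21 = 0 /\ a12 = 0 /\ a03 = 0)
  \/ (a11 = 0 /\ a30 = 0 /\ b02 = 0 /\ b21 = 0 /\ a12 = 0 /\ b03 = 0)
  \/ (b11 = 0 /\ a20 = 0 /\ b21 = 0 /\ a02 = 0 /\ a30 = 0 /\ b03 = 0 /\ a12 = 0)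
  \/ (b11 + 2 * a20 = 0 /\ b02 + a11 / 2 = 0 /\ b21 + 3 * a30 = 0 /\
     b03 + a12 / 3 = 0 /\ b12 + a21 = 0).
Proof.
  destruct (general_facts) as [G1 [G2 [G3 G4]]]. assert (E21 : b21 = - 3 * a30) by lra.
  (* The cofactor [tau] decides which free terms are usable, so the flat branch [tau = 0] is treated
     apart; outside it every way to (C3) goes through [X2]. *)
  destruct (Req_dec (b11 + 2 * a20) 0) as [F|F].
  - destruct (Req_dec a20 0) as [Z|Z].
    + destruct (zero_case Z !! E21) as [E [[C1 C2]|[C1 [C2 [C3|[C3 C4]]]]]].
      * right; right; right; right. repeat (apply conj); lra.
      * right; right; right; left. repeat (apply conj); lra.
      * right; right; left. repeat (apply conj); lra.
    + assert (Eb : b02 = - a11 / 2).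
      { replace b11 with (- 2 * a20) in G2 by lra. assert (J : a20 * (2 * b02 + a11) = 0) by lra. apply Rmult_integral in J. destruct J; [contradiction|lra]. }
      destruct (flat_case !! Eb E21) as [E C]. destruct (Req_dec (b12 + a21) 0) as [K|K].
      * right; right; right; right. repeat (apply conj); lra.
      * destruct C as [C|[C [C'|C']]]; try contradiction.
        assert (J : a12 * (b12 + a21) = 0) by (apply (flat_case5); lra). cancel J.
        right; right; left. repeat (apply conj); lra.
  - assert (X2 : a11 = 0 -> a30 = 0 -> b02 = 0 -> a11 = 0 /\ a30 = 0 /\ b02 = 0 /\ b21 = 0 /\ a12 = 0 /\ b03 = 0).
    { intros Y1 Y2 Y3. destruct (x2_case Y1 Y2 Y3 !! F). repeat (apply conj); lra. }
    destruct (Req_dec (b11 - 3 * a20) 0) as [B|B].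
    + assert (N20 : a20 <> 0) by (intros N; apply F; lra). assert (Eb : b02 = - 3 * a11).
      { replace b11 with (3 * a20) in G2 by lra. assert (J : a20 * (b02 + 3 * a11) = 0) by lra. apply Rmult_integral in J. destruct J; [contradiction|lra]. }
      destruct (triple_case !! N20 Eb E21) as [T1 [T2|[T2 [T3 [T4 [T5 [T6 T7]]]]]]].
      * right; right; left. apply X2; lra.
      * left. repeat (apply conj); lra.
    + assert (Z30 : a30 = 0).
      { cancel G3. apply Rmult_integral in G3. destruct G3; [auto|contradiction]. }
      destruct (Req_dec a20 0) as [Z|Z].
      * rewrite Z in G2. assert (N11 : b11 <> 0) by (intros N; apply F; lra).
        assert (J : b11 * (b02 - 2 * a11) = 0) by lra. cancel J.
        destruct (Req_dec a11 0) as [Y|Y]. { right; right; left. apply X2; lra. }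
        destruct (a20_zero_case Z N11 Z30 !! !! Y) as [T1 [T2 [T3 [T4 T5]]]].
        right; left. repeat (apply conj); lra.
      * right; right; left. cancel G4. { apply Rmult_integral in G4. destruct G4; contradiction. }
        (* Elimination of [b02] between the relations [G2] and [G4], both of which are linear in
           [a11] and [b02]. *)
        assert (J : a11 * ((b11 - 3 * a20) * (b11 + 2 * a20)) = 0).
        { assert (T : 12 * (a11 * ((b11 - 3 * a20) * (b11 + 2 * a20))) = (b11 - 2 * a20) * (4 * b02 * (8 * a20 - b11) + a11 * (8 * b11 + 36 * a20)) - (8 * a20 - b11) * 4 * (b02 * (b11 - 2 * a20) + b11 * a11)) by ring.
          rewrite G2, G4 in T. lra. }
        cancel J.
        2:{ exfalso. apply Rmult_integral in J. destruct J; contradiction. }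
        apply X2; auto. rewrite J in G2, G4.
        assert (J2 : b02 * (b11 - 2 * a20) = 0) by lra. assert (J3 : b02 * (8 * a20 - b11) = 0) by lra.
        assert (J4 : a20 * b02 = 0) by lra. apply Rmult_integral in J4. destruct J4; [contradiction|auto].
Qed.
End Branches.

Theorem theorem5p1
    (a20 a11 a02 a30 a21 a12 a03 b11 b02 b21 b12 b03 : R) :
  weakly_persistent_center
    (cubic_system a20 a11 a02 a30 a21 a12 a03 b11 b02 b21 b12 b03)
  <->
  ( (* C1 *)
    (b02 = 0 /\ b11 - 3 * a20 = 0 /\ b21 + 3 * a30 = 0 /\ a02 = 0 /\ a12 = 0 /\
     a21 = 0 /\ b03 = 0 /\ b12 = 0 /\ a11 = 0 /\ a03 = 0)
  \/ (* C2 *)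
    (a20 = 0 /\ a30 = 0 /\ b02 - 2 * a11 = 0 /\ b21 = 0 /\ a02 = 0 /\ b03 = 0 /\
     b12 - 2 * a21 = 0 /\ a12 = 0 /\ a03 = 0)
  \/ (* C3 *)
    (a11 = 0 /\ a30 = 0 /\ b02 = 0 /\ b21 = 0 /\ a12 = 0 /\ b03 = 0)
  \/ (* C4 *)
    (b11 = 0 /\ a20 = 0 /\ b21 = 0 /\ a02 = 0 /\ a30 = 0 /\ b03 = 0 /\ a12 = 0)
  \/ (* C5 *)
    (b11 + 2 * a20 = 0 /\ b02 + a11 / 2 = 0 /\ b21 + 3 * a30 = 0 /\
     b03 + a12 / 3 = 0 /\ b12 + a21 = 0)).
Proof.
  split.
  - apply necessary.
  - intros [H|[H|[H|[H|H]]]] eps.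
    + destruct H as [H1 [H2 [H3 [H4 [H5 [H6 [H7 [H8 [H9 H10]]]]]]]]]. apply C1_case; lra.
    + destruct H as [H1 [H2 [H3 [H4 [H5 [H6 [H7 [H8 H9]]]]]]]].
      replace b02 with (2 * a11) by lra. replace b12 with (2 * a21) by lra. subst. apply C2_case.
    + destruct H as [H1 [H2 [H3 [H4 [H5 H6]]]]]. apply C3_case; auto.
    + destruct H as [H1 [H2 [H3 [H4 [H5 [H6 H7]]]]]]. apply C4_case; auto.
    + destruct H as [H1 [H2 [H3 [H4 H5]]]]. apply hamiltonian_case; lra.
Qed.
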